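(* Let $\mathbb D$ be a pointed, finitely complete, finitely cocomplete, efficiently regular, protomodular and peri-abelian category. Let $Y$ be an object of $\mathbb D$ of projective dimension $1$. Then, for any internal abelian group $A$ in the slice category $\mathbb D/Y$ and any integer $n\geq 0$, the cohomology groups $H^n_{M(\mathbb D/Y)}(A)$ and $H^n_{\mathbb D/Y}(A)$ are isomorphic.
   Context: All categories are finitely complete. $R[f]$, with projections $p_0,p_1$ and diagonal $s_0$, denotes the kernel pair of a map $f$. **Conditions on $\mathbb D$.** A regular category is efficiently regular when any equivalence relation $T$ on an object $X$ which is a subobject $T\rightarrowtail R[f]$ of an effective equivalence relation on $X$ by a monomorphism which is an equalizer of some pair of maps is itself effective (i.e. a kernel pair). $Pt_Y\mathbb D$ is the category of split epimorphisms $(f:X\to Y,\ s:Y\to X)$, $fs=1_Y$, above $Y$, with commutative triangles (commuting with the sections) as morphisms; a map $h:Y'\to Y$ induces by pullback the change of base functor $h^*:Pt_Y\mathbb D\to Pt_{Y'}\mathbb D$. $\mathbb D$ is protomodular when all these functors $h^*$ reflect isomorphisms; it is then a Mal'cev category (every reflexive relation is an equivalence relation), and so is every slice. When $\mathbb D$ is finitely cocomplete, regular, pointed (has a zero object, written $1$) and protomodular, the full subcategory $Ab(Pt_Y\mathbb D)$ of (internal) abelian group objects of $Pt_Y\mathbb D$ is reflective, with regular epimorphic units; the reflection $A_Y$ gives the associated abelian object. Such a $\mathbb D$ is peri-abelian when for every map $h:Y'\to Y$ the functor $h^*$ preserves the associated abelian object, i.e. the canonical map $A_{Y'}(h^*(f,s))\to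 h^*(A_Y(f,s))$ is an isomorphism. An object $Y$ has projective dimension $1$ when there is an exact sequence $1\to K\rightarrowtail H\twoheadrightarrow Y\to 1$ with $H$ and $K$ projective with respect to regular epimorphisms. **Commutative objects.** In a Mal'cev category $\mathbb E$ an object $X$ is commutative when it has a (necessarily unique) internal Mal'cev operation $p:X\times X\times X\to X$, $p(x,y,y)=x$, $p(x,x,y)=y$. $M\mathbb E$ is the full subcategory of commutative objects. In $\mathbb D/Y$ the terminal object is $1_Y$ and products are fibre products over $Y$. $M(\mathbb D/Y)$ contains all internal abelian groups of $\mathbb D/Y$ and is closed under finite limits and subobjects in $\mathbb D/Y$. **$n$-groupoids in a category $\mathbb E$.** $()_0: Grd\,\mathbb E\to\mathbb E$ sends an internal groupoid $\underline X_1$ (objects $X_0$, arrows $X_1$, domain $d_0$, codomain $d_1$, identities $s_0$) to $X_0$; it is a left exact fibration. Inductively for $n\ge2$ an $n$-groupoid is an internal groupoid inside a fibre of $()_{n-2}:(n-1)\text{-}Grd\,\mathbb E\to (n-2)\text{-}Grd\,\mathbb E$ (with $0\text{-}Grd\,\mathbb E=\mathbb E$), and $()_{n-1}: n\text{-}Grd\,\mathbb E\to(n-1)\text{-}Grd\,\mathbb E$ sends it to its object of objects. An $n$-groupoid $\underline X_n$ has an underlying diagram of reflexive graphs $X_n\rightrightarrows X_{n-1}\rightrightarrows\cdots\rightrightarrows X_0$ and underlying $k$-groupoids $\underline X_k$. Put $X_0^{\bumpeq}=X_0\times X_0$ and let $X_k^{\bumpeq}$ be the kernel pair of $(d_0,d_1):X_k\to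 X_{k-1}^{\bumpeq}$ (parallel $k$-cells). The map $(d_0,d_1):X_n\to X_{n-1}^{\bumpeq}$ is the core of $\underline X_n$. When $\mathbb E$ is regular, $\underline X_n$ is aspherical when all cores $X_k\to X_{k-1}^{\bumpeq}$, $1\le k\le n$, and the map $X_0\to1$ are regular epimorphisms ($X_0\to 1$ regular epic: $X_0$ has global support). **Directions and cohomology** ($\mathbb E$ regular Mal'cev; here $\mathbb E=\mathbb D/Y$, which is efficiently regular, or its subcategory $M(\mathbb D/Y)$). An aspherical $n$-groupoid $\underline X_n$ ($n\ge1$) has direction an internal abelian group $A$ given by a regular epimorphism $\nu:X_n^{\bumpeq}\to A$ such that $(p_i,\nu):X_n^{\bumpeq}\to X_n\times A$ is an isomorphism for $i=0,1$ and the square formed by $s_0:X_n\to X_n^{\bumpeq}$, $\nu$, $X_n\to 1$ and $0:1\to A$ is a pushout. A commutative object $X$ with global support has direction $A$, the quotient of $X\times X$ by the equivalence relation identifying $(x,y)$ with $(z,p(z,x,y))$. $n$-functors (resp. maps) induce homomorphisms between directions. $H^0_{\mathbb E}(A)=Hom_{\mathbb E}(1,A)$; $H^1_{\mathbb E}(A)$ is the set of connected components of the category of commutative objects with global support and direction (identified with) $A$; for $n\geq1$, $H^{n+1}_{\mathbb E}(A)$ is the set of connected components of the category of aspherical $n$-groupoids with direction (identified with) $A$; morphisms are those inducing $1_A$ on directions. The abelian group structure is the analogue of the tensor product (Baer sum) of torsors: the sum of the classes of $X$ and $X'$ is the class of any $Z$ admitting a morphism $X\times X'\to Z$ inducing the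 addition $A\times A\to A$ on directions. *)

(* Defs.v *)
From Stdlib Require Import List ProofIrrelevance IndefiniteDescription.

Set Implicit Arguments.
Unset Strict Implicit.
Unset Printing Implicit Defensive.

Record Category := {
  Ob :> Type;
  Hom : Ob -> Ob -> Type;
  id : forall X, Hom X X;
  comp : forall X Y Z, Hom Y Z -> Hom X Y -> Hom X Z;
  comp_idl : forall X Y (f : Hom X Y), comp (id Y) f = f;
  comp_idr : forall X Y (f : Hom X Y), comp f (id X) = f;
  comp_assoc : forall X Y Z W (h : Hom Z W) (g : Hom Y Z) (f : Hom X Y),
      comp h (comp g f) = comp (comp h g) f
}.
Arguments Hom {c} X Y.
Arguments id {c} X.
Arguments comp {c X Y Z} g f.
Notation "X ~> Y" := (Hom X Y) (at level 90, right associativity).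
Notation "g ∘ f" := (comp g f) (at level 40, left associativity).

Definition op (C : Category) : Category := {|
  Ob := C;
  Hom := fun X Y => @Hom C Y X;
  id := fun X => id X;
  comp := fun X Y Z g f => @comp C Z Y X f g;
  comp_idl := fun X Y f => @comp_idr C Y X f;
  comp_idr := fun X Y f => @comp_idl C Y X f;
  comp_assoc := fun X Y Z W h g f => eq_sym (@comp_assoc C W Z Y X f g h)
|}.

Record Functor (C D : Category) := {
  fob :> C -> D;
  fmap : forall X Y, (X ~> Y) -> (fob X ~> fob Y);
  fmap_id : forall X, fmap (id X) = id (fob X);
  fmap_comp : forall X Y Z (g : Y ~> Z) (f : X ~> Y),
      fmap (g ∘ f) = fmap g ∘ fmap f
}.

Definition IsIso {C : Category} {X Y : C} (f : X ~> Y) : Prop :=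
  exists g : Y ~> X, g ∘ f = id X /\ f ∘ g = id Y.

Definition FullSub (C : Category) (P : C -> Prop) : Category := {|
  Ob := {X : C | P X};
  Hom := fun X Y => proj1_sig X ~> proj1_sig Y;
  id := fun X => id (proj1_sig X);
  comp := fun X Y Z g f => g ∘ f;
  comp_idl := fun X Y f => comp_idl f;
  comp_idr := fun X Y f => comp_idr f;
  comp_assoc := fun X Y Z W h g f => comp_assoc h g f
|}.

Lemma sig_ext (T : Type) (P : T -> Prop) (x y : {t | P t}) :
  proj1_sig x = proj1_sig y -> x = y.
Proof. exact (eq_sig_hprop (fun _ _ _ => proof_irrelevance _ _ _) x y). Qed.

Definition IsFinite (T : Type) : Prop := exists l : list T, forall t, In t l.

Definition IsFiniteCategory (J : Category) : Prop :=
  IsFinite J /\ forall i j : J, IsFinite (i ~> j).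

Definition IsLimit (J C : Category) (F : Functor J C)
    (L : C) (leg : forall j, L ~> F j) : Prop :=
  (forall i j (a : i ~> j), fmap F a ∘ leg i = leg j) /\
  forall (T : C) (t : forall j, T ~> F j),
    (forall i j (a : i ~> j), fmap F a ∘ t i = t j) ->
    exists! u : T ~> L, forall j, leg j ∘ u = t j.

Definition FinitelyComplete (C : Category) : Prop :=
  forall (J : Category), IsFiniteCategory J ->
  forall F : Functor J C, exists L leg, @IsLimit J C F L leg.

Definition FinitelyCocomplete (C : Category) : Prop := FinitelyComplete (op C).

(** The universal properties below carry their mediating maps as data, so that
    internal algebraic laws can be written on generalised elements. *)

Record is_terminal {C : Category} (T : C) := {
  bang : forall X, X ~> T;
  bang_uniq : forall X (f g : X ~> T), f = g
}.

Definition is_initial {C : Category} (I : C) := @is_terminal (op C) I.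

Record is_product {C : Category} {A B P : C} (p : P ~> A) (q : P ~> B) := {
  pair : forall T, (T ~> A) -> (T ~> B) -> (T ~> P);
  pair_l : forall T (a : T ~> A) (b : T ~> B), p ∘ pair a b = a;
  pair_r : forall T (a : T ~> A) (b : T ~> B), q ∘ pair a b = b;
  pair_uniq : forall T (u v : T ~> P), p ∘ u = p ∘ v -> q ∘ u = q ∘ v -> u = v
}.

Record Product {C : Category} (A B : C) := {
  prod_ob :> C;
  prl : prod_ob ~> A;
  prr : prod_ob ~> B;
  prod_is : is_product prl prr
}.
Arguments prl {C A B} _.
Arguments prr {C A B} _.

Definition pr_pair {C : Category} {A B : C} (P : Product A B) {T : C}
  (a : T ~> A) (b : T ~> B) : T ~> P := pair (prod_is P) a b.

Record is_pullback {C : Category} {A B Z P : C} (f : A ~> Z) (g : B ~> Z)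
    (p : P ~> A) (q : P ~> B) := {
  pb_sq : f ∘ p = g ∘ q;
  pb_pair : forall T (a : T ~> A) (b : T ~> B), f ∘ a = g ∘ b -> (T ~> P);
  pb_l : forall T (a : T ~> A) (b : T ~> B) e, p ∘ @pb_pair T a b e = a;
  pb_r : forall T (a : T ~> A) (b : T ~> B) e, q ∘ @pb_pair T a b e = b;
  pb_uniq : forall T (u v : T ~> P), p ∘ u = p ∘ v -> q ∘ u = q ∘ v -> u = v
}.

Definition IsKernelPair {C : Category} {X Y R : C} (f : X ~> Y)
  (p0 p1 : R ~> X) : Prop := inhabited (is_pullback f f p0 p1).

Definition IsPushout {C : Category} {Z A B P : C} (f : Z ~> A) (g : Z ~> B)
  (i : A ~> P) (j : B ~> P) : Prop :=
  inhabited (@is_pullback (op C) A B Z P f g i j).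

Definition IsEqualizer {C : Category} {E X Y : C} (e : E ~> X)
    (a b : X ~> Y) : Prop :=
  a ∘ e = b ∘ e /\
  forall T (t : T ~> X), a ∘ t = b ∘ t -> exists! u : T ~> E, e ∘ u = t.

Definition IsCoequalizer {C : Category} {X Y Q : C} (a b : X ~> Y)
  (q : Y ~> Q) : Prop := @IsEqualizer (op C) Q Y X q a b.

Definition RegEpi {C : Category} {X Y : C} (f : X ~> Y) : Prop :=
  exists (W : C) (a b : W ~> X), IsCoequalizer a b f.

Definition Regular (C : Category) : Prop :=
  FinitelyComplete C /\
  (forall (X Y R : C) (f : X ~> Y) (p0 p1 : R ~> X), IsKernelPair f p0 p1 ->
     exists (Q : C) (q : X ~> Q), IsCoequalizer p0 p1 q) /\
  (forall (A B Z P : C) (f : A ~> Z) (g : B ~> Z) (p : P ~> A) (q : P ~> B),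
     inhabited (is_pullback f g p q) -> RegEpi f -> RegEpi q).

Definition IsEquivRel {C : Category} {T X : C} (t0 t1 : T ~> X) : Prop :=
  (forall W (u v : W ~> T), t0 ∘ u = t0 ∘ v -> t1 ∘ u = t1 ∘ v -> u = v) /\
  (exists r : X ~> T, t0 ∘ r = id X /\ t1 ∘ r = id X) /\
  (exists s : T ~> T, t0 ∘ s = t1 /\ t1 ∘ s = t0) /\
  (forall W (a b : W ~> T), t1 ∘ a = t0 ∘ b ->
     exists c : W ~> T, t0 ∘ c = t0 ∘ a /\ t1 ∘ c = t1 ∘ b).

Definition IsEffective {C : Category} {T X : C} (t0 t1 : T ~> X) : Prop :=
  exists (Y : C) (g : X ~> Y), IsKernelPair g t0 t1.

Definition EfficientlyRegular (C : Category) : Prop :=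
  Regular C /\
  forall (X Y R T : C) (f : X ~> Y) (p0 p1 : R ~> X) (j : T ~> R),
    IsKernelPair f p0 p1 ->
    IsEquivRel (p0 ∘ j) (p1 ∘ j) ->
    (exists (W : C) (a b : R ~> W), IsEqualizer j a b) ->
    IsEffective (p0 ∘ j) (p1 ∘ j).

Definition IsZero {C : Category} (Z : C) : Prop :=
  inhabited (is_terminal Z) /\ inhabited (is_initial Z).

Definition Pointed (C : Category) : Prop := exists Z : C, IsZero Z.

Definition Projective {C : Category} (P : C) : Prop :=
  forall (X Y : C) (e : X ~> Y) (g : P ~> Y), RegEpi e ->
    exists l : P ~> X, e ∘ l = g.

Definition IsKernel {C : Category} {K H Y : C} (k : K ~> H) (q : H ~> Y) : Prop :=
  exists (Z : C) (o : Z ~> Y) (w : K ~> Z),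
    IsZero Z /\ inhabited (is_pullback q o k w).

Definition ProjectiveDimension1 {C : Category} (Y : C) : Prop :=
  exists (K H : C) (k : K ~> H) (q : H ~> Y),
    IsKernel k q /\ RegEpi q /\ Projective H /\ Projective K.

Record AbStr {C : Category} (A : C) := {
  ab_one : C;
  ab_one_term : is_terminal ab_one;
  ab_sq : Product A A;
  ab_zero : ab_one ~> A;
  ab_add : ab_sq ~> A;
  ab_neg : A ~> A;
  ab_plus := fun (T : C) (x y : T ~> A) => ab_add ∘ pr_pair ab_sq x y;
  ab_addA : forall T (x y z : T ~> A),
      ab_plus x (ab_plus y z) = ab_plus (ab_plus x y) z;
  ab_addC : forall T (x y : T ~> A), ab_plus x y = ab_plus y x;
  ab_add0 : forall T (x : T ~> A), ab_plus x (ab_zero ∘ bang ab_one_term T) = x;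
  ab_addN : forall T (x : T ~> A),
      ab_plus x (ab_neg ∘ x) = ab_zero ∘ bang ab_one_term T
}.

Record AbGroup (C : Category) := {
  ab_ob :> C;
  ab_str : AbStr ab_ob
}.
Definition one {C : Category} (A : AbGroup C) : C := ab_one (ab_str A).
Definition to_one {C : Category} (A : AbGroup C) (T : C) : T ~> one A :=
  bang (ab_one_term (ab_str A)) T.
Definition zero {C : Category} (A : AbGroup C) : one A ~> A := ab_zero (ab_str A).
Definition plus {C : Category} (A : AbGroup C) {T : C} (x y : T ~> A) : T ~> A :=
  ab_plus (ab_str A) x y.

Record Point (D : Category) (Y : D) := {
  pt_ob :> D;
  pt_map : pt_ob ~> Y;
  pt_sec : Y ~> pt_ob;
  pt_split : pt_map ∘ pt_sec = id Y
}.

Section Pt.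
Variables (D : Category) (Y : D).

Definition PtHom (P Q : Point Y) :=
  {h : P ~> Q | pt_map Q ∘ h = pt_map P /\ h ∘ pt_sec P = pt_sec Q}.

Definition pt_id (P : Point Y) : PtHom P P.
Proof. exists (id P). split; [apply comp_idr | apply comp_idl]. Defined.

Definition pt_comp (P Q R : Point Y) (g : PtHom Q R) (f : PtHom P Q) : PtHom P R.
Proof.
exists (proj1_sig g ∘ proj1_sig f).
destruct f as [f [f1 f2]], g as [g [g1 g2]]; simpl; split.
- now rewrite comp_assoc, g1.
- now rewrite <- comp_assoc, f2.
Defined.

Definition Pt : Category.
Proof.
refine {| Ob := Point Y; Hom := PtHom; id := pt_id; comp := pt_comp |}.
- abstract (intros; apply sig_ext, comp_idl).
- abstract (intros; apply sig_ext, comp_idr).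
- abstract (intros; apply sig_ext, comp_assoc).
Defined.
End Pt.

(** [IsBaseChange h u]: the point [P'] is h^*(P), with [u] the projection. *)
Definition IsBaseChange {D : Category} {Y Y' : D} (h : Y' ~> Y)
    (P : Pt Y) (P' : Pt Y') (u : pt_ob P' ~> pt_ob P) : Prop :=
  inhabited (is_pullback (pt_map P) h u (pt_map P')) /\
  u ∘ pt_sec P' = pt_sec P ∘ h.

(** [IsBaseChangeMap u v k k']: k' = h^*(k), for the projections [u] and [v]. *)
Definition IsBaseChangeMap {D : Category} {Y Y' : D}
    {P Q : Pt Y} {P' Q' : Pt Y'}
    (u : pt_ob P' ~> pt_ob P) (v : pt_ob Q' ~> pt_ob Q)
    (k : P ~> Q) (k' : P' ~> Q') : Prop :=
  v ∘ proj1_sig k' = proj1_sig k ∘ u.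

Definition Protomodular (D : Category) : Prop :=
  forall (Y Y' : D) (h : Y' ~> Y) (P Q : Pt Y) (P' Q' : Pt Y')
    (u : pt_ob P' ~> pt_ob P) (v : pt_ob Q' ~> pt_ob Q)
    (k : P ~> Q) (k' : P' ~> Q'),
    IsBaseChange h u -> IsBaseChange h v -> IsBaseChangeMap u v k k' ->
    IsIso k' -> IsIso k.

Definition IsReflection {C : Category} (S : C -> Prop) {X A : C}
    (eta : X ~> A) : Prop :=
  S A /\ forall B, S B -> forall g : X ~> B, exists! g' : A ~> B, g' ∘ eta = g.

Definition IsAbelian {C : Category} (A : C) : Prop := inhabited (AbStr A).

Definition IsAssociatedAbelian {C : Category} {X A : C} (eta : X ~> A) : Prop :=
  IsReflection (@IsAbelian C) eta.

Definition PeriAbelian (D : Category) : Prop :=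
  forall (Y Y' : D) (h : Y' ~> Y) (P A : Pt Y) (P' hA B : Pt Y')
    (u : pt_ob P' ~> pt_ob P) (v : pt_ob hA ~> pt_ob A)
    (eta : P ~> A) (heta : P' ~> hA) (eta' : P' ~> B),
    IsBaseChange h u -> IsBaseChange h v -> IsBaseChangeMap u v eta heta ->
    IsAssociatedAbelian eta -> IsAssociatedAbelian eta' ->
    exists c : B ~> hA, c ∘ eta' = heta /\ IsIso c.

Section Slice.
Variables (D : Category) (Y : D).

Definition SliceOb := {X : D & X ~> Y}.
Definition SliceHom (a b : SliceOb) :=
  {h : projT1 a ~> projT1 b | projT2 b ∘ h = projT2 a}.

Definition slice_id (a : SliceOb) : SliceHom a a.
Proof. exists (id _). apply comp_idr. Defined.

Definition slice_comp (a b c : SliceOb) (g : SliceHom b c) (f : SliceHom a b) :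
  SliceHom a c.
Proof.
exists (proj1_sig g ∘ proj1_sig f).
destruct f as [f f1], g as [g g1]; simpl. now rewrite comp_assoc, g1.
Defined.

Definition Slice : Category.
Proof.
refine {| Ob := SliceOb; Hom := SliceHom; id := slice_id; comp := slice_comp |}.
- abstract (intros; apply sig_ext, comp_idl).
- abstract (intros; apply sig_ext, comp_idr).
- abstract (intros; apply sig_ext, comp_assoc).
Defined.
End Slice.

Record MalcevOp {C : Category} (X : C) := {
  mal_sq : Product X X;
  mal_cube : Product mal_sq X;
  mal_op : mal_cube ~> X;
  mal := fun (T : C) (x y z : T ~> X) =>
    mal_op ∘ pr_pair mal_cube (pr_pair mal_sq x y) z;
  mal_xyy : forall T (x y : T ~> X), mal x y y = x;
  mal_xxy : forall T (x y : T ~> X), mal x x y = y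
}.

Definition Commutative {C : Category} (X : C) : Prop := inhabited (MalcevOp X).

Definition M (C : Category) : Category := FullSub (@Commutative C).

(** A category over [B], i.e. a functor [fproj] to [B], presented with its
    objects indexed by their image in [B]: this gives access to strict fibres
    without any equality between objects.  Morphisms are those of the total
    category. *)
Record CatOver (B : Category) := {
  FOb : B -> Type;
  FHom : forall b b', FOb b -> FOb b' -> Type;
  fid : forall b (x : FOb b), FHom x x;
  fcomp : forall b b' b'' (x : FOb b) (x' : FOb b') (x'' : FOb b''),
      FHom x' x'' -> FHom x x' -> FHom x x'';
  fcomp_idl : forall b b' (x : FOb b) (x' : FOb b') (f : FHom x x'),
      fcomp (fid x') f = f;
  fcomp_idr : forall b b' (x : FOb b) (x' : FOb b') (f : FHom x x'),
      fcomp f (fid x) = f;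
  fcomp_assoc : forall b b' b'' b''' (x : FOb b) (x' : FOb b') (x'' : FOb b'')
      (x''' : FOb b''') (h : FHom x'' x''') (g : FHom x' x'') (f : FHom x x'),
      fcomp h (fcomp g f) = fcomp (fcomp h g) f;
  fproj : forall b b' (x : FOb b) (x' : FOb b'), FHom x x' -> (b ~> b');
  fproj_id : forall b (x : FOb b), fproj (fid x) = id b;
  fproj_comp : forall b b' b'' (x : FOb b) (x' : FOb b') (x'' : FOb b'')
      (g : FHom x' x'') (f : FHom x x'), fproj (fcomp g f) = fproj g ∘ fproj f
}.
Arguments fid {B c b} x.

Definition Total (B : Category) (F : CatOver B) : Category := {|
  Ob := {b : B & FOb F b};
  Hom := fun X Y => FHom (projT2 X) (projT2 Y);
  id := fun X => fid (projT2 X);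
  comp := fun X Y Z g f => fcomp g f;
  comp_idl := fun X Y f => fcomp_idl f;
  comp_idr := fun X Y f => fcomp_idr f;
  comp_assoc := fun X Y Z W h g f => fcomp_assoc h g f
|}.

Section Fibre.
Variables (B : Category) (F : CatOver B) (b : B).

Definition FibreHom (x y : FOb F b) := {f : FHom x y | fproj f = id b}.

Definition fibre_id (x : FOb F b) : FibreHom x x :=
  exist _ (fid x) (fproj_id x).

Definition fibre_comp (x y z : FOb F b) (g : FibreHom y z) (f : FibreHom x y) :
  FibreHom x z.
Proof.
exists (fcomp (proj1_sig g) (proj1_sig f)).
rewrite fproj_comp, (proj2_sig f), (proj2_sig g). apply comp_idl.
Defined.

Definition Fibre : Category.
Proof.
refine {| Ob := FOb F b; Hom := FibreHom; id := fibre_id; comp := fibre_comp |}.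
- abstract (intros; apply sig_ext, fcomp_idl).
- abstract (intros; apply sig_ext, fcomp_idr).
- abstract (intros; apply sig_ext, fcomp_assoc).
Defined.
End Fibre.

(** An internal groupoid with object of objects [X0].  The composite
    [g_then x y] is "x followed by y". *)
Record Groupoid {C : Category} (X0 : C) := {
  X1 : C;
  d0 : X1 ~> X0;
  d1 : X1 ~> X0;
  s0 : X0 ~> X1;
  X2 : C;
  c0 : X2 ~> X1;
  c1 : X2 ~> X1;
  X2_is : is_pullback d1 d0 c0 c1;
  g_comp : X2 ~> X1;
  g_inv : X1 ~> X1;
  g_then := fun (T : C) (x y : T ~> X1) (e : d1 ∘ x = d0 ∘ y) =>
    g_comp ∘ pb_pair X2_is e;
  d0_s0 : d0 ∘ s0 = id X0;
  d1_s0 : d1 ∘ s0 = id X0;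
  d0_comp : d0 ∘ g_comp = d0 ∘ c0;
  d1_comp : d1 ∘ g_comp = d1 ∘ c1;
  d0_inv : d0 ∘ g_inv = d1;
  d1_inv : d1 ∘ g_inv = d0;
  g_unitl : forall T (x : T ~> X1) e, @g_then T (s0 ∘ (d0 ∘ x)) x e = x;
  g_unitr : forall T (x : T ~> X1) e, @g_then T x (s0 ∘ (d1 ∘ x)) e = x;
  g_assoc : forall T (x y z : T ~> X1) e1 e2 e3 e4,
      @g_then T (@g_then T x y e1) z e2 = @g_then T x (@g_then T y z e3) e4;
  g_invr : forall T (x : T ~> X1) e,
      @g_then T x (g_inv ∘ x) e = s0 ∘ (d0 ∘ x);
  g_invl : forall T (x : T ~> X1) e,
      @g_then T (g_inv ∘ x) x e = s0 ∘ (d1 ∘ x)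
}.

Section GrdOver.
Variables (B : Category) (F : CatOver B).

Definition GrdOb (bx : Total F) : Type := @Groupoid (Fibre F (projT1 bx)) (projT2 bx).

(** Internal functors, not necessarily between groupoids of the same fibre. *)
Record GrdHom (bx bx' : Total F) (G : GrdOb bx) (G' : GrdOb bx') := {
  gf0 : FHom (projT2 bx) (projT2 bx');
  gf1 : FHom (X1 G) (X1 G');
  gf_over : fproj gf1 = fproj gf0;
  gf_d0 : fcomp (proj1_sig (d0 G')) gf1 = fcomp gf0 (proj1_sig (d0 G));
  gf_d1 : fcomp (proj1_sig (d1 G')) gf1 = fcomp gf0 (proj1_sig (d1 G));
  gf_s0 : fcomp gf1 (proj1_sig (s0 G)) = fcomp (proj1_sig (s0 G')) gf0;
  gf_comp : exists gf2 : FHom (X2 G) (X2 G'),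
      fproj gf2 = fproj gf0 /\
      fcomp (proj1_sig (c0 G')) gf2 = fcomp gf1 (proj1_sig (c0 G)) /\
      fcomp (proj1_sig (c1 G')) gf2 = fcomp gf1 (proj1_sig (c1 G)) /\
      fcomp (proj1_sig (g_comp G')) gf2 = fcomp gf1 (proj1_sig (g_comp G))
}.

Lemma GrdHom_ext bx bx' (G : GrdOb bx) (G' : GrdOb bx') (f g : GrdHom G G') :
  gf0 f = gf0 g -> gf1 f = gf1 g -> f = g.
Proof.
destruct f, g; simpl; intros; subst; f_equal; apply proof_irrelevance.
Qed.

Definition grd_id bx (G : GrdOb bx) : GrdHom G G.
Proof.
refine {| gf0 := fid (projT2 bx); gf1 := fid (X1 G) |};
  try (now rewrite ?fproj_id, ?fcomp_idl, ?fcomp_idr).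
exists (fid (X2 G)). now rewrite !fproj_id, !fcomp_idl, !fcomp_idr.
Defined.

Definition grd_comp bx bx' bx'' (G : GrdOb bx) (G' : GrdOb bx') (G'' : GrdOb bx'')
  (g : GrdHom G' G'') (f : GrdHom G G') : GrdHom G G''.
Proof.
refine {| gf0 := fcomp (gf0 g) (gf0 f); gf1 := fcomp (gf1 g) (gf1 f) |}.
- now rewrite !fproj_comp, !gf_over.
- now rewrite fcomp_assoc, gf_d0, <- fcomp_assoc, gf_d0, fcomp_assoc.
- now rewrite fcomp_assoc, gf_d1, <- fcomp_assoc, gf_d1, fcomp_assoc.
- now rewrite <- fcomp_assoc, gf_s0, fcomp_assoc, gf_s0, fcomp_assoc.
- destruct (gf_comp f) as [f2 [Hf [Hf0 [Hf1 Hfm]]]].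
  destruct (gf_comp g) as [g2 [Hg [Hg0 [Hg1 Hgm]]]].
  exists (fcomp g2 f2). rewrite !fproj_comp, Hf, Hg. split; [easy |].
  rewrite !fcomp_assoc, Hg0, Hg1, Hgm, <- !fcomp_assoc, Hf0, Hf1, Hfm. easy.
Defined.

(** The functor ()_0 from internal groupoids in the fibres of [F] to [Total F]. *)
Definition GrdOver : CatOver (Total F).
Proof.
refine {|
  FOb := GrdOb;
  FHom := GrdHom;
  fid := grd_id;
  fcomp := grd_comp;
  fproj := fun bx bx' G G' f => (gf0 f : @Hom (Total F) bx bx')
|}.
- abstract (intros; apply GrdHom_ext; apply fcomp_idl).
- abstract (intros; apply GrdHom_ext; apply fcomp_idr).
- abstract (intros; apply GrdHom_ext; apply fcomp_assoc).
- abstract (reflexivity).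
- abstract (reflexivity).
Defined.
End GrdOver.

Definition UnitCat : Category.
Proof.
refine {| Ob := unit; Hom := fun _ _ => unit; id := fun _ => tt;
          comp := fun _ _ _ _ _ => tt |};
  abstract (intros; repeat match goal with x : unit |- _ => destruct x end;
            reflexivity).
Defined.

Definition OverUnit (E : Category) : CatOver UnitCat.
Proof.
refine {|
  FOb := fun _ => Ob E;
  FHom := fun _ _ X Y => X ~> Y;
  fid := fun _ X => id X;
  fcomp := fun _ _ _ X Y Z g f => g ∘ f;
  fproj := fun (o o' : UnitCat) X Y f => (tt : @Hom UnitCat o o')
|}; abstract (intros; first [apply comp_idl | apply comp_idr
                            | apply comp_assoc | reflexivity]).
Defined.

(** Stage [n] consists of ()_{n-1} : n-Grd -> (n-1)-Grd together with the
    functor sending an n-groupoid to its object X_n of n-cells.  Stage 0 is the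
    functor from E to the terminal category, whose unique fibre is E: stage 1
    is therefore Grd(E) -> E. *)
Record Stage (E : Category) := {
  st_base : Category;
  st_over : CatOver st_base;
  st_cells : Functor (Total st_over) E
}.

Definition cells0 (E : Category) : Functor (Total (OverUnit E)) E :=
  @Build_Functor (Total (OverUnit E)) E
    (fun X => projT2 X) (fun X Y f => f)
    (fun X => eq_refl) (fun X Y Z g f => eq_refl).

Definition cellsS (E B : Category) (F : CatOver B) (cells : Functor (Total F) E) :
  Functor (Total (GrdOver F)) E :=
  let tot (X : Total (GrdOver F)) : Total F :=
    existT _ (projT1 (projT1 X)) (X1 (projT2 X)) in
  @Build_Functor (Total (GrdOver F)) E
    (fun X => cells (tot X))
    (fun X Y f => @fmap _ _ cells (tot X) (tot Y) (gf1 f))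
    (fun X => @fmap_id _ _ cells (tot X))
    (fun X Y Z g f => @fmap_comp _ _ cells (tot X) (tot Y) (tot Z) (gf1 g) (gf1 f)).

Fixpoint stage (E : Category) (n : nat) : Stage E :=
  match n with
  | O => {| st_over := OverUnit E; st_cells := cells0 E |}
  | S m => {| st_over := GrdOver (st_over (stage E m));
              st_cells := cellsS (st_cells (stage E m)) |}
  end.

Definition nGrd (E : Category) (n : nat) : Category := Total (st_over (stage E n)).

Definition cells {E : Category} {n : nat} : Functor (nGrd E n) E :=
  st_cells (stage E n).

Definition under {E : Category} {n : nat} (X : nGrd E (S n)) : nGrd E n := projT1 X.

Section Domain.
Variables (E : Category) (n : nat) (X : nGrd E (S n)).

(** The n-groupoid with X_{n+1} as object of n-cells and the same underlying
    (n-1)-groupoid as [under X]. *)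
Definition arrows : nGrd E n := existT _ (projT1 (projT1 X)) (X1 (projT2 X)).

Definition dom : cells X ~> cells (under X) :=
  @fmap _ _ (@cells E n) arrows (under X) (proj1_sig (d0 (projT2 X))).
Definition cod : cells X ~> cells (under X) :=
  @fmap _ _ (@cells E n) arrows (under X) (proj1_sig (d1 (projT2 X))).
End Domain.

(** [IsParallel p0 p1]: (p0, p1) : P => X_n is the object of parallel n-cells. *)
Fixpoint IsParallel (E : Category) (n : nat) :
    forall (X : nGrd E n) (P : E), (P ~> cells X) -> (P ~> cells X) -> Prop :=
  match n with
  | O => fun X P p0 p1 => inhabited (is_product p0 p1)
  | S m => fun X P p0 p1 =>
      exists (Q : E) (q0 q1 : Q ~> cells (under X)) (c : cells X ~> Q),
        IsParallel q0 q1 /\ q0 ∘ c = dom X /\ q1 ∘ c = cod X /\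
        IsKernelPair c p0 p1
  end.

Definition IsCore {E : Category} {n : nat} (X : nGrd E (S n)) {Q : E}
    (c : cells X ~> Q) : Prop :=
  exists q0 q1 : Q ~> cells (under X),
    IsParallel q0 q1 /\ q0 ∘ c = dom X /\ q1 ∘ c = cod X.

Definition GlobalSupport {E : Category} (X : E) : Prop :=
  exists (T : E) (t : X ~> T), inhabited (is_terminal T) /\ RegEpi t.

Fixpoint Aspherical (E : Category) (n : nat) : nGrd E n -> Prop :=
  match n with
  | O => fun X => GlobalSupport (cells X)
  | S m => fun X =>
      Aspherical (under X) /\
      exists (Q : E) (c : cells X ~> Q), IsCore c /\ RegEpi c
  end.

(** A group given by the graph of its addition: [r_sum a b c] is a + b = c.
    The Baer sum is defined as a relation between classes, and its being an
    everywhere defined abelian group law is a theorem about cohomology. *)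
Record RelGroup := {
  r_set :> Type;
  r_sum : r_set -> r_set -> r_set -> Prop
}.

Definition GroupIso (G H : RelGroup) : Prop :=
  exists (f : G -> H) (g : H -> G),
    (forall x, g (f x) = x) /\ (forall y, f (g y) = y) /\
    forall a b c, r_sum a b c <-> r_sum (f a) (f b) (f c).

Inductive Connected (T : Type) (mor : T -> T -> Prop) : T -> T -> Prop :=
| conn_refl : forall x, Connected mor x x
| conn_mor : forall x y z, mor x y -> Connected mor y z -> Connected mor x z
| conn_rom : forall x y z, mor y x -> Connected mor y z -> Connected mor x z.

(** Connected components, as sets of objects; [sum X X' Z] is the existence of
    a morphism X × X' -> Z inducing the addition on directions. *)
Definition Components (T : Type) (mor : T -> T -> Prop)
    (sum : T -> T -> T -> Prop) : RelGroup := {|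
  r_set := {c : T -> Prop | exists x, c = Connected mor x};
  r_sum := fun a b c => exists x y z,
      proj1_sig a x /\ proj1_sig b y /\ proj1_sig c z /\ sum x y z
|}.

Section Cohomology.
Variables (E : Category) (A : AbGroup E).

Definition H0 : RelGroup := {|
  r_set := one A ~> A;
  r_sum := fun x y z => plus x y = z
|}.

(** [chasles_l] and [chasles_r] are the legs (x,y,z) |-> (x,y) and
    (x,y,z) |-> (z,p(z,x,y)) of the equivalence relation on X × X.  The quotient
    carries the group structure with [x,y] + [y,z] = [x,z], see [t_add]. *)
Definition chasles_l (X : E) (p : MalcevOp X) : mal_cube p ~> mal_sq p :=
  prl (mal_cube p).
Definition chasles_r (X : E) (p : MalcevOp X) : mal_cube p ~> mal_sq p :=
  let x := prl (mal_sq p) ∘ prl (mal_cube p) in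
  let y := prr (mal_sq p) ∘ prl (mal_cube p) in
  let z := prr (mal_cube p) in
  pr_pair (mal_sq p) z (mal p z x y).

Record Torsor := {
  t_ob : E;
  t_mal : MalcevOp t_ob;
  t_supp : GlobalSupport t_ob;
  t_dir : mal_sq t_mal ~> A;
  t_diff := fun (T : E) (x y : T ~> t_ob) => t_dir ∘ pr_pair (mal_sq t_mal) x y;
  t_quot : IsCoequalizer (chasles_l t_mal) (chasles_r t_mal) t_dir;
  t_add : forall T (x y z : T ~> t_ob), plus (t_diff x y) (t_diff y z) = t_diff x z
}.

Arguments t_diff t {T} x y.

Definition torsor_mor (X Z : Torsor) : Prop :=
  exists f : t_ob X ~> t_ob Z, forall T (x y : T ~> t_ob X),
    t_diff Z (f ∘ x) (f ∘ y) = t_diff X x y.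

Definition torsor_sum (X X' Z : Torsor) : Prop :=
  exists (Q : Product (t_ob X) (t_ob X')) (f : Q ~> t_ob Z),
    forall T (x y : T ~> Q),
      t_diff Z (f ∘ x) (f ∘ y) =
      plus (t_diff X (prl Q ∘ x) (prl Q ∘ y)) (t_diff X' (prr Q ∘ x) (prr Q ∘ y)).

Definition H1 : RelGroup := Components torsor_mor torsor_sum.

(** The group structure of [A] enters only through [zero A]: in a Mal'cev
    category an internal group structure is determined by its zero. *)
Record AsphGrd (n : nat) := {
  a_grd : nGrd E n;
  a_asph : Aspherical a_grd;
  a_par : E;
  a_p0 : a_par ~> cells a_grd;
  a_p1 : a_par ~> cells a_grd;
  a_par_is : IsParallel a_p0 a_p1;
  a_nu : a_par ~> A;
  a_nu_epi : RegEpi a_nu;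
  a_nu0 : exists W : Product (cells a_grd) A, IsIso (pr_pair W a_p0 a_nu);
  a_nu1 : exists W : Product (cells a_grd) A, IsIso (pr_pair W a_p1 a_nu);
  a_push : exists s : cells a_grd ~> a_par,
      a_p0 ∘ s = id _ /\ a_p1 ∘ s = id _ /\
      IsPushout s (to_one A (cells a_grd)) a_nu (zero A)
}.

(** [f] is the map induced by the n-functor [F] on objects of parallel n-cells. *)
Definition ParMap {n : nat} {X Y : nGrd E n} (F : X ~> Y) {P Q : E}
    (p0 p1 : P ~> cells X) (q0 q1 : Q ~> cells Y) (f : P ~> Q) : Prop :=
  q0 ∘ f = fmap cells F ∘ p0 /\ q1 ∘ f = fmap cells F ∘ p1.

Definition asph_mor (n : nat) (X Z : AsphGrd n) : Prop :=
  exists (F : a_grd X ~> a_grd Z) (f : a_par X ~> a_par Z),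
    ParMap F (a_p0 X) (a_p1 X) (a_p0 Z) (a_p1 Z) f /\ a_nu Z ∘ f = a_nu X.

Definition asph_sum (n : nat) (X X' Z : AsphGrd n) : Prop :=
  exists (Q : Product (a_grd X) (a_grd X')) (F : Q ~> a_grd Z)
    (P : E) (p0 p1 : P ~> cells (prod_ob Q))
    (f : P ~> a_par Z) (g : P ~> a_par X) (g' : P ~> a_par X'),
    IsParallel p0 p1 /\
    ParMap F p0 p1 (a_p0 Z) (a_p1 Z) f /\
    ParMap (prl Q) p0 p1 (a_p0 X) (a_p1 X) g /\
    ParMap (prr Q) p0 p1 (a_p0 X') (a_p1 X') g' /\
    a_nu Z ∘ f = plus (a_nu X ∘ g) (a_nu X' ∘ g').

Definition Hsucc (n : nat) : RelGroup := Components (@asph_mor n) (@asph_sum n).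

Definition Cohomology (n : nat) : RelGroup :=
  match n with
  | 0 => H0
  | 1 => H1
  | S (S m) => Hsucc (S m)
  end.
End Cohomology.

Definition HasProducts (C : Category) : Prop :=
  forall X Y : C, inhabited (Product X Y).

Lemma pr_pair_comp (C : Category) (A B : C) (P : Product A B) (T S : C)
  (a : T ~> A) (b : T ~> B) (u : S ~> T) :
  pr_pair P a b ∘ u = pr_pair P (a ∘ u) (b ∘ u).
Proof.
unfold pr_pair. apply (pair_uniq (prod_is P)); rewrite comp_assoc.
- now rewrite !pair_l.
- now rewrite !pair_r.
Qed.

Section InM.
Variables (C : Category) (hp : HasProducts C).

Lemma commutative_of_nat (X : C)
  (f : forall T, (T ~> X) -> (T ~> X) -> (T ~> X) -> (T ~> X)) :
  (forall T S x y z (u : S ~> T), f T x y z ∘ u = f S (x ∘ u) (y ∘ u) (z ∘ u)) ->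
  (forall T x y, f T x y y = x) -> (forall T x y, f T x x y = y) ->
  Commutative X.
Proof.
intros fn f1 f2.
destruct (hp X X) as [Q]. destruct (hp Q X) as [R].
set (o := f R (prl Q ∘ prl R) (prr Q ∘ prl R) (prr R)).
assert (H : forall T (x y z : T ~> X),
  o ∘ pr_pair R (pr_pair Q x y) z = f T x y z).
{ intros T x y z. unfold o. rewrite fn, <- !comp_assoc. unfold pr_pair.
  now rewrite !pair_l, !pair_r. }
constructor.
refine {| mal_sq := Q; mal_cube := R; mal_op := o |}; simpl; intros;
  rewrite H; auto.
Qed.

Lemma commutative_terminal (T : C) : is_terminal T -> Commutative T.
Proof.
intros t. apply commutative_of_nat with (f := fun S _ _ _ => bang t S);
  intros; apply (bang_uniq t).
Qed.

Lemma commutative_ab (A : C) : AbStr A -> Commutative A.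
Proof.
intros a.
assert (pn : forall T S (x y : T ~> A) (u : S ~> T),
  ab_plus a x y ∘ u = ab_plus a (x ∘ u) (y ∘ u)).
{ intros. unfold ab_plus. now rewrite <- comp_assoc, pr_pair_comp. }
apply commutative_of_nat with
  (f := fun T x y z => ab_plus a x (ab_plus a (ab_neg a ∘ y) z)).
- intros. now rewrite !pn, comp_assoc.
- intros. now rewrite (ab_addC a _ y), ab_addN, ab_add0.
- intros. now rewrite ab_addA, ab_addN, ab_addC, ab_add0.
Qed.

Lemma commutative_prod (A B : C) (P : Product A B) :
  Commutative A -> Commutative B -> Commutative P.
Proof.
intros [a] [b].
assert (mn : forall (X : C) (m : MalcevOp X) T S (x y z : T ~> X) (u : S ~> T),
  mal m x y z ∘ u = mal m (x ∘ u) (y ∘ u) (z ∘ u)).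
{ intros. unfold mal. now rewrite <- comp_assoc, !pr_pair_comp. }
apply commutative_of_nat with
  (f := fun T x y z => pr_pair P
     (mal a (prl P ∘ x) (prl P ∘ y) (prl P ∘ z))
     (mal b (prr P ∘ x) (prr P ∘ y) (prr P ∘ z))).
- intros. now rewrite pr_pair_comp, !mn, <- !comp_assoc.
- intros. unfold pr_pair. apply (pair_uniq (prod_is P));
  [rewrite pair_l | rewrite pair_r]; apply mal_xyy.
- intros. unfold pr_pair. apply (pair_uniq (prod_is P));
  [rewrite pair_l | rewrite pair_r]; apply mal_xxy.
Qed.

(** As M(C) is full in C, the group operations are unchanged. *)
Definition in_M (A : AbGroup C) : AbGroup (M C) :=
  let a := ab_str A in
  let cA := commutative_ab a in
  let A' : M C := exist _ (ab_ob A) cA in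
  let I' : M C := exist _ (ab_one a) (commutative_terminal (ab_one_term a)) in
  let Q' : M C := exist _ (prod_ob (ab_sq a)) (commutative_prod (ab_sq a) cA cA) in
  let t := ab_one_term a in
  let q := prod_is (ab_sq a) in
  let t' : is_terminal I' :=
    @Build_is_terminal (M C) I' (fun X => bang t (proj1_sig X))
      (fun X => @bang_uniq _ _ t (proj1_sig X)) in
  let q' : @is_product (M C) A' A' Q' (prl (ab_sq a)) (prr (ab_sq a)) :=
    @Build_is_product (M C) A' A' Q' (prl (ab_sq a)) (prr (ab_sq a))
      (fun T => @pair _ _ _ _ _ _ q (proj1_sig T))
      (fun T => @pair_l _ _ _ _ _ _ q (proj1_sig T))
      (fun T => @pair_r _ _ _ _ _ _ q (proj1_sig T))
      (fun T => @pair_uniq _ _ _ _ _ _ q (proj1_sig T)) in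
  {| ab_ob := A';
     ab_str := @Build_AbStr (M C) A' I' t' (Build_Product q')
       (ab_zero a) (ab_add a) (ab_neg a)
       (fun T => @ab_addA _ _ a (proj1_sig T))
       (fun T => @ab_addC _ _ a (proj1_sig T))
       (fun T => @ab_add0 _ _ a (proj1_sig T))
       (fun T => @ab_addN _ _ a (proj1_sig T)) |}.
End InM.

Inductive cospan_ob := cs_l | cs_r | cs_m.

Definition cospan_hom (i j : cospan_ob) : Type :=
  match i, j with
  | cs_l, cs_l | cs_r, cs_r | cs_m, cs_m | cs_l, cs_m | cs_r, cs_m => unit
  | _, _ => Empty_set
  end.

Definition cospan_id (i : cospan_ob) : cospan_hom i i :=
  match i with cs_l | cs_r | cs_m => tt end.

Definition cospan_comp (i j k : cospan_ob) :
  cospan_hom j k -> cospan_hom i j -> cospan_hom i k.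
Proof.
destruct i, j, k; simpl; intros g f;
  first [exact tt | destruct f; fail | destruct g; fail].
Defined.

Definition Cospan : Category.
Proof.
refine {| Ob := cospan_ob; Hom := cospan_hom;
          id := cospan_id; comp := cospan_comp |};
  abstract (intros; repeat match goal with
      | x : cospan_ob |- _ => destruct x end; simpl in *;
    repeat match goal with
      | x : unit |- _ => destruct x
      | x : Empty_set |- _ => destruct x end; reflexivity).
Defined.

Lemma cospan_finite : IsFiniteCategory Cospan.
Proof.
split.
- exists (cs_l :: cs_r :: cs_m :: nil). intros []; simpl; auto.
- intros [] []; (exists (tt :: nil) || exists nil); intros []; simpl; auto.
Qed.

Definition cospan_functor (C : Category) (A B Z : C) (f : A ~> Z) (g : B ~> Z) :
  Functor Cospan C.
Proof.
unshelve refine {|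
  fob := fun i : Cospan =>
    match i with cs_l => A | cs_r => B | cs_m => Z end |}.
- intros [] [] a; simpl in *;
    first [destruct a; fail | exact f | exact g | exact (id _)].
- intros []; reflexivity.
- intros [] [] [] b a; simpl in *;
    first [destruct a; fail | destruct b; fail
          | symmetry; first [apply comp_idl | apply comp_idr]].
Defined.

Lemma pullback_exists (C : Category) (hC : FinitelyComplete C)
  (A B Z : C) (f : A ~> Z) (g : B ~> Z) :
  exists (P : C) (p : P ~> A) (q : P ~> B), f ∘ p = g ∘ q /\
    forall T (a : T ~> A) (b : T ~> B), f ∘ a = g ∘ b ->
      exists! u : T ~> P, p ∘ u = a /\ q ∘ u = b.
Proof.
destruct (hC Cospan cospan_finite (cospan_functor f g)) as [L [leg [H1 H2]]].
exists L, (leg cs_l), (leg cs_r).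
assert (Hl := H1 cs_l cs_m tt). assert (Hr := H1 cs_r cs_m tt). simpl in Hl, Hr.
split; [congruence |].
intros T a b e.
unshelve edestruct (H2 T (fun j => match j with
  | cs_l => a | cs_r => b | cs_m => f ∘ a end)) as [u [Hu Hu']].
{ intros [] [] []; simpl; auto using comp_idl. }
exists u. split.
- split; [exact (Hu cs_l) | exact (Hu cs_r)].
- intros v [Hv1 Hv2]. apply Hu'. intros []; simpl; auto.
  now rewrite <- Hl, <- comp_assoc, Hv1.
Qed.

Lemma slice_products (D : Category) (Y : D) :
  FinitelyComplete D -> HasProducts (Slice Y).
Proof.
intros hD [A f] [B g].
destruct (pullback_exists hD f g) as [P [p [q [e H]]]].
set (PP := existT _ P (f ∘ p) : Slice Y).
set (pp := exist _ p eq_refl : PP ~> existT _ A f).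
set (qq := exist _ q (eq_sym e) : PP ~> existT _ B g).
constructor. refine {| prod_ob := PP; prl := pp; prr := qq |}.
assert (K : forall (T : Slice Y) (a : T ~> existT _ A f) (b : T ~> existT _ B g),
  {u : T ~> PP | pp ∘ u = a /\ qq ∘ u = b}).
{ intros T a b. apply constructive_indefinite_description.
  destruct T as [T t], a as [a ea], b as [b eb]; simpl in *.
  destruct (H T a b) as [u [[Hu1 Hu2] _]]; [congruence |].
  assert (eu : f ∘ p ∘ u = t) by now rewrite <- comp_assoc, Hu1.
  exists (exist _ u eu). split; apply sig_ext; simpl; assumption. }
refine {| pair := fun T a b => proj1_sig (K T a b) |}.
- intros T a b. apply (proj2_sig (K T a b)).
- intros T a b. apply (proj2_sig (K T a b)).
- intros [T t] [u eu] [v ev] H1 H2. apply sig_ext; simpl in *.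
  apply (f_equal (@proj1_sig _ _)) in H1, H2; simpl in H1, H2.
  destruct (H T (p ∘ u) (q ∘ u)) as [w [_ Hw]].
  + now rewrite !comp_assoc, e.
  + transitivity w; [symmetry |]; apply Hw; auto.
Qed.
Arguments slice_products {D} Y _.

(* Main.v *)
From Stdlib Require Import Classical IndefiniteDescription ProofIrrelevance.
From Stdlib Require Import FunctionalExtensionality PropExtensionality.
Require Import Defs.
Set Implicit Arguments.
Unset Strict Implicit.
Unset Printing Implicit Defensive.

(** The two cohomologies are compared degree by degree in the slice E = D/Y. In
    degree 0 they are equal, and in degree 1 both classify the same torsors, whose
    objects are commutative. From degree 2 on, an aspherical n-groupoid in M(E) is
    the same as one in E all of whose levels are commutative. So it has to be shown
    that every aspherical n-groupoid of E is connected, within those of the same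
    direction, to one with commutative levels, and that zigzags and sums can be
    moved along.

    This is done by reflecting an n-groupoid levelwise into commutative objects, and
    the point is that, after a preparation, the reflection does not alter the
    direction. Each level of an aspherical n-groupoid is a connected groupoid T over
    its objects U. Peri-abelianness implies that the abelian object associated with
    T, as a point over U via the source map, is constant ([trivialize]); this gives
    a universal difference from T to a commutative object V. For the indiscrete
    groupoid it yields the reflection of U itself ([orefl_exists]), with differences
    of objects in V_U. If moreover a base point I -> U, with I initial in E, is
    joined to every object by an arrow depending naturally on it, then by
    protomodularity T is the pullback of V -> V_U along the difference of source and
    target ([grefl_exists]). Hence T is the restriction of its reflection along the
    map on objects, and arrows with equal reflections differ by composition with
    arrows depending on the source and target only. Since differences of parallel
    cells are invariant under composition ([whisker]), the direction descends to the
    reflection ([push_dir]).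

    The joining arrows are obtained from the hypothesis on Y. A projective
    resolution K -> H -> Y provides the projective object F = (H -> Y) of the slice,
    and the product of F with the initial object is K, again projective ([proj_S]).
    Restricting an n-groupoid along a map from F to its objects changes neither
    asphericity nor direction, and then, K being projective, the arrows exist
    globally because they exist locally. Different choices of the map from F lead to
    results related by a functor: two such maps are joined by 1-cells, by which one
    conjugates ([twist]). This makes restriction followed by reflection compatible
    with morphisms ([rx_mor]) and, the reflection being stable under products, with
    Baer sums ([sum_comm]).

    Two reductions make the nested definition of n-groupoids tractable. In a
    category in which a pullback of split epimorphisms is covered by its sections,
    functors are maps of reflexive graphs, and by the interchange law the
    composition of higher cells is determined by their composition along the objects
    ([gpd_over]); so n-groupoids are reflexive globular objects whose levels are
    groupoids over the objects ([nGrd_build], [nGrd_mor], [nGrd_ext]). And in M(E)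
    this groupoid structure is automatic ([comm_gpd]). *)

(** * Generalised elements and internal groupoids *)

Definition choice_of (T : Type) (h : inhabited T) : T :=
  proj1_sig (constructive_indefinite_description (fun _ : T => True)
    (match h with inhabits t => ex_intro _ t I end)).

Lemma dec (P : Prop) : {P} + {~ P}.
Proof.
apply choice_of. destruct (classic P) as [h | h]; constructor; auto.
Qed.

Lemma ca {C : Category} {X Y Z : C} {f : Y ~> Z} {g : X ~> Y} {h : X ~> Z} :
  f ∘ g = h -> forall T (x : T ~> X), f ∘ (g ∘ x) = h ∘ x.
Proof. intros <- T x. apply comp_assoc. Qed.

Lemma ca1 {C : Category} {X Y : C} {f : Y ~> X} {g : X ~> Y} :
  f ∘ g = id X -> forall T (x : T ~> X), f ∘ (g ∘ x) = x.
Proof. intros e T x. now rewrite (ca e), comp_idl. Qed.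

Ltac ra := rewrite <- ?comp_assoc, ?comp_idl, ?comp_idr.

Record Pbk {C : Category} {A B Z : C} (f : A ~> Z) (g : B ~> Z) := {
  pbo :> C;
  pp0 : pbo ~> A;
  pp1 : pbo ~> B;
  pbi : is_pullback f g pp0 pp1
}.
Arguments pp0 {C A B Z f g} _.
Arguments pp1 {C A B Z f g} _.

Record Lex (C : Category) := {
  lx_one : C;
  lx_term : is_terminal lx_one;
  lx_pb : forall (A B Z : C) (f : A ~> Z) (g : B ~> Z), Pbk f g
}.

(** A pullback of two split epimorphisms is covered by its two sections, as far
    as maps out of it are concerned. This consequence of protomodularity passes
    to the full subcategory of commutative objects, so that whatever is deduced
    from it alone holds in both categories compared here. *)
Definition JE (C : Category) : Prop :=
  forall (A B Z P : C) (f : A ~> Z) (g : B ~> Z) (p : P ~> A) (q : P ~> B),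
  is_pullback f g p q ->
  forall (s : Z ~> A) (t : Z ~> B), f ∘ s = id Z -> g ∘ t = id Z ->
  forall (ja : A ~> P) (jb : B ~> P),
  p ∘ ja = id A -> q ∘ ja = t ∘ f -> p ∘ jb = s ∘ g -> q ∘ jb = id B ->
  forall W (u v : P ~> W), u ∘ ja = v ∘ ja -> u ∘ jb = v ∘ jb -> u = v.

Section Lex.
Variables (C : Category) (L : Lex C).

Notation "1" := (lx_one L).
Definition bng (X : C) : X ~> 1 := bang (lx_term L) X.
Lemma one_eq (X : C) (f g : X ~> 1) : f = g.
Proof. apply (bang_uniq (lx_term L)). Qed.

Lemma pb_ex (A B Z P : C) (f : A ~> Z) (g : B ~> Z) (p : P ~> A) (q : P ~> B)
  (h : is_pullback f g p q) T (a : T ~> A) (b : T ~> B) :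
  f ∘ a = g ∘ b -> exists w : T ~> P, p ∘ w = a /\ q ∘ w = b.
Proof. intros e. exists (pb_pair h e). split; [apply pb_l | apply pb_r]. Qed.

Definition prd (A B : C) : Product A B.
Proof.
pose (P := lx_pb L (bng A) (bng B)).
refine {| prod_ob := P; prl := pp0 P; prr := pp1 P |}.
refine {| pair := fun T a b =>
  pb_pair (pbi P) (one_eq (bng A ∘ a) (bng B ∘ b)) |}.
- intros; apply pb_l.
- intros; apply pb_r.
- intros T u v; apply (pb_uniq (pbi P)).
Qed.

Lemma prl_pair (A B : C) (P : Product A B) T (a : T ~> A) (b : T ~> B) :
  prl P ∘ pr_pair P a b = a.
Proof. apply pair_l. Qed.
Lemma prr_pair (A B : C) (P : Product A B) T (a : T ~> A) (b : T ~> B) :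
  prr P ∘ pr_pair P a b = b.
Proof. apply pair_r. Qed.
Lemma prod_eq (A B : C) (P : Product A B) T (u v : T ~> P) :
  prl P ∘ u = prl P ∘ v -> prr P ∘ u = prr P ∘ v -> u = v.
Proof. apply (pair_uniq (prod_is P)). Qed.
Lemma pair_eta (A B : C) (P : Product A B) T (u : T ~> P) :
  pr_pair P (prl P ∘ u) (prr P ∘ u) = u.
Proof. apply prod_eq; now rewrite ?prl_pair, ?prr_pair. Qed.

Lemma equ_ex (X W : C) (a b : X ~> W) :
  exists (Eq : C) (e : Eq ~> X), a ∘ e = b ∘ e /\
    (forall T (t : T ~> X), a ∘ t = b ∘ t -> exists u : T ~> Eq, e ∘ u = t) /\
    (forall T (u v : T ~> Eq), e ∘ u = e ∘ v -> u = v).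
Proof.
pose (WW := prd W W).
pose (P := lx_pb L (pr_pair WW a b) (pr_pair WW (id W) (id W))).
exists P, (pp0 P).
assert (S := pb_sq (pbi P)).
rewrite !pr_pair_comp, !comp_idl in S.
assert (S1 := f_equal (fun h => prl WW ∘ h) S).
assert (S2 := f_equal (fun h => prr WW ∘ h) S).
cbv beta in S1, S2. rewrite !prl_pair in S1. rewrite !prr_pair in S2.
split; [congruence |]. split.
- intros T t e. destruct (pb_ex (pbi P) (a := t) (b := a ∘ t)) as [w [Hw _]].
  { rewrite !pr_pair_comp. rewrite comp_idl. now rewrite <- e. }
  now exists w.
- intros T u v e. apply (pb_uniq (pbi P) e).
  rewrite <- S1. ra. now rewrite e.
Qed.

Section JE.
Hypothesis je : JE C.

(** The form in which [JE] is applied: an identity between two natural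
    operations on compatible pairs of generalised elements may be verified on
    the pairs (a, t f a) and (s g b, b). *)
Lemma je_fun (A B Z W : C) (f : A ~> Z) (g : B ~> Z) (s : Z ~> A) (t : Z ~> B)
  (Phi Psi : forall T, (T ~> A) -> (T ~> B) -> (T ~> W)) :
  f ∘ s = id Z -> g ∘ t = id Z ->
  (forall T S a b (u : S ~> T), f ∘ a = g ∘ b ->
     Phi T a b ∘ u = Phi S (a ∘ u) (b ∘ u)) ->
  (forall T S a b (u : S ~> T), f ∘ a = g ∘ b ->
     Psi T a b ∘ u = Psi S (a ∘ u) (b ∘ u)) ->
  (Phi A (id A) (t ∘ f) = Psi A (id A) (t ∘ f)) ->
  (Phi B (s ∘ g) (id B) = Psi B (s ∘ g) (id B)) ->
  forall T (a : T ~> A) (b : T ~> B), f ∘ a = g ∘ b -> Phi T a b = Psi T a b.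
Proof.
intros fs gt nPhi nPsi ha hb T a b e.
pose (P := lx_pb L f g).
assert (Q := pb_sq (pbi P)).
destruct (pb_ex (pbi P) (a := id A) (b := t ∘ f)) as [ja [ja0 ja1]].
{ now rewrite (ca1 gt), comp_idr. }
destruct (pb_ex (pbi P) (a := s ∘ g) (b := id B)) as [jb [jb0 jb1]].
{ now rewrite (ca1 fs), comp_idr. }
assert (K : Phi P (pp0 P) (pp1 P) = Psi P (pp0 P) (pp1 P)).
{ apply (je (pbi P) fs gt ja0 ja1 jb0 jb1).
  - now rewrite nPhi, nPsi, ja0, ja1.
  - now rewrite nPhi, nPsi, jb0, jb1. }
destruct (pb_ex (pbi P) e) as [w [w0 w1]].
now rewrite <- w0, <- w1, <- nPhi, <- nPsi, K.
Qed.

(** Over the base [V] the two sections become the axes through [s] and [t]. *)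
Lemma je_prod (V A B W : C) (s : V ~> A) (t : V ~> B)
  (Phi Psi : forall T, (T ~> V) -> (T ~> A) -> (T ~> B) -> (T ~> W)) :
  (forall T S w a b (u : S ~> T), Phi T w a b ∘ u = Phi S (w ∘ u) (a ∘ u) (b ∘ u)) ->
  (forall T S w a b (u : S ~> T), Psi T w a b ∘ u = Psi S (w ∘ u) (a ∘ u) (b ∘ u)) ->
  (forall T w a, Phi T w a (t ∘ w) = Psi T w a (t ∘ w)) ->
  (forall T w b, Phi T w (s ∘ w) b = Psi T w (s ∘ w) b) ->
  forall T w a b, Phi T w a b = Psi T w a b.
Proof.
intros nPhi nPsi ha hb T w a b.
pose (VA := prd V A). pose (VB := prd V B).
assert (K := @je_fun VA VB V W (prl VA) (prl VB)
  (pr_pair VA (id V) s) (pr_pair VB (id V) t)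
  (fun T x y => Phi T (prl VA ∘ x) (prr VA ∘ x) (prr VB ∘ y))
  (fun T x y => Psi T (prl VA ∘ x) (prr VA ∘ x) (prr VB ∘ y))).
specialize (K (prl_pair VA _ _) (prl_pair VB _ _)).
lapply K; clear K;
  [| intros; rewrite nPhi; now ra].
intros K; lapply K; clear K;
  [| intros; rewrite nPsi; now ra].
intros K; lapply K; clear K.
2:{ rewrite comp_assoc, prr_pair, !comp_idr. apply ha. }
intros K; lapply K; clear K.
2:{ rewrite !comp_assoc, prl_pair, prr_pair, !comp_idl, !comp_idr. apply hb. }
intros K. specialize (K T (pr_pair VA w a) (pr_pair VB w b)).
rewrite !prl_pair, !prr_pair in K. now apply K.
Qed.
End JE.
End Lex.

(** A groupoid with multiplication given on generalised elements; off the
    composable pairs [mul] takes arbitrary values, which spares every composite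
    its proof of composability. Only the unit and inverse laws are recorded: in
    the presence of [JE] the others follow. *)
Record Gpd {C : Category} {Z X : C} (d c : Z ~> X) (s : X ~> Z) := {
  mul : forall T, (T ~> Z) -> (T ~> Z) -> (T ~> Z);
  inv : Z ~> Z;
  mul_nat : forall T S (x y : T ~> Z) (u : S ~> T), c ∘ x = d ∘ y ->
    mul x y ∘ u = mul (x ∘ u) (y ∘ u);
  gds : d ∘ s = id X;
  gcs : c ∘ s = id X;
  mul1l : forall T (x : T ~> Z), mul (s ∘ (d ∘ x)) x = x;
  mul1r : forall T (x : T ~> Z), mul x (s ∘ (c ∘ x)) = x;
  gdi : d ∘ inv = c;
  gci : c ∘ inv = d;
  mulV : forall T (x : T ~> Z), mul x (inv ∘ x) = s ∘ (d ∘ x);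
  mulVl : forall T (x : T ~> Z), mul (inv ∘ x) x = s ∘ (c ∘ x)
}.

Section Gpd.
Variables (C : Category) (L : Lex C) (je : JE C).

Lemma gpd_of_map (Z X : C) (d c : Z ~> X) (s : X ~> Z)
  (P : C) (p q : P ~> Z) (pb : is_pullback c d p q) (m : P ~> Z) (i : Z ~> Z) :
  d ∘ s = id X -> c ∘ s = id X -> d ∘ i = c -> c ∘ i = d ->
  (forall T (w : T ~> P), p ∘ w = s ∘ (d ∘ (q ∘ w)) -> m ∘ w = q ∘ w) ->
  (forall T (w : T ~> P), q ∘ w = s ∘ (c ∘ (p ∘ w)) -> m ∘ w = p ∘ w) ->
  (forall T (w : T ~> P), q ∘ w = i ∘ (p ∘ w) -> m ∘ w = s ∘ (d ∘ (p ∘ w))) ->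
  (forall T (w : T ~> P), p ∘ w = i ∘ (q ∘ w) -> m ∘ w = s ∘ (c ∘ (q ∘ w))) ->
  exists G : Gpd d c s, forall T (w : T ~> P), mul G (p ∘ w) (q ∘ w) = m ∘ w.
Proof.
intros ds cs di ci h1 h2 h3 h4.
set (mu := fun T (x y : T ~> Z) =>
  match dec (c ∘ x = d ∘ y) with
  | left e => m ∘ pb_pair pb e | right _ => x end).
assert (E : forall T (w : T ~> P), mu T (p ∘ w) (q ∘ w) = m ∘ w).
{ intros T w. unfold mu. destruct (dec _) as [e | n].
  - f_equal. apply (pb_uniq pb); now rewrite ?pb_l, ?pb_r.
  - destruct n. now rewrite !comp_assoc, (pb_sq pb). }
assert (E' : forall T (x y : T ~> Z) (R : T ~> Z), c ∘ x = d ∘ y ->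
  (forall w : T ~> P, p ∘ w = x -> q ∘ w = y -> m ∘ w = R) -> mu T x y = R).
{ intros T x y R e H. destruct (pb_ex pb e) as [w [w0 w1]].
  rewrite <- (H w w0 w1), <- E. congruence. }
unshelve eexists {| mul := mu; inv := i |}; auto.
- intros T S x y u e. destruct (pb_ex pb e) as [w [w0 w1]].
  rewrite <- w0, <- w1, E, <- !comp_assoc, E. reflexivity.
- intros T x. apply E'; [now rewrite (ca1 cs) |].
  intros w w0 w1. rewrite h1; congruence.
- intros T x. apply E'; [now rewrite (ca1 ds) |].
  intros w w0 w1. rewrite h2; congruence.
- intros T x. apply E'; [now rewrite (ca di) |].
  intros w w0 w1. rewrite h3; congruence.
- intros T x. apply E'; [now rewrite (ca ci) |].
  intros w w0 w1. rewrite h4; congruence.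
Qed.

Section Laws.
Variables (Z X : C) (d c : Z ~> X) (s : X ~> Z) (G : Gpd d c s).

Lemma ds T (x : T ~> X) : d ∘ (s ∘ x) = x. Proof. apply (ca1 (gds G)). Qed.
Lemma cs T (x : T ~> X) : c ∘ (s ∘ x) = x. Proof. apply (ca1 (gcs G)). Qed.
Lemma di T (x : T ~> Z) : d ∘ (inv G ∘ x) = c ∘ x. Proof. apply (ca (gdi G)). Qed.
Lemma ci T (x : T ~> Z) : c ∘ (inv G ∘ x) = d ∘ x. Proof. apply (ca (gci G)). Qed.

(** Composable pairs form a pullback of split epimorphisms whose two sections
    compose an arrow with an identity; hence every law about composites below
    is verified on trivial composites only. *)
Lemma mul_ext W (Phi Psi : forall T, (T ~> Z) -> (T ~> Z) -> (T ~> W)) :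
  (forall T S a b (u : S ~> T), c ∘ a = d ∘ b ->
     Phi T a b ∘ u = Phi S (a ∘ u) (b ∘ u)) ->
  (forall T S a b (u : S ~> T), c ∘ a = d ∘ b ->
     Psi T a b ∘ u = Psi S (a ∘ u) (b ∘ u)) ->
  (forall T a, Phi T a (s ∘ (c ∘ a)) = Psi T a (s ∘ (c ∘ a))) ->
  (forall T b, Phi T (s ∘ (d ∘ b)) b = Psi T (s ∘ (d ∘ b)) b) ->
  forall T (a b : T ~> Z), c ∘ a = d ∘ b -> Phi T a b = Psi T a b.
Proof.
intros n1 n2 h1 h2.
apply (je_fun L je (gcs G) (gds G)); auto.
- specialize (h1 _ (id Z)). now rewrite comp_idr in h1.
- specialize (h2 _ (id Z)). now rewrite comp_idr in h2.
Qed.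

Lemma d_mul T (x y : T ~> Z) : c ∘ x = d ∘ y -> d ∘ mul G x y = d ∘ x.
Proof.
apply (mul_ext (Phi := fun T x y => d ∘ mul G x y) (Psi := fun T x y => d ∘ x)).
- intros. now rewrite <- comp_assoc, mul_nat.
- intros. now rewrite comp_assoc.
- intros. now rewrite mul1r.
- intros. now rewrite mul1l, ds.
Qed.
Lemma c_mul T (x y : T ~> Z) : c ∘ x = d ∘ y -> c ∘ mul G x y = c ∘ y.
Proof.
apply (mul_ext (Phi := fun T x y => c ∘ mul G x y) (Psi := fun T x y => c ∘ y)).
- intros. now rewrite <- comp_assoc, mul_nat.
- intros. now rewrite comp_assoc.
- intros. now rewrite mul1r, cs.
- intros. now rewrite mul1l.
Qed.

Lemma mul_assoc T (x y z : T ~> Z) : c ∘ x = d ∘ y -> c ∘ y = d ∘ z ->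
  mul G (mul G x y) z = mul G x (mul G y z).
Proof.
pose (P := lx_pb L c d).
intros e1 e2.
destruct (pb_ex (pbi P) e1) as [w [w0 w1]].
assert (PP : forall T (w : T ~> P), c ∘ (pp0 P ∘ w) = d ∘ (pp1 P ∘ w)).
{ intros. now rewrite !comp_assoc, (pb_sq (pbi P)). }
destruct (pb_ex (pbi P) (a := id Z) (b := s ∘ c)) as [t [t0 t1]].
{ rewrite comp_idr. now rewrite ds. }
(* composable triples are the pullback of [c ∘ q : P -> X] along [d] *)
assert (N : forall T (w : T ~> P) (z : T ~> Z), c ∘ pp1 P ∘ w = d ∘ z ->
  mul G (mul G (pp0 P ∘ w) (pp1 P ∘ w)) z = mul G (pp0 P ∘ w) (mul G (pp1 P ∘ w) z)).
{ apply (@je_fun C L je P Z X Z (c ∘ pp1 P) d (t ∘ s) s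
  (fun T w z => mul G (mul G (pp0 P ∘ w) (pp1 P ∘ w)) z)
  (fun T w z => mul G (pp0 P ∘ w) (mul G (pp1 P ∘ w) z))).
- rewrite <- comp_assoc, (ca t1), <- !comp_assoc, cs. apply (gcs G).
- apply (gds G).
- intros T0 S a b u e. rewrite mul_nat, mul_nat, <- !comp_assoc; auto.
  rewrite c_mul, comp_assoc; auto.
- intros T0 S a b u e.
  assert (e' : c ∘ (pp1 P ∘ a) = d ∘ b) by now rewrite comp_assoc.
  rewrite mul_nat, mul_nat, <- !comp_assoc; auto.
  rewrite d_mul; auto.
- rewrite !comp_idr.
  assert (R := c_mul (pb_sq (pbi P))). rewrite <- R at 1. rewrite !mul1r.
  reflexivity.
- rewrite <- ?comp_assoc. rewrite ?(ca t1), ?(ca t0), ?comp_idl. ra. rewrite cs.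
  assert (R := mul1l G (id Z)). rewrite comp_idr in R. rewrite R.
  assert (R' := mul1r G (s ∘ d)). rewrite cs in R'. now rewrite R', R. }
rewrite <- w0, <- w1. apply N. now rewrite <- comp_assoc, w1.
Qed.
End Laws.

(** A map of reflexive graphs between groupoids preserves trivial composites,
    hence all composites. *)
Lemma functor_mul (Z X Z' X' : C) (d c : Z ~> X) (s : X ~> Z)
  (d' c' : Z' ~> X') (s' : X' ~> Z') (G : Gpd d c s) (G' : Gpd d' c' s')
  (h : Z ~> Z') (k : X ~> X') :
  d' ∘ h = k ∘ d -> c' ∘ h = k ∘ c -> h ∘ s = s' ∘ k ->
  forall T (x y : T ~> Z), c ∘ x = d ∘ y ->
  h ∘ mul G x y = mul G' (h ∘ x) (h ∘ y).
Proof.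
intros hd hc hs.
assert (E : forall T (x y : T ~> Z), c ∘ x = d ∘ y ->
  c' ∘ (h ∘ x) = d' ∘ (h ∘ y)).
{ intros T x y e. rewrite (ca hc), (ca hd), <- !comp_assoc. now rewrite e. }
apply (mul_ext G (Phi := fun T x y => h ∘ mul G x y)
  (Psi := fun T x y => mul G' (h ∘ x) (h ∘ y))).
- intros. now rewrite <- comp_assoc, mul_nat.
- intros. now rewrite mul_nat, <- !comp_assoc by auto.
- intros. rewrite mul1r, (ca hs); ra. rewrite (comp_assoc k), <- hc, <- comp_assoc. now rewrite mul1r.
- intros. rewrite mul1l, (ca hs); ra. rewrite (comp_assoc k), <- hd, <- comp_assoc. now rewrite mul1l.
Qed.

Lemma inv_uniq (Z X : C) (d c : Z ~> X) (s : X ~> Z) (G : Gpd d c s)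
  T (x y : T ~> Z) : c ∘ x = d ∘ y -> mul G x y = s ∘ (d ∘ x) ->
  y = inv G ∘ x.
Proof.
intros e h.
rewrite <- (mul1l G y), <- e, <- (mulVl G x), mul_assoc, h; auto.
- rewrite <- (ci G x). now rewrite mul1r.
- now rewrite ci.
Qed.

Lemma functor_inv (Z X Z' X' : C) (d c : Z ~> X) (s : X ~> Z)
  (d' c' : Z' ~> X') (s' : X' ~> Z') (G : Gpd d c s) (G' : Gpd d' c' s')
  (h : Z ~> Z') (k : X ~> X') :
  d' ∘ h = k ∘ d -> c' ∘ h = k ∘ c -> h ∘ s = s' ∘ k ->
  h ∘ inv G = inv G' ∘ h.
Proof.
intros hd hc hs.
apply inv_uniq.
- now rewrite hc, (ca hd), <- comp_assoc, gdi.
- rewrite <- (comp_idr h) at 1.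
  rewrite <- (functor_mul G G' hd hc hs); [| now rewrite comp_idr, gdi].
  rewrite <- (comp_idr (inv G)), mulV, comp_idr, (ca hs), hd. now rewrite comp_assoc.
Qed.

Lemma gpd_eq (Z X : C) (d c d' c' : Z ~> X) (s s' : X ~> Z) :
  d = d' -> c = c' -> s = s' -> inhabited (Gpd d c s) -> inhabited (Gpd d' c' s').
Proof. now intros <- <- <-. Qed.

(** The Eckmann-Hilton phenomenon of Mal'cev categories: loops form a unital
    object over the objects, and a unital operation is commutative. *)
Lemma loops_comm (Z X : C) (d c : Z ~> X) (s : X ~> Z) (G : Gpd d c s)
  T (x y : T ~> Z) : d ∘ x = c ∘ x -> d ∘ y = c ∘ y -> d ∘ x = d ∘ y ->
  mul G x y = mul G y x.
Proof.
intros lx ly e.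
destruct (equ_ex L d c) as [Lo [l [hl [ll lm]]]].
destruct (ll X s) as [t ht]; [now rewrite (gds G), (gcs G) |].
destruct (ll T x lx) as [x' <-]. destruct (ll T y ly) as [y' <-].
assert (E : forall S (a b : S ~> Lo), d ∘ l ∘ a = d ∘ l ∘ b ->
  c ∘ (l ∘ a) = d ∘ (l ∘ b)).
{ intros S a b H. now rewrite (comp_assoc c), <- hl, H, comp_assoc. }
assert (R1 := mul1l G l).
assert (R2 : mul G l (s ∘ (d ∘ l)) = l) by (rewrite hl; apply mul1r).
apply (@je_fun C L je Lo Lo X Z (d ∘ l) (d ∘ l) t t
  (fun T a b => mul G (l ∘ a) (l ∘ b)) (fun T a b => mul G (l ∘ b) (l ∘ a))).
- now rewrite <- comp_assoc, ht, (gds G).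
- now rewrite <- comp_assoc, ht, (gds G).
- intros. rewrite mul_nat; [now ra | auto].
- intros. rewrite mul_nat; [now ra | auto].
- now rewrite (comp_assoc l), ht, comp_idr, R1, R2.
- now rewrite (comp_assoc l), ht, comp_idr, R1, R2.
- now ra.
Qed.

Lemma mulKV (Z X : C) (d c : Z ~> X) (s : X ~> Z) (G : Gpd d c s)
  T (x y : T ~> Z) : c ∘ x = c ∘ y -> mul G (mul G x (inv G ∘ y)) y = x.
Proof.
intros e. rewrite mul_assoc, mulVl, <- e; [apply mul1r | now rewrite di | apply ci].
Qed.

(** For a 2-cell groupoid over [Y] that is compatible with a groupoid structure
    over [X], the interchange law leaves no choice: the composite of [x] and [y]
    along [Y] is x (s d y)^-1 y, computed along [X]. Conversely this formula
    defines a groupoid, the inverse of x being (s d x) x^-1 (s c x). *)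
Lemma gpd_over (Z Y X : C) (d c : Z ~> Y) (s : Y ~> Z)
  (bd bc : Y ~> X) (bs : X ~> Y) :
  d ∘ s = id Y -> c ∘ s = id Y ->
  bd ∘ d = bd ∘ c -> bc ∘ d = bc ∘ c ->
  Gpd bd bc bs -> Gpd (bd ∘ d) (bc ∘ c) (s ∘ bs) -> inhabited (Gpd d c s).
Proof.
intros ds0 cs0 e0 e1 H G.
assert (fd0 : bd ∘ d = id X ∘ (bd ∘ d)) by now rewrite comp_idl.
assert (fd1 : bc ∘ d = id X ∘ (bc ∘ c)) by now rewrite comp_idl.
assert (fds : d ∘ (s ∘ bs) = bs ∘ id X) by now rewrite (ca1 ds0), comp_idr.
assert (fc0 : bd ∘ c = id X ∘ (bd ∘ d)) by now rewrite comp_idl.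
assert (fc1 : bc ∘ c = id X ∘ (bc ∘ c)) by now rewrite comp_idl.
assert (fcs : c ∘ (s ∘ bs) = bs ∘ id X) by now rewrite (ca1 cs0), comp_idr.
set (D := bd ∘ d). set (K := bc ∘ c). fold D K in G, fd0, fd1, fc0, fc1.
assert (Dsd : forall T (x : T ~> Z), D ∘ (s ∘ (d ∘ x)) = D ∘ x).
{ intros. unfold D. ra. now rewrite (ca1 ds0). }
assert (Dsc : forall T (x : T ~> Z), D ∘ (s ∘ (c ∘ x)) = D ∘ x).
{ intros. unfold D. ra. now rewrite (ca1 ds0), (ca e0), <- comp_assoc. }
assert (Ksd : forall T (x : T ~> Z), K ∘ (s ∘ (d ∘ x)) = K ∘ x).
{ intros. unfold K. ra. now rewrite (ca1 cs0), (ca e1), <- comp_assoc. }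
assert (Ksc : forall T (x : T ~> Z), K ∘ (s ∘ (c ∘ x)) = K ∘ x).
{ intros. unfold K. ra. now rewrite (ca1 cs0). }
assert (Di := di G). assert (Ki := ci G).
assert (A1 : forall T (x y : T ~> Z), c ∘ x = d ∘ y ->
  K ∘ x = D ∘ (inv G ∘ (s ∘ (d ∘ y)))).
{ intros T x y e. rewrite Di, <- e, Ksc. reflexivity. }
assert (A2 : forall T (x y : T ~> Z), c ∘ x = d ∘ y ->
  K ∘ mul G x (inv G ∘ (s ∘ (d ∘ y))) = D ∘ y).
{ intros T x y e. rewrite (c_mul G) by auto. now rewrite Ki, Dsd. }
set (mu := fun T (x y : T ~> Z) => mul G (mul G x (inv G ∘ (s ∘ (d ∘ y)))) y).
set (iw := mul G (mul G (s ∘ d) (inv G)) (s ∘ c)).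
assert (B1 : K ∘ (s ∘ d) = D ∘ inv G).
{ rewrite (gdi G), <- (comp_idr d), Ksd. apply comp_idr. }
assert (B2 : K ∘ mul G (s ∘ d) (inv G) = D ∘ (s ∘ c)).
{ rewrite (c_mul G B1), (gci G), <- (comp_idr c), Dsc. now rewrite comp_idr. }
assert (iwE : forall T (x : T ~> Z),
  iw ∘ x = mul G (mul G (s ∘ (d ∘ x)) (inv G ∘ x)) (s ∘ (c ∘ x))).
{ intros. unfold iw. rewrite mul_nat by exact B2. rewrite mul_nat by exact B1. now ra. }
assert (iwd : d ∘ iw = c).
{ unfold iw. rewrite (functor_mul G H fd0 fd1 fds B2).
  rewrite (functor_mul G H fd0 fd1 fds B1), (functor_inv G H fd0 fd1 fds).
  rewrite !(ca1 ds0), mulV, e0. apply mul1l. }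
assert (iwc : c ∘ iw = d).
{ unfold iw. rewrite (functor_mul G H fc0 fc1 fcs B2).
  rewrite (functor_mul G H fc0 fc1 fcs B1), (functor_inv G H fc0 fc1 fcs).
  rewrite !(ca1 cs0), mulKV; auto. }
constructor. unshelve refine {| mul := mu; inv := iw |}; auto.
- intros T S x y u e. unfold mu.
  rewrite !mul_nat; auto. now rewrite <- !comp_assoc.
- intros T x. unfold mu. rewrite mulV, Dsd. apply (mul1l G).
- intros T x. unfold mu. rewrite (ca1 ds0). apply mulKV. now rewrite Ksc.
- intros T x. unfold mu. rewrite (ca iwd), iwE.
  (* x p^-1 and q x^-1 are loops, and loops commute *)
  set (p := s ∘ (c ∘ x)). set (q := s ∘ (d ∘ x)).
  assert (Dp : D ∘ p = D ∘ x) by apply Dsc.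
  assert (Kp : K ∘ p = K ∘ x) by apply Ksc.
  assert (Dq : D ∘ q = D ∘ x) by apply Dsd.
  assert (Kq : K ∘ q = K ∘ x) by apply Ksd.
  assert (E1 : K ∘ x = D ∘ (inv G ∘ p)) by (rewrite Di; congruence).
  assert (E2 : K ∘ q = D ∘ (inv G ∘ x)) by (rewrite Di; congruence).
  rewrite <- (mul_assoc G); [| | rewrite c_mul; auto; now rewrite Ki].
  2:{ rewrite (c_mul G E1), (d_mul G E2), Ki. congruence. }
  rewrite (loops_comm G (x := mul G x (inv G ∘ p))).
  2,3: rewrite d_mul, c_mul, Ki; congruence.
  2: rewrite !d_mul; congruence.
  rewrite (mul_assoc G (x := mul G q (inv G ∘ x))).
  2: rewrite c_mul, Ki, d_mul; auto; congruence.
  2: rewrite c_mul, Ki; auto; congruence.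
  rewrite mulKV by congruence. apply mulKV. congruence.
- intros T x. unfold mu. rewrite iwE.
  set (p := s ∘ (c ∘ x)). set (q := s ∘ (d ∘ x)).
  assert (Dp : D ∘ p = D ∘ x) by apply Dsc.
  assert (Kp : K ∘ p = K ∘ x) by apply Ksc.
  assert (Dq : D ∘ q = D ∘ x) by apply Dsd.
  assert (Kq : K ∘ q = K ∘ x) by apply Ksd.
  assert (E1 : K ∘ p = D ∘ (inv G ∘ q)) by (rewrite Di; congruence).
  assert (E2 : K ∘ q = D ∘ (inv G ∘ x)) by (rewrite Di; congruence).
  rewrite (mul_assoc G (z := inv G ∘ q)); auto.
  2: rewrite c_mul, Ki; auto; congruence.
  rewrite (loops_comm G (x := mul G q (inv G ∘ x))).
  2,3: rewrite d_mul, c_mul, Ki; congruence.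
  2: rewrite !d_mul; congruence.
  rewrite (mul_assoc G (z := x)).
  2: rewrite c_mul, Ki, d_mul; auto; congruence.
  2: rewrite c_mul, Ki; auto; congruence.
  rewrite mulKV by congruence. apply mulKV. congruence.
Qed.
End Gpd.

(** * Higher groupoids as globular objects *)

Section Cells.
Variable (C : Category).

(** The iterated source, target and identity [bd], [bc], [bs] present the cells
    of an n-groupoid as arrows over its objects. *)
Fixpoint obj0 (n : nat) : nGrd C n -> C :=
  match n return nGrd C n -> C with
  | O => fun X => cells X
  | S m => fun X => @obj0 m (under X)
  end.

Definition idc (n : nat) (X : nGrd C (S n)) : cells (under X) ~> cells X :=
  @fmap _ _ (@cells C n) (under X) (arrows X) (proj1_sig (s0 (projT2 X))).

Definition umor (n : nat) (X Y : nGrd C (S n)) (F : X ~> Y) : under X ~> under Y :=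
  gf0 F.

Fixpoint bd (n : nat) : forall X : nGrd C n, cells X ~> obj0 X :=
  match n return forall X : nGrd C n, cells X ~> obj0 X with
  | O => fun X => id (cells X)
  | S m => fun X => @bd m (under X) ∘ dom X
  end.

Fixpoint bc (n : nat) : forall X : nGrd C n, cells X ~> obj0 X :=
  match n return forall X : nGrd C n, cells X ~> obj0 X with
  | O => fun X => id (cells X)
  | S m => fun X => @bc m (under X) ∘ cod X
  end.

Fixpoint bs (n : nat) : forall X : nGrd C n, obj0 X ~> cells X :=
  match n return forall X : nGrd C n, obj0 X ~> cells X with
  | O => fun X => id (cells X)
  | S m => fun X => idc X ∘ @bs m (under X)
  end.

Definition par (n : nat) : forall (X : nGrd C n) T, (T ~> cells X) -> (T ~> cells X) -> Prop :=
  match n return forall (X : nGrd C n) T, (T ~> cells X) -> (T ~> cells X) -> Prop with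
  | O => fun X T u v => True
  | S m => fun X T u v => dom X ∘ u = dom X ∘ v /\ cod X ∘ u = cod X ∘ v
  end.

Lemma sq_comp (X X' X'' Y Y' Y'' : C) (a : X ~> X') (a' : X' ~> X'')
  (b : Y ~> Y') (b' : Y' ~> Y'') (d : X ~> Y) (d' : X' ~> Y') (d'' : X'' ~> Y'') :
  d'' ∘ a' = b' ∘ d' -> d' ∘ a = b ∘ d -> d'' ∘ (a' ∘ a) = (b' ∘ b) ∘ d.
Proof. intros e' e. now rewrite (ca e'), <- comp_assoc, e, comp_assoc. Qed.

Lemma fmap_eq (n : nat) (X Y Y' Z : nGrd C n) (g : Y ~> Z) (f : X ~> Y)
  (g' : Y' ~> Z) (f' : X ~> Y') : g ∘ f = g' ∘ f' ->
  fmap cells g ∘ fmap cells f = fmap cells g' ∘ fmap cells f'.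
Proof. intros e. now rewrite <- !fmap_comp, e. Qed.

Lemma dom_nat n (X Y : nGrd C (S n)) (F : X ~> Y) :
  dom Y ∘ fmap cells F = fmap cells (umor F) ∘ dom X.
Proof.
exact (@fmap_eq n (arrows X) (arrows Y) (under X) (under Y)
  (proj1_sig (d0 (projT2 Y))) (gf1 F) (umor F) (proj1_sig (d0 (projT2 X))) (gf_d0 F)).
Qed.

Lemma cod_nat n (X Y : nGrd C (S n)) (F : X ~> Y) :
  cod Y ∘ fmap cells F = fmap cells (umor F) ∘ cod X.
Proof.
exact (@fmap_eq n (arrows X) (arrows Y) (under X) (under Y)
  (proj1_sig (d1 (projT2 Y))) (gf1 F) (umor F) (proj1_sig (d1 (projT2 X))) (gf_d1 F)).
Qed.

Lemma idc_nat n (X Y : nGrd C (S n)) (F : X ~> Y) :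
  fmap cells F ∘ idc X = idc Y ∘ fmap cells (umor F).
Proof.
exact (@fmap_eq n (under X) (arrows X) (under Y) (arrows Y)
  (gf1 F) (proj1_sig (s0 (projT2 X))) (proj1_sig (s0 (projT2 Y))) (umor F) (gf_s0 F)).
Qed.

Lemma fmap_eq1 (n : nat) (X Y : nGrd C n) (g : Y ~> X) (f : X ~> Y) :
  g ∘ f = id X -> fmap cells g ∘ fmap cells f = id (cells X).
Proof. intros e. now rewrite <- fmap_comp, e, fmap_id. Qed.

Lemma dom_idc n (X : nGrd C (S n)) : dom X ∘ idc X = id _.
Proof.
exact (@fmap_eq1 n (under X) (arrows X) (proj1_sig (d0 (projT2 X)))
  (proj1_sig (s0 (projT2 X))) (f_equal (@proj1_sig _ _) (d0_s0 (projT2 X)))).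
Qed.

Lemma cod_idc n (X : nGrd C (S n)) : cod X ∘ idc X = id _.
Proof.
exact (@fmap_eq1 n (under X) (arrows X) (proj1_sig (d1 (projT2 X)))
  (proj1_sig (s0 (projT2 X))) (f_equal (@proj1_sig _ _) (d1_s0 (projT2 X)))).
Qed.

Lemma arr_over n (X : nGrd C (S (S n)))
  (f : FibreHom (X1 (projT2 X)) (projT2 (under X))) :
  dom (under X) ∘ @fmap _ _ (@cells C (S n)) (arrows X) (under X) (proj1_sig f)
   = dom (arrows X) /\
  cod (under X) ∘ @fmap _ _ (@cells C (S n)) (arrows X) (under X) (proj1_sig f)
   = cod (arrows X).
Proof.
destruct f as [g hg].
pose (g' := g : @Hom (nGrd C (S n)) (arrows X) (under X)).
assert (e : umor g' = id (under (under X))) by exact hg.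
assert (A := dom_nat g'). assert (B := cod_nat g').
rewrite e, fmap_id, comp_idl in A. rewrite e, fmap_id, comp_idl in B. auto.
Qed.

Lemma arr_idc n (X : nGrd C (S (S n))) : idc X ∘ idc (under X) = idc (arrows X).
Proof.
pose (g := proj1_sig (s0 (projT2 X)) : @Hom (nGrd C (S n)) (under X) (arrows X)).
assert (e : umor g = id (under (under X))) by exact (proj2_sig (s0 (projT2 X))).
assert (A := idc_nat g). rewrite e, fmap_id, comp_idr in A. exact A.
Qed.

Lemma par_dc n (X : nGrd C (S n)) : par (dom X) (cod X).
Proof.
destruct n as [| n]; [exact I |].
destruct (arr_over (d0 (projT2 X))) as [a1 a2], (arr_over (d1 (projT2 X))) as [b1 b2].
split; [exact (eq_trans a1 (eq_sym b1)) | exact (eq_trans a2 (eq_sym b2))].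
Qed.

Lemma par_comp n (X : nGrd C n) T (u v : T ~> cells X) S (w : S ~> T) :
  par u v -> par (u ∘ w) (v ∘ w).
Proof.
destruct n; [easy |]. intros [e1 e2]. split; rewrite !comp_assoc; congruence.
Qed.

Lemma bd_S n (X : nGrd C (S n)) : bd X = bd (under X) ∘ dom X.
Proof. reflexivity. Qed.
Lemma bc_S n (X : nGrd C (S n)) : bc X = bc (under X) ∘ cod X.
Proof. reflexivity. Qed.
Lemma bs_S n (X : nGrd C (S n)) : bs X = idc X ∘ bs (under X).
Proof. reflexivity. Qed.

Lemma par_b n (X : nGrd C (S n)) T (u v : T ~> cells X) : par u v ->
  bd X ∘ u = bd X ∘ v /\ bc X ∘ u = bc X ∘ v.
Proof.
intros [e1 e2]. rewrite bd_S, bc_S, <- !comp_assoc, e1, e2. auto.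
Qed.

Lemma par_mor n (X Y : nGrd C n) (F : X ~> Y) T (u v : T ~> cells X) :
  par u v -> par (fmap cells F ∘ u) (fmap cells F ∘ v).
Proof.
destruct n; [easy |]. intros [e1 e2].
split; [rewrite !(ca (dom_nat F)) | rewrite !(ca (cod_nat F))];
  rewrite <- !comp_assoc; congruence.
Qed.

(** The globular data of one more dimension over [b]. The whole higher groupoid
    structure is encoded in [rgp]: the new cells compose along the objects. *)
Record RG (m : nat) (b : nGrd C m) (Z : C) := {
  rd : Z ~> cells b;
  rc : Z ~> cells b;
  rs : cells b ~> Z;
  rds : rd ∘ rs = id _;
  rcs : rc ∘ rs = id _;
  rpar : par rd rc;
  rgp : inhabited (Gpd (bd b ∘ rd) (bc b ∘ rc) (rs ∘ bs b))
}.

Definition RGd (n : nat) : st_base (stage C n) -> C -> Type :=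
  match n return st_base (stage C n) -> C -> Type with
  | O => fun _ _ => unit
  | S m => fun b Z => @RG m b Z
  end.

Notation FO n b := (FOb (st_over (stage C n)) b).
Definition tot (n : nat) (b : st_base (stage C n)) (x : FO n b) : nGrd C n :=
  existT _ b x.
Definition cellF (n : nat) (b b' : st_base (stage C n)) (x : FO n b) (x' : FO n b')
  (f : FHom x x') : cells (tot x) ~> cells (tot x') :=
  @fmap _ _ (@cells C n) (tot x) (tot x') f.

Lemma cellF_comp (n : nat) (b b' b'' : st_base (stage C n)) (x : FO n b)
  (x' : FO n b') (x'' : FO n b'') (g : FHom x' x'') (f : FHom x x') :
  cellF (fcomp g f) = cellF g ∘ cellF f.
Proof. exact (@fmap_comp _ _ (@cells C n) (tot x) (tot x') (tot x'') g f). Qed.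
Lemma cellF_id (n : nat) (b : st_base (stage C n)) (x : FO n b) :
  cellF (fid x) = id (cells (tot x)).
Proof. exact (@fmap_id _ _ (@cells C n) (tot x)). Qed.

Definition cpt (n : nat) : forall (b b' : st_base (stage C n)) (x : FO n b)
    (x' : FO n b') (be : b ~> b') (u : cells (tot x) ~> cells (tot x')), Prop :=
  match n return forall (b b' : st_base (stage C n)) (x : FO n b)
    (x' : FO n b') (be : b ~> b') (u : cells (tot x) ~> cells (tot x')), Prop with
  | O => fun _ _ _ _ _ _ => True
  | S m => fun b b' x x' be u =>
     dom (tot (n := S m) x') ∘ u = @fmap _ _ (@cells C m) b b' be ∘ dom (tot (n := S m) x) /\
     cod (tot (n := S m) x') ∘ u = @fmap _ _ (@cells C m) b b' be ∘ cod (tot (n := S m) x) /\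
     u ∘ idc (tot (n := S m) x) = idc (tot (n := S m) x') ∘ @fmap _ _ (@cells C m) b b' be
  end.

Lemma cpt_cell (n : nat) (b b' : st_base (stage C n)) (x : FO n b)
    (x' : FO n b') (f : FHom x x') : cpt (fproj f) (cellF f).
Proof.
destruct n; [exact I |]. simpl in *.
set (F := f : @Hom (nGrd C (S n)) (tot (n := S n) x) (tot (n := S n) x')).
split; [exact (dom_nat F) | split; [exact (cod_nat F) | exact (idc_nat F)]].
Qed.

Lemma cpt_comp (n : nat) (b b' b'' : st_base (stage C n)) (x : FO n b)
    (x' : FO n b') (x'' : FO n b'') (be : b ~> b') (be' : b' ~> b'')
   (u : cells (tot x) ~> cells (tot x')) (u' : cells (tot x') ~> cells (tot x'')) :
  cpt be u -> cpt be' u' -> cpt (be' ∘ be) (u' ∘ u).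
Proof.
destruct n; [intros; exact I |].
intros [a1 [a2 a3]] [b1 [b2 b3]].
pose (k := @fmap_comp _ _ (@cells C n) b b' b'' be' be).
repeat split.
- exact (eq_trans (sq_comp b1 a1) (f_equal (fun h => h ∘ _) (eq_sym k))).
- exact (eq_trans (sq_comp b2 a2) (f_equal (fun h => h ∘ _) (eq_sym k))).
- exact (eq_trans (eq_sym (sq_comp (eq_sym b3) (eq_sym a3)))
    (f_equal (fun h => _ ∘ h) (eq_sym k))).
Qed.

Definition Faith (n : nat) : Prop :=
  forall (b b' : st_base (stage C n)) (x : FO n b) (x' : FO n b') (f g : FHom x x'),
  fproj f = fproj g -> cellF f = cellF g -> f = g.

Lemma faith (n : nat) : Faith n.
Proof.
induction n as [| n IH]; intros b b' x x' f g e h.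
- exact h.
- apply GrdHom_ext; [exact e |].
  apply IH; [| exact h].
  rewrite !gf_over. apply (f_equal (fun k => fproj k) e).
Qed.

Lemma nGrd_ext (n : nat) (X Y : nGrd C (S n)) (F G : X ~> Y) :
  umor F = umor G -> fmap cells F = fmap cells G -> F = G.
Proof. destruct X, Y. exact (@faith (S n) _ _ _ _ F G). Qed.

Definition Morph (n : nat) : Prop :=
  forall (b b' : st_base (stage C n)) (x : FO n b) (x' : FO n b') (be : b ~> b') u,
  cpt (x := x) (x' := x') be u -> exists f : FHom x x', fproj f = be /\ cellF f = u.

Section Lex.
Variables (L : Lex C) (je : JE C).

Lemma mk_pb (D : Category) (A B Z P : D) (f : A ~> Z) (g : B ~> Z)
  (p : P ~> A) (q : P ~> B) : f ∘ p = g ∘ q ->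
  (forall T (a : T ~> A) (b : T ~> B), f ∘ a = g ∘ b ->
    exists w : T ~> P, p ∘ w = a /\ q ∘ w = b) ->
  (forall T (u v : T ~> P), p ∘ u = p ∘ v -> q ∘ u = q ∘ v -> u = v) ->
  is_pullback f g p q.
Proof.
intros sq ex un.
refine {| pb_sq := sq;
  pb_pair := fun T a b e => proj1_sig (constructive_indefinite_description _ (ex T a b e));
  pb_uniq := un |}; intros; destruct constructive_indefinite_description; simpl; tauto.
Qed.

Lemma gpd_pb (X Z1 Z2 Z3 P : C) (dA cA : Z1 ~> X) (sA : X ~> Z1)
  (dB cB : Z2 ~> X) (sB : X ~> Z2) (dX cX : Z3 ~> X) (sX : X ~> Z3)
  (G1 : Gpd dA cA sA) (G2 : Gpd dB cB sB) (G3 : Gpd dX cX sX)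
  (f : Z1 ~> Z3) (g : Z2 ~> Z3) (p : P ~> Z1) (q : P ~> Z2) (sP : X ~> P) :
  dX ∘ f = dA -> cX ∘ f = cA -> f ∘ sA = sX ->
  dX ∘ g = dB -> cX ∘ g = cB -> g ∘ sB = sX ->
  is_pullback f g p q -> p ∘ sP = sA -> q ∘ sP = sB ->
  inhabited (Gpd (dA ∘ p) (cA ∘ p) sP).
Proof.
intros fd fc fs gd gc gs pb hp hq.
assert (fd' : dX ∘ f = id X ∘ dA) by now rewrite comp_idl.
assert (fc' : cX ∘ f = id X ∘ cA) by now rewrite comp_idl.
assert (fs' : f ∘ sA = sX ∘ id X) by now rewrite comp_idr.
assert (gd' : dX ∘ g = id X ∘ dB) by now rewrite comp_idl.
assert (gc' : cX ∘ g = id X ∘ cB) by now rewrite comp_idl.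
assert (gs' : g ∘ sB = sX ∘ id X) by now rewrite comp_idr.
assert (sq := pb_sq pb).
assert (dPB : dA ∘ p = dB ∘ q) by (rewrite <- fd, <- gd, <- !comp_assoc; congruence).
assert (cPB : cA ∘ p = cB ∘ q) by (rewrite <- fc, <- gc, <- !comp_assoc; congruence).
pose (K := lx_pb L (cA ∘ p) (dA ∘ p)).
assert (E1 := pb_sq (pbi K)).
assert (E2 : cB ∘ q ∘ pp0 K = dB ∘ q ∘ pp1 K) by (rewrite <- dPB, <- cPB; exact E1).
rewrite <- !comp_assoc in E1, E2.
assert (e : f ∘ mul G1 (p ∘ pp0 K) (p ∘ pp1 K) = g ∘ mul G2 (q ∘ pp0 K) (q ∘ pp1 K)).
{ rewrite (functor_mul L je G1 G3 fd' fc' fs' E1).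
  rewrite (functor_mul L je G2 G3 gd' gc' gs' E2). rewrite !comp_assoc, sq. auto. }
destruct (pb_ex pb e) as [m [m0 m1]].
assert (e' : f ∘ (inv G1 ∘ p) = g ∘ (inv G2 ∘ q)).
{ rewrite (comp_assoc f), (comp_assoc g), (functor_inv L je G1 G3 fd' fc' fs').
  rewrite (functor_inv L je G2 G3 gd' gc' gs'), <- !comp_assoc. congruence. }
destruct (pb_ex pb e') as [i [i0 i1]].
assert (Cmp : forall T (w : T ~> K), cA ∘ (p ∘ (pp0 K ∘ w)) = dA ∘ (p ∘ (pp1 K ∘ w))).
{ intros. transitivity (cA ∘ (p ∘ pp0 K) ∘ w); [now ra |]. rewrite E1. now ra. }
assert (DB : forall T (y : T ~> P), dA ∘ p ∘ y = dB ∘ (q ∘ y)).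
{ intros. now rewrite dPB, comp_assoc. }
assert (CB : forall T (y : T ~> P), cA ∘ p ∘ y = cB ∘ (q ∘ y)).
{ intros. now rewrite cPB, comp_assoc. }
assert (MW : forall T (w : T ~> K),
  p ∘ (m ∘ w) = mul G1 (p ∘ (pp0 K ∘ w)) (p ∘ (pp1 K ∘ w)) /\
  q ∘ (m ∘ w) = mul G2 (q ∘ (pp0 K ∘ w)) (q ∘ (pp1 K ∘ w))).
{ intros T w. rewrite (ca m0), (ca m1), !mul_nat, <- !comp_assoc; auto. }
edestruct (gpd_of_map (s := sP) (pbi K) (m := m) (i := i)) as [G _]; [.. | now constructor].
- rewrite <- comp_assoc, hp. apply (gds G1).
- rewrite <- comp_assoc, hp. apply (gcs G1).
- rewrite <- comp_assoc, i0, comp_assoc. now rewrite (gdi G1).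
- rewrite <- comp_assoc, i0, comp_assoc. now rewrite (gci G1).
- intros T w h. destruct (MW T w) as [h1 h2].
  apply (pb_uniq pb); [rewrite h1, h | rewrite h2, h].
  + rewrite (ca hp), <- comp_assoc. apply mul1l.
  + rewrite (ca hq), DB. apply mul1l.
- intros T w h. destruct (MW T w) as [h1 h2].
  apply (pb_uniq pb); [rewrite h1, h | rewrite h2, h].
  + rewrite (ca hp), <- comp_assoc. apply mul1r.
  + rewrite (ca hq), CB. apply mul1r.
- intros T w h. destruct (MW T w) as [h1 h2].
  apply (pb_uniq pb); [rewrite h1, h | rewrite h2, h].
  + rewrite (ca hp), (ca i0), <- !comp_assoc. apply mulV.
  + rewrite (ca hq), (ca i1), DB, <- ?comp_assoc. apply mulV.
- intros T w h. destruct (MW T w) as [h1 h2].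
  apply (pb_uniq pb); [rewrite h1, h | rewrite h2, h].
  + rewrite (ca hp), (ca i0), <- !comp_assoc. apply mulVl.
  + rewrite (ca hq), (ca i1), CB, <- ?comp_assoc. apply mulVl.
Qed.

(** Cells of the top dimension compose along the objects. By induction: the
    (n+1)-cells of [X] are the n-cells of the n-groupoid [arrows X], which has
    the same objects as [X]. *)
Lemma extr (m : nat) (X : nGrd C (S m)) : inhabited (Gpd (bd X) (bc X) (bs X)).
Proof.
induction m as [| m IH].
- destruct X as [[b x] G]. simpl in *. destruct b.
  pose (F := fun (A B : C) (f : A ~> B) =>
    exist _ f eq_refl : @Hom (Fibre (OverUnit C) tt) A B).
  assert (pb : @is_pullback C (X1 G) (X1 G) x (X2 G) (proj1_sig (d1 G)) (proj1_sig (d0 G))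
    (proj1_sig (c0 G)) (proj1_sig (c1 G))).
  { apply mk_pb.
    - exact (f_equal (@proj1_sig _ _) (pb_sq (X2_is G))).
    - intros T a b e.
      assert (e' : d1 G ∘ F T _ a = d0 G ∘ F T _ b) by (apply sig_ext; exact e).
      exists (proj1_sig (pb_pair (X2_is G) e')). split.
      + exact (f_equal (@proj1_sig _ _) (pb_l (X2_is G) e')).
      + exact (f_equal (@proj1_sig _ _) (pb_r (X2_is G) e')).
    - intros T u v e1 e2.
      exact (f_equal (@proj1_sig _ _) (pb_uniq (X2_is G) (u := F _ _ u) (v := F _ _ v)
        (sig_ext (x := c0 G ∘ F _ _ u) (y := c0 G ∘ F _ _ v) e1)
        (sig_ext (x := c1 G ∘ F _ _ u) (y := c1 G ∘ F _ _ v) e2))). }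
  assert (TH : forall (T : Fibre (OverUnit C) tt)
     (a b : @Hom (Fibre (OverUnit C) tt) T (X1 G)) (w : @Hom C T (X2 G))
     (e : d1 G ∘ a = d0 G ∘ b),
     @comp C _ _ _ (proj1_sig (c0 G)) w = proj1_sig a ->
     @comp C _ _ _ (proj1_sig (c1 G)) w = proj1_sig b ->
     proj1_sig (@g_then _ _ G T a b e) = @comp C _ _ _ (proj1_sig (g_comp G)) w).
  { intros T a b w e h1 h2. unfold g_then.
    replace (pb_pair (X2_is G) e) with (F _ _ w); [reflexivity |].
    apply (pb_uniq (X2_is G)); rewrite ?pb_l, ?pb_r; apply sig_ext; assumption. }
  assert (K0 := f_equal (@proj1_sig _ _) (d0_s0 G)).
  assert (K1 := f_equal (@proj1_sig _ _) (d1_s0 G)).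
  assert (K2 := f_equal (@proj1_sig _ _) (d0_inv G)).
  assert (K3 := f_equal (@proj1_sig _ _) (d1_inv G)).
  simpl in K0, K1, K2, K3.
  edestruct (gpd_of_map (s := proj1_sig (s0 G)) pb (m := proj1_sig (g_comp G))
    (i := proj1_sig (g_inv G)) K0 K1 K2 K3) as [Gp _].
  + intros T w h.
    assert (e : d1 G ∘ (s0 G ∘ (d0 G ∘ F _ _ (proj1_sig (c1 G) ∘ w)))
       = d0 G ∘ F _ _ (proj1_sig (c1 G) ∘ w)).
    { now rewrite (ca1 (d1_s0 G)). }
    assert (A := f_equal (@proj1_sig _ _) (g_unitl e)).
    refine (eq_trans _ A). symmetry. exact (TH _ _ _ w e h eq_refl).
  + intros T w h.
    assert (e : d1 G ∘ F _ _ (proj1_sig (c0 G) ∘ w)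
       = d0 G ∘ (s0 G ∘ (d1 G ∘ F _ _ (proj1_sig (c0 G) ∘ w)))).
    { now rewrite (ca1 (d0_s0 G)). }
    assert (A := f_equal (@proj1_sig _ _) (g_unitr e)).
    refine (eq_trans _ A). symmetry. exact (TH _ _ _ w e eq_refl h).
  + intros T w h.
    assert (e : d1 G ∘ F _ _ (proj1_sig (c0 G) ∘ w)
       = d0 G ∘ (g_inv G ∘ F _ _ (proj1_sig (c0 G) ∘ w))).
    { now rewrite (ca (d0_inv G)). }
    assert (A := f_equal (@proj1_sig _ _) (g_invr e)).
    refine (eq_trans _ A). symmetry. exact (TH _ _ _ w e eq_refl h).
  + intros T w h.
    assert (e : d1 G ∘ (g_inv G ∘ F _ _ (proj1_sig (c1 G) ∘ w))
       = d0 G ∘ F _ _ (proj1_sig (c1 G) ∘ w)).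
    { now rewrite (ca (d1_inv G)). }
    assert (A := f_equal (@proj1_sig _ _) (g_invl e)).
    refine (eq_trans _ A). symmetry. exact (TH _ _ _ w e h eq_refl).
  + exact (gpd_eq (eq_sym (comp_idl (c := C) _)) (eq_sym (comp_idl (c := C) _))
      (eq_sym (comp_idr (c := C) _)) (inhabits Gp)).
- refine (gpd_eq _ _ _ (IH (arrows X))).
  + rewrite (bd_S X), (bd_S (arrows X)), (bd_S (under X)), <- comp_assoc.
    exact (f_equal (fun h => bd (under (under X)) ∘ h) (eq_sym (proj1 (arr_over (d0 (projT2 X)))))).
  + rewrite (bc_S X), (bc_S (arrows X)), (bc_S (under X)), <- comp_assoc.
    exact (f_equal (fun h => bc (under (under X)) ∘ h) (eq_sym (proj2 (arr_over (d1 (projT2 X)))))).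
  + rewrite (bs_S X), (bs_S (arrows X)), (bs_S (under X)), comp_assoc.
    exact (f_equal (fun h => h ∘ bs (under (under X))) (eq_sym (arr_idc X))).
Qed.

Definition RGof (n : nat) : forall (b : st_base (stage C n)) (x : FO n b),
    RGd b (cells (tot x)) :=
  match n return forall (b : st_base (stage C n)) (x : FO n b), RGd b (cells (tot x)) with
  | O => fun _ _ => tt
  | S m => fun b x =>
     let X := tot (n := S m) x in
     {| rd := dom X; rc := cod X; rs := idc X; rds := dom_idc X; rcs := cod_idc X;
        rpar := par_dc X; rgp := extr X |}
  end.

Definition rcpt (n : nat) : forall (b : st_base (stage C n)) (Z Z' : C)
    (R : RGd b Z) (R' : RGd b Z') (u : Z ~> Z'), Prop :=
  match n return forall (b : st_base (stage C n)) (Z Z' : C)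
    (R : RGd b Z) (R' : RGd b Z') (u : Z ~> Z'), Prop with
  | O => fun _ _ _ _ _ _ => True
  | S m => fun b Z Z' R R' u =>
      rd R' ∘ u = rd R /\ rc R' ∘ u = rc R /\ u ∘ rs R = rs R'
  end.

Lemma rcpt_comp n (b : st_base (stage C n)) (Z Z' Z'' : C) (R : RGd b Z)
  (R' : RGd b Z') (R'' : RGd b Z'') (u : Z ~> Z') (v : Z' ~> Z'') :
  rcpt R R' u -> rcpt R' R'' v -> rcpt R R'' (v ∘ u).
Proof.
destruct n; [easy |]. intros [a1 [a2 a3]] [b1 [b2 b3]]. repeat split.
- now rewrite (ca b1).
- now rewrite (ca b2).
- now rewrite <- comp_assoc, a3.
Qed.

Lemma rcpt_inv n (b : st_base (stage C n)) (Z Z' : C) (R : RGd b Z)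
  (R' : RGd b Z') (u : Z ~> Z') (v : Z' ~> Z) :
  rcpt R R' u -> v ∘ u = id Z -> u ∘ v = id Z' -> rcpt R' R v.
Proof.
destruct n; [easy |]. intros [a1 [a2 a3]] e1 e2. repeat split.
- now rewrite <- a1, <- comp_assoc, e2, comp_idr.
- now rewrite <- a2, <- comp_assoc, e2, comp_idr.
- now rewrite <- a3, (ca1 e1).
Qed.

Lemma rg_pb n (b : st_base (stage C n)) (Z1 Z2 Z3 P : C) (R1 : RGd b Z1)
  (R2 : RGd b Z2) (R3 : RGd b Z3) (f : Z1 ~> Z3) (g : Z2 ~> Z3)
  (p : P ~> Z1) (q : P ~> Z2) :
  rcpt R1 R3 f -> rcpt R2 R3 g -> is_pullback f g p q ->
  exists R : RGd b P, rcpt R R1 p /\ rcpt R R2 q /\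
   forall T (RT : RGd b T) (w : T ~> P),
     rcpt RT R1 (p ∘ w) -> rcpt RT R2 (q ∘ w) -> rcpt RT R w.
Proof.
destruct n; [intros; exists tt; easy |].
intros [f1 [f2 f3]] [g1 [g2 g3]] pb.
assert (sq := pb_sq pb).
destruct (pb_ex pb (a := rs R1) (b := rs R2)) as [sP [s1 s2]]; [congruence |].
destruct (rgp R1) as [G1], (rgp R2) as [G2], (rgp R3) as [G3].
assert (GP : inhabited (Gpd (bd b ∘ rd R1 ∘ p) (bc b ∘ rc R1 ∘ p) (sP ∘ bs b))).
{ apply (gpd_pb G1 G2 G3 (f := f) (g := g) (q := q)); auto; ra;
    rewrite ?f1, ?f2, ?(ca f3), ?g1, ?g2, ?(ca g3), ?(ca s1), ?(ca s2); auto. }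
assert (e1 : rd R1 ∘ p = rd R2 ∘ q) by (rewrite <- f1, <- g1, <- !comp_assoc; congruence).
assert (e2 : rc R1 ∘ p = rc R2 ∘ q) by (rewrite <- f2, <- g2, <- !comp_assoc; congruence).
unshelve eexists {| rd := rd R1 ∘ p; rc := rc R1 ∘ p; rs := sP |}.
- rewrite <- comp_assoc, s1. apply rds.
- rewrite <- comp_assoc, s1. apply rcs.
- apply par_comp, rpar.
- revert GP. now rewrite <- !comp_assoc.
- simpl. split; [auto |]. split; [auto |].
  intros T RT w [a1 [a2 a3]] [b1 [b2 b3]].
  repeat split.
  + now rewrite <- comp_assoc.
  + now rewrite <- comp_assoc.
  + apply (pb_uniq pb); rewrite comp_assoc; congruence.
Qed.

(** Composition along the objects determines the composition along the cells one
    dimension lower. *)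
Lemma topg m (b : nGrd C m) Z (R : RG b Z) : inhabited (Gpd (rd R) (rc R) (rs R)).
Proof.
destruct m as [| m].
- refine (gpd_eq _ _ _ (rgp R)).
  + exact (comp_idl (rd R)).
  + exact (comp_idl (rc R)).
  + exact (comp_idr (rs R)).
- destruct (extr b) as [H], (rgp R) as [G].
  destruct (par_b (rpar R)) as [e1 e2].
  exact (gpd_over L je (rds R) (rcs R) e1 e2 H G).
Qed.

(** Forgetting the cells [b] of the next lower dimension: the cells [Z] are then
    globular one dimension lower, over the base of [b]. This is what lets the
    new groupoid be built inside a fibre. *)
Definition low (m : nat) : forall (b : nGrd C m) Z (R : RG b Z),
    @RGd m (projT1 b) Z.
Proof.
destruct m as [| m]; [intros; exact tt |].
intros b Z R. refine {| rd := dom b ∘ rd R; rc := cod b ∘ rc R; rs := rs R ∘ idc b |}.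
- abstract (rewrite <- comp_assoc, (ca1 (rds R)); apply dom_idc).
- abstract (rewrite <- comp_assoc, (ca1 (rcs R)); apply cod_idc).
- abstract (rewrite <- (proj2 (rpar R)); apply par_comp, par_dc).
- abstract (apply (fun e1 e2 e3 => gpd_eq e1 e2 e3 (rgp R));
   [rewrite bd_S | rewrite bc_S | rewrite bs_S]; now rewrite comp_assoc).
Defined.

Lemma low_d m (b : st_base (stage C m)) (x : FO m b) Z (R : RG (tot x) Z) :
  rcpt (n := m) (low R) (RGof x) (rd R).
Proof.
destruct m as [| m]; [exact I |].
refine (conj _ (conj _ _)).
- reflexivity.
- exact (proj2 (rpar R)).
- exact (ca1 (rds R) _).
Qed.
Lemma low_c m (b : st_base (stage C m)) (x : FO m b) Z (R : RG (tot x) Z) :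
  rcpt (n := m) (low R) (RGof x) (rc R).
Proof.
destruct m as [| m]; [exact I |].
refine (conj _ (conj _ _)).
- exact (eq_sym (proj1 (rpar R))).
- reflexivity.
- exact (ca1 (rcs R) _).
Qed.
Lemma low_s m (b : st_base (stage C m)) (x : FO m b) Z (R : RG (tot x) Z) :
  rcpt (n := m) (RGof x) (low R) (rs R).
Proof.
destruct m as [| m]; [exact I |].
refine (conj _ (conj _ _)).
- exact (eq_trans (eq_sym (comp_assoc _ _ _)) (eq_trans (f_equal (fun h => _ ∘ h) (rds R)) (comp_idr _))).
- exact (eq_trans (eq_sym (comp_assoc _ _ _)) (eq_trans (f_equal (fun h => _ ∘ h) (rcs R)) (comp_idr _))).
- reflexivity.
Qed.

Lemma inv_s (Z X : C) (d c : Z ~> X) (s : X ~> Z) (G : Gpd d c s) : inv G ∘ s = s.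
Proof.
symmetry. apply (inv_uniq L je).
- now rewrite (gcs G), (gds G).
- assert (K := mul1r G s). rewrite (gds G), comp_idr. now rewrite (gcs G), comp_idr in K.
Qed.

Lemma mul_s (Z X : C) (d c : Z ~> X) (s : X ~> Z) (G : Gpd d c s) T (x : T ~> X) :
  mul G (s ∘ x) (s ∘ x) = s ∘ x.
Proof. assert (K := mul1r G (s ∘ x)). now rewrite (ca1 (gcs G)) in K. Qed.

Lemma low_mul m (b : nGrd C m) Z (R : RG b Z) (G : Gpd (rd R) (rc R) (rs R))
  T (RT : @RGd m (projT1 b) T) (x y : T ~> Z) :
  rcpt (n := m) RT (low R) x -> rcpt (n := m) RT (low R) y ->
  rc R ∘ x = rd R ∘ y -> rcpt (n := m) RT (low R) (mul G x y).
Proof.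
destruct m as [| m]; [intros; exact I |].
intros [a1 [a2 a3]] [b1 [b2 b3]] e. simpl in *.
destruct (rpar R) as [r1 r2].
rewrite <- comp_assoc in a1, a2, b1, b2.
repeat split.
- rewrite <- comp_assoc, (d_mul L je G e). exact a1.
- rewrite <- comp_assoc, (c_mul L je G e). exact b2.
- rewrite mul_nat by exact e. rewrite a3, b3. apply mul_s.
Qed.

Lemma low_inv m (b : nGrd C m) Z (R : RG b Z) (G : Gpd (rd R) (rc R) (rs R)) :
  rcpt (n := m) (low R) (low R) (inv G).
Proof.
destruct m as [| m]; [intros; exact I |].
destruct (rpar R) as [r1 r2]. refine (conj _ (conj _ _)).
- exact (eq_trans (eq_sym (comp_assoc _ _ _))
    (eq_trans (f_equal (fun h => dom b ∘ h) (gdi G)) (eq_sym r1))).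
- exact (eq_trans (eq_sym (comp_assoc _ _ _))
    (eq_trans (f_equal (fun h => cod b ∘ h) (gci G)) r2)).
- exact (ca (inv_s G) _).
Qed.
End Lex.
End Cells.

(** The construction of a groupoid in a fibre and of a functor between two such
    groupoids proceed together by induction on the dimension: the structure maps
    of the groupoid to be built are morphisms of n-groupoids. *)
Section Nested.
Variables (C : Category) (L : Lex C) (je : JE C).
Notation FO n b := (FOb (st_over (stage C n)) b).
Notation FB n b := (Fibre (st_over (stage C n)) b).
Notation rgof x := (RGof x).

Definition cf (n : nat) (b : st_base (stage C n)) (x y : FB n b) (f : x ~> y) :
  cells (tot x) ~> cells (tot y) := cellF (proj1_sig f).

Lemma cf_comp (n : nat) (b : st_base (stage C n)) (x y z : FB n b)
  (g : y ~> z) (f : x ~> y) : cf (g ∘ f) = cf g ∘ cf f.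
Proof. exact (cellF_comp (proj1_sig g) (proj1_sig f)). Qed.
Lemma cf_id (n : nat) (b : st_base (stage C n)) (x : FB n b) :
  cf (id x) = id (cells (tot x)).
Proof. exact (cellF_id x). Qed.
Lemma cf_ext (n : nat) (b : st_base (stage C n)) (x y : FB n b) (f g : x ~> y) :
  cf f = cf g -> f = g.
Proof.
intros e. apply sig_ext. apply faith; [| exact e].
now rewrite (proj2_sig f), (proj2_sig g).
Qed.

Lemma cf_cpt (n : nat) (b : st_base (stage C n)) (x y : FB n b) (f : x ~> y) :
  cpt (x := x) (x' := y) (id b) (cf f).
Proof.
destruct f as [f e]. unfold cf. simpl.
exact (eq_ind _ (fun k => cpt k (cellF f)) (cpt_cell f) _ e).
Qed.

Lemma cf_rcpt (n : nat) (b : st_base (stage C n)) (x y : FB n b) (f : x ~> y) :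
  rcpt (rgof x) (rgof y) (cf f).
Proof.
destruct f as [f e]. assert (K := cpt_cell f). rewrite e in K.
destruct n as [| n]; [exact I |].
destruct K as [k1 [k2 k3]].
assert (I := @fmap_id _ _ (@cells C n) b).
refine (conj _ (conj _ _)).
- refine (eq_trans k1 (eq_trans (f_equal (fun h => h ∘ _) I) (comp_idl _))).
- refine (eq_trans k2 (eq_trans (f_equal (fun h => h ∘ _) I) (comp_idl _))).
- refine (eq_trans k3 (eq_trans (f_equal (fun h => _ ∘ h) I) (comp_idr _))).
Qed.

Lemma faith_sq (n : nat) (b b' : st_base (stage C n)) (y x : FO n b) (y' x' : FO n b')
  (d' : FHom y' x') (d : FHom y x) (f1 : FHom y y') (f0 : FHom x x') :
  fproj d' = id b' -> fproj d = id b -> fproj f1 = fproj f0 ->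
  cellF d' ∘ cellF f1 = cellF f0 ∘ cellF d -> fcomp d' f1 = fcomp f0 d.
Proof.
intros e1 e2 e3 e4. apply faith.
- now rewrite !fproj_comp, e1, e2, e3, comp_idl, comp_idr.
- now rewrite !cellF_comp.
Qed.

Lemma cpt_lift (n : nat) (b b' : st_base (stage C n)) (t : FO n b) (P x y : FB n b')
  (p : P ~> x) (q : P ~> y) (be : b ~> b') (w : cells (tot t) ~> cells (tot P)) :
  (forall T (u v : T ~> cells (tot P)), cf p ∘ u = cf p ∘ v -> cf q ∘ u = cf q ∘ v -> u = v) ->
  cpt (x := t) (x' := x) be (cf p ∘ w) -> cpt (x := t) (x' := y) be (cf q ∘ w) ->
  cpt (x := t) (x' := P) be w.
Proof.
intros un.
assert (cp := cf_rcpt p). assert (cq := cf_rcpt q).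
destruct n as [| n]; [easy |].
destruct cp as [p1 [p2 p3]], cq as [q1 [q2 q3]].
intros [a1 [a2 a3]] [b1 [b2 b3]].
refine (conj _ (conj _ _)).
- refine (eq_trans (f_equal (fun h => h ∘ w) (eq_sym p1)) _).
  exact (eq_trans (eq_sym (comp_assoc _ _ _)) a1).
- refine (eq_trans (f_equal (fun h => h ∘ w) (eq_sym p2)) _).
  exact (eq_trans (eq_sym (comp_assoc _ _ _)) a2).
- apply un.
  + refine (eq_trans (comp_assoc _ _ _) (eq_trans a3 _)).
    exact (eq_sym (ca p3 _)).
  + refine (eq_trans (comp_assoc _ _ _) (eq_trans b3 _)).
    exact (eq_sym (ca q3 _)).
Qed.

Section Step.
Variable n : nat.
Hypothesis HM : Morph C n.

Lemma morphF (b : st_base (stage C n)) (x y : FB n b) (u : cells (tot x) ~> cells (tot y)) :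
  rcpt (rgof x) (rgof y) u -> exists f : x ~> y, cf f = u.
Proof.
intros K.
assert (K' : cpt (x := x) (x' := y) (id b) u).
{ destruct n as [| m]; [exact I |].
  destruct K as [k1 [k2 k3]].
  assert (I := eq_sym (@fmap_id _ _ (@cells C m) b)).
  refine (conj _ (conj _ _)).
  - refine (eq_trans k1 (eq_trans (eq_sym (comp_idl _)) (f_equal (fun h => h ∘ _) I))).
  - refine (eq_trans k2 (eq_trans (eq_sym (comp_idl _)) (f_equal (fun h => h ∘ _) I))).
  - refine (eq_trans k3 (eq_trans (eq_sym (comp_idr _)) (f_equal (fun h => _ ∘ h) I))). }
destruct (HM K') as [f [e1 e2]]. exists (exist _ f e1). exact e2.
Qed.

Hypothesis HB : forall (b : st_base (stage C n)) (Z : C) (R : RGd b Z),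
  exists (x : FO n b) (i : cells (tot x) ~> Z), IsIso i /\ rcpt (rgof x) R i.

Lemma pbex (b : st_base (stage C n)) (x y z : FB n b) (f : x ~> z) (g : y ~> z) :
  exists (P : FB n b) (p : P ~> x) (q : P ~> y),
    inhabited (is_pullback f g p q) /\ inhabited (is_pullback (cf f) (cf g) (cf p) (cf q)).
Proof.
pose (K := lx_pb L (cf f) (cf g)).
destruct (rg_pb L je (cf_rcpt f) (cf_rcpt g) (pbi K)) as [R [R1 [R2 RU]]].
destruct (HB R) as [P [i [[j [ji ij]] Ri]]].
assert (Rj := rcpt_inv Ri ji ij).
destruct (morphF (rcpt_comp Ri R1)) as [p hp].
destruct (morphF (rcpt_comp Ri R2)) as [q hq].
exists P, p, q.
assert (sq : cf f ∘ cf p = cf g ∘ cf q).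
{ rewrite hp, hq, !comp_assoc. now rewrite (pb_sq (pbi K)). }
split; constructor; apply mk_pb.
- apply cf_ext. now rewrite !cf_comp.
- intros T a b0 e.
  assert (e' : cf f ∘ cf a = cf g ∘ cf b0) by (rewrite <- !cf_comp; congruence).
  destruct (pb_ex (pbi K) e') as [w [w0 w1]].
  assert (Rw : rcpt (rgof T) R w).
  { apply RU; rewrite ?w0, ?w1; apply cf_rcpt. }
  destruct (morphF (rcpt_comp Rw Rj)) as [v hv].
  exists v. split; apply cf_ext; rewrite cf_comp, hv, ?hp, ?hq, <- comp_assoc, (ca1 ij); auto.
- intros T u v e1 e2. apply cf_ext.
  assert (cf u = cf v); [| assumption].
  assert (E : i ∘ cf u = i ∘ cf v).
  { apply (pb_uniq (pbi K)); rewrite !comp_assoc, <- ?hp, <- ?hq, <- !cf_comp; congruence. }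
  rewrite <- (ca1 ji (cf u)), E. now rewrite (ca1 ji).
- exact sq.
- intros T a b0 e. destruct (pb_ex (pbi K) e) as [w [w0 w1]].
  exists (j ∘ w). rewrite hp, hq, <- !comp_assoc, (ca1 ij). auto.
- intros T u v. rewrite hp, hq, <- !comp_assoc. intros e1 e2.
  rewrite <- (ca1 ji u), <- (ca1 ji v). f_equal.
  now apply (pb_uniq (pbi K)).
Qed.

(** Taking cells preserves pullbacks: one pullback is constructed on cells in
    [pbex], and pullbacks are unique up to isomorphism. *)
Lemma pb_cells (b : st_base (stage C n)) (x y z P : FB n b) (f : x ~> z) (g : y ~> z)
  (p : P ~> x) (q : P ~> y) : is_pullback f g p q ->
  inhabited (is_pullback (cf f) (cf g) (cf p) (cf q)).
Proof.
intros pb.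
destruct (pbex f g) as [P' [p' [q' [[pb'] [pbc]]]]].
destruct (pb_ex pb (pb_sq pb')) as [u [u1 u2]].
destruct (pb_ex pb' (pb_sq pb)) as [v [v1 v2]].
assert (uv : u ∘ v = id P).
{ apply (pb_uniq pb); rewrite comp_assoc, ?u1, ?u2, comp_idr; auto. }
apply (f_equal (@cf n b P P)) in uv. rewrite cf_comp, cf_id in uv.
constructor. apply mk_pb.
- rewrite <- !cf_comp. now rewrite (pb_sq pb).
- intros T a b0 e. destruct (pb_ex pbc e) as [w [w0 w1]].
  exists (cf u ∘ w). rewrite !comp_assoc, <- !cf_comp, u1, u2. auto.
- intros T s t. rewrite <- v1, <- v2, !cf_comp, <- !comp_assoc. intros e1 e2.
  rewrite <- (ca1 uv s), <- (ca1 uv t). f_equal. now apply (pb_uniq pbc).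
Qed.

(** The two sections of the object of composable pairs, to which [JE] applies. *)
Lemma unit_pairs (b : st_base (stage C n)) (x : FO n b) (G : @Groupoid (FB n b) x) :
  exists r l : cells (tot (X1 G)) ~> cells (tot (X2 G)),
  cf (c0 G) ∘ r = id _ /\ cf (c1 G) ∘ r = cf (s0 G) ∘ cf (d1 G) /\
  cf (g_comp G) ∘ r = id _ /\
  cf (c0 G) ∘ l = cf (s0 G) ∘ cf (d0 G) /\ cf (c1 G) ∘ l = id _ /\
  cf (g_comp G) ∘ l = id _.
Proof.
assert (er : d1 G ∘ id (X1 G) = d0 G ∘ (s0 G ∘ (d1 G ∘ id (X1 G)))).
{ now rewrite (ca1 (d0_s0 G)). }
assert (el : d1 G ∘ (s0 G ∘ (d0 G ∘ id (X1 G))) = d0 G ∘ id (X1 G)).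
{ now rewrite (ca1 (d1_s0 G)). }
exists (cf (pb_pair (X2_is G) er)), (cf (pb_pair (X2_is G) el)).
assert (K1 := g_unitr er). assert (K2 := g_unitl el).
unfold g_then in K1, K2.
repeat split; rewrite <- ?cf_comp, ?pb_l, ?pb_r.
- apply cf_id.
- f_equal. f_equal. apply comp_idr.
- rewrite K1. apply cf_id.
- f_equal. f_equal. apply comp_idr.
- apply cf_id.
- rewrite K2. apply cf_id.
Qed.

Lemma morphS : Morph C (S n).
Proof.
intros b b' G G' be u [k1 [k2 k3]].
destruct b as [b x], b' as [b' x'].
change (cells (tot (X1 G)) ~> cells (tot (X1 G'))) in u.
assert (A : cpt (x := X1 G) (x' := X1 G') (fproj be) u).
{ destruct n as [| m]; [exact I |].
  pose (X := tot (n := S (S m)) (b := existT _ b x) G).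
  pose (X' := tot (n := S (S m)) (b := existT _ b' x') G').
  pose (Be := be : under X ~> under X').
  assert (B1 := dom_nat Be). assert (B2 := cod_nat Be). assert (B3 := idc_nat Be).
  destruct (arr_over (X := X) (d0 G)) as [a1 _].
  destruct (arr_over (X := X') (d0 G')) as [a1' _].
  destruct (arr_over (X := X) (d1 G)) as [_ a2].
  destruct (arr_over (X := X') (d1 G')) as [_ a2'].
  assert (a3 := arr_idc X). assert (a3' := arr_idc X').
  refine (conj _ (conj _ _)).
  - refine (eq_trans (f_equal (fun h => h ∘ u) (eq_sym a1')) _).
    refine (eq_trans (eq_sym (comp_assoc _ _ _)) _).
    refine (eq_trans (f_equal (fun h => dom (under X') ∘ h) k1) _).
    refine (eq_trans (ca B1 _) _).
    refine (eq_trans (eq_sym (comp_assoc _ _ _)) _).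
    exact (f_equal (fun h => fmap cells (umor Be) ∘ h) a1).
  - refine (eq_trans (f_equal (fun h => h ∘ u) (eq_sym a2')) _).
    refine (eq_trans (eq_sym (comp_assoc _ _ _)) _).
    refine (eq_trans (f_equal (fun h => cod (under X') ∘ h) k2) _).
    refine (eq_trans (ca B2 _) _).
    refine (eq_trans (eq_sym (comp_assoc _ _ _)) _).
    exact (f_equal (fun h => fmap cells (umor Be) ∘ h) a2).
  - refine (eq_trans (f_equal (fun h => u ∘ h) (eq_sym a3)) _).
    refine (eq_trans (ca k3 _) _).
    refine (eq_trans (eq_sym (comp_assoc _ _ _)) _).
    refine (eq_trans (f_equal (fun h => idc X' ∘ h) B3) _).
    refine (eq_trans (comp_assoc _ _ _) _).
    exact (f_equal (fun h => h ∘ fmap cells (umor Be)) a3'). }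
destruct (HM A) as [f1 [p1 hu]].
assert (E0 : fcomp (proj1_sig (d0 G')) f1 = fcomp be (proj1_sig (d0 G))).
{ apply faith_sq; [exact (proj2_sig (d0 G')) | exact (proj2_sig (d0 G)) | exact p1 |].
  rewrite hu. exact k1. }
assert (E1 : fcomp (proj1_sig (d1 G')) f1 = fcomp be (proj1_sig (d1 G))).
{ apply faith_sq; [exact (proj2_sig (d1 G')) | exact (proj2_sig (d1 G)) | exact p1 |].
  rewrite hu. exact k2. }
assert (E2 : fcomp f1 (proj1_sig (s0 G)) = fcomp (proj1_sig (s0 G')) be).
{ symmetry. apply faith_sq; [exact (proj2_sig (s0 G')) | exact (proj2_sig (s0 G)) | exact (eq_sym p1) |].
  rewrite hu. symmetry. exact k3. }
destruct (pb_cells (X2_is G)) as [pbG], (pb_cells (X2_is G')) as [pbG'].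
assert (W0 : cpt (x := X2 G) (x' := X1 G') (fproj be) (u ∘ cf (c0 G))).
{ rewrite <- (comp_idr (fproj be)). exact (cpt_comp (cf_cpt (c0 G)) A). }
assert (W1 : cpt (x := X2 G) (x' := X1 G') (fproj be) (u ∘ cf (c1 G))).
{ rewrite <- (comp_idr (fproj be)). exact (cpt_comp (cf_cpt (c1 G)) A). }
assert (e : cf (d1 G') ∘ (u ∘ cf (c0 G)) = cf (d0 G') ∘ (u ∘ cf (c1 G))).
{ refine (eq_trans (ca k2 _) (eq_trans _ (eq_sym (ca k1 _)))).
  refine (eq_trans (eq_sym (comp_assoc _ _ _)) (eq_trans _ (comp_assoc _ _ _))).
  exact (f_equal (fun h => fmap cells be ∘ h) (pb_sq pbG)). }
destruct (pb_ex pbG' e) as [u2 [h0 h1]].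
assert (A2 : cpt (x := X2 G) (x' := X2 G') (fproj be) u2).
{ apply (cpt_lift (p := c0 G') (q := c1 G')); [exact (pb_uniq pbG') | |];
  [now rewrite h0 | now rewrite h1]. }
destruct (HM A2) as [f2 [p2 e2]].
assert (F0 : fcomp (proj1_sig (c0 G')) f2 = fcomp f1 (proj1_sig (c0 G))).
{ apply faith_sq; [exact (proj2_sig (c0 G')) | exact (proj2_sig (c0 G)) | congruence |].
  rewrite hu, e2. exact h0. }
assert (F1 : fcomp (proj1_sig (c1 G')) f2 = fcomp f1 (proj1_sig (c1 G))).
{ apply faith_sq; [exact (proj2_sig (c1 G')) | exact (proj2_sig (c1 G)) | congruence |].
  rewrite hu, e2. exact h1. }
assert (F2 : fcomp (proj1_sig (g_comp G')) f2 = fcomp f1 (proj1_sig (g_comp G))).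
{ apply faith_sq; [exact (proj2_sig (g_comp G')) | exact (proj2_sig (g_comp G)) | congruence |].
  rewrite hu, e2. change (cf (g_comp G') ∘ u2 = u ∘ cf (g_comp G)).
  destruct (unit_pairs G) as [r [l [r0 [r1 [rm [l0 [l1 lm]]]]]]].
  destruct (unit_pairs G') as [r' [l' [r0' [r1' [rm' [l0' [l1' lm']]]]]]].
  assert (s1 : cf (d0 G) ∘ cf (s0 G) = id _) by (rewrite <- cf_comp, d0_s0; apply cf_id).
  assert (s2 : cf (d1 G) ∘ cf (s0 G) = id _) by (rewrite <- cf_comp, d1_s0; apply cf_id).
  apply (je pbG s2 s1 r0 r1 l0 l1);
   refine (eq_trans (eq_sym (comp_assoc _ _ _)) (eq_trans _ (comp_assoc _ _ _))).
  - refine (eq_trans _ (eq_sym (eq_trans (f_equal (fun h => u ∘ h) rm) (comp_idr u)))).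
    assert (E : u2 ∘ r = r' ∘ u);
      [| exact (eq_trans (f_equal (fun h => cf (g_comp G') ∘ h) E) (ca1 rm' u))].
    apply (pb_uniq pbG').
    + exact (eq_trans (ca h0 r) (eq_trans (eq_sym (comp_assoc _ _ _)) (eq_trans
      (f_equal (fun h => u ∘ h) r0) (eq_trans (comp_idr u) (eq_sym (ca1 r0' u)))))).
    + exact (eq_trans (ca h1 r) (eq_trans (eq_sym (comp_assoc _ _ _)) (eq_trans
      (f_equal (fun h => u ∘ h) r1) (eq_trans
      (eq_trans (comp_assoc u (cf (s0 G)) (cf (d1 G))) (eq_trans (f_equal (fun h => h ∘ cf (d1 G)) k3)
       (eq_trans (eq_sym (comp_assoc _ _ _)) (eq_trans (f_equal (fun h => cf (s0 G') ∘ h) (eq_sym k2))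
       (comp_assoc _ _ _))))) (eq_sym (ca r1' u)))))).
  - refine (eq_trans _ (eq_sym (eq_trans (f_equal (fun h => u ∘ h) lm) (comp_idr u)))).
    assert (E : u2 ∘ l = l' ∘ u);
      [| exact (eq_trans (f_equal (fun h => cf (g_comp G') ∘ h) E) (ca1 lm' u))].
    apply (pb_uniq pbG').
    + exact (eq_trans (ca h0 l) (eq_trans (eq_sym (comp_assoc _ _ _)) (eq_trans
      (f_equal (fun h => u ∘ h) l0) (eq_trans
      (eq_trans (comp_assoc u (cf (s0 G)) (cf (d0 G))) (eq_trans (f_equal (fun h => h ∘ cf (d0 G)) k3)
       (eq_trans (eq_sym (comp_assoc _ _ _)) (eq_trans (f_equal (fun h => cf (s0 G') ∘ h) (eq_sym k1))
       (comp_assoc _ _ _))))) (eq_sym (ca l0' u)))))).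
    + exact (eq_trans (ca h1 l) (eq_trans (eq_sym (comp_assoc _ _ _)) (eq_trans
      (f_equal (fun h => u ∘ h) l1) (eq_trans (comp_idr u) (eq_sym (ca1 l1' u)))))). }
unshelve eexists.
{ refine (@Build_GrdHom _ _ _ _ G G' be f1 p1 E0 E1 E2 _). exists f2. auto. }
split; [reflexivity | exact hu].
Qed.

Lemma buildS (b : st_base (stage C (S n))) (Z : C) (R : RGd (n := S n) b Z) :
  exists (x : FO (S n) b) (i : cells (tot x) ~> Z), IsIso i /\ rcpt (rgof x) R i.
Proof.
destruct b as [b x]. simpl in R.
destruct (HB (b := b) (low (b := tot x) R)) as [y [i [[j [ji ij]] Ri]]].
change (FO n b) in y.
assert (Rj := rcpt_inv Ri ji ij).
destruct (morphF (b := b) (rcpt_comp Ri (low_d R))) as [D hD].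
destruct (morphF (b := b) (rcpt_comp Ri (low_c R))) as [K hK].
destruct (morphF (b := b) (rcpt_comp (low_s R) Rj)) as [S hS].
destruct (topg L je R) as [T].
destruct (pbex (b := b) K D) as [P [p [q [[pb] [pbc]]]]].
assert (sqc := pb_sq pbc). rewrite hD, hK, <- !comp_assoc in sqc.
assert (rp : rcpt (rgof P) (low R) (i ∘ cf p)) by exact (rcpt_comp (cf_rcpt p) Ri).
assert (rq : rcpt (rgof P) (low R) (i ∘ cf q)) by exact (rcpt_comp (cf_rcpt q) Ri).
destruct (morphF (b := b) (rcpt_comp (low_mul L je T rp rq sqc) Rj)) as [m hm].
destruct (morphF (b := b) (rcpt_comp (rcpt_comp Ri (low_inv L je T)) Rj)) as [v hv].
assert (iS : i ∘ cf S = rs R) by (rewrite hS; apply (ca1 ij)).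
assert (iv : i ∘ cf v = inv T ∘ i).
{ rewrite hv. rewrite (ca1 ij). reflexivity. }
assert (CX : forall (W : FB n b) (a a' : @Hom (FB n b) W y), K ∘ a = D ∘ a' ->
  rc R ∘ (i ∘ cf a) = rd R ∘ (i ∘ cf a')).
{ intros W a a' e. apply (f_equal (@cf _ _ _ _)) in e.
  rewrite !cf_comp, hK, hD, <- !comp_assoc in e. exact e. }
assert (TH : forall (W : FB n b) (a a' : @Hom (FB n b) W y) (e : K ∘ a = D ∘ a'),
  i ∘ cf (m ∘ pb_pair pb e) = mul T (i ∘ cf a) (i ∘ cf a')).
{ intros W a a' e.
  rewrite cf_comp, hm, <- comp_assoc, (ca1 ij).
  rewrite mul_nat by exact sqc. rewrite <- !comp_assoc, <- !cf_comp, pb_l, pb_r. reflexivity. }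
assert (EXT : forall (W : FB n b) (a a' : @Hom (FB n b) W y), i ∘ cf a = i ∘ cf a' -> a = a').
{ intros W a a' e. apply cf_ext. rewrite <- (ca1 ji (cf a)), e. apply (ca1 ji). }
unshelve eexists.
{ refine (@Build_Groupoid (FB n b) x y D K S P p q pb m v _ _ _ _ _ _ _ _ _ _ _).
  - apply cf_ext. rewrite cf_comp, hD, <- comp_assoc, iS, cf_id. apply rds.
  - apply cf_ext. rewrite cf_comp, hK, <- comp_assoc, iS, cf_id. apply rcs.
  - apply cf_ext. rewrite !cf_comp, hD, hm, <- !comp_assoc, (ca1 ij).
    apply (d_mul L je T sqc).
  - apply cf_ext. rewrite !cf_comp, hK, hm, <- !comp_assoc, (ca1 ij).
    apply (c_mul L je T sqc).
  - apply cf_ext. rewrite !cf_comp, hD, hK, <- comp_assoc, iv. apply (ca (gdi T)).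
  - apply cf_ext. rewrite !cf_comp, hD, hK, <- comp_assoc, iv. apply (ca (gci T)).
  - intros W a e. apply EXT. rewrite TH, !cf_comp, (ca iS), hD, <- comp_assoc.
    apply mul1l.
  - intros W a e. apply EXT. rewrite TH, !cf_comp, (ca iS), hK, <- comp_assoc.
    apply mul1r.
  - intros W a a' a'' e1 e2 e3 e4. apply EXT. rewrite !TH.
    apply (mul_assoc L je); auto.
  - intros W a e. apply EXT. rewrite TH, !cf_comp, (ca iS), (ca iv), hD, <- !comp_assoc.
    apply mulV.
  - intros W a e. apply EXT. rewrite TH, !cf_comp, (ca iS), (ca iv), hK, <- !comp_assoc.
    apply mulVl. }
exists i. split; [exact (ex_intro _ j (conj ji ij)) |].
refine (conj _ (conj _ _)).
- exact (eq_sym hD).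
- exact (eq_sym hK).
- exact iS.
Qed.
End Step.
End Nested.

Section Interface.
Variables (C : Category) (L : Lex C) (je : JE C).

Lemma morph_build (n : nat) : Morph C n /\
  (forall (b : st_base (stage C n)) (Z : C) (R : RGd b Z),
  exists (x : FOb (st_over (stage C n)) b) (i : cells (tot x) ~> Z),
    IsIso i /\ rcpt (RGof x) R i).
Proof.
induction n as [| n [HM HB]].
- split.
  + intros b b' x x' be u _. exists u. split; [now destruct be | reflexivity].
  + intros b Z R. exists Z, (id Z). split; [| exact I].
    exists (id Z). split; apply comp_idl.
- split; [exact (morphS L je HM HB) | exact (buildS L je HM HB)].
Qed.

Lemma nGrd_mor (n : nat) (X Y : nGrd C (S n)) (F : under X ~> under Y)
  (u : cells X ~> cells Y) :
  dom Y ∘ u = fmap cells F ∘ dom X -> cod Y ∘ u = fmap cells F ∘ cod X ->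
  u ∘ idc X = idc Y ∘ fmap cells F ->
  exists G : X ~> Y, umor G = F /\ fmap cells G = u.
Proof.
destruct X as [b x], Y as [b' x']. intros e1 e2 e3.
exact (proj1 (morph_build (S n)) b b' x x' F u (conj e1 (conj e2 e3))).
Qed.

(** Together with [nGrd_mor] and [nGrd_ext] this replaces the nested definition
    of higher groupoids by a flat one: a tower of cells, each of whose levels is
    a groupoid over the objects, with globular maps as functors. *)
Lemma nGrd_build (n : nat) (b : nGrd C n) (Z : C) (R : RG b Z) :
  exists (x : FOb (st_over (stage C (S n))) b),
  let X := tot (n := S n) x in exists i : cells X ~> Z,
  IsIso i /\ rd R ∘ i = dom X /\ rc R ∘ i = cod X /\ i ∘ idc X = rs R.
Proof.
exact (proj2 (morph_build (S n)) b Z R).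
Qed.
End Interface.

(** * Regular protomodular categories *)

Definition Mono {C : Category} {X Y : C} (m : X ~> Y) : Prop :=
  forall T (u v : T ~> X), m ∘ u = m ∘ v -> u = v.

Lemma coeqP (C : Category) (X Y Q : C) (a b : X ~> Y) (q : Y ~> Q) :
  IsCoequalizer a b q <-> (q ∘ a = q ∘ b /\
    forall T (t : Y ~> T), t ∘ a = t ∘ b -> exists! u : Q ~> T, u ∘ q = t).
Proof. split; intros h; exact h. Qed.

Record RegCtx (C : Category) := {
  rx_lex : Lex C;
  rx_kp : forall (X Y R : C) (f : X ~> Y) (p0 p1 : R ~> X), IsKernelPair f p0 p1 ->
     exists (Q : C) (q : X ~> Q), IsCoequalizer p0 p1 q;
  rx_st : forall (A B Z P : C) (f : A ~> Z) (g : B ~> Z) (p : P ~> A) (q : P ~> B),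
     inhabited (is_pullback f g p q) -> RegEpi f -> RegEpi q
}.

Section Reg.
Variables (C : Category) (R : RegCtx C).
Let L := rx_lex R.

Lemma regepi_epi (X Y : C) (q : X ~> Y) : RegEpi q ->
  forall T (u v : Y ~> T), u ∘ q = v ∘ q -> u = v.
Proof.
intros [W [a [b h]]] T u v e. apply coeqP in h. destruct h as [h1 h2].
destruct (h2 T (u ∘ q)) as [w [_ hw]].
- now rewrite <- !comp_assoc, h1.
- transitivity w; [symmetry |]; apply hw; auto.
Qed.

Lemma regepi_desc (X Y W : C) (q : X ~> Y) (g : X ~> W) : RegEpi q ->
  (forall T (u v : T ~> X), q ∘ u = q ∘ v -> g ∘ u = g ∘ v) ->
  exists g' : Y ~> W, g' ∘ q = g.
Proof.
intros [V [a [b h]]] H. apply coeqP in h. destruct h as [h1 h2].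
destruct (h2 W g (H _ _ _ h1)) as [g' [hg _]]. now exists g'.
Qed.

Lemma regepi_strong (X Y I : C) (q : X ~> Y) (m : I ~> Y) (h : X ~> I) :
  RegEpi q -> Mono m -> m ∘ h = q -> IsIso m.
Proof.
intros hq hm e.
destruct (regepi_desc (g := h) hq) as [k hk].
{ intros T u v H. apply hm. now rewrite !comp_assoc, e. }
assert (mk : m ∘ k = id Y).
{ apply (regepi_epi hq). now rewrite <- comp_assoc, hk, comp_idl. }
exists k. split; [| exact mk]. apply hm. now rewrite comp_assoc, mk, comp_idl, comp_idr.
Qed.

Lemma cover (A B T : C) (e : A ~> B) (t : T ~> B) : RegEpi e ->
  exists (T' : C) (c : T' ~> T) (a : T' ~> A), RegEpi c /\ e ∘ a = t ∘ c.
Proof.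
intros he. pose (P := lx_pb L e t). exists P, (pp1 P), (pp0 P). split.
- exact (rx_st R (inhabits (pbi P)) he).
- apply (pb_sq (pbi P)).
Qed.

Lemma image (X Y : C) (f : X ~> Y) :
  exists (I : C) (q : X ~> I) (m : I ~> Y), RegEpi q /\ Mono m /\ m ∘ q = f.
Proof.
pose (K := lx_pb L f f).
destruct (rx_kp R (inhabits (pbi K))) as [I [q hq]].
assert (rq : RegEpi q) by (exists K, (pp0 K), (pp1 K); exact hq).
apply coeqP in hq. destruct hq as [h1 h2].
destruct (h2 Y f (pb_sq (pbi K))) as [m [hm _]].
exists I, q, m. split; [exact rq |]. split; [| exact hm].
intros T u v e.
destruct (cover u rq) as [T1 [c1 [a1 [rc1 e1]]]].
destruct (cover (v ∘ c1) rq) as [T2 [c2 [a2 [rc2 e2]]]].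
apply (regepi_epi rc1), (regepi_epi rc2).
destruct (pb_ex (pbi K) (a := a1 ∘ c2) (b := a2)) as [w [w0 w1]].
{ rewrite <- hm, <- !comp_assoc, e2, (ca e1), !comp_assoc, e. reflexivity. }
rewrite <- e2, <- e1, <- comp_assoc, <- w0, <- w1, !comp_assoc, h1. reflexivity.
Qed.

Lemma iso_regepi (X Y : C) (f : X ~> Y) : IsIso f -> RegEpi f.
Proof.
intros [g [h1 h2]]. exists X, (id X), (id X). apply coeqP. split; [reflexivity |].
intros T t _. exists (t ∘ g). split.
- now rewrite <- comp_assoc, h1, comp_idr.
- intros u <-. now rewrite <- comp_assoc, h2, comp_idr.
Qed.

Lemma regepi_iso_l (X Y Z : C) (q : X ~> Y) (i : Y ~> Z) :
  RegEpi q -> IsIso i -> RegEpi (i ∘ q).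
Proof.
intros [W [a [b h]]] [j [ji ij]]. exists W, a, b.
apply coeqP in h. apply coeqP. destruct h as [h1 h2]. split.
- now rewrite <- !comp_assoc, h1.
- intros T t e. destruct (h2 T t e) as [u [hu uu]].
  exists (u ∘ j). split.
  + now rewrite <- comp_assoc, (ca1 ji).
  + intros v hv. rewrite (uu (v ∘ i)); [| now rewrite <- comp_assoc].
    now rewrite <- comp_assoc, ij, comp_idr.
Qed.

Lemma strong_regepi (X Y : C) (f : X ~> Y) :
  (forall (I : C) (m : I ~> Y) (h : X ~> I), Mono m -> m ∘ h = f -> IsIso m) ->
  RegEpi f.
Proof.
intros H. destruct (image f) as [I [q [m [rq [mm e]]]]].
rewrite <- e. apply regepi_iso_l; [exact rq |]. exact (H _ _ _ mm e).
Qed.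

Lemma regepi_right (X Y Z : C) (f : X ~> Y) (g : Y ~> Z) :
  RegEpi (g ∘ f) -> RegEpi g.
Proof.
intros h. apply strong_regepi. intros I m k mm e.
apply (regepi_strong (h := k ∘ f) h mm). now rewrite comp_assoc, e.
Qed.

Lemma regepi_comp (X Y Z : C) (f : X ~> Y) (g : Y ~> Z) :
  RegEpi f -> RegEpi g -> RegEpi (g ∘ f).
Proof.
intros hf hg. apply strong_regepi. intros I m k mm e.
pose (P := lx_pb L m g).
assert (mp : Mono (pp1 P)).
{ intros T u v h. apply (pb_uniq (pbi P)); [| exact h].
  apply mm. rewrite !comp_assoc, (pb_sq (pbi P)), <- !comp_assoc, h. reflexivity. }
destruct (pb_ex (pbi P) e) as [w [_ w1]].
destruct (regepi_strong hf mp w1) as [j [_ j2]].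
apply (regepi_strong (h := pp0 P ∘ j) hg mm).
now rewrite comp_assoc, (pb_sq (pbi P)), <- comp_assoc, j2, comp_idr.
Qed.

(** With [cover] this makes regular epimorphisms the locally surjective maps:
    statements about generalised elements may be proved after passing to a
    cover, as with a Kripke-Joyal semantics. *)
Lemma regepi_local (A B T : C) (e : A ~> B) (c : T ~> B) (a : T ~> A) :
  RegEpi c -> e ∘ a = c -> RegEpi e.
Proof. intros h <-. exact (regepi_right h). Qed.

Lemma mono_regepi_iso (X Y : C) (f : X ~> Y) : Mono f -> RegEpi f -> IsIso f.
Proof. intros m r. apply (regepi_strong (h := id X) r m), comp_idr. Qed.
End Reg.

(** The properties of a slice of the given category that the comparison relies
    on; [cx_eff] is what efficient regularity says when the ambient effective
    relation is the indiscrete one. *)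
Record Ctx (E : Category) := {
  cx_reg : RegCtx E;
  cx_eff : forall (X T : E) (t0 t1 : T ~> X), IsEquivRel t0 t1 ->
    (exists (W : E) (a b : prd (rx_lex cx_reg) X X ~> W),
       IsEqualizer (pr_pair (prd (rx_lex cx_reg) X X) t0 t1) a b) ->
    IsEffective t0 t1;
  cx_coeq : forall (X Y : E) (a b : X ~> Y),
    exists (Q : E) (q : Y ~> Q), IsCoequalizer a b q;
  cx_proto : Protomodular E;
  cx_peri : PeriAbelian E
}.

Section Proto.
Variables (E : Category) (L : Lex E) (proto : Protomodular E).

(** Protomodularity: a subobject [I] of [P] containing both sections is a subpoint
    of [P] over [A]. Its base change along [s] is isomorphic to [B] because [I]
    contains the second section, so the inclusion becomes invertible along [s]. *)
Lemma je_strong (A B Z P : E) (f : A ~> Z) (g : B ~> Z) (p : P ~> A) (q : P ~> B)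
  (pb : is_pullback f g p q) (s : Z ~> A) (t : Z ~> B) :
  f ∘ s = id Z -> g ∘ t = id Z ->
  forall (ja : A ~> P) (jb : B ~> P),
  p ∘ ja = id A -> q ∘ ja = t ∘ f -> p ∘ jb = s ∘ g -> q ∘ jb = id B ->
  forall (I : E) (i : I ~> P) (a : A ~> I) (b : B ~> I),
  Mono i -> i ∘ a = ja -> i ∘ b = jb -> IsIso i.
Proof.
intros fs gt ja jb pa qa pb' qb I i a b mi ia ib.
assert (sI : p ∘ i ∘ a = id A) by now rewrite <- comp_assoc, ia.
pose (PP := {| pt_map := p; pt_sec := ja; pt_split := pa |} : Pt A).
pose (PI := {| pt_map := p ∘ i; pt_sec := a; pt_split := sI |} : Pt A).
pose (PB := {| pt_map := g; pt_sec := t; pt_split := gt |} : Pt Z).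
assert (hk : pt_map PP ∘ i = pt_map PI /\ i ∘ pt_sec PI = pt_sec PP) by auto.
pose (k := exist _ i hk : PI ~> PP).
assert (sq := pb_sq pb).
assert (jt : jb ∘ t = ja ∘ s).
{ apply (pb_uniq pb).
  - now rewrite (ca pb'), (ca pa), <- comp_assoc, gt, comp_idr, comp_idl.
  - now rewrite (ca qb), (ca qa), <- comp_assoc, fs, comp_idr, comp_idl. }
assert (lift : forall T (x : T ~> P) (z : T ~> Z), p ∘ x = s ∘ z ->
  jb ∘ (q ∘ x) = x /\ g ∘ (q ∘ x) = z).
{ intros T x z e.
  assert (e2 : g ∘ (q ∘ x) = z).
  { now rewrite comp_assoc, <- sq, <- comp_assoc, e, (ca1 fs). }
  split; [| exact e2]. apply (pb_uniq pb).
  - now rewrite (ca pb'), <- comp_assoc, e2.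
  - now rewrite (ca1 qb). }
assert (B1 : IsBaseChange (P := PP) (P' := PB) s jb).
{ split; [| exact jt]. constructor. apply mk_pb.
  - exact pb'.
  - intros T x z e. destruct (lift T x z e) as [l1 l2]. exists (q ∘ x). auto.
  - intros T u v e _. simpl in e.
    rewrite <- (ca1 qb u), <- (ca1 qb v). now rewrite e. }
assert (B2 : IsBaseChange (P := PI) (P' := PB) s b).
{ split; [| apply mi; simpl; rewrite !comp_assoc, ia, ib; exact jt].
  constructor. apply mk_pb.
  - simpl. now rewrite <- comp_assoc, ib.
  - intros T x z e. simpl in e. rewrite <- comp_assoc in e.
    destruct (lift T _ z e) as [l1 l2]. exists (q ∘ (i ∘ x)). split; [| exact l2].
    apply mi. now rewrite (ca ib).
  - intros T u v e _. simpl in e.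
    rewrite <- (ca1 qb u), <- (ca1 qb v), <- ib, <- !comp_assoc. now rewrite e. }
assert (BM : IsBaseChangeMap (P := PI) (Q := PP) (P' := PB) (Q' := PB) b jb k (id PB)).
{ red. simpl. now rewrite comp_idr. }
destruct (proto B2 B1 BM) as [[i' [h1 h2]] [e1 e2]].
{ exists (id PB). split; apply comp_idl. }
exists i'. split.
- exact (f_equal (@proj1_sig _ _) e1).
- exact (f_equal (@proj1_sig _ _) e2).
Qed.

Lemma je_proto : JE E.
Proof.
intros A B Z P f g p q pb s t fs gt ja jb pa qa pb' qb W u v ea eb.
destruct (equ_ex L u v) as [I [i [hi [hl hm]]]].
destruct (hl _ ja ea) as [a ha]. destruct (hl _ jb eb) as [b hb].
destruct (je_strong pb fs gt pa qa pb' qb (fun T => hm T) ha hb) as [j [_ h]].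
now rewrite <- (comp_idr u), <- (comp_idr v), <- h, !comp_assoc, hi.
Qed.
End Proto.

Lemma je_ctx (E : Category) (K : Ctx E) : JE E.
Proof. exact (je_proto (rx_lex (cx_reg K)) (cx_proto K)). Qed.

(** * Abelian objects in the fibres of points *)

Section Ab.
Variables (E : Category) (L : Lex E) (je : JE E).

Definition mkpt (Q M : E) (m : M ~> Q) (z : Q ~> M) (e : m ∘ z = id Q) : Pt Q :=
  {| pt_map := m; pt_sec := z; pt_split := e |}.

Section Obj.
Variables (Q M : E) (m : M ~> Q) (z : Q ~> M) (mz : m ∘ z = id Q).
Let P := mkpt mz.
Let KP := lx_pb L m m.

Lemma kp_sec : exists s : Q ~> KP, pp0 KP ∘ s = z /\ pp1 KP ∘ s = z.
Proof. now apply (pb_ex (pbi KP)). Qed.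

Definition kps : Q ~> KP := proj1_sig (constructive_indefinite_description _ kp_sec).
Lemma kps0 : pp0 KP ∘ kps = z.
Proof. unfold kps. now destruct constructive_indefinite_description. Qed.
Lemma kps1 : pp1 KP ∘ kps = z.
Proof. unfold kps. now destruct constructive_indefinite_description. Qed.

Lemma kp_split : m ∘ pp0 KP ∘ kps = id Q.
Proof. now rewrite <- comp_assoc, kps0. Qed.
Definition KPt : Pt Q := mkpt kp_split.
Definition kp0 : KPt ~> P.
Proof. exists (pp0 KP). abstract (split; [reflexivity | apply kps0]). Defined.
Definition kp1 : KPt ~> P.
Proof. exists (pp1 KP). abstract (split; [symmetry; apply (pb_sq (pbi KP)) | apply kps1]). Defined.

Lemma kp_ex (T : Pt Q) (x y : T ~> P) : exists w : T ~> KPt, kp0 ∘ w = x /\ kp1 ∘ w = y.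
Proof.
destruct x as [x [x1 x2]], y as [y [y1 y2]]. simpl in *.
destruct (pb_ex (pbi KP) (a := x) (b := y)) as [w [w0 w1]]; [congruence |].
assert (hw : pt_map KPt ∘ w = pt_map T /\ w ∘ pt_sec T = pt_sec KPt).
{ simpl. split.
  - now rewrite <- comp_assoc, w0.
  - apply (pb_uniq (pbi KP)); rewrite comp_assoc, ?w0, ?w1, ?kps0, ?kps1; auto. }
exists (exist _ w hw). split; apply sig_ext; assumption.
Qed.

Definition KProd : @Product (Pt Q) P P.
Proof.
refine {| prod_ob := KPt; prl := kp0; prr := kp1 |}.
refine {| pair := fun T x y =>
  proj1_sig (constructive_indefinite_description _ (kp_ex x y)) |}.
- intros. now destruct constructive_indefinite_description.
- intros. now destruct constructive_indefinite_description.
- intros T u v e1 e2. apply sig_ext.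
  apply (pb_uniq (pbi KP)).
  + exact (f_equal (@proj1_sig _ _) e1).
  + exact (f_equal (@proj1_sig _ _) e2).
Defined.

Definition QP : Pt Q := mkpt (comp_idl (id Q)).
Definition QPterm : @is_terminal (Pt Q) QP.
Proof.
unshelve refine (@Build_is_terminal (Pt Q) QP (fun X : Pt Q => exist _ (pt_map X) _) _).
- simpl. split; [apply comp_idl | apply pt_split].
- intros X [f [f1 f2]] [g [g1 g2]]. apply sig_ext. simpl in *.
  rewrite <- (comp_idl f), <- (comp_idl g). congruence.
Defined.

(** An abelian group in the points over [Q] and a groupoid with equal source and
    target [m] are the same thing: commutativity is automatic ([loops_comm]), and
    the second form can be handled without leaving the base category. *)
Lemma gpd_ab : Gpd m m z -> IsAbelian (C := Pt Q) P.
Proof.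
intros G. constructor.
assert (dm := d_mul L je G). assert (cm := c_mul L je G).
assert (madd : m ∘ mul G (pp0 KP) (pp1 KP) = m ∘ pp0 KP /\
   mul G (pp0 KP) (pp1 KP) ∘ kps = z).
{ split; [apply dm, (pb_sq (pbi KP)) |].
  rewrite mul_nat by apply (pb_sq (pbi KP)). rewrite kps0, kps1.
  assert (Q1 := mul1r G z). now rewrite (gcs G), comp_idr in Q1. }
pose (add := exist _ (mul G (pp0 KP) (pp1 KP)) madd : KPt ~> P).
assert (hneg : m ∘ inv G = m /\ inv G ∘ z = z).
{ split; [apply (gdi G) |]. apply inv_s; auto. }
pose (neg := exist _ (inv G) hneg : P ~> P).
assert (hz : m ∘ z = id Q /\ z ∘ id Q = z) by (split; [exact mz | apply comp_idr]).
pose (zer := exist _ z hz : QP ~> P).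
assert (PL : forall (T : Pt Q) (x y : T ~> P),
  proj1_sig (add ∘ pr_pair KProd x y) = mul G (proj1_sig x) (proj1_sig y)).
{ intros T x y. simpl. rewrite mul_nat by apply (pb_sq (pbi KP)).
  assert (e0 := f_equal (@proj1_sig _ _) (prl_pair KProd x y)).
  assert (e1 := f_equal (@proj1_sig _ _) (prr_pair KProd x y)).
  simpl in e0, e1. now rewrite e0, e1. }
assert (EM : forall (T : Pt Q) (x y : T ~> P), m ∘ proj1_sig x = m ∘ proj1_sig y).
{ intros T [x [x1 x2]] [y [y1 y2]]. simpl in *. congruence. }
refine (@Build_AbStr (Pt Q) P QP QPterm KProd zer add neg _ _ _ _); intros T x.
- intros y w.
  change (add ∘ pr_pair KProd x (add ∘ pr_pair KProd y w) =
    add ∘ pr_pair KProd (add ∘ pr_pair KProd x y) w).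
  apply sig_ext. rewrite !PL. symmetry. apply (mul_assoc L je G); apply EM.
- intros y.
  change (add ∘ pr_pair KProd x y = add ∘ pr_pair KProd y x).
  apply sig_ext. rewrite !PL. apply (loops_comm L je G); auto.
- change (add ∘ pr_pair KProd x (zer ∘ bang QPterm T) = x).
  apply sig_ext. rewrite PL. simpl. destruct x as [x [x1 x2]]; simpl in *.
  rewrite <- x1. apply mul1r.
- change (add ∘ pr_pair KProd x (neg ∘ x) = zer ∘ bang QPterm T).
  apply sig_ext. rewrite PL. simpl. destruct x as [x [x1 x2]]; simpl in *.
  rewrite <- x1. apply mulV.
Qed.

Lemma ab_gpd : IsAbelian (C := Pt Q) P -> inhabited (Gpd m m z).
Proof.
intros [A].
pose (ad := proj1_sig (ab_plus A kp0 kp1) : KP ~> M).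
assert (Z0 : forall T : Pt Q, proj1_sig (ab_zero A ∘ bang (ab_one_term A) T) = z ∘ pt_map T).
{ intros T.
  assert (e : bang (ab_one_term A) T = bang (ab_one_term A) QP ∘ bang QPterm T)
   by apply (bang_uniq (ab_one_term A)).
  rewrite e, comp_assoc. simpl.
  destruct (ab_zero A ∘ bang (ab_one_term A) QP) as [k [k1 k2]] eqn:Ek.
  apply (f_equal (@proj1_sig _ _)) in Ek. simpl in *. rewrite Ek.
  now rewrite <- k2, comp_idr. }
assert (PL : forall (T : Pt Q) (x y : T ~> P) (w : T ~> KPt), kp0 ∘ w = x -> kp1 ∘ w = y ->
  proj1_sig (ab_plus A x y) = ad ∘ proj1_sig w).
{ intros T x y w <- <-. unfold ad. change (proj1_sig (ab_plus A (kp0 ∘ w) (kp1 ∘ w)) =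
   proj1_sig (ab_plus A kp0 kp1 ∘ w)). f_equal. unfold ab_plus.
  now rewrite <- comp_assoc, pr_pair_comp. }
assert (zm : m ∘ (z ∘ m) = m /\ z ∘ m ∘ z = z).
{ rewrite <- comp_assoc, !(ca1 mz), mz, comp_idr. auto. }
pose (zz := exist _ (z ∘ m) zm : P ~> P).
assert (zzE : zz = ab_zero A ∘ bang (ab_one_term A) P).
{ apply sig_ext. now rewrite Z0. }
destruct (kp_ex (id P) zz) as [r [r0 r1]]. destruct (kp_ex zz (id P)) as [l [l0 l1]].
destruct (kp_ex (id P) (ab_neg A)) as [n [n0 n1]].
destruct (kp_ex (ab_neg A) (id P)) as [n' [n0' n1']].
assert (Er : ad ∘ proj1_sig r = id M).
{ rewrite <- (PL _ _ _ _ r0 r1), zzE, ab_add0. reflexivity. }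
assert (El : ad ∘ proj1_sig l = id M).
{ rewrite <- (PL _ _ _ _ l0 l1), zzE, ab_addC, ab_add0. reflexivity. }
assert (N1 : forall X : Pt Q, forall x : X ~> P, ab_neg A ∘ x = ab_neg A ∘ x) by auto.
assert (En : ad ∘ proj1_sig n = z ∘ m).
{ rewrite <- (PL _ _ _ _ n0 n1). rewrite <- (comp_idr (ab_neg A)), ab_addN, Z0. reflexivity. }
assert (En' : ad ∘ proj1_sig n' = z ∘ m).
{ rewrite <- (PL _ _ _ _ n0' n1'), ab_addC.
  rewrite <- (comp_idr (ab_neg A)), ab_addN, Z0. reflexivity. }
apply (f_equal (@proj1_sig _ _)) in r0, r1, l0, l1, n0, n1, n0', n1'. simpl in *.
assert (hn := proj1 (proj2_sig (ab_neg A))). simpl in hn.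
destruct (gpd_of_map (s := z) (pbi KP) (m := ad) (i := proj1_sig (ab_neg A)) mz mz hn hn)
  as [G _]; [.. | now constructor].
- intros T w h. transitivity (ad ∘ (proj1_sig l ∘ (pp1 KP ∘ w))).
  + f_equal. apply (pb_uniq (pbi KP)); rewrite ?(ca l0), ?(ca l1), ?comp_idl, ?h; auto;
    now rewrite <- comp_assoc.
  + now rewrite (ca El), comp_idl.
- intros T w h. transitivity (ad ∘ (proj1_sig r ∘ (pp0 KP ∘ w))).
  + f_equal. apply (pb_uniq (pbi KP)); rewrite ?(ca r0), ?(ca r1), ?comp_idl, ?h; auto;
    now rewrite <- comp_assoc.
  + now rewrite (ca Er), comp_idl.
- intros T w h. transitivity (ad ∘ (proj1_sig n ∘ (pp0 KP ∘ w))).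
  + f_equal. apply (pb_uniq (pbi KP)); rewrite ?(ca n0), ?(ca n1), ?comp_idl, ?h; auto.
  + now rewrite (ca En), <- comp_assoc.
- intros T w h. transitivity (ad ∘ (proj1_sig n' ∘ (pp1 KP ∘ w))).
  + f_equal. apply (pb_uniq (pbi KP)); rewrite ?(ca n0'), ?(ca n1'), ?comp_idl, ?h; auto.
  + now rewrite (ca En'), <- comp_assoc.
Qed.
End Obj.
End Ab.

(** * Associated abelian objects *)

Section AssocAb.
Variables (E : Category) (K : Ctx E).
Let Rg := cx_reg K.
Let L := rx_lex Rg.
Let je := je_ctx K.

(** Inverses come from protomodularity: the shear map (x, y) |-> (x, x + y) over
    the first projection becomes an identity when restricted along the zero
    section, hence is invertible. *)
Lemma unital_gpd (Q N NN : E) (m : N ~> Q) (z : Q ~> N) (p q : NN ~> N)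
  (pb : is_pullback m m p q) (add : NN ~> N) : m ∘ z = id Q ->
  (forall T (w : T ~> NN), p ∘ w = z ∘ (m ∘ (q ∘ w)) -> add ∘ w = q ∘ w) ->
  (forall T (w : T ~> NN), q ∘ w = z ∘ (m ∘ (p ∘ w)) -> add ∘ w = p ∘ w) ->
  exists G : Gpd m m z, forall T (w : T ~> NN), mul G (p ∘ w) (q ∘ w) = add ∘ w.
Proof.
intros mz ul ur.
assert (sq := pb_sq pb).
destruct (pb_ex pb (a := id N) (b := z ∘ m)) as [ja [ja0 ja1]].
{ now rewrite (ca1 mz), comp_idr. }
destruct (pb_ex pb (a := z ∘ m) (b := id N)) as [jb [jb0 jb1]].
{ now rewrite (ca1 mz), comp_idr. }
assert (aa : add ∘ ja = id N).
{ rewrite ur; [exact ja0 |]. now rewrite ja0, ja1, comp_idr. }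
assert (ab : add ∘ jb = id N).
{ rewrite ul; [exact jb1 |]. now rewrite jb0, jb1, comp_idr. }
assert (madd : m ∘ p = m ∘ add).
{ apply (je pb mz mz ja0 ja1 jb0 jb1); rewrite <- !comp_assoc, ?aa, ?ab, ?ja0, ?jb0; auto.
  now rewrite (ca1 mz), comp_idr. }
destruct (pb_ex pb madd) as [ph [ph0 ph1]].
destruct (pb_ex pb (eq_refl (m ∘ id N))) as [dg [dg0 dg1]].
pose (PN := mkpt mz).
pose (PS := mkpt ja0).
pose (PT := mkpt dg0).
assert (hph : pt_map PT ∘ ph = pt_map PS /\ ph ∘ pt_sec PS = pt_sec PT).
{ split; [exact ph0 |]. simpl. apply (pb_uniq pb).
  - now rewrite (ca ph0), ja0, dg0.
  - now rewrite (ca ph1), aa, dg1. }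
pose (k := exist _ ph hph : PS ~> PT).
assert (PBz : inhabited (is_pullback p z jb m)).
{ constructor. apply mk_pb.
  - exact jb0.
  - intros T x y e. exists (q ∘ x).
    assert (e2 : m ∘ (q ∘ x) = y).
    { now rewrite comp_assoc, <- sq, <- comp_assoc, e, (ca1 mz). }
    split; [| exact e2]. apply (pb_uniq pb).
    + now rewrite (ca jb0), <- comp_assoc, e2.
    + now rewrite (ca1 jb1).
  - intros T u v e _. rewrite <- (ca1 jb1 u), <- (ca1 jb1 v). now rewrite e. }
assert (jz : jb ∘ z = ja ∘ z).
{ apply (pb_uniq pb).
  - now rewrite (ca jb0), (ca1 ja0), <- comp_assoc, mz, comp_idr.
  - now rewrite (ca1 jb1), (ca ja1), <- comp_assoc, mz, comp_idr. }
assert (dz : jb ∘ z = dg ∘ z).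
{ apply (pb_uniq pb).
  - now rewrite (ca jb0), (ca1 dg0), <- comp_assoc, mz, comp_idr.
  - now rewrite (ca1 jb1), (ca1 dg1). }
assert (B1 : IsBaseChange (P := PS) (P' := PN) z jb) by (split; [exact PBz | exact jz]).
assert (B2 : IsBaseChange (P := PT) (P' := PN) z jb) by (split; [exact PBz | exact dz]).
assert (BM : IsBaseChangeMap (P := PS) (Q := PT) (P' := PN) (Q' := PN) jb jb k (id PN)).
{ red. simpl. rewrite comp_idr. apply (pb_uniq pb).
  - now rewrite (ca ph0).
  - rewrite (ca ph1), ab. exact jb1. }
destruct (cx_proto K B1 B2 BM) as [[ps hps] [e1 e2]].
{ exists (id PN). split; apply comp_idl. }
apply (f_equal (@proj1_sig _ _)) in e1, e2. simpl in e1, e2.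
pose (iv := q ∘ (ps ∘ ja)).
assert (p_ps : forall T (x : T ~> NN), p ∘ (ps ∘ x) = p ∘ x).
{ intros. destruct hps as [h _]. simpl in h. now rewrite (ca h). }
assert (miv : m ∘ iv = m).
{ unfold iv. rewrite comp_assoc, <- sq, <- comp_assoc, p_ps, ja0. apply comp_idr. }
assert (AV : forall T (w : T ~> NN), q ∘ w = iv ∘ (p ∘ w) -> add ∘ w = z ∘ (m ∘ (p ∘ w))).
{ intros T w h. rewrite <- ph1, <- comp_assoc.
  assert (W : w = ps ∘ (ja ∘ (p ∘ w))).
  { apply (pb_uniq pb).
    - now rewrite p_ps, (ca1 ja0).
    - rewrite h. unfold iv. now ra. }
  rewrite W at 1. rewrite (ca1 e2), (ca ja1). now ra. }
assert (tw : exists t : NN ~> NN, p ∘ t = q /\ q ∘ t = p).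
{ destruct (pb_ex pb (eq_sym sq)) as [t [t0 t1]]. now exists t. }
destruct tw as [t [t0 t1]].
assert (comm : add ∘ t = add).
{ apply (je pb mz mz ja0 ja1 jb0 jb1); rewrite <- comp_assoc.
  - rewrite aa, ul; [now rewrite (ca t1) |]. rewrite (ca t0), (ca t1), ja0, ja1. now rewrite comp_idr.
  - rewrite ab, ur; [now rewrite (ca t0) |]. rewrite (ca t0), (ca t1), jb0, jb1. now rewrite comp_idr. }
destruct (gpd_of_map (s := z) pb (m := add) (i := iv) mz mz miv miv) as [G HG]; auto.
- intros T w h. rewrite <- comm, <- comp_assoc, AV; now rewrite !(ca t0), ?(ca t1).
- now exists G.
Qed.

(** In a unital category the coequalizer of the two axes x |-> (x, 0) and
    x |-> (0, x) of the square of an object is abelian: the quotient map plays the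
    role of (x, y) |-> x + y. The restriction of the quotient map to an axis is
    the universal map; it is a regular epimorphism since the two axes jointly
    cover the square. The construction yields what the bare universal property
    does not: [eta] is a regular epimorphism. *)
Theorem assoc_ab_exists (Z P : E) (d : P ~> Z) (s : Z ~> P) (ds : d ∘ s = id Z) :
  exists (N : E) (m : N ~> Z) (z : Z ~> N) (mz : m ∘ z = id Z)
    (eta : mkpt ds ~> mkpt mz), RegEpi (proj1_sig eta) /\ IsAssociatedAbelian eta.
Proof.
pose (KP := lx_pb L d d).
assert (sq := pb_sq (pbi KP)).
destruct (pb_ex (pbi KP) (a := id P) (b := s ∘ d)) as [a [a0 a1]].
{ now rewrite (ca1 ds), comp_idr. }
destruct (pb_ex (pbi KP) (a := s ∘ d) (b := id P)) as [b [b0 b1]].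
{ now rewrite (ca1 ds), comp_idr. }
destruct (cx_coeq K a b) as [N [w hw]]. apply coeqP in hw. destruct hw as [wab wu].
destruct (wu Z (d ∘ pp0 KP)) as [m [hm _]].
{ rewrite <- !comp_assoc, a0, b0. now rewrite (ca1 ds), comp_idr. }
pose (et := w ∘ a).
assert (et' : w ∘ b = et) by now rewrite <- wab.
assert (wepi : forall T (u v : N ~> T), u ∘ w = v ∘ w -> u = v).
{ intros T u v e. destruct (wu T (u ∘ w)) as [x [_ hx]].
  - now rewrite <- !comp_assoc, wab.
  - transitivity x; [symmetry |]; apply hx; auto. }
assert (met : m ∘ et = d).
{ unfold et. now rewrite (ca hm), <- comp_assoc, a0, comp_idr. }
pose (z := et ∘ s).
assert (mz : m ∘ z = id Z) by (unfold z; now rewrite (ca met)).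
assert (ret : RegEpi et).
{ destruct (image Rg et) as [I [q [i [rq [mi e]]]]].
  rewrite <- e. apply regepi_iso_l; [exact rq |].
  pose (J := lx_pb L i w).
  assert (mJ : Mono (pp1 J)).
  { intros T u v h. apply (pb_uniq (pbi J)); [| exact h].
    apply mi. rewrite !comp_assoc, (pb_sq (pbi J)), <- !comp_assoc, h. reflexivity. }
  destruct (pb_ex (pbi J) (a := q) (b := a)) as [ka [_ ka1]]; [exact e |].
  destruct (pb_ex (pbi J) (a := q) (b := b)) as [kb [_ kb1]]; [now rewrite et' |].
  destruct (je_strong (cx_proto K) (pbi KP) ds ds a0 a1 b0 b1 mJ ka1 kb1) as [j [_ j2]].
  destruct (wu I (pp0 J ∘ j)) as [x [hx _]].
  { apply mi. rewrite !comp_assoc, (pb_sq (pbi J)).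
    rewrite <- !(comp_assoc w), j2, !comp_idl. exact wab. }
  exists x. assert (ix : i ∘ x = id N).
  { apply wepi. rewrite <- comp_assoc, hx, comp_assoc, (pb_sq (pbi J)), <- comp_assoc, j2.
    now rewrite comp_idl, comp_idr. }
  split; [| exact ix]. apply mi. now rewrite (ca1 ix), comp_idr. }
pose (NN := lx_pb L m m).
destruct (pb_ex (pbi NN) (a := et ∘ pp0 KP) (b := et ∘ pp1 KP)) as [ee [ee0 ee1]].
{ now rewrite !(ca met). }
assert (ree : RegEpi ee).
{ destruct (cover Rg (pp0 NN) ret) as [T1 [c1 [x1 [r1 h1]]]].
  destruct (cover Rg (pp1 NN ∘ c1) ret) as [T2 [c2 [x2 [r2 h2]]]].
  destruct (pb_ex (pbi KP) (a := x1 ∘ c2) (b := x2)) as [y [y0 y1]].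
  { rewrite <- met, <- !comp_assoc, h2, (ca h1), <- !comp_assoc.
    rewrite !(comp_assoc m). now rewrite (pb_sq (pbi NN)). }
  apply (regepi_local Rg (c := c1 ∘ c2) (a := y)); [now apply regepi_comp |].
  apply (pb_uniq (pbi NN)).
  - now rewrite (ca ee0), <- comp_assoc, y0, (ca h1), comp_assoc.
  - now rewrite (ca ee1), <- comp_assoc, y1, h2, comp_assoc. }
destruct (regepi_desc (g := w) ree) as [add hadd].
{
  (* w respects the kernel pair of eta x eta, a pullback of split epimorphisms,
     because it does so on the two axes *)
  intros T u v e.
  assert (e0 : et ∘ (pp0 KP ∘ u) = et ∘ (pp0 KP ∘ v)).
  { rewrite !(ca (eq_sym ee0)), <- !comp_assoc. congruence. }
  assert (e1 : et ∘ (pp1 KP ∘ u) = et ∘ (pp1 KP ∘ v)).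
  { rewrite !(ca (eq_sym ee1)), <- !comp_assoc. congruence. }
  pose (R := lx_pb L et et).
  assert (sR := pb_sq (pbi R)).
  assert (dR : d ∘ pp0 R = d ∘ pp1 R).
  { rewrite <- met, <- !comp_assoc. congruence. }
  destruct (pb_ex (pbi R) (eq_refl (et ∘ s))) as [sr [sr0 sr1]].
  destruct (pb_ex (pbi R) e0) as [x [x0 x1]]. destruct (pb_ex (pbi R) e1) as [y [y0 y1]].
  assert (dxy : d ∘ pp0 R ∘ x = d ∘ pp0 R ∘ y).
  { rewrite <- !comp_assoc, x0, y0, !(comp_assoc d), sq. reflexivity. }
  pose (Q := lx_pb L (d ∘ pp0 R) (d ∘ pp0 R)).
  assert (sQ := pb_sq (pbi Q)).
  assert (dsr : d ∘ pp0 R ∘ sr = id Z) by now rewrite <- comp_assoc, sr0.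
  destruct (pb_ex (pbi Q) (a := id R) (b := sr ∘ (d ∘ pp0 R))) as [ja [ja0 ja1]].
  { now rewrite (ca1 dsr), comp_idr. }
  destruct (pb_ex (pbi Q) (a := sr ∘ (d ∘ pp0 R)) (b := id R)) as [jb [jb0 jb1]].
  { now rewrite (ca1 dsr), comp_idr. }
  destruct (pb_ex (pbi KP) (a := pp0 R ∘ pp0 Q) (b := pp0 R ∘ pp1 Q)) as [f [f0 f1]].
  { now rewrite !comp_assoc. }
  destruct (pb_ex (pbi KP) (a := pp1 R ∘ pp0 Q) (b := pp1 R ∘ pp1 Q)) as [g [g0 g1]].
  { rewrite !comp_assoc, <- dR. exact sQ. }
  assert (Hd : d ∘ (pp0 R) = d ∘ pp1 R) by exact dR.
  assert (fg : w ∘ f = w ∘ g).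
  { apply (je (pbi Q) dsr dsr ja0 ja1 jb0 jb1); rewrite <- !comp_assoc.
    - assert (fa : f ∘ ja = a ∘ pp0 R).
      { apply (pb_uniq (pbi KP)).
        - now rewrite (ca f0), (ca1 a0), <- comp_assoc, ja0, comp_idr.
        - now rewrite (ca f1), (ca a1), <- !comp_assoc, ja1, (ca sr0). }
      assert (ga : g ∘ ja = a ∘ pp1 R).
      { apply (pb_uniq (pbi KP)).
        - now rewrite (ca g0), (ca1 a0), <- comp_assoc, ja0, comp_idr.
        - rewrite (ca g1), (ca a1), <- !comp_assoc, ja1, (ca sr1). now rewrite Hd. }
      rewrite fa, ga, !comp_assoc. exact sR.
    - assert (fa : f ∘ jb = b ∘ pp0 R).
      { apply (pb_uniq (pbi KP)).
        - now rewrite (ca f0), (ca b0), <- !comp_assoc, jb0, (ca sr0).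
        - now rewrite (ca f1), (ca1 b1), <- comp_assoc, jb1, comp_idr. }
      assert (ga : g ∘ jb = b ∘ pp1 R).
      { apply (pb_uniq (pbi KP)).
        - rewrite (ca g0), (ca b0), <- !comp_assoc, jb0, (ca sr1). now rewrite Hd.
        - now rewrite (ca g1), (ca1 b1), <- comp_assoc, jb1, comp_idr. }
      rewrite fa, ga, !comp_assoc, et'. exact sR. }
  destruct (pb_ex (pbi Q) dxy) as [k [k0 k1]].
  assert (fk : f ∘ k = u).
  { apply (pb_uniq (pbi KP)).
    - now rewrite (ca f0), <- comp_assoc, k0.
    - now rewrite (ca f1), <- comp_assoc, k1. }
  assert (gk : g ∘ k = v).
  { apply (pb_uniq (pbi KP)).
    - now rewrite (ca g0), <- comp_assoc, k0.
    - now rewrite (ca g1), <- comp_assoc, k1. }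
  now rewrite <- fk, <- gk, !comp_assoc, fg. }
assert (eea : forall (j : N ~> NN) , pp0 NN ∘ j = id N -> pp1 NN ∘ j = z ∘ m -> add ∘ j = id N).
{ intros j j0 j1. apply (regepi_epi ret). rewrite <- comp_assoc.
  assert (J : j ∘ et = ee ∘ a).
  { apply (pb_uniq (pbi NN)).
    - now rewrite (ca j0), (ca ee0), <- comp_assoc, a0, comp_idl, comp_idr.
    - now rewrite (ca j1), (ca ee1), <- !comp_assoc, a1, met, comp_assoc. }
  now rewrite J, (ca hadd), comp_idl. }
assert (eeb : forall (j : N ~> NN) , pp1 NN ∘ j = id N -> pp0 NN ∘ j = z ∘ m -> add ∘ j = id N).
{ intros j j0 j1. apply (regepi_epi ret). rewrite <- comp_assoc.
  assert (J : j ∘ et = ee ∘ b).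
  { apply (pb_uniq (pbi NN)).
    - now rewrite (ca j1), (ca ee0), <- !comp_assoc, b0, met, comp_assoc.
    - now rewrite (ca j0), (ca ee1), <- comp_assoc, b1, comp_idl, comp_idr. }
  now rewrite J, (ca hadd), comp_idl. }
destruct (pb_ex (pbi NN) (a := id N) (b := z ∘ m)) as [Ja [Ja0 Ja1]].
{ now rewrite (ca1 mz), comp_idr. }
destruct (pb_ex (pbi NN) (a := z ∘ m) (b := id N)) as [Jb [Jb0 Jb1]].
{ now rewrite (ca1 mz), comp_idr. }
destruct (unital_gpd (pbi NN) (add := add) mz) as [G HG].
{ intros T x h. transitivity (add ∘ (Jb ∘ (pp1 NN ∘ x))).
  - f_equal. apply (pb_uniq (pbi NN)).
    + now rewrite (ca Jb0), <- comp_assoc.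
    + now rewrite (ca1 Jb1).
  - now rewrite (ca1 (eeb Jb Jb1 Jb0)). }
{ intros T x h. transitivity (add ∘ (Ja ∘ (pp0 NN ∘ x))).
  - f_equal. apply (pb_uniq (pbi NN)).
    + now rewrite (ca1 Ja0).
    + now rewrite (ca Ja1), <- comp_assoc.
  - now rewrite (ca1 (eea Ja Ja0 Ja1)). }
exists N, m, z, mz.
exists (exist _ et (conj met eq_refl : pt_map (mkpt mz) ∘ et = pt_map (mkpt ds) /\
  et ∘ pt_sec (mkpt ds) = pt_sec (mkpt mz))).
split; [exact ret |].
split; [exact (gpd_ab L je mz G) |].
intros B SB g.
destruct B as [B mb zb mzb]. destruct (ab_gpd L (mz := mzb) SB) as [GB].
destruct g as [g [g1 g2]]. simpl in *.
assert (cmp : mb ∘ (g ∘ pp0 KP) = mb ∘ (g ∘ pp1 KP)) by now rewrite !(ca g1).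
destruct (wu B (mul GB (g ∘ pp0 KP) (g ∘ pp1 KP))) as [h [hh _]].
{ rewrite !mul_nat by exact cmp. rewrite <- !comp_assoc, a0, a1, b0, b1, !comp_idr.
  rewrite (ca g2), <- g1. now rewrite mul1r, mul1l. }
assert (he : h ∘ et = g).
{ unfold et. rewrite (ca hh), mul_nat by exact cmp.
  rewrite <- !comp_assoc, a0, a1, comp_idr, (ca g2), <- g1. apply mul1r. }
assert (Hh : mb ∘ h = m /\ h ∘ z = zb).
{ split.
  - apply (regepi_epi ret). now rewrite <- comp_assoc, he, g1, met.
  - unfold z. now rewrite (ca he). }
exists (exist _ h Hh). split.
- apply sig_ext. exact he.
- intros [h' h2] e. apply sig_ext. simpl.
  apply (regepi_epi ret). apply (f_equal (@proj1_sig _ _)) in e. simpl in e. congruence.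
Qed.
End AssocAb.

(** * Stability under change of base *)

Section Stable.
Variables (E : Category) (K : Ctx E).
Let Rg := cx_reg K.
Let L := rx_lex Rg.
Let je := je_ctx K.

(** The form in which peri-abelianness is applied: since the associated abelian
    object commutes with changes of base, a map from any base change of [T] to a
    group over the new base [Q] factors through the base change of [N]. *)
Theorem stable_ab (U T : E) (d : T ~> U) (s : U ~> T) (ds : d ∘ s = id U) :
  exists (N : E) (m : N ~> U) (z : U ~> N) (G : Gpd m m z) (eta : T ~> N),
  m ∘ eta = d /\ eta ∘ s = z /\ RegEpi eta /\
  forall (Q TQ NQ M : E) (h : Q ~> U) (mm : M ~> Q) (zz : Q ~> M) (GM : Gpd mm mm zz)
    (pt : TQ ~> T) (pq : TQ ~> Q) (pb : is_pullback d h pt pq) (sQ : Q ~> TQ)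
    (nt : NQ ~> N) (nq : NQ ~> Q) (pbN : is_pullback m h nt nq) (g : TQ ~> M),
    pt ∘ sQ = s ∘ h -> pq ∘ sQ = id Q -> mm ∘ g = pq -> g ∘ sQ = zz ->
    exists g' : NQ ~> M, mm ∘ g' = nq /\
     forall W (w : W ~> TQ) (n : W ~> NQ),
       nt ∘ n = eta ∘ (pt ∘ w) -> nq ∘ n = pq ∘ w -> g' ∘ n = g ∘ w.
Proof.
destruct (assoc_ab_exists K ds) as [N [m [z [mz [[eta [e1 e2]] [reta heta]]]]]].
simpl in *.
destruct (ab_gpd L (mz := mz) (proj1 heta)) as [G].
exists N, m, z, G, eta. split; [exact e1 |]. split; [exact e2 |].
split; [exact reta |].
intros Q TQ NQ M h mm zz GM pt pq pb sQ nt nq pbN g ps qs mg gs.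
destruct (pb_ex pbN (a := z ∘ h) (b := id Q)) as [zQ [zQ0 zQ1]].
{ now rewrite (ca1 mz), comp_idr. }
destruct (pb_ex pbN (a := eta ∘ pt) (b := pq)) as [he [he0 he1]].
{ rewrite (ca e1). apply (pb_sq pb). }
destruct (assoc_ab_exists K qs) as [B [mB [zB [mzB [eta' [reta' heta']]]]]].
assert (hes : nq ∘ he = pq /\ he ∘ sQ = zQ).
{ split; [exact he1 |]. apply (pb_uniq pbN).
  - rewrite (ca he0), <- comp_assoc, ps, (ca e2). now rewrite zQ0.
  - now rewrite (ca he1), qs, zQ1. }
pose (heta0 := exist _ he hes : mkpt qs ~> mkpt zQ1).
assert (B1 : IsBaseChange (P := mkpt ds) (P' := mkpt qs) h pt).
{ split; [constructor; exact pb | exact ps]. }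
assert (B2 : IsBaseChange (P := mkpt mz) (P' := mkpt zQ1) h nt).
{ split; [constructor; exact pbN | exact zQ0]. }
destruct (cx_peri K (eta := exist _ eta (conj e1 e2) : mkpt ds ~> mkpt mz)
   (heta := heta0) (eta' := eta') B1 B2 he0 heta heta') as [c [hc [c' [c1 c2]]]].
assert (SM : IsAbelian (C := Pt Q) (mkpt (gds GM))) by exact (gpd_ab L je (gds GM) GM).
pose (gg := exist _ g (conj mg gs) : mkpt qs ~> mkpt (gds GM)).
destruct (proj2 heta' _ SM gg) as [g1 [hg1 _]].
exists (proj1_sig (g1 ∘ c')). split.
- exact (proj1 (proj2_sig (g1 ∘ c'))).
- intros W w n h1 h2.
  assert (n = he ∘ w) as ->.
  { apply (pb_uniq pbN); rewrite comp_assoc, ?he0, ?he1; [now rewrite <- comp_assoc | exact h2]. }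
  rewrite comp_assoc. f_equal.
  assert (Q1 : (g1 ∘ c') ∘ heta0 = gg).
  { rewrite <- hc, <- comp_assoc, (comp_assoc c'), c1, comp_idl. exact hg1. }
  exact (f_equal (@proj1_sig _ _) Q1).
Qed.
End Stable.

(** * Commutative objects *)

Section Mal.
Variables (C : Category) (L : Lex C) (je : JE C).

Lemma mal_nat (X : C) (p : MalcevOp X) T S (x y z : T ~> X) (u : S ~> T) :
  mal p x y z ∘ u = mal p (x ∘ u) (y ∘ u) (z ∘ u).
Proof. unfold mal. now rewrite <- comp_assoc, !pr_pair_comp. Qed.

Lemma mal_comm (X : C) (p : MalcevOp X) T (a b c : T ~> X) :
  mal p a b c = mal p c b a.
Proof.
apply (je_prod L je (V := X) (A := X) (B := X) (s := id X) (t := id X)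
  (Phi := fun T w a b => mal p a w b) (Psi := fun T w a b => mal p b w a)).
- intros. apply mal_nat.
- intros. apply mal_nat.
- intros. now rewrite comp_idl, mal_xyy, mal_xxy.
- intros. now rewrite comp_idl, mal_xyy, mal_xxy.
Qed.

Lemma mal_assoc (X : C) (p : MalcevOp X) T (a b c d e : T ~> X) :
  mal p (mal p a b c) d e = mal p a b (mal p c d e).
Proof.
pose (XX := prd L X X). pose (V := prd L XX X).
assert (H := @je_prod C L je V X X X (prl XX ∘ prl V) (prr V)
  (fun T w a e => mal p (mal p a (prl XX ∘ prl V ∘ w) (prr XX ∘ prl V ∘ w)) (prr V ∘ w) e)
  (fun T w a e => mal p a (prl XX ∘ prl V ∘ w) (mal p (prr XX ∘ prl V ∘ w) (prr V ∘ w) e))).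
lapply H; clear H; [intros H | intros; rewrite !mal_nat; now ra].
lapply H; clear H; [intros H | intros; rewrite !mal_nat; now ra].
lapply H; clear H; [intros H | intros; now rewrite !mal_xyy].
lapply H; clear H; [intros H | intros; now rewrite !mal_xxy].
specialize (H T (pr_pair V (pr_pair XX b c) d) a e).
cbv beta in H. rewrite <- !comp_assoc, !prl_pair, !prr_pair in H. exact H.
Qed.

Lemma mal_cancel (X : C) (p : MalcevOp X) T (a b c : T ~> X) :
  mal p (mal p a b c) c b = a.
Proof. now rewrite mal_assoc, mal_xxy, mal_xyy. Qed.

(** Any map from arrows to a commutative object is a functor up to the values on
    identities. *)
Lemma mal_functor (X Z U : C) (p : MalcevOp X) (d c : Z ~> U) (s : U ~> Z)
  (G : Gpd d c s) (g : Z ~> X) T (x y : T ~> Z) : c ∘ x = d ∘ y ->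
  g ∘ mul G x y = mal p (g ∘ x) (g ∘ (s ∘ (c ∘ x))) (g ∘ y).
Proof.
apply (mul_ext L je G (Phi := fun T x y => g ∘ mul G x y)
  (Psi := fun T x y => mal p (g ∘ x) (g ∘ (s ∘ (c ∘ x))) (g ∘ y))).
- intros. now rewrite <- comp_assoc, mul_nat.
- intros. rewrite mal_nat. now ra.
- intros. now rewrite mul1r, mal_xyy.
- intros. now rewrite mul1l, (ca1 (gcs G)), mal_xxy.
Qed.

Lemma mal_map (X Y : C) (p : MalcevOp X) (q : MalcevOp Y) (f : X ~> Y) T (a b c : T ~> X) :
  f ∘ mal p a b c = mal q (f ∘ a) (f ∘ b) (f ∘ c).
Proof.
apply (je_prod L je (V := X) (A := X) (B := X) (s := id X) (t := id X)
  (Phi := fun T w a b => f ∘ mal p a w b)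
  (Psi := fun T w a b => mal q (f ∘ a) (f ∘ w) (f ∘ b))).
- intros. now rewrite <- comp_assoc, mal_nat.
- intros. rewrite mal_nat. now ra.
- intros. now rewrite comp_idl, !mal_xyy.
- intros. now rewrite comp_idl, !mal_xxy.
Qed.

Lemma comm_pb (A B Z P : C) (f : A ~> Z) (g : B ~> Z) (p : P ~> A) (q : P ~> B) :
  Commutative A -> Commutative B -> Commutative Z -> is_pullback f g p q -> Commutative P.
Proof.
intros [a] [b] [z] pb.
pose (P2 := prd L P P). pose (P3 := prd L P2 P).
pose (x := prl P2 ∘ prl P3). pose (y := prr P2 ∘ prl P3). pose (w := prr P3).
destruct (pb_ex pb (a := mal a (p ∘ x) (p ∘ y) (p ∘ w)) (b := mal b (q ∘ x) (q ∘ y) (q ∘ w)))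
  as [m [m0 m1]].
{ rewrite (mal_map a z), (mal_map b z), !comp_assoc. now rewrite (pb_sq pb). }
assert (H : forall T (k : T ~> P3),
  p ∘ (m ∘ k) = mal a (p ∘ (x ∘ k)) (p ∘ (y ∘ k)) (p ∘ (w ∘ k)) /\
  q ∘ (m ∘ k) = mal b (q ∘ (x ∘ k)) (q ∘ (y ∘ k)) (q ∘ (w ∘ k))).
{ intros. rewrite (ca m0), (ca m1), !mal_nat. split; now ra. }
constructor. refine {| mal_sq := P2; mal_cube := P3; mal_op := m |}; simpl; intros T u v.
- destruct (H T (pr_pair P3 (pr_pair P2 u v) v)) as [h0 h1].
  unfold x, y, w in h0, h1. rewrite <- !comp_assoc, !prl_pair, !prr_pair in h0, h1.
  rewrite mal_xyy in h0, h1. now apply (pb_uniq pb).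
- destruct (H T (pr_pair P3 (pr_pair P2 u u) v)) as [h0 h1].
  unfold x, y, w in h0, h1. rewrite <- !comp_assoc, !prl_pair, !prr_pair in h0, h1.
  rewrite mal_xxy in h0, h1. now apply (pb_uniq pb).
Qed.

Lemma pair_ext (A B : C) (P : Product A B) T (x : T ~> P) a b :
  prl P ∘ x = a -> prr P ∘ x = b -> x = pr_pair P a b.
Proof. intros <- <-. symmetry. apply pair_eta. Qed.

(** A commutative object lacks only a zero to be a group; over [Q] the map [o]
    provides one. *)
Lemma mal_gpd (X Q : C) (p : MalcevOp X) (o : Q ~> X) :
  exists G : Gpd (prl (prd L Q X)) (prl (prd L Q X)) (pr_pair (prd L Q X) (id Q) o),
  (forall T (x y : T ~> prd L Q X),
    prr _ ∘ mul G x y = mal p (prr _ ∘ x) (o ∘ (prl _ ∘ x)) (prr _ ∘ y)) /\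
  (forall T (x : T ~> prd L Q X),
    prr _ ∘ (inv G ∘ x) = mal p (o ∘ (prl _ ∘ x)) (prr _ ∘ x) (o ∘ (prl _ ∘ x))).
Proof.
set (P := prd L Q X).
set (iv := pr_pair P (prl P) (mal p (o ∘ prl P) (prr P) (o ∘ prl P))).
assert (ivl : forall T (x : T ~> P), prl P ∘ (iv ∘ x) = prl P ∘ x).
{ intros. unfold iv. now rewrite (ca (prl_pair _ _ _)). }
assert (ivr : forall T (x : T ~> P),
  prr P ∘ (iv ∘ x) = mal p (o ∘ (prl P ∘ x)) (prr P ∘ x) (o ∘ (prl P ∘ x))).
{ intros. unfold iv. rewrite (ca (prr_pair _ _ _)), mal_nat. now ra. }
assert (zl : forall T (x : T ~> Q), prl P ∘ (pr_pair P (id Q) o ∘ x) = x).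
{ intros. now rewrite (ca (prl_pair _ _ _)), comp_idl. }
assert (zr : forall T (x : T ~> Q), prr P ∘ (pr_pair P (id Q) o ∘ x) = o ∘ x).
{ intros. now rewrite (ca (prr_pair _ _ _)). }
unshelve eexists {| mul := fun T x y =>
  pr_pair P (prl P ∘ x) (mal p (prr P ∘ x) (o ∘ (prl P ∘ x)) (prr P ∘ y)); inv := iv |}.
- intros. cbv beta. rewrite pr_pair_comp, mal_nat. now ra.
- apply prl_pair.
- apply prl_pair.
- intros. symmetry. apply pair_ext; rewrite ?zl, ?zr; auto. now rewrite mal_xxy.
- intros. symmetry. apply pair_ext; rewrite ?zl, ?zr; auto. now rewrite mal_xyy.
- unfold iv. apply prl_pair.
- unfold iv. apply prl_pair.
- intros. symmetry. apply pair_ext; rewrite ?zl, ?zr, ?ivr; auto.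
  now rewrite <- mal_assoc, mal_xyy, mal_xxy.
- intros. symmetry. apply pair_ext; rewrite ?zl, ?zr, ?ivr, ?ivl; auto.
  rewrite mal_assoc, mal_xxy, mal_xyy. reflexivity.
- split; [| exact ivr]. intros. apply prr_pair.
Qed.

Lemma gpd_bc (U N Q NQ : C) (m : N ~> U) (z : U ~> N) (G : Gpd m m z) (h : Q ~> U)
  (nt : NQ ~> N) (nq : NQ ~> Q) (pb : is_pullback m h nt nq) (zQ : Q ~> NQ) :
  nt ∘ zQ = z ∘ h -> nq ∘ zQ = id Q ->
  exists G' : Gpd nq nq zQ, forall T (x y : T ~> NQ), nq ∘ x = nq ∘ y ->
   nt ∘ mul G' x y = mul G (nt ∘ x) (nt ∘ y).
Proof.
intros z0 z1. assert (sq := pb_sq pb).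
pose (KP := lx_pb L nq nq). assert (sk := pb_sq (pbi KP)).
assert (e : m ∘ (nt ∘ pp0 KP) = m ∘ (nt ∘ pp1 KP)).
{ rewrite !comp_assoc, sq, <- !comp_assoc. now rewrite sk. }
assert (eK : forall T (w : T ~> KP), m ∘ (nt ∘ (pp0 KP ∘ w)) = m ∘ (nt ∘ (pp1 KP ∘ w))).
{ intros. rewrite (comp_assoc nt), (comp_assoc m), e. now ra. }
destruct (pb_ex pb (a := mul G (nt ∘ pp0 KP) (nt ∘ pp1 KP)) (b := nq ∘ pp0 KP)) as [mu [mu0 mu1]].
{ rewrite (d_mul L je G e), !comp_assoc. now rewrite sq. }
destruct (pb_ex pb (a := inv G ∘ nt) (b := nq)) as [iv [iv0 iv1]].
{ now rewrite (ca (gdi G)). }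
assert (MU : forall T (w : T ~> KP), nt ∘ (mu ∘ w) = mul G (nt ∘ (pp0 KP ∘ w)) (nt ∘ (pp1 KP ∘ w))).
{ intros. rewrite (ca mu0), mul_nat by exact e. now ra. }
assert (MQ : forall T (w : T ~> KP), nq ∘ (mu ∘ w) = nq ∘ (pp0 KP ∘ w)).
{ intros. rewrite (ca mu1). now ra. }
assert (sk' : forall T (w : T ~> KP), nq ∘ (pp0 KP ∘ w) = nq ∘ (pp1 KP ∘ w)).
{ intros. rewrite !(comp_assoc nq). now rewrite sk. }
assert (ZN : forall T (w : T ~> NQ), nt ∘ (zQ ∘ (nq ∘ w)) = z ∘ (m ∘ (nt ∘ w))).
{ intros. rewrite (ca z0), (comp_assoc m nt), sq. now ra. }
destruct (gpd_of_map (s := zQ) (pbi KP) (m := mu) (i := iv) z1 z1 iv1 iv1) as [G' HG'].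
- intros T w h0. apply (pb_uniq pb).
  + rewrite MU, h0, ZN. apply mul1l.
  + now rewrite MQ.
- intros T w h0. apply (pb_uniq pb).
  + rewrite MU, h0, ZN. apply mul1r.
  + now rewrite MQ.
- intros T w h0. apply (pb_uniq pb).
  + rewrite MU, h0, ZN, (ca iv0), <- comp_assoc. apply mulV.
  + now rewrite MQ, (ca1 z1).
- intros T w h0. apply (pb_uniq pb).
  + rewrite MU, h0, ZN, (ca iv0), <- comp_assoc. apply mulVl.
  + now rewrite MQ, (ca1 z1), sk'.
- exists G'. intros T x y exy. destruct (pb_ex (pbi KP) exy) as [w [<- <-]].
  rewrite HG'. apply MU.
Qed.

Section Sub.
Variables (U N : C) (m : N ~> U) (z : U ~> N) (G : Gpd m m z).
Definition sub T (x y : T ~> N) : T ~> N := mul G x (inv G ∘ y).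
Let mi T (x : T ~> N) : m ∘ (inv G ∘ x) = m ∘ x := di G x.
Lemma sub_nat T S (x y : T ~> N) (u : S ~> T) : m ∘ x = m ∘ y ->
  sub x y ∘ u = sub (x ∘ u) (y ∘ u).
Proof. intros e. unfold sub. rewrite mul_nat; [now ra | now rewrite mi]. Qed.
Lemma m_sub T (x y : T ~> N) : m ∘ x = m ∘ y -> m ∘ sub x y = m ∘ x.
Proof. intros e. unfold sub. apply (d_mul L je G). now rewrite mi. Qed.
Lemma sub_self T (x : T ~> N) : sub x x = z ∘ (m ∘ x).
Proof. apply mulV. Qed.
Lemma sub_z T (x : T ~> N) (y : T ~> U) : m ∘ x = y -> sub x (z ∘ y) = x.
Proof.
intros <-. unfold sub. rewrite (ca (inv_s L je G)). apply mul1r.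
Qed.
Lemma sub_sub T (x y w : T ~> N) : m ∘ x = m ∘ w -> m ∘ y = m ∘ w ->
  sub (sub x w) (sub y w) = sub x y.
Proof.
intros e1 e2. unfold sub.
assert (e3 : mul G w (inv G ∘ y) = inv G ∘ mul G y (inv G ∘ w)).
{ apply (inv_uniq L je).
  - rewrite (c_mul L je G), (d_mul L je G), ?mi; rewrite ?mi; auto.
  - rewrite <- (mul_assoc L je G), (mulKV L je G), mulV, (d_mul L je G); auto.
    + rewrite mi; auto.
    + rewrite (c_mul L je G); rewrite !mi; auto.
    + rewrite mi; auto. }
rewrite <- e3, <- (mul_assoc L je G), (mulKV L je G); auto.
- rewrite (c_mul L je G); rewrite mi; auto.
- rewrite mi; auto.
Qed.
End Sub.

Lemma gpd_times (U T Q : C) (d c : T ~> U) (s : U ~> T) (G : Gpd d c s) :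
  let TQ := prd L T Q in let UQ := prd L U Q in
  exists GQ : Gpd (pr_pair UQ (d ∘ prl TQ) (prr TQ)) (pr_pair UQ (c ∘ prl TQ) (prr TQ))
    (pr_pair TQ (s ∘ prl UQ) (prr UQ)),
  forall W (x y : W ~> TQ), mul GQ x y = pr_pair TQ (mul G (prl TQ ∘ x) (prl TQ ∘ y)) (prr TQ ∘ x).
Proof.
intros TQ UQ.
assert (D : forall (k : T ~> U) W (x : W ~> TQ), pr_pair UQ (k ∘ prl TQ) (prr TQ) ∘ x =
  pr_pair UQ (k ∘ (prl TQ ∘ x)) (prr TQ ∘ x)).
{ intros. rewrite pr_pair_comp. now ra. }
assert (S : forall W (x : W ~> UQ), pr_pair TQ (s ∘ prl UQ) (prr UQ) ∘ x =
  pr_pair TQ (s ∘ (prl UQ ∘ x)) (prr UQ ∘ x)).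
{ intros. rewrite pr_pair_comp. now ra. }
assert (N : forall W (x y : W ~> TQ),
  pr_pair UQ (c ∘ prl TQ) (prr TQ) ∘ x = pr_pair UQ (d ∘ prl TQ) (prr TQ) ∘ y ->
  c ∘ (prl TQ ∘ x) = d ∘ (prl TQ ∘ y)).
{ intros W x y e. rewrite !D in e. apply (f_equal (fun h => prl UQ ∘ h)) in e.
  now rewrite !prl_pair in e. }
unshelve eexists {| mul := fun W x y =>
    pr_pair TQ (mul G (prl TQ ∘ x) (prl TQ ∘ y)) (prr TQ ∘ x);
  inv := pr_pair TQ (inv G ∘ prl TQ) (prr TQ) |}; cbv beta.
- intros W W' x y u e. rewrite pr_pair_comp, mul_nat by now apply N. now ra.
- rewrite D, prl_pair, prr_pair, (ca1 (gds G)). symmetry; apply pair_ext; apply comp_idr.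
- rewrite D, prl_pair, prr_pair, (ca1 (gcs G)). symmetry; apply pair_ext; apply comp_idr.
- intros W x. rewrite D, S, ?prl_pair, ?prr_pair, mul1l. apply pair_eta.
- intros W x. rewrite D, S, ?prl_pair, ?prr_pair, mul1r. apply pair_eta.
- rewrite D, prl_pair, prr_pair, (ca (gdi G)). reflexivity.
- rewrite D, prl_pair, prr_pair, (ca (gci G)). reflexivity.
- intros W x. rewrite D, S, !pr_pair_comp, ?prl_pair, ?prr_pair. ra. now rewrite mulV.
- intros W x. rewrite D, S, !pr_pair_comp, ?prl_pair, ?prr_pair. ra. now rewrite mulVl.
- reflexivity.
Qed.
End Mal.

(** The Mal'cev operation descends because, by [JE], its effect on triples of
    pairs identified by [q] is determined by the triples (x, y, y) and (x, x, y).
*)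
Lemma comm_quot (E : Category) (R : RegCtx E) (je : JE E) (X Y : E) (q : X ~> Y) :
  RegEpi q -> Commutative X -> Commutative Y.
Proof.
intros rq [p]. set (L := rx_lex R).
pose (X2 := prd L X X). pose (X3 := prd L X2 X).
pose (Y2 := prd L Y Y). pose (Y3 := prd L Y2 Y).
pose (q3 := pr_pair Y3 (pr_pair Y2 (q ∘ (prl X2 ∘ prl X3)) (q ∘ (prr X2 ∘ prl X3))) (q ∘ prr X3)).
assert (q3E : forall W (x y z : W ~> X), q3 ∘ pr_pair X3 (pr_pair X2 x y) z =
  pr_pair Y3 (pr_pair Y2 (q ∘ x) (q ∘ y)) (q ∘ z)).
{ intros. unfold q3. rewrite !pr_pair_comp, <- !comp_assoc.
  now rewrite ?prl_pair, ?prr_pair, ?prl_pair. }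
assert (lift : forall W (w : W ~> Y3), exists W' (k : W' ~> W) (x y z : W' ~> X), RegEpi k /\
   w ∘ k = pr_pair Y3 (pr_pair Y2 (q ∘ x) (q ∘ y)) (q ∘ z)).
{ intros W w.
  destruct (cover R (prl Y2 ∘ prl Y3 ∘ w) rq) as [W1 [k1 [x [r1 h1]]]].
  destruct (cover R (prr Y2 ∘ prl Y3 ∘ w ∘ k1) rq) as [W2 [k2 [y [r2 h2]]]].
  destruct (cover R (prr Y3 ∘ w ∘ k1 ∘ k2) rq) as [W3 [k3 [z [r3 h3]]]].
  exists W3, (k1 ∘ k2 ∘ k3), (x ∘ k2 ∘ k3), (y ∘ k3), z. split.
  - apply (regepi_comp R); auto. now apply (regepi_comp R).
  - apply pair_ext; [apply pair_ext |].
    + rewrite !comp_assoc, h1. now ra.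
    + rewrite !comp_assoc, h2. now ra.
    + rewrite h3. now ra. }
assert (rq3 : RegEpi q3).
{ destruct (lift Y3 (id Y3)) as [W [k [x [y [z [rk e]]]]]].
  apply (regepi_local R (c := k) (a := pr_pair X3 (pr_pair X2 x y) z) rk).
  rewrite q3E, <- e. apply comp_idl. }
assert (X3E : forall W (u : W ~> X3), u = pr_pair X3 (pr_pair X2 (prl X2 ∘ prl X3 ∘ u)
     (prr X2 ∘ prl X3 ∘ u)) (prr X3 ∘ u)).
{ intros W w. apply pair_ext; [| reflexivity]. apply pair_ext; now rewrite comp_assoc. }
destruct (regepi_desc (g := q ∘ mal p (prl X2 ∘ prl X3) (prr X2 ∘ prl X3) (prr X3)) rq3) as [m hm].
{   intros W u v e. rewrite (X3E _ u), (X3E _ v), !q3E in e.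
  rewrite <- !comp_assoc, !mal_nat.
  set (u0 := prl X2 ∘ prl X3 ∘ u) in *. set (u1 := prr X2 ∘ prl X3 ∘ u) in *. set (u2 := prr X3 ∘ u) in *.
  set (v0 := prl X2 ∘ prl X3 ∘ v) in *. set (v1 := prr X2 ∘ prl X3 ∘ v) in *. set (v2 := prr X3 ∘ v) in *.
  assert (e2 := f_equal (fun h => prr Y3 ∘ h) e).
  assert (e1 := f_equal (fun h => prr Y2 ∘ (prl Y3 ∘ h)) e).
  assert (e0 := f_equal (fun h => prl Y2 ∘ (prl Y3 ∘ h)) e).
  cbv beta in e0, e1, e2.
  rewrite !prr_pair in e2. rewrite !prl_pair, !prr_pair in e1. rewrite !prl_pair in e0.
  pose (S := lx_pb L q q). assert (sS := pb_sq (pbi S)).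
  destruct (pb_ex (pbi S) e0) as [a [a0 a1]].
  destruct (pb_ex (pbi S) e1) as [b [b0 b1]].
  destruct (pb_ex (pbi S) e2) as [c [c0 c1]].
  assert (Q := @je_prod E L je S S S Y (id S) (id S)
    (fun T w a b => q ∘ mal p (pp0 S ∘ a) (pp0 S ∘ w) (pp0 S ∘ b))
    (fun T w a b => q ∘ mal p (pp1 S ∘ a) (pp1 S ∘ w) (pp1 S ∘ b))).
  lapply Q; clear Q; [intros Q | intros; rewrite <- comp_assoc, mal_nat; now ra].
  lapply Q; clear Q; [intros Q | intros; rewrite <- comp_assoc, mal_nat; now ra].
  lapply Q; clear Q; [intros Q | intros; rewrite !comp_idl, !mal_xyy, !comp_assoc; now rewrite sS].
  lapply Q; clear Q; [intros Q | intros; rewrite !comp_idl, !mal_xxy, !comp_assoc; now rewrite sS].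
  specialize (Q W b a c). cbv beta in Q.
  now rewrite a0, a1, b0, b1, c0, c1 in Q. }
assert (mE : forall W (x y z : W ~> X),
  m ∘ pr_pair Y3 (pr_pair Y2 (q ∘ x) (q ∘ y)) (q ∘ z) = q ∘ mal p x y z).
{ intros. rewrite <- q3E, (ca hm), <- comp_assoc, mal_nat, <- !comp_assoc.
  now rewrite ?prl_pair, ?prr_pair, ?prl_pair. }
constructor. refine {| mal_sq := Y2; mal_cube := Y3; mal_op := m |}; simpl; intros W x y.
- destruct (cover R x rq) as [W1 [k1 [x' [r1 h1]]]].
  destruct (cover R (y ∘ k1) rq) as [W2 [k2 [y' [r2 h2]]]].
  apply (regepi_epi r1), (regepi_epi r2).
  rewrite <- !comp_assoc, !pr_pair_comp, (comp_assoc x), (comp_assoc y), <- h1, <- h2, <- comp_assoc, mE.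
  now rewrite mal_xyy.
- destruct (cover R x rq) as [W1 [k1 [x' [r1 h1]]]].
  destruct (cover R (y ∘ k1) rq) as [W2 [k2 [y' [r2 h2]]]].
  apply (regepi_epi r1), (regepi_epi r2).
  rewrite <- !comp_assoc, !pr_pair_comp, (comp_assoc x), (comp_assoc y), <- h1, <- h2, <- comp_assoc, mE.
  now rewrite mal_xxy.
Qed.

(** * The associated abelian object of a connected groupoid *)

Section TR.
Variables (E : Category) (K : Ctx E).
Let Rg := cx_reg K.
Let L := rx_lex Rg.
Let je := je_ctx K.
Notation "⟪ a , b ⟫" := (pr_pair (prd L _ _) a b).

Lemma pl (A B T : E) (a : T ~> A) (b : T ~> B) : prl (prd L A B) ∘ ⟪a, b⟫ = a.
Proof. apply prl_pair. Qed.
Lemma pr (A B T : E) (a : T ~> A) (b : T ~> B) : prr (prd L A B) ∘ ⟪a, b⟫ = b.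
Proof. apply prr_pair. Qed.
Lemma pc (A B T S : E) (a : T ~> A) (b : T ~> B) (u : S ~> T) :
  ⟪a, b⟫ ∘ u = ⟪a ∘ u, b ∘ u⟫.
Proof. apply pr_pair_comp. Qed.

Lemma pair_id (A B : E) : ⟪prl (prd L A B), prr (prd L A B)⟫ = id _.
Proof. symmetry. apply pair_ext; apply comp_idr. Qed.

(** Efficient regularity, in the only way it is used: a relation singled out by an
    equation is an equalizer, so that it has a quotient with no further
    identifications. *)
Lemma eff_quot (X S W : E) (t0 t1 : S ~> X) (a b : prd L X X ~> W) :
  IsEquivRel t0 t1 -> a ∘ ⟪t0, t1⟫ = b ∘ ⟪t0, t1⟫ ->
  (forall T (u v : T ~> X), a ∘ ⟪u, v⟫ = b ∘ ⟪u, v⟫ ->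
     exists w : T ~> S, t0 ∘ w = u /\ t1 ∘ w = v) ->
  exists (Q : E) (q : X ~> Q), RegEpi q /\ q ∘ t0 = q ∘ t1 /\
   forall T (u v : T ~> X), q ∘ u = q ∘ v -> exists w : T ~> S, t0 ∘ w = u /\ t1 ∘ w = v.
Proof.
intros er hab H.
destruct (@cx_eff E K X S t0 t1 er) as [Y [g [pb]]].
{ exists W, a, b. split; [exact hab |].
  intros T t e. destruct (H T (prl _ ∘ t) (prr _ ∘ t)) as [w [w0 w1]].
  { now rewrite pair_eta. }
  exists w. split.
  - rewrite pc, w0, w1. apply pair_eta.
  - intros v hv. apply (proj1 er).
    + rewrite w0, <- hv, comp_assoc, pl. reflexivity.
    + rewrite w1, <- hv, comp_assoc, pr. reflexivity. }
destruct (rx_kp Rg (inhabits pb)) as [Q [q hq]].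
assert (rq : RegEpi q) by (exists S, t0, t1; exact hq).
apply coeqP in hq. destruct hq as [h1 h2].
destruct (h2 Y g (pb_sq pb)) as [k [hk _]].
exists Q, q. split; [exact rq |]. split; [exact h1 |].
intros T u v e. apply (pb_ex pb). rewrite <- hk, <- !comp_assoc. now rewrite e.
Qed.

Section Groupoid.
Variables (U T : E) (d c : T ~> U) (s : U ~> T) (G : Gpd d c s).
Hypothesis gU : RegEpi (bng L U).
Hypothesis gT : RegEpi ⟪d, c⟫.

Lemma arrow_cover W (x y : W ~> U) :
  exists (W' : E) (k : W' ~> W) (t : W' ~> T),
    RegEpi k /\ d ∘ t = x ∘ k /\ c ∘ t = y ∘ k.
Proof.
destruct (cover Rg ⟪x, y⟫ gT) as [W' [k [t [rk e]]]].
exists W', k, t. split; [exact rk |].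
rewrite !pc in e.
split; [apply (f_equal (fun h => prl _ ∘ h)) in e | apply (f_equal (fun h => prr _ ∘ h)) in e];
 rewrite ?pl, ?pr in e; exact e.
Qed.

Lemma glob_cover (X W : E) : RegEpi (bng L X) ->
  exists (W' : E) (k : W' ~> W) (t : W' ~> X), RegEpi k.
Proof.
intros h. destruct (cover Rg (bng L W) h) as [W' [k [t [rk _]]]]. now exists W', k, t.
Qed.

(** Let N be the abelian object associated with the arrows of a connected
    groupoid, as a point over their source. An arrow t : x -> y transports
    N_y to N_x by eta t' |-> eta (t t') - eta t. Stability under change of base
    makes this well defined on N rather than on arrows t'. It depends only on the
    ends of t: for two parallel arrows t the transports agree at zero, and that
    is enough because they agree for equal arrows. Hence N is constant: it is U x V,
    with V the quotient of N by transport. The resulting map [tau] from arrows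
    to [V] is universal among maps to commutative objects which are constant on
    identities; after any change of base, [tau] still separates what maps to
    groups over the new base can distinguish. *)
Theorem trivialize :
  exists (V : E) (o : lx_one L ~> V) (tau : T ~> V),
  Commutative V /\ tau ∘ s = o ∘ bng L U /\ RegEpi ⟪d, tau⟫ /\
  (forall (Q TQ M : E) (h : Q ~> U) (mm : M ~> Q) (zz : Q ~> M) (GM : Gpd mm mm zz)
     (pt : TQ ~> T) (pq : TQ ~> Q) (pb : is_pullback d h pt pq) (sQ : Q ~> TQ)
     (g : TQ ~> M),
     pt ∘ sQ = s ∘ h -> pq ∘ sQ = id Q -> mm ∘ g = pq -> g ∘ sQ = zz ->
     forall W (w w' : W ~> TQ), pq ∘ w = pq ∘ w' -> tau ∘ (pt ∘ w) = tau ∘ (pt ∘ w') ->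
     g ∘ w = g ∘ w') /\
  (forall (X : E) (g : T ~> X) (o' : lx_one L ~> X), Commutative X ->
     g ∘ s = o' ∘ bng L U -> exists g' : V ~> X, g' ∘ tau = g).
Proof.
destruct (stable_ab K (gds G)) as [N [m [z [GN [et [met [ets [ret UP]]]]]]]].
assert (mz := gds GN).
pose (sb := sub GN).
(* t' |-> eta (t t') - eta t, to be descended along T2 -> U x N *)
pose (T2 := lx_pb L c d).
assert (sT2 := pb_sq (pbi T2)).
pose (UN := prd L U N).
pose (q2 := ⟪d ∘ pp0 T2, et ∘ pp1 T2⟫ : T2 ~> UN).
assert (rq2 : RegEpi q2).
{ destruct (cover Rg (prr UN) ret) as [W1 [k1 [t1 [rk1 h1]]]].
  destruct (arrow_cover (prl UN ∘ k1) (d ∘ t1)) as [W2 [k2 [t2 [rk2 [h2 h3]]]]].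
  destruct (pb_ex (pbi T2) (a := t2) (b := t1 ∘ k2)) as [w [w0 w1]].
  { now rewrite h3, comp_assoc. }
  apply (regepi_local Rg (c := k1 ∘ k2) (a := w)); [now apply regepi_comp |].
  unfold q2. rewrite pc, <- !comp_assoc, w0, w1, h2, (ca h1), <- comp_assoc.
  symmetry. apply pair_ext; now rewrite ?comp_assoc. }
assert (Q2 : forall W (t t' : W ~> T), c ∘ t = d ∘ t' ->
   exists w : W ~> T2, q2 ∘ w = ⟪d ∘ t, et ∘ t'⟫ /\ pp0 T2 ∘ w = t /\ pp1 T2 ∘ w = t').
{ intros W t t' e. destruct (pb_ex (pbi T2) e) as [w [w0 w1]]. exists w.
  unfold q2. rewrite pc, <- !comp_assoc, w0, w1. auto. }
assert (mek : forall W (x : W ~> T), m ∘ (et ∘ x) = d ∘ x).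
{ intros. now rewrite (ca met). }
assert (dm : forall W (x y : W ~> T), c ∘ x = d ∘ y -> d ∘ mul G x y = d ∘ x).
{ intros W x y. apply (d_mul L je G). }
assert (cm : forall W (x y : W ~> T), c ∘ x = d ∘ y -> c ∘ mul G x y = c ∘ y).
{ intros W x y. apply (c_mul L je G). }
pose (al0 := sb T2 (et ∘ mul G (pp0 T2) (pp1 T2)) (et ∘ pp0 T2)).
assert (al0e : forall W (w : W ~> T2), al0 ∘ w =
   sb W (et ∘ mul G (pp0 T2 ∘ w) (pp1 T2 ∘ w)) (et ∘ (pp0 T2 ∘ w))).
{ intros W w. unfold al0, sb. rewrite sub_nat.
  - rewrite <- !comp_assoc, mul_nat; auto.
  - rewrite !mek. apply dm, sT2. }
assert (desc : forall W (u v : W ~> T2), q2 ∘ u = q2 ∘ v -> al0 ∘ u = al0 ∘ v).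
{
  (* over T, with t as the variable of the new base, the formula is a map of
     points, so it factors through the base change of N along c *)
  pose (TQ := lx_pb L d c). pose (NQ := lx_pb L m c). pose (M := lx_pb L m d).
  destruct (pb_ex (pbi TQ) (a := s ∘ c) (b := id T)) as [sQ [sQ0 sQ1]].
  { now rewrite (ca1 (gds G)), comp_idr. }
  destruct (pb_ex (pbi M) (a := z ∘ d) (b := id T)) as [zz [zz0 zz1]].
  { now rewrite (ca1 mz), comp_idr. }
  destruct (gpd_bc L je GN (pbi M) zz0 zz1) as [GM HGM].
  assert (sTQ := pb_sq (pbi TQ)).
  destruct (pb_ex (pbi M)
    (a := sb TQ (et ∘ mul G (pp1 TQ) (pp0 TQ)) (et ∘ pp1 TQ)) (b := pp1 TQ)) as [g [g0 g1]].
  { unfold sb. rewrite (m_sub L je); auto.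
    - rewrite mek. apply dm. auto.
    - rewrite !mek. apply dm. auto. }
  assert (ge : forall W (w : W ~> TQ), pp0 M ∘ (g ∘ w) =
    sb W (et ∘ mul G (pp1 TQ ∘ w) (pp0 TQ ∘ w)) (et ∘ (pp1 TQ ∘ w))).
  { intros W w. rewrite (ca g0). unfold sb. rewrite sub_nat.
    - rewrite <- !comp_assoc, mul_nat; auto.
    - rewrite !mek. apply dm. auto. }
  assert (gs : g ∘ sQ = zz).
  { apply (pb_uniq (pbi M)).
    - rewrite ge, sQ0, sQ1, zz0. unfold sb.
      assert (R1 := mul1r G (id T)). rewrite comp_idr in R1. rewrite R1, sub_self.
      now rewrite !(ca met), comp_idr.
    - now rewrite (ca g1), sQ1, zz1. }
  destruct (UP T TQ NQ M c (pp1 M) zz GM (pp0 TQ) (pp1 TQ) (pbi TQ) sQ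
     (pp0 NQ) (pp1 NQ) (pbi NQ) g sQ0 sQ1 g1 gs) as [ka [ka1 kae]].
  (* parallel arrows give the same transport: compare on the kernel pair of (d, c),
     pulled back to N, whose two axes are n = 0 and t = t' *)
  pose (TT := lx_pb L ⟪d, c⟫ ⟪d, c⟫).
  assert (sTT := pb_sq (pbi TT)). rewrite !pc in sTT.
  assert (dTT : d ∘ pp0 TT = d ∘ pp1 TT).
  { apply (f_equal (fun h => prl _ ∘ h)) in sTT. now rewrite !pl in sTT. }
  assert (cTT : c ∘ pp0 TT = c ∘ pp1 TT).
  { apply (f_equal (fun h => prr _ ∘ h)) in sTT. now rewrite !pr in sTT. }
  destruct (pb_ex (pbi TT) (eq_refl (⟪d, c⟫ ∘ id T))) as [dg [dg0 dg1]].
  pose (P := lx_pb L (pp0 TT) (pp1 NQ)).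
  destruct (pb_ex (pbi NQ) (a := z ∘ c) (b := id T)) as [zN [zN0 zN1]].
  { now rewrite (ca1 mz), comp_idr. }
  assert (sNQ := pb_sq (pbi NQ)).
  assert (sP := pb_sq (pbi P)).
  destruct (pb_ex (pbi NQ) (a := pp0 NQ ∘ pp1 P) (b := pp1 TT ∘ pp0 P)) as [v0 [v00 v01]].
  { rewrite comp_assoc, sNQ, <- comp_assoc, <- sP, !comp_assoc, cTT. reflexivity. }
  assert (kz : forall W (t : W ~> T) (n : W ~> NQ), pp0 NQ ∘ n = z ∘ (c ∘ t) ->
     pp1 NQ ∘ n = t -> pp0 M ∘ (ka ∘ n) = z ∘ (d ∘ t)).
  { intros W t n h1 h2. rewrite (kae W (sQ ∘ t) n).
    - rewrite (ca gs), (ca zz0). now ra.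
    - rewrite h1, (ca sQ0), <- ets. now ra.
    - now rewrite (ca sQ1), comp_idl. }
  destruct (pb_ex (pbi P) (a := id TT) (b := zN ∘ pp0 TT)) as [ja [ja0 ja1]].
  { now rewrite (ca1 zN1), comp_idr. }
  destruct (pb_ex (pbi P) (a := dg ∘ pp1 NQ) (b := id NQ)) as [jb [jb0 jb1]].
  { now rewrite (ca1 dg0), comp_idr. }
  assert (KK : pp0 M ∘ ka ∘ pp1 P = pp0 M ∘ ka ∘ v0).
  { apply (je (pbi P) dg0 zN1 ja0 ja1 jb0 jb1); rewrite <- !comp_assoc.
    - rewrite (kz _ (pp0 TT)), (kz _ (pp1 TT)); [now rewrite dTT | | | |].
      + rewrite (ca v00), <- comp_assoc, ja1, (ca zN0), <- comp_assoc. now rewrite cTT.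
      + now rewrite (ca v01), <- comp_assoc, ja0, comp_idr.
      + now rewrite ja1, (ca zN0), <- comp_assoc.
      + now rewrite ja1, (ca1 zN1).
    - do 2 f_equal. apply (pb_uniq (pbi NQ)).
      + now rewrite (ca v00), <- comp_assoc.
      + now rewrite (ca v01), <- comp_assoc, jb0, jb1, (ca1 dg1), comp_idr. }
  intros W u v e. unfold q2 in e. rewrite !pc in e.
  assert (e1 := f_equal (fun h => prl _ ∘ h) e). assert (e2 := f_equal (fun h => prr _ ∘ h) e).
  cbv beta in e1, e2. rewrite !pl in e1. rewrite !pr in e2. clear e.
  rewrite <- !comp_assoc in e1, e2.
  set (t := pp0 T2 ∘ u) in *. set (t1 := pp1 T2 ∘ u) in *.
  set (t' := pp0 T2 ∘ v) in *. set (t1' := pp1 T2 ∘ v) in *.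
  assert (ct : c ∘ t = d ∘ t1) by (unfold t, t1; rewrite !comp_assoc; now rewrite sT2).
  assert (ct' : c ∘ t' = d ∘ t1') by (unfold t', t1'; rewrite !comp_assoc; now rewrite sT2).
  assert (dd : d ∘ t1 = d ∘ t1').
  { rewrite <- (mek _ t1), <- (mek _ t1'). now rewrite e2. }
  destruct (pb_ex (pbi TQ) (a := t1) (b := t)) as [x [x0 x1]]; [auto |].
  destruct (pb_ex (pbi TQ) (a := t1') (b := t')) as [x' [x0' x1']]; [auto |].
  destruct (pb_ex (pbi NQ) (a := et ∘ t1) (b := t)) as [n [n0 n1]]; [now rewrite mek |].
  destruct (pb_ex (pbi NQ) (a := et ∘ t1') (b := t')) as [n' [n0' n1']]; [now rewrite mek |].
  rewrite !al0e. fold t t1 t' t1'.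
  assert (A1 : pp0 M ∘ (ka ∘ n) = sb W (et ∘ mul G t t1) (et ∘ t)).
  { rewrite (kae W x n); [rewrite ge; now rewrite x0, x1 | now rewrite x0 | now rewrite x1]. }
  assert (A2 : pp0 M ∘ (ka ∘ n') = sb W (et ∘ mul G t' t1') (et ∘ t')).
  { rewrite (kae W x' n'); [rewrite ge; now rewrite x0', x1' | now rewrite x0' | now rewrite x1']. }
  rewrite <- A1, <- A2.
  destruct (pb_ex (pbi TT) (a := t) (b := t')) as [tt [tt0 tt1]].
  { rewrite !pc. f_equal; congruence. }
  destruct (pb_ex (pbi P) (a := tt) (b := n)) as [y [y0 y1]]; [congruence |].
  assert (vn : v0 ∘ y = n').
  { apply (pb_uniq (pbi NQ)).
    - rewrite (ca v00), <- comp_assoc, y1. congruence.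
    - rewrite (ca v01), <- comp_assoc, y0. congruence. }
  rewrite <- vn, <- y1. transitivity (pp0 M ∘ ka ∘ pp1 P ∘ y); [now ra |].
  rewrite KK. now ra. }
destruct (regepi_desc (g := al0) rq2 desc) as [a ha].
assert (AE : forall W (t t' : W ~> T), c ∘ t = d ∘ t' ->
   a ∘ ⟪d ∘ t, et ∘ t'⟫ = sb W (et ∘ mul G t t') (et ∘ t)).
{ intros W t t' e. destruct (Q2 W t t' e) as [w [h [w0 w1]]].
  rewrite <- h, (ca ha), al0e. now rewrite w0, w1. }
(* every pair (x, n) is locally of the form (d t, eta t') *)
assert (LOC : forall W (x : W ~> U) (n : W ~> N), exists W' (k : W' ~> W) (t t' : W' ~> T),
  RegEpi k /\ c ∘ t = d ∘ t' /\ x ∘ k = d ∘ t /\ n ∘ k = et ∘ t').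
{ intros W x n. destruct (cover Rg ⟪x, n⟫ rq2) as [W' [k [w [rk e]]]].
  exists W', k, (pp0 T2 ∘ w), (pp1 T2 ∘ w). split; [exact rk |].
  unfold q2 in e. rewrite !pc in e.
  assert (e1 := f_equal (fun h => prl _ ∘ h) e). assert (e2 := f_equal (fun h => prr _ ∘ h) e).
  cbv beta in e1, e2. rewrite !pl in e1. rewrite !pr in e2.
  rewrite <- !comp_assoc in e1, e2.
  repeat split; auto. rewrite !comp_assoc. now rewrite sT2. }
assert (ma : forall W (x : W ~> U) (n : W ~> N), m ∘ (a ∘ ⟪x, n⟫) = x).
{ intros W x n. destruct (LOC W x n) as [W' [k [t [t' [rk [e [e1 e2]]]]]]].
  apply (regepi_epi rk). rewrite <- !comp_assoc, pc, e1, e2, AE by exact e.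
  unfold sb. rewrite (m_sub L je); auto; rewrite !mek; now rewrite dm. }
assert (a_id : forall W (n : W ~> N), a ∘ ⟪m ∘ n, n⟫ = n).
{ intros W n. destruct (cover Rg n ret) as [W' [k [t [rk e]]]].
  apply (regepi_epi rk). rewrite <- comp_assoc, pc, <- comp_assoc, <- e, mek.
  assert (R := AE W' (s ∘ (d ∘ t)) t).
  rewrite (ds G), (cs G) in R. rewrite R by reflexivity.
  rewrite mul1l. unfold sb. rewrite (ca ets). apply (sub_z L je); auto. }
assert (a_z : forall W (x y : W ~> U), a ∘ ⟪x, z ∘ y⟫ = z ∘ x).
{ intros W x y. destruct (arrow_cover x y) as [W' [k [t [rk [e1 e2]]]]].
  apply (regepi_epi rk). rewrite <- !comp_assoc, pc, <- comp_assoc, <- e1, <- e2.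
  rewrite <- (ca ets), AE by now rewrite (ds G).
  rewrite mul1r. unfold sb. rewrite sub_self. now rewrite mek. }
(* transport preserves zeros, so it is additive: it is a map of groupoids from
   U x N over U x U to N over U *)
pose (UU := prd L U U).
assert (GUN : exists GU : Gpd (⟪prl UN, m ∘ prr UN⟫) ⟪prl UN, m ∘ prr UN⟫ ⟪prl UU, z ∘ prr UU⟫,
  forall W (x y : W ~> UN), mul GU x y = ⟪prl UN ∘ x, mul GN (prr UN ∘ x) (prr UN ∘ y)⟫ ).
{ assert (es : forall W (x : W ~> UN), ⟪prl UN, m ∘ prr UN⟫ ∘ x = ⟪prl UN ∘ x, m ∘ (prr UN ∘ x)⟫).
  { intros. rewrite pc. now ra. }
  assert (esl : forall W (x y : W ~> UN), ⟪prl UN, m ∘ prr UN⟫ ∘ x = ⟪prl UN, m ∘ prr UN⟫ ∘ y ->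
    m ∘ (prr UN ∘ x) = m ∘ (prr UN ∘ y) /\ prl UN ∘ x = prl UN ∘ y).
  { intros W x y. rewrite !es. intros e. split.
    - apply (f_equal (fun h => prr _ ∘ h)) in e. now rewrite !pr in e.
    - apply (f_equal (fun h => prl _ ∘ h)) in e. now rewrite !pl in e. }
  unshelve eexists {| mul := fun W x y => ⟪prl UN ∘ x, mul GN (prr UN ∘ x) (prr UN ∘ y)⟫;
     inv := ⟪prl UN, inv GN ∘ prr UN⟫ |}; cbv beta.
  - intros W S x y u e. destruct (esl _ _ _ e). rewrite pc, mul_nat; auto. now ra.
  - rewrite es, pl, pr, (ca1 mz). apply pair_id.
  - rewrite es, pl, pr, (ca1 mz). apply pair_id.
  - intros W x. rewrite es, !pc, <- ?comp_assoc, ?pl, ?pr, mul1l. apply pair_eta.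
  - intros W x. rewrite es, !pc, <- ?comp_assoc, ?pl, ?pr, mul1r. apply pair_eta.
  - rewrite es, pl, pr, (ca (gdi GN)). reflexivity.
  - rewrite es, pl, pr, (ca (gci GN)). reflexivity.
  - intros W x. rewrite es, !pc, <- !comp_assoc, pl, !pr. f_equal. apply mulV.
  - intros W x. rewrite es, !pc, <- !comp_assoc, !pl, !pr. f_equal. apply mulVl.
  - reflexivity. }
destruct GUN as [GU HGU].
assert (aGm : m ∘ a = prl UU ∘ ⟪prl UN, m ∘ prr UN⟫).
{ rewrite pl. assert (R := ma _ (prl UN) (prr UN)).
  replace ⟪prl UN, prr UN⟫ with (id UN) in R; [now rewrite comp_idr in R |].
  apply pair_ext; apply comp_idr. }
assert (aGz : a ∘ ⟪prl UU, z ∘ prr UU⟫ = z ∘ prl UU) by apply a_z.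
assert (a_mul : forall W (x : W ~> U) (n1 n2 : W ~> N), m ∘ n1 = m ∘ n2 ->
  a ∘ ⟪x, mul GN n1 n2⟫ = mul GN (a ∘ ⟪x, n1⟫) (a ∘ ⟪x, n2⟫)).
{ intros W x n1 n2 e.
  rewrite <- (functor_mul L je GU GN aGm aGm aGz).
  - now rewrite HGU, pl, !pr.
  - rewrite !pc, <- !comp_assoc, !pl, !pr. now rewrite e. }
assert (a_inv : forall W (x : W ~> U) (n1 : W ~> N),
  a ∘ ⟪x, inv GN ∘ n1⟫ = inv GN ∘ (a ∘ ⟪x, n1⟫)).
{ intros W x n1. apply (inv_uniq L je).
  - now rewrite !ma.
  - rewrite <- a_mul, mulV, a_z, ma; [reflexivity |]. now rewrite (ca (gdi GN)). }
assert (a_sub : forall W (x : W ~> U) (n1 n2 : W ~> N), m ∘ n1 = m ∘ n2 ->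
  a ∘ ⟪x, sb W n1 n2⟫ = sb W (a ∘ ⟪x, n1⟫) (a ∘ ⟪x, n2⟫)).
{ intros W x n1 n2 e. unfold sb, sub. rewrite a_mul, a_inv; auto.
  now rewrite (ca (gdi GN)). }
assert (a_a : forall W (x y : W ~> U) (n : W ~> N), a ∘ ⟪y, a ∘ ⟪x, n⟫⟫ = a ∘ ⟪y, n⟫).
{ intros W x y n. destruct (LOC W x n) as [W1 [k1 [t [t' [rk1 [e [e1 e2]]]]]]].
  destruct (arrow_cover (y ∘ k1) (x ∘ k1)) as [W2 [k2 [t2 [rk2 [e3 e4]]]]].
  apply (regepi_epi rk1), (regepi_epi rk2). rewrite <- !comp_assoc, !pc, <- !comp_assoc, !pc.
  rewrite (comp_assoc x), (comp_assoc n), (comp_assoc y), e1, e2, <- e3, <- !comp_assoc.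
  set (u := t ∘ k2). set (u' := t' ∘ k2).
  assert (cu : c ∘ u = d ∘ u') by (unfold u, u'; now rewrite !comp_assoc, e).
  assert (cu2 : c ∘ t2 = d ∘ u) by (unfold u; now rewrite e4, e1, comp_assoc).
  rewrite (AE _ u u' cu), a_sub.
  - rewrite AE by now rewrite (dm _ u u' cu).
    rewrite (AE _ t2 u cu2).
    unfold sb. rewrite (sub_sub L je).
    + assert (R := AE _ (mul G t2 u) u'). rewrite (cm _ _ _ cu2), (dm _ _ _ cu2) in R.
      rewrite R by exact cu. unfold sb. now rewrite (mul_assoc L je G).
    + rewrite !mek, !dm; auto. now rewrite dm.
    + rewrite !mek, !dm; auto.
  - rewrite !mek. now apply dm. }
(* transport is an action of the indiscrete groupoid, so it defines an
   equivalence relation on N, with quotient V *)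
assert (ER : IsEquivRel (prr UN) a).
{ assert (AP : forall W (x : W ~> UN), a ∘ x = a ∘ ⟪prl UN ∘ x, prr UN ∘ x⟫).
  { intros. now rewrite pair_eta. }
  split; [| split; [| split]].
  - intros W u v e1 e2. apply prod_eq; [| exact e1].
    rewrite <- (ma _ (prl UN ∘ u) (prr UN ∘ u)), <- (ma _ (prl UN ∘ v) (prr UN ∘ v)).
    now rewrite !pair_eta, e2.
  - exists ⟪m, id N⟫. split; [apply pr |].
    assert (R := a_id _ (id N)). now rewrite comp_idr in R.
  - exists ⟪m ∘ prr UN, a⟫. split; [apply pr |].
    rewrite <- (a_id _ (prr UN)) at 2.
    rewrite <- (a_a _ (prl UN) (m ∘ prr UN) (prr UN)). do 2 f_equal.
    rewrite <- (comp_idr a) at 1. rewrite AP. do 2 f_equal; apply comp_idr.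
  - intros W u v e. exists ⟪prl UN ∘ v, prr UN ∘ u⟫. split; [apply pr |].
    rewrite (AP _ v), <- e, (AP _ u). symmetry. apply a_a. }
destruct (@eff_quot N UN N (prr UN) a (a ∘ ⟪m ∘ prr (prd L N N), prl (prd L N N)⟫) (prr (prd L N N)) ER)
  as [V [q [rq [qa qk]]]].
{ rewrite <- comp_assoc, pc, <- comp_assoc, pl, !pr.
  rewrite aGm, pl. now rewrite pair_id, comp_idr. }
{ intros W u v. rewrite <- comp_assoc, pc, <- comp_assoc, pl, !pr.
  intros e. exists ⟪m ∘ v, u⟫. split; [apply pr | exact e]. }
assert (q_a : forall W (x : W ~> U) (n : W ~> N), q ∘ (a ∘ ⟪x, n⟫) = q ∘ n).
{ intros. rewrite comp_assoc, <- qa, <- comp_assoc. now rewrite pr. }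
assert (q_k : forall W (n n' : W ~> N), q ∘ n = q ∘ n' -> n' = a ∘ ⟪m ∘ n', n⟫).
{ intros W n n' e. destruct (qk _ _ _ e) as [w [w0 w1]].
  assert (X : a ∘ ⟪prl UN ∘ w, n⟫ = n') by (rewrite <- w0, pair_eta; exact w1).
  rewrite <- X. now rewrite ma. }
pose (UV := prd L U V).
assert (ruq : RegEpi (⟪prl UN, q ∘ prr UN⟫ : UN ~> UV)).
{ destruct (cover Rg (prr UV) rq) as [W [k [n [rk e]]]].
  apply (regepi_local Rg (c := k) (a := ⟪prl UV ∘ k, n⟫) rk).
  rewrite pc, <- comp_assoc, pl, pr, e. symmetry. now apply pair_ext. }
destruct (regepi_desc (g := a) ruq) as [b hb].
{ intros W u v e. rewrite !pc, <- !comp_assoc in e.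
  assert (e1 := f_equal (fun h => prl _ ∘ h) e). assert (e2 := f_equal (fun h => prr _ ∘ h) e).
  cbv beta in e1, e2. rewrite !pl in e1. rewrite !pr in e2.
  rewrite <- (pair_eta u), <- (pair_eta v), e1.
  rewrite (q_k _ _ _ e2). now rewrite a_a. }
assert (b_q : forall W (x : W ~> U) (n : W ~> N), b ∘ ⟪x, q ∘ n⟫ = a ∘ ⟪x, n⟫).
{ intros. rewrite <- hb, <- comp_assoc, pc, <- comp_assoc. now rewrite pl, pr. }
assert (m_b : forall W (x : W ~> U) (v : W ~> V), m ∘ (b ∘ ⟪x, v⟫) = x).
{ intros W x v. destruct (cover Rg v rq) as [W' [k [n [rk e]]]].
  apply (regepi_epi rk). rewrite <- !comp_assoc, pc, <- e, b_q. apply ma. }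
assert (q_b : forall W (x : W ~> U) (v : W ~> V), q ∘ (b ∘ ⟪x, v⟫) = v).
{ intros W x v. destruct (cover Rg v rq) as [W' [k [n [rk e]]]].
  apply (regepi_epi rk). rewrite <- !comp_assoc, pc, <- e, b_q. apply q_a. }
assert (b_b : forall W (n : W ~> N), b ∘ ⟪m ∘ n, q ∘ n⟫ = n).
{ intros. rewrite b_q. apply a_id. }
assert (a_b : forall W (x y : W ~> U) v, a ∘ ⟪y, b ∘ ⟪x, v⟫⟫ = b ∘ ⟪y, v⟫).
{ intros. now rewrite <- b_q, q_b. }
destruct (regepi_desc (g := q ∘ z) gU) as [o ho].
{ intros W x y _. rewrite <- !comp_assoc, <- (a_z _ y x). symmetry. apply q_a. }
pose (tau := q ∘ et).
exists V, o, tau.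
assert (COM : Commutative V).
{ pose (V2 := prd L V V). pose (V3 := prd L V2 V). pose (UV3 := prd L U V3).
  pose (v1 := prl V2 ∘ prl V3). pose (v2 := prr V2 ∘ prl V3). pose (v3 := prr V3).
  pose (ph := fun W (x : W ~> U) (y : W ~> V3) =>
    mul GN (sb W (b ∘ ⟪x, v1 ∘ y⟫) (b ∘ ⟪x, v2 ∘ y⟫)) (b ∘ ⟪x, v3 ∘ y⟫)).
  assert (mb2 : forall W (x : W ~> U) (v w : W ~> V), m ∘ (b ∘ ⟪x, v⟫) = m ∘ (b ∘ ⟪x, w⟫)).
  { intros. now rewrite !m_b. }
  assert (phm : forall W (x : W ~> U) (y : W ~> V3), m ∘ sb W (b ∘ ⟪x, v1 ∘ y⟫) (b ∘ ⟪x, v2 ∘ y⟫)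
     = m ∘ (b ∘ ⟪x, v3 ∘ y⟫)).
  { intros. unfold sb. rewrite (m_sub L je); auto. }
  assert (ph_nat : forall W S (x : W ~> U) (y : W ~> V3) (u : S ~> W),
    ph W x y ∘ u = ph S (x ∘ u) (y ∘ u)).
  { intros. unfold ph. rewrite mul_nat by apply phm. unfold sb. rewrite sub_nat by apply mb2.
    rewrite <- !comp_assoc, !pc, <- !comp_assoc. reflexivity. }
  assert (ph_a : forall W (x x' : W ~> U) (y : W ~> V3), a ∘ ⟪x', ph W x y⟫ = ph W x' y).
  { intros. unfold ph. rewrite a_mul by apply phm. rewrite a_sub by apply mb2.
    now rewrite !a_b. }
  assert (rU3 : RegEpi (prr UV3)).
  { destruct (glob_cover V3 gU) as [W [k [u rk]]].
    apply (regepi_local Rg (c := k) (a := ⟪u, k⟫) rk). apply pr. }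
  destruct (regepi_desc (g := q ∘ ph UV3 (prl UV3) (prr UV3)) rU3) as [p hp].
  { intros W u v e. rewrite <- !comp_assoc, !ph_nat, e.
    rewrite <- (ph_a _ (prl UV3 ∘ v) (prl UV3 ∘ u)). apply q_a. }
  assert (pE : forall W (x : W ~> U) (y : W ~> V3), p ∘ y = q ∘ ph W x y).
  { intros W x y. rewrite <- (pr x y) at 1. rewrite (ca hp), <- comp_assoc, ph_nat.
    now rewrite pl, pr. }
  assert (vE : forall W (x y w : W ~> V),
    v1 ∘ pr_pair V3 (pr_pair V2 x y) w = x /\ v2 ∘ pr_pair V3 (pr_pair V2 x y) w = y /\
    v3 ∘ pr_pair V3 (pr_pair V2 x y) w = w).
  { intros. unfold v1, v2, v3. now rewrite <- !comp_assoc, !prl_pair, !prr_pair. }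
  constructor. refine {| mal_sq := V2; mal_cube := V3; mal_op := p |}; simpl; intros W x y.
  - destruct (vE _ x y y) as [h1 [h2 h3]].
    destruct (glob_cover W gU) as [W' [k [u rk]]]. apply (regepi_epi rk).
    rewrite <- comp_assoc, (pE _ u). unfold ph.
    rewrite !comp_assoc, h1, h2, h3. unfold sb, sub. rewrite (mulKV L je GN) by apply mb2.
    apply q_b.
  - destruct (vE _ x x y) as [h1 [h2 h3]].
    destruct (glob_cover W gU) as [W' [k [u rk]]]. apply (regepi_epi rk).
    rewrite <- comp_assoc, (pE _ u). unfold ph.
    rewrite !comp_assoc, h1, h2, h3. unfold sb. rewrite sub_self, m_b.
    rewrite <- (m_b _ u (y ∘ k)) at 1. rewrite mul1l. apply q_b. }
split; [exact COM |]. split; [unfold tau; rewrite <- comp_assoc, ets; now rewrite ho |].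
split.
{ destruct (cover Rg (b : UV ~> N) ret) as [W [k [t [rk e]]]].
  apply (regepi_local Rg (c := k) (a := t) rk).
  assert (bE : b = b ∘ ⟪prl UV, prr UV⟫).
  { rewrite <- (comp_idr b) at 1. f_equal. apply pair_ext; apply comp_idr. }
  unfold tau. rewrite pc, <- (mek _ t), <- comp_assoc, e, bE, <- comp_assoc, pc.
  rewrite m_b, q_b. now apply pair_eta. }
split.
- intros Q TQ M h mm zz GM pt pq pb sQ g h1 h2 h3 h4 W w w' e1 e2.
  pose (NQ := lx_pb L m h).
  destruct (UP Q TQ NQ M h mm zz GM pt pq pb sQ (pp0 NQ) (pp1 NQ) (pbi NQ) g h1 h2 h3 h4)
    as [g' [_ hg]].
  assert (dd : d ∘ (pt ∘ w) = d ∘ (pt ∘ w')).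
  { rewrite !(comp_assoc d), (pb_sq pb), <- !comp_assoc. now rewrite e1. }
  assert (ee : et ∘ (pt ∘ w) = et ∘ (pt ∘ w')).
  { unfold tau in e2. rewrite <- !(comp_assoc q) in e2.
    rewrite (q_k _ _ _ e2), mek, <- dd, <- (mek _ (pt ∘ w)). symmetry. apply a_id. }
  destruct (pb_ex (pbi NQ) (a := et ∘ (pt ∘ w)) (b := pq ∘ w)) as [n [n0 n1]].
  { rewrite mek, !comp_assoc. now rewrite (pb_sq pb). }
  rewrite <- (hg _ w n n0 n1). apply hg; congruence.
- intros X g o' [p] gs.
  destruct (mal_gpd L je p (o' ∘ bng L U)) as [GX [HX HXi]].
  set (UX := prd L U X) in *.
  assert (pid : is_pullback d (id U) (id T) d).
  { apply mk_pb; [now rewrite comp_idl, comp_idr | |].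
    - intros W x y e. exists x. rewrite comp_idl in *. auto.
    - intros W u v e _. now rewrite !comp_idl in e. }
  assert (pidN : is_pullback m (id U) (id N) m).
  { apply mk_pb; [now rewrite comp_idl, comp_idr | |].
    - intros W x y e. exists x. rewrite comp_idl in *. auto.
    - intros W u v e _. now rewrite !comp_idl in e. }
  destruct (UP U T N UX (id U) (prl UX) ⟪id U, o' ∘ bng L U⟫ GX (id T) d pid s (id N) m pidN ⟪d, g⟫)
    as [g' [mg hg]].
  { now rewrite comp_idl, comp_idr. }
  { apply (gds G). }
  { apply pl. }
  { rewrite pc, gs, (gds G). reflexivity. }
  assert (gE : forall W (t : W ~> T), g' ∘ (et ∘ t) = ⟪d ∘ t, g ∘ t⟫).
  { intros W t. rewrite <- pc. apply hg; [now rewrite !comp_idl | now rewrite mek]. }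
  assert (gz : g' ∘ z = ⟪id U, o' ∘ bng L U⟫).
  { rewrite <- ets, gE, (gds G), gs. reflexivity. }
  assert (mg' : prl UX ∘ g' = id U ∘ m) by now rewrite comp_idl.
  assert (gz' : g' ∘ z = ⟪id U, o' ∘ bng L U⟫ ∘ id U) by now rewrite comp_idr.
  set (O := fun W => o' ∘ bng L W).
  assert (OE : forall W S (x : W ~> S), O S ∘ x = O W).
  { intros. unfold O. rewrite <- comp_assoc. f_equal. apply one_eq. }
  assert (SUB : forall W (t t' : W ~> T), d ∘ t = d ∘ t' ->
    prr UX ∘ (g' ∘ sb W (et ∘ t) (et ∘ t')) = mal p (g ∘ t) (g ∘ t') (O W)).
  { intros W t t' e. unfold sb, sub.
    rewrite (functor_mul L je GN GX mg' mg' gz') by (rewrite (ca (gdi GN)), !mek; auto).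
    rewrite HX. rewrite (comp_assoc g' (inv GN)), (functor_inv L je GN GX mg' mg' gz').
    rewrite <- (comp_assoc (inv GX)), HXi, !gE, !pr, !pl.
    rewrite <- (comp_assoc o'). change (o' ∘ bng L U ∘ (d ∘ t)) with (O U ∘ (d ∘ t)).
    replace (o' ∘ (bng L U ∘ (d ∘ t))) with (O W) by (unfold O; f_equal; apply one_eq).
    replace (o' ∘ bng L U ∘ (d ∘ t')) with (O W) by (symmetry; apply OE).
    now rewrite <- (mal_assoc L je), mal_xyy. }
  assert (INV : forall W (x : W ~> U) (n : W ~> N),
    prr UX ∘ (g' ∘ (a ∘ ⟪x, n⟫)) = prr UX ∘ (g' ∘ n)).
  { intros W x n. destruct (LOC W x n) as [W' [k [t [t' [rk [e [e1 e2]]]]]]].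
    apply (regepi_epi rk). rewrite <- !comp_assoc, pc, e1, e2, AE by exact e.
    rewrite SUB by now apply dm.
    rewrite gE, pr, (mal_functor L je p G g e).
    rewrite (ca gs). replace (o' ∘ bng L U ∘ (c ∘ t)) with (O W') by (symmetry; apply OE).
    rewrite (mal_comm L je p (g ∘ t)). apply (mal_cancel L je). }
  destruct (regepi_desc (g := prr UX ∘ g') rq) as [f hf].
  { intros W u v e. rewrite (q_k _ _ _ e), <- !comp_assoc. symmetry. apply INV. }
  exists f. unfold tau. rewrite (ca hf), <- comp_assoc.
  rewrite <- (comp_idr et), gE, comp_idr, pr. apply comp_idr.
Qed.
End Groupoid.
End TR.

(** * Stable reflections into commutative objects *)

Section Refl.
Variables (E : Category) (K : Ctx E).
Notation Rg := (cx_reg K).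
Notation L := (rx_lex (cx_reg K)).
Notation je := (je_ctx K).
Notation "⟪ a , b ⟫" := (pr_pair (prd L _ _) a b).
Notation pl := (pl K).
Notation pr := (pr K).
Notation pc := (pc K).

(** A reflection into commutative objects which survives products with a
    parameter: whatever is identified in [Pb] is identified by every map to a
    commutative object, for each fixed value of the parameter. Sums of
    cohomology classes require the parameter. *)
Definition SRefl (P Pb : E) (ps : P ~> Pb) : Prop :=
  RegEpi ps /\ Commutative Pb /\
  forall (P' X : E) (g : prd L P P' ~> X), Commutative X ->
  forall W (u v : W ~> P) (w : W ~> P'), ps ∘ u = ps ∘ v -> g ∘ ⟪u, w⟫ = g ∘ ⟪v, w⟫.

Lemma srefl_fac (P Pb X : E) (ps : P ~> Pb) (g : P ~> X) : SRefl ps -> Commutative X ->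
  exists g' : Pb ~> X, g' ∘ ps = g.
Proof.
intros [r [_ H]] cX. apply (regepi_desc r). intros W u v e.
assert (Q := H (lx_one L) X (g ∘ prl _) cX W u v (bng L W) e).
now rewrite <- !comp_assoc, !pl in Q.
Qed.

(** The reflection U -> Ub of an object with the data from which it arises:
    the universal difference [or_de] of two points of U, with values in a
    commutative object [or_V] with zero [or_o], and the fact that it descends to
    Ub, where it vanishes on the diagonal only. *)
Record ORefl (U : E) := {
  or_V : E;
  or_o : lx_one L ~> or_V;
  or_de : prd L U U ~> or_V;
  or_U : E;
  or_ps : U ~> or_U;
  or_db : prd L or_U or_U ~> or_V;
  or_comV : Commutative or_V;
  or_refl : SRefl or_ps;
  or_dbe : forall T (x y : T ~> U), or_db ∘ ⟪or_ps ∘ x, or_ps ∘ y⟫ = or_de ∘ ⟪x, y⟫;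
  or_ker : forall T (x y : T ~> U),
    or_de ∘ ⟪x, y⟫ = or_o ∘ bng L T -> or_ps ∘ x = or_ps ∘ y;
  or_xx : forall T (x : T ~> U), or_de ∘ ⟪x, x⟫ = or_o ∘ bng L T;
  or_up : forall (Q X : E) (h : Q ~> U) (g : prd L U Q ~> X), Commutative X ->
    forall W (u v : W ~> U) (k : W ~> Q),
    or_de ∘ ⟪h ∘ k, u⟫ = or_de ∘ ⟪h ∘ k, v⟫ -> g ∘ ⟪u, k⟫ = g ∘ ⟪v, k⟫
}.

Lemma indiscrete (U : E) : exists G : Gpd (prl (prd L U U)) (prr (prd L U U)) ⟪id U, id U⟫,
  forall T (x y : T ~> prd L U U), mul G x y = ⟪prl _ ∘ x, prr _ ∘ y⟫.
Proof.
unshelve eexists {| mul := fun T x y => ⟪prl (prd L U U) ∘ x, prr (prd L U U) ∘ y⟫;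
  inv := ⟪prr (prd L U U), prl (prd L U U)⟫ |}; cbv beta; [intros .. |].
- rewrite pc. now ra.
- apply pl.
- apply pr.
- rewrite pc, comp_idl, pl. apply pair_eta.
- rewrite pc, comp_idl, pr. apply pair_eta.
- apply pl.
- apply pr.
- rewrite !pc, <- ?comp_assoc, pr, !comp_idl. reflexivity.
- rewrite !pc, <- ?comp_assoc, pl, !comp_idl. reflexivity.
- reflexivity.
Qed.

Lemma pair_inj (A B T : E) (a a' : T ~> A) (b b' : T ~> B) :
  ⟪a, b⟫ = ⟪a', b'⟫ -> a = a' /\ b = b'.
Proof.
intros e. split.
- apply (f_equal (fun h => prl _ ∘ h)) in e. now rewrite !pl in e.
- apply (f_equal (fun h => prr _ ∘ h)) in e. now rewrite !pr in e.
Qed.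

(** Applied to the indiscrete groupoid, [trivialize] gives differences of points
    with values in [V]. Points with difference zero have to be identified in a
    commutative object; the quotient by this relation is commutative, since [V]
    acts on it and x - y + z can be defined as the point at difference z - y
    from x. *)
Theorem orefl_exists (U : E) : RegEpi (bng L U) -> inhabited (ORefl U).
Proof.
intros gU.
destruct (indiscrete U) as [G HG].
assert (gT : RegEpi ⟪prl (prd L U U), prr (prd L U U)⟫).
{ rewrite (pair_id K). apply iso_regepi. exists (id _). split; apply comp_idl. }
destruct (trivialize G gU gT) as [V [o [de [cV [des [rde [UP _]]]]]]].
set (O := fun W => o ∘ bng L W).
assert (OE : forall W S (x : W ~> S), O S ∘ x = O W).
{ intros. unfold O. rewrite <- comp_assoc. f_equal. apply one_eq. }
assert (xx : forall T (x : T ~> U), de ∘ ⟪x, x⟫ = O T).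
{ intros T x. assert (Q := f_equal (fun h => h ∘ x) des). cbv beta in Q.
  rewrite <- comp_assoc, pc, comp_idl in Q. rewrite Q. apply OE. }
assert (up : forall (Q X : E) (h : Q ~> U) (g : prd L U Q ~> X), Commutative X ->
    forall W (u v : W ~> U) (k : W ~> Q),
    de ∘ ⟪h ∘ k, u⟫ = de ∘ ⟪h ∘ k, v⟫ -> g ∘ ⟪u, k⟫ = g ∘ ⟪v, k⟫).
{ intros Q X h g [p] W u v k e.
  destruct (mal_gpd L je p (g ∘ ⟪h, id Q⟫)) as [GM _].
  assert (pb : is_pullback (prl (prd L U U)) h ⟪h ∘ prr (prd L U Q), prl (prd L U Q)⟫ (prr (prd L U Q))).
  { apply mk_pb.
    - apply pl.
    - intros T a b e0. exists ⟪prr (prd L U U) ∘ a, b⟫. split; [| apply pr].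
      rewrite pc, <- comp_assoc, pl, pr, <- e0. apply pair_eta.
    - intros T a b e1 e2. apply prod_eq; [| exact e2].
      rewrite !pc in e1. apply (pair_inj e1). }
  assert (R := UP Q (prd L U Q) (prd L Q X) h (prl _) ⟪id Q, g ∘ ⟪h, id Q⟫⟫ GM
    _ _ pb ⟪h, id Q⟫ ⟪prr (prd L U Q), g⟫).
  lapply R; clear R; [intros R | now rewrite !pc, <- comp_assoc, pl, pr, comp_idl, comp_idr].
  lapply R; clear R; [intros R | apply pr].
  lapply R; clear R; [intros R | apply pl].
  lapply R; clear R; [intros R | now rewrite pc, pr].
  assert (R' := R W ⟪u, k⟫ ⟪v, k⟫). rewrite !pr in R'. specialize (R' eq_refl).
  rewrite !pc, <- !comp_assoc, !pl, !pr in R'. specialize (R' e).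
  apply (pair_inj R'). }
destruct cV as [p].
assert (co : forall T (x y z : T ~> U),
  de ∘ ⟪x, z⟫ = mal p (de ∘ ⟪x, y⟫) (O T) (de ∘ ⟪y, z⟫)).
{ intros T x y z.
  assert (e : prr (prd L U U) ∘ ⟪x, y⟫ = prl (prd L U U) ∘ ⟪y, z⟫) by (now rewrite pl, pr).
  assert (Q := mal_functor L je p G de e). rewrite HG in Q.
  rewrite pl, !pr, pc, !comp_idl, xx in Q. exact Q. }
assert (sy : forall T (x y : T ~> U), de ∘ ⟪x, y⟫ = O T -> de ∘ ⟪y, x⟫ = O T).
{ intros T x y e. assert (Q := co T x y x). rewrite xx, e, mal_xxy in Q. auto. }
assert (tr : forall T (x y z : T ~> U), de ∘ ⟪x, y⟫ = O T -> de ∘ ⟪x, z⟫ = de ∘ ⟪y, z⟫).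
{ intros T x y z e. now rewrite (co T x y z), e, mal_xxy. }
assert (tr' : forall T (x y z : T ~> U), de ∘ ⟪y, z⟫ = O T -> de ∘ ⟪x, z⟫ = de ∘ ⟪x, y⟫).
{ intros T x y z e. now rewrite (co T x y z), e, mal_xyy. }
destruct (equ_ex L de (O (prd L U U))) as [S [i [hi [il im]]]].
assert (SI : forall W (x y : W ~> U), de ∘ ⟪x, y⟫ = O W -> exists w : W ~> S, i ∘ w = ⟪x, y⟫).
{ intros W x y e. apply il. rewrite e. symmetry. apply OE. }
assert (Si : forall W (w : W ~> S), de ∘ ⟪prl (prd L U U) ∘ i ∘ w, prr (prd L U U) ∘ i ∘ w⟫ = O W).
{ intros W w. rewrite <- !comp_assoc, pair_eta, comp_assoc, hi, <- comp_assoc. apply OE. }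
destruct (@eff_quot E K U S V (prl (prd L U U) ∘ i) (prr (prd L U U) ∘ i) de (O (prd L U U))) as [Ub [ps [rps [ps01 kps]]]].
{ split; [| split; [| split]].
  - intros W u v e1 e2. apply im. apply prod_eq; now rewrite !comp_assoc.
  - destruct (SI U (id U) (id U) (xx _ _)) as [r hr]. exists r.
    rewrite <- !comp_assoc, hr. rewrite pl, pr. auto.
  - destruct (SI S (prr (prd L U U) ∘ i) (prl (prd L U U) ∘ i)) as [r hr].
    { apply sy. assert (Q := Si S (id S)). now rewrite !comp_idr in Q. }
    exists r. rewrite <- !comp_assoc, hr. rewrite pl, pr. auto.
  - intros W a b e. destruct (SI W (prl (prd L U U) ∘ i ∘ a) (prr (prd L U U) ∘ i ∘ b)) as [r hr].
    { rewrite (tr _ _ (prr (prd L U U) ∘ i ∘ a)); [| apply Si]. rewrite e. apply Si. }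
    exists r. rewrite <- (comp_assoc (prl (prd L U U))), <- (comp_assoc (prr (prd L U U)) i r), hr.
    rewrite pl, pr. auto. }
{ rewrite <- pc, pair_id, comp_idl. exact hi. }
{ intros W u v e. rewrite OE in e. destruct (SI W u v e) as [w hw]. exists w.
  rewrite <- !comp_assoc, hw. now rewrite pl, pr. }
assert (psk : forall W (u v : W ~> U), ps ∘ u = ps ∘ v -> de ∘ ⟪u, v⟫ = O W).
{ intros W u v e. destruct (kps W u v e) as [w [<- <-]]. apply Si. }
assert (psq : forall W (u v : W ~> U), de ∘ ⟪u, v⟫ = O W -> ps ∘ u = ps ∘ v).
{ intros W u v e. destruct (SI W u v e) as [w hw].
  transitivity (ps ∘ (prl (prd L U U) ∘ i) ∘ w).
  - now rewrite <- !comp_assoc, hw, pl.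
  - now rewrite ps01, <- !comp_assoc, hw, pr. }
(* V acts on the quotient: (x, v) is sent to the class of any point at difference
   v from x *)
destruct (regepi_desc (g := ps ∘ prr (prd L U U)) rde) as [wa hwa].
{ intros W u v e. rewrite !pc in e. destruct (pair_inj e) as [e1 e2].
  rewrite <- !comp_assoc. apply psq.
  rewrite <- (pair_eta u), <- (pair_eta v), e1 in e2.
  rewrite (co _ _ (prl (prd L U U) ∘ v)), <- e2, <- co. apply xx. }
assert (waE : forall W (x y : W ~> U), wa ∘ ⟪x, de ∘ ⟪x, y⟫⟫ = ps ∘ y).
{ intros W x y. assert (Q := f_equal (fun h => h ∘ ⟪x, y⟫) hwa). cbv beta in Q.
  rewrite <- !comp_assoc, pc in Q. rewrite pl, pr in Q. exact Q. }
assert (dloc : forall W (x : W ~> U) (v : W ~> V), exists W' (k : W' ~> W) (y : W' ~> U),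
  RegEpi k /\ de ∘ ⟪x ∘ k, y⟫ = v ∘ k).
{ intros W x v. destruct (cover Rg ⟪x, v⟫ rde) as [W' [k [w [rk e]]]].
  rewrite !pc in e. destruct (pair_inj e) as [e1 e2].
  exists W', k, (prr (prd L U U) ∘ w). split; [exact rk |].
  rewrite <- e1. now rewrite pair_eta. }
assert (waP : forall W (x x' : W ~> U) (v : W ~> V), ps ∘ x = ps ∘ x' ->
  wa ∘ ⟪x, v⟫ = wa ∘ ⟪x', v⟫).
{ intros W x x' v e. destruct (dloc W x v) as [W' [k [y [rk h]]]].
  apply (regepi_epi rk). rewrite <- !comp_assoc, !pc, <- h, waE.
  rewrite (tr _ (x ∘ k) (x' ∘ k)).
  - now rewrite waE.
  - apply psk. now rewrite !comp_assoc, e. }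
assert (ps_cov : forall W (x : W ~> Ub), exists W' (k : W' ~> W) (y : W' ~> U),
  RegEpi k /\ ps ∘ y = x ∘ k).
{ intros W x. destruct (cover Rg x rps) as [W' [k [y [rk h]]]]. now exists W', k, y. }
pose (U2 := prd L U U). pose (U3 := prd L U2 U).
pose (B2 := prd L Ub Ub). pose (B3 := prd L B2 Ub).
pose (p3 := pr_pair B3 (pr_pair B2 (ps ∘ (prl U2 ∘ prl U3)) (ps ∘ (prr U2 ∘ prl U3)))
   (ps ∘ prr U3) : U3 ~> B3).
assert (p3E : forall W (x y z : W ~> U), p3 ∘ pr_pair U3 (pr_pair U2 x y) z =
  pr_pair B3 (pr_pair B2 (ps ∘ x) (ps ∘ y)) (ps ∘ z)).
{ intros. unfold p3. rewrite !pr_pair_comp, <- !comp_assoc.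
  now rewrite ?prl_pair, ?prr_pair, ?prl_pair. }
assert (rp3 : RegEpi p3).
{ destruct (ps_cov _ (prl B2 ∘ prl B3)) as [W1 [k1 [x [r1 h1]]]].
  destruct (ps_cov _ (prr B2 ∘ prl B3 ∘ k1)) as [W2 [k2 [y [r2 h2]]]].
  destruct (ps_cov _ (prr B3 ∘ k1 ∘ k2)) as [W3 [k3 [z [r3 h3]]]].
  apply (regepi_local Rg (c := k1 ∘ k2 ∘ k3) (a := pr_pair U3 (pr_pair U2 (x ∘ k2 ∘ k3) (y ∘ k3)) z)).
  - apply (regepi_comp Rg); auto. apply (regepi_comp Rg); auto.
  - rewrite p3E. symmetry. apply pair_ext; [apply pair_ext |].
    + rewrite !comp_assoc, <- h1. now ra.
    + rewrite !comp_assoc, h2. now ra.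
    + rewrite h3. now ra. }
pose (mu := fun W (x y z : W ~> U) => wa ∘ ⟪x, de ∘ ⟪y, z⟫⟫).
assert (mu_nat : forall W S (x y z : W ~> U) (u : S ~> W),
  mu W x y z ∘ u = mu S (x ∘ u) (y ∘ u) (z ∘ u)).
{ intros. unfold mu. rewrite <- comp_assoc, pc, <- comp_assoc, pc. reflexivity. }
destruct (regepi_desc (g := mu U3 (prl U2 ∘ prl U3) (prr U2 ∘ prl U3) (prr U3)) rp3) as [q hq].
{ intros W u v e.
  assert (R : forall w : W ~> U3, w = pr_pair U3 (pr_pair U2 (prl U2 ∘ prl U3 ∘ w)
     (prr U2 ∘ prl U3 ∘ w)) (prr U3 ∘ w)).
  { intros w. apply pair_ext; [| reflexivity]. apply pair_ext; now rewrite comp_assoc. }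
  rewrite (R u), (R v), !p3E in e. rewrite !mu_nat.
  assert (e0 := f_equal (fun h => prr B3 ∘ h) e).
  assert (e1 := f_equal (fun h => prr B2 ∘ (prl B3 ∘ h)) e).
  assert (e2 := f_equal (fun h => prl B2 ∘ (prl B3 ∘ h)) e).
  cbv beta in e0, e1, e2.
  rewrite !prr_pair in e0. rewrite !prl_pair, !prr_pair in e1. rewrite !prl_pair in e2.
  unfold mu. rewrite (waP _ _ _ _ e2). do 2 f_equal.
  rewrite (tr _ _ _ _ (psk _ _ _ e1)). symmetry. apply tr', psk. auto. }
assert (qE : forall W (x y z : W ~> U),
  q ∘ pr_pair B3 (pr_pair B2 (ps ∘ x) (ps ∘ y)) (ps ∘ z) = mu W x y z).
{ intros. rewrite <- p3E, (ca hq), mu_nat, <- !comp_assoc.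
  now rewrite ?prl_pair, ?prr_pair, ?prl_pair. }
assert (cU : Commutative Ub).
{ constructor. refine {| mal_sq := B2; mal_cube := B3; mal_op := q |}; simpl; intros W x y.
  - destruct (ps_cov W x) as [W1 [k1 [x' [r1 h1]]]].
    destruct (ps_cov W1 (y ∘ k1)) as [W2 [k2 [y' [r2 h2]]]].
    apply (regepi_epi r1), (regepi_epi r2).
    rewrite <- !comp_assoc, !pr_pair_comp, (comp_assoc x), (comp_assoc y), <- h1, <- h2, <- comp_assoc, qE.
    unfold mu. rewrite (xx _ y'), <- (xx _ (x' ∘ k2)). apply waE.
  - destruct (ps_cov W x) as [W1 [k1 [x' [r1 h1]]]].
    destruct (ps_cov W1 (y ∘ k1)) as [W2 [k2 [y' [r2 h2]]]].
    apply (regepi_epi r1), (regepi_epi r2).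
    rewrite <- !comp_assoc, !pr_pair_comp, (comp_assoc x), (comp_assoc y), <- h1, <- h2, <- comp_assoc, qE.
    apply waE. }
pose (p2 := ⟪ps ∘ prl (prd L U U), ps ∘ prr (prd L U U)⟫ : (prd L U U) ~> B2).
assert (rp2 : RegEpi p2).
{ destruct (ps_cov _ (prl B2)) as [W1 [k1 [x [r1 h1]]]].
  destruct (ps_cov _ (prr B2 ∘ k1)) as [W2 [k2 [y [r2 h2]]]].
  apply (regepi_local Rg (c := k1 ∘ k2) (a := ⟪x ∘ k2, y⟫)); [now apply (regepi_comp Rg) |].
  unfold p2. rewrite pc, <- !comp_assoc. rewrite pl, pr.
  symmetry. apply pair_ext.
  - fold B2. now rewrite !comp_assoc, <- h1.
  - fold B2. now rewrite h2, comp_assoc. }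
destruct (regepi_desc (g := de) rp2) as [db hdb].
{ intros W u v e. unfold p2 in e. rewrite !pc, <- !comp_assoc in e.
  destruct (pair_inj e) as [e1 e2].
  rewrite <- (pair_eta u), <- (pair_eta v).
  rewrite (tr _ _ _ _ (psk _ _ _ e1)). symmetry. apply tr', psk. auto. }
constructor.
refine (@Build_ORefl U V o de Ub ps db (inhabits p) _ _ psq xx up).
- split; [exact rps |]. split; [exact cU |].
  intros P' X g cX W u v w e.
  pose (Q := prd L U P').
  assert (R := up Q X (prl Q) (g ∘ ⟪prl (prd L U Q), prr Q ∘ prr (prd L U Q)⟫) cX W u v ⟪u, w⟫).
  unfold Q in R. rewrite pl in R. rewrite (xx _ u), (psk _ _ _ e) in R. specialize (R eq_refl).
  rewrite <- !comp_assoc, !pc, <- !comp_assoc, !pl, !pr in R. exact R.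
- intros W x y. rewrite <- hdb, <- comp_assoc. f_equal. unfold p2.
  rewrite pc, <- !comp_assoc. now rewrite pl, pr.
Qed.

Section Groupoid.
Variables (U T I : E) (iI : is_initial I) (om : I ~> U) (R : ORefl U).
Variables (d c : T ~> U) (s : U ~> T) (G : Gpd d c s).
Hypothesis gU : RegEpi (bng L U).
Hypothesis gT : RegEpi ⟪d, c⟫.
Variable r : prd L U I ~> T.
Hypothesis dr : d ∘ r = om ∘ prr (prd L U I).
Hypothesis cr : c ∘ r = prl (prd L U I).
Notation ps := (or_ps R).

(** Let T be the arrows of a connected groupoid over U, V and [or_V] the values of
    the universal differences of arrows and of objects. The claim is that T is
    the pullback of V -> V_U along the difference map U x U -> V_U. It is a map of
    points over the source, so by protomodularity it suffices to compare both
    sides over a single point I of U, and there the choice [r] of an arrow from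
    that point to every object reduces the comparison to loops: sending an arrow
    to the loop it forms with the chosen arrow is a map of points over I, the
    zero sections being preserved because I is initial, and so it factors through
    [tau]. Consequently the same pullback formed
    from the reflected objects is a commutative reflection of T, and T is pulled
    back from it: no arrow between given objects is lost by reflecting. Two arrows
    with the same reflection differ by composition with arrows of trivial
    difference, which may be chosen to depend on the objects only. *)
Theorem grefl_exists :
  exists (Tb : E) (pt : T ~> Tb) (db cb : Tb ~> or_U R),
  SRefl pt /\ db ∘ pt = ps ∘ d /\ cb ∘ pt = ps ∘ c /\
  (forall W (x y : W ~> U) (t : W ~> Tb), db ∘ t = ps ∘ x -> cb ∘ t = ps ∘ y ->
    exists t' : W ~> T, d ∘ t' = x /\ c ∘ t' = y /\ pt ∘ t' = t) /\
  (forall W (t t' : W ~> T), d ∘ t = d ∘ t' -> c ∘ t = c ∘ t' -> pt ∘ t = pt ∘ t' -> t = t') /\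
  (forall W (x x' y y' : W ~> U), ps ∘ x = ps ∘ x' -> ps ∘ y = ps ∘ y' ->
    exists al be : W ~> T, d ∘ al = x' /\ c ∘ al = x /\ d ∘ be = y /\ c ∘ be = y' /\
    forall t t' : W ~> T, d ∘ t = x -> c ∘ t = y -> d ∘ t' = x' -> c ∘ t' = y' ->
      pt ∘ t = pt ∘ t' -> t' = mul G (mul G al t) be).
Proof.
destruct (trivialize G gU gT) as [V [o [tau [cV [taus [rtau [UP FAC]]]]]]].
set (de := or_de R).
assert (iU : forall X (f g : I ~> X), f = g) by (intros X; exact (@bang_uniq _ _ iI X)).
destruct (FAC (or_V R) (de ∘ ⟪d, c⟫) (or_o R) (or_comV R)) as [v hv].
{ rewrite <- comp_assoc, pc, (gds G), (gcs G). apply or_xx. }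
assert (hvE : forall W (t : W ~> T), v ∘ (tau ∘ t) = de ∘ ⟪d ∘ t, c ∘ t⟫).
{ intros. now rewrite (ca hv), <- comp_assoc, pc. }
set (O := fun W => o ∘ bng L W).
assert (OE : forall W S (x : W ~> S), O S ∘ x = O W).
{ intros. unfold O. rewrite <- comp_assoc. f_equal. apply one_eq. }
assert (tsE : forall W (x : W ~> U), tau ∘ (s ∘ x) = O W).
{ intros. rewrite (ca taus). unfold O. rewrite <- comp_assoc. f_equal. apply one_eq. }
destruct cV as [p].
assert (tauM : forall W (x y : W ~> T), c ∘ x = d ∘ y ->
  tau ∘ mul G x y = mal p (tau ∘ x) (O W) (tau ∘ y)).
{ intros W x y e. now rewrite (mal_functor L je p G tau e), tsE. }
assert (dm : forall W (x y : W ~> T), c ∘ x = d ∘ y -> d ∘ mul G x y = d ∘ x).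
{ intros W x y. apply (d_mul L je G). }
assert (cm : forall W (x y : W ~> T), c ∘ x = d ∘ y -> c ∘ mul G x y = c ∘ y).
{ intros W x y. apply (c_mul L je G). }
(* T is the pullback of V along the difference map: it suffices to check this
   after base change along I -> U *)
pose (TV := lx_pb L de v).
assert (sTV := pb_sq (pbi TV)).
destruct (pb_ex (pbi TV) (a := ⟪d, c⟫) (b := tau)) as [th [th0 th1]].
{ now rewrite hv. }
assert (Hth : IsIso th).
{ pose (CT := lx_pb L d om).
  pose (dW := prl (prd L U U) ∘ pp0 TV).
  assert (dth : dW ∘ th = d) by (unfold dW; now rewrite <- comp_assoc, th0, pl).
  pose (CW := lx_pb L dW om).
  assert (sCT := pb_sq (pbi CT)). assert (sCW := pb_sq (pbi CW)).
  destruct (pb_ex (pbi CW) (a := th ∘ pp0 CT) (b := pp1 CT)) as [th' [t0 t1]].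
  { now rewrite (ca dth). }
  assert (dsth : dW ∘ (th ∘ s) = id U) by (rewrite (ca dth); apply (gds G)).
  destruct (pb_ex (pbi CT) (a := s ∘ om) (b := id I)) as [sC [sC0 sC1]].
  { now rewrite (ca1 (gds G)), comp_idr. }
  assert (sC1' : pp1 CW ∘ (th' ∘ sC) = id I) by now rewrite (ca t1).
  pose (PT := mkpt (gds G)). pose (PW := mkpt dsth).
  pose (PCT := mkpt sC1). pose (PCW := mkpt sC1').
  pose (k := exist _ th (conj dth eq_refl) : PT ~> PW).
  pose (k' := exist _ th' (conj t1 eq_refl) : PCT ~> PCW).
  assert (B1 : IsBaseChange (P := PT) (P' := PCT) om (pp0 CT)).
  { split; [constructor; exact (pbi CT) | exact sC0]. }
  assert (B2 : IsBaseChange (P := PW) (P' := PCW) om (pp0 CW)).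
  { split; [constructor; exact (pbi CW) |]. simpl.
    now rewrite (ca t0), <- comp_assoc, sC0, comp_assoc. }
  assert (BM : IsBaseChangeMap (P := PT) (Q := PW) (P' := PCT) (Q' := PCW) (pp0 CT) (pp0 CW) k k').
  { exact t0. }
  assert (Ik' : IsIso th').
  {
    (* compare arrows out of the base point with r: rho is the loop
       t (r (c t))^-1 *)
    assert (rE : forall W (y : W ~> U) (w : W ~> I),
      d ∘ (r ∘ ⟪y, w⟫) = om ∘ w /\ c ∘ (r ∘ ⟪y, w⟫) = y).
    { intros. rewrite (ca dr), (ca cr), <- comp_assoc, pl, pr. auto. }
    pose (RR := fun W (t : W ~> CT) => r ∘ ⟪c ∘ (pp0 CT ∘ t), pp1 CT ∘ t⟫).
    assert (RRd : forall W (t : W ~> CT), d ∘ RR W t = d ∘ (pp0 CT ∘ t)).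
    { intros. unfold RR. rewrite (proj1 (rE _ _ _)), !comp_assoc. now rewrite sCT. }
    assert (RRc : forall W (t : W ~> CT), c ∘ RR W t = c ∘ (pp0 CT ∘ t)).
    { intros. unfold RR. apply rE. }
    assert (RRi : forall W (t : W ~> CT), c ∘ (pp0 CT ∘ t) = d ∘ (inv G ∘ RR W t)).
    { intros. rewrite (di G). now rewrite RRc. }
    pose (rho := fun W (t : W ~> CT) => mul G (pp0 CT ∘ t) (inv G ∘ RR W t)).
    assert (rho_nat : forall W S (t : W ~> CT) (u : S ~> W), rho W t ∘ u = rho S (t ∘ u)).
    { intros. unfold rho. rewrite mul_nat by apply RRi. unfold RR.
      rewrite <- !comp_assoc, pc, <- !comp_assoc. reflexivity. }
    assert (rho_d : forall W (t : W ~> CT), d ∘ rho W t = om ∘ (pp1 CT ∘ t)).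
    { intros. unfold rho. rewrite dm by apply RRi. rewrite !comp_assoc. now rewrite sCT. }
    assert (rho_c : forall W (t : W ~> CT), c ∘ rho W t = om ∘ (pp1 CT ∘ t)).
    { intros. unfold rho. rewrite cm by apply RRi. rewrite (ci G), RRd, !comp_assoc. now rewrite sCT. }
    assert (rho_t : forall W (t : W ~> CT), mul G (rho W t) (RR W t) = pp0 CT ∘ t).
    { intros. unfold rho. apply (mulKV L je G). now rewrite RRc. }
    (* rho is a map of points over I into the group of loops; over the initial
       object it preserves the zero sections for lack of alternatives *)
    destruct (equ_ex L d c) as [Lo [l [hl [ll lm]]]].
    destruct (ll U s) as [sl hsl]; [now rewrite (gds G), (gcs G) |].
    pose (LI := lx_pb L (d ∘ l) om).
    assert (sLI := pb_sq (pbi LI)).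
    destruct (pb_ex (pbi LI) (a := sl ∘ om) (b := id I)) as [zI [zI0 zI1]].
    { now rewrite <- comp_assoc, (ca hsl), (ca1 (gds G)), comp_idr. }
    assert (GL : inhabited (Gpd (d ∘ l) (d ∘ l) sl)).
    { pose (LL := lx_pb L (d ∘ l) (d ∘ l)). assert (sLL := pb_sq (pbi LL)).
      rewrite <- !comp_assoc in sLL.
      assert (hlE : forall W (x : W ~> Lo), c ∘ (l ∘ x) = d ∘ (l ∘ x)).
      { intros. now rewrite !comp_assoc, hl. }
      assert (e : c ∘ (l ∘ pp0 LL) = d ∘ (l ∘ pp1 LL)) by now rewrite hlE.
      destruct (ll _ (mul G (l ∘ pp0 LL) (l ∘ pp1 LL))) as [m hm].
      { rewrite dm, cm; auto. now rewrite hlE. }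
      destruct (ll _ (inv G ∘ l)) as [i hi].
      { now rewrite (di G), (ci G). }
      assert (dsl : d ∘ l ∘ sl = id U) by (rewrite <- comp_assoc, hsl; apply (gds G)).
      assert (di0 : d ∘ l ∘ i = d ∘ l) by (rewrite <- comp_assoc, hi, (di G); auto).
      assert (LM : forall W (w : W ~> LL), l ∘ (m ∘ w) = mul G (l ∘ (pp0 LL ∘ w)) (l ∘ (pp1 LL ∘ w))).
      { intros. rewrite (ca hm), mul_nat by exact e. now ra. }
      edestruct (gpd_of_map (s := sl) (pbi LL) (m := m) (i := i) dsl dsl di0 di0) as [g _];
        [.. | now constructor]; intros W w h; apply lm; rewrite LM, h.
      - rewrite (ca hsl), <- comp_assoc. apply mul1l.
      - rewrite (ca hsl), <- comp_assoc, <- hlE. apply mul1r.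
      - rewrite (ca hi), (ca hsl), <- !comp_assoc. apply mulV.
      - rewrite (ca hi), (ca hsl), <- !comp_assoc, <- hlE. apply mulVl. }
    destruct GL as [GL].
    destruct (gpd_bc L je GL (pbi LI) zI0 zI1) as [GI _].
    destruct (ll CT (rho CT (id CT))) as [rl hrl]; [now rewrite rho_d, rho_c |].
    destruct (pb_ex (pbi LI) (a := rl) (b := pp1 CT)) as [g [g0 g1]].
    { now rewrite <- comp_assoc, hrl, rho_d, comp_idr. }
    assert (gE : forall W (t : W ~> CT), l ∘ (pp0 LI ∘ (g ∘ t)) = rho W t).
    { intros. rewrite (ca g0), (ca hrl), rho_nat. now rewrite comp_idl. }
    assert (RU := UP I CT LI om (pp1 LI) zI GI (pp0 CT) (pp1 CT) (pbi CT) sC g sC0 sC1 g1 (iU _ _ _)).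
    assert (mono' : Mono th').
    { intros W t t' e.
      assert (e1 : pp1 CT ∘ t = pp1 CT ∘ t').
      { rewrite <- t1, <- !comp_assoc. now rewrite e. }
      assert (e0 : th ∘ (pp0 CT ∘ t) = th ∘ (pp0 CT ∘ t')).
      { rewrite !(comp_assoc th), <- t0, <- !comp_assoc. now rewrite e. }
      assert (e2 : tau ∘ (pp0 CT ∘ t) = tau ∘ (pp0 CT ∘ t')).
      { rewrite <- th1, <- !(comp_assoc (pp1 TV)). now rewrite e0. }
      assert (e3 : ⟪d, c⟫ ∘ (pp0 CT ∘ t) = ⟪d, c⟫ ∘ (pp0 CT ∘ t')).
      { rewrite <- th0, <- !(comp_assoc (pp0 TV)). now rewrite e0. }
      rewrite !pc in e3. destruct (pair_inj e3) as [_ e4].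
      assert (e5 := RU W t t' e1 e2).
      apply (pb_uniq (pbi CT)); [| exact e1].
      rewrite <- !rho_t, <- !gE, e5. unfold RR. now rewrite e4, e1. }
    assert (reg' : RegEpi th').
    {
      (* surjectivity: an arrow out of the base point with the difference w exists
         locally; correct its target with the help of r *)
      set (i := pp1 CW).
      set (y := prr (prd L U U) ∘ (pp0 TV ∘ pp0 CW)).
      set (w := pp1 TV ∘ pp0 CW).
      assert (yE : pp0 TV ∘ pp0 CW = ⟪om ∘ i, y⟫).
      { apply pair_ext; [| reflexivity]. rewrite comp_assoc. exact sCW. }
      assert (dw : de ∘ ⟪om ∘ i, y⟫ = v ∘ w).
      { unfold w. rewrite <- yE, !comp_assoc. now rewrite sTV. }
      destruct (cover Rg ⟪om ∘ i, w⟫ rtau) as [W [k0 [t [rk e]]]].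
      rewrite !pc in e. destruct (pair_inj e) as [e1 e2].
      destruct (pb_ex (pbi CT) (a := t) (b := i ∘ k0)) as [t2 [h0 h1]].
      { now rewrite e1, comp_assoc. }
      assert (Rd := proj1 (rE _ (y ∘ k0) (i ∘ k0))). assert (Rc := proj2 (rE _ (y ∘ k0) (i ∘ k0))).
      assert (cR : c ∘ rho W t2 = d ∘ (r ∘ ⟪y ∘ k0, i ∘ k0⟫)).
      { now rewrite Rd, rho_c, h1. }
      pose (t3 := mul G (rho W t2) (r ∘ ⟪y ∘ k0, i ∘ k0⟫)).
      assert (rr : tau ∘ (r ∘ ⟪y ∘ k0, i ∘ k0⟫) = tau ∘ RR W t2).
      { assert (Z := or_up (o := R) (h := om) (tau ∘ r) (inhabits p) (u := y ∘ k0) (v := c ∘ t) (k := i ∘ k0)).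
        rewrite <- !comp_assoc in Z. unfold RR. rewrite h0, h1. apply Z.
        fold de. transitivity (v ∘ (w ∘ k0)).
        - rewrite (comp_assoc v), <- dw, <- comp_assoc, pc, <- comp_assoc. reflexivity.
        - now rewrite <- e2, hvE, e1, comp_assoc. }
      destruct (pb_ex (pbi CT) (a := t3) (b := i ∘ k0)) as [t4 [f0 f1]].
      { unfold t3. rewrite dm by exact cR. now rewrite rho_d, h1. }
      apply (regepi_local Rg (c := k0) (a := t4) rk).
      apply (pb_uniq (pbi CW)).
      - rewrite (ca t0), <- comp_assoc, f0. apply (pb_uniq (pbi TV)).
        + rewrite (ca th0), (comp_assoc (pp0 TV)), yE, !pc. f_equal.
          * unfold t3. rewrite dm by exact cR. now rewrite rho_d, h1, comp_assoc.
          * unfold t3. rewrite cm by exact cR. exact Rc.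
        + rewrite (ca th1), comp_assoc. fold w. rewrite <- e2.
          unfold t3. rewrite tauM by exact cR. rewrite rr, <- tauM.
          * now rewrite rho_t, h0.
          * now rewrite RRd, h0, e1, rho_c, h1, comp_assoc.
      - rewrite (ca t1), f1. reflexivity. }
    exact (mono_regepi_iso mono' reg'). }
  destruct (cx_proto K B1 B2 BM) as [[ki hki] [e1 e2]].
  { destruct Ik' as [j [j1 j2]].
    unshelve eexists.
    - exists j. split; simpl.
      + rewrite <- t1, <- comp_assoc, j2. apply comp_idr.
      + now rewrite (ca1 j1).
    - split; apply sig_ext; assumption. }
  exists ki. split.
  - exact (f_equal (@proj1_sig _ _) e1).
  - exact (f_equal (@proj1_sig _ _) e2). }
destruct Hth as [thi [thi1 thi2]].
assert (TEX : forall W (x y : W ~> U) (w : W ~> V), de ∘ ⟪x, y⟫ = v ∘ w ->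
  exists t : W ~> T, d ∘ t = x /\ c ∘ t = y /\ tau ∘ t = w).
{ intros W x y w e. destruct (pb_ex (pbi TV) e) as [a [a0 a1]].
  exists (thi ∘ a).
  assert (h : ⟪d, c⟫ ∘ (thi ∘ a) = ⟪x, y⟫) by now rewrite <- th0, <- comp_assoc, (ca1 thi2).
  rewrite pc in h. destruct (pair_inj h) as [h1 h2]. repeat split; auto.
  now rewrite <- th1, <- comp_assoc, (ca1 thi2). }
assert (TUN : forall W (t t' : W ~> T), d ∘ t = d ∘ t' -> c ∘ t = c ∘ t' ->
  tau ∘ t = tau ∘ t' -> t = t').
{ intros W t t' e1 e2 e3. rewrite <- (ca1 thi1 t), <- (ca1 thi1 t'). f_equal.
  apply (pb_uniq (pbi TV)).
  - rewrite !(ca th0), !pc. congruence.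
  - now rewrite !(ca th1). }
pose (Tb := lx_pb L (or_db R) v).
assert (sTb := pb_sq (pbi Tb)).
destruct (pb_ex (pbi Tb) (a := ⟪ps ∘ d, ps ∘ c⟫) (b := tau)) as [pt [pt0 pt1]].
{ rewrite or_dbe. exact (eq_sym hv). }
pose (db := prl (prd L (or_U R) (or_U R)) ∘ pp0 Tb).
pose (cb := prr (prd L (or_U R) (or_U R)) ∘ pp0 Tb).
assert (dbE : db ∘ pt = ps ∘ d) by (unfold db; now rewrite <- comp_assoc, pt0, pl).
assert (cbE : cb ∘ pt = ps ∘ c) by (unfold cb; now rewrite <- comp_assoc, pt0, pr).
assert (tbE : forall W (t : W ~> Tb), pp0 Tb ∘ t = ⟪db ∘ t, cb ∘ t⟫).
{ intros. apply pair_ext; unfold db, cb; now ra. }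
assert (PULL : forall W (x y : W ~> U) (t : W ~> Tb), db ∘ t = ps ∘ x -> cb ∘ t = ps ∘ y ->
    exists t' : W ~> T, d ∘ t' = x /\ c ∘ t' = y /\ pt ∘ t' = t).
{ intros W x y t e1 e2. destruct (TEX W x y (pp1 Tb ∘ t)) as [t' [h1 [h2 h3]]].
  - unfold de. rewrite <- or_dbe, <- e1, <- e2, <- tbE.
    exact (eq_trans (comp_assoc _ _ _) (eq_trans (f_equal (fun h => h ∘ t) sTb)
      (eq_sym (comp_assoc _ _ _)))).
  - exists t'. repeat split; auto. apply (pb_uniq (pbi Tb)).
    + rewrite !tbE, (ca dbE), (ca cbE), <- !comp_assoc. congruence.
    + now rewrite (ca pt1). }
assert (UNI : forall W (t t' : W ~> T), d ∘ t = d ∘ t' -> c ∘ t = c ∘ t' -> pt ∘ t = pt ∘ t' -> t = t').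
{ intros W t t' e1 e2 e3. apply TUN; auto. rewrite <- pt1, <- !comp_assoc. congruence. }
destruct (or_refl R) as [rps [cUb SU]].
assert (rpt : RegEpi pt).
{ destruct (cover Rg db rps) as [W1 [k1 [x [r1 h1]]]].
  destruct (cover Rg (cb ∘ k1) rps) as [W2 [k2 [y [r2 h2]]]].
  destruct (PULL W2 (x ∘ k2) y (k1 ∘ k2)) as [t [_ [_ h]]].
  - now rewrite !comp_assoc, <- h1.
  - now rewrite h2, comp_assoc.
  - apply (regepi_local Rg (c := k1 ∘ k2) (a := t)); [now apply (regepi_comp Rg) | exact h]. }
assert (SIG : forall W (x x' : W ~> U), ps ∘ x = ps ∘ x' ->
   exists al : W ~> T, d ∘ al = x /\ c ∘ al = x' /\ tau ∘ al = O W).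
{ intros W x x' e. apply TEX. unfold de. rewrite <- or_dbe, e, or_dbe.
  transitivity (v ∘ (tau ∘ (s ∘ x'))).
  - now rewrite hvE, (ds G), (cs G).
  - now rewrite tsE. }
assert (KEY : forall W (x x' y y' : W ~> U) (al be : W ~> T),
  d ∘ al = x' -> c ∘ al = x -> tau ∘ al = O W -> d ∘ be = y -> c ∘ be = y' -> tau ∘ be = O W ->
  forall t t' : W ~> T, d ∘ t = x -> c ∘ t = y -> d ∘ t' = x' -> c ∘ t' = y' ->
      pt ∘ t = pt ∘ t' -> t' = mul G (mul G al t) be).
{ intros W x x' y y' al be a1 a2 a3 b1 b2 b3 t t' h1 h2 h3 h4 h5.
  assert (e1 : c ∘ al = d ∘ t) by congruence.
  assert (e2 : c ∘ mul G al t = d ∘ be) by (rewrite cm; congruence).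
  apply TUN.
  - rewrite !dm; congruence.
  - rewrite !cm; congruence.
  - rewrite !tauM, a3, b3, mal_xxy, mal_xyy by auto.
    rewrite <- pt1, <- !comp_assoc. congruence. }
exists Tb, pt, db, cb.
split; [split; [exact rpt | split] |].
- (* Tb is a finite limit of commutative objects *)
  assert (cUU : Commutative (prd L (or_U R) (or_U R))) by (apply commutative_prod; auto;
    intros A B; constructor; apply (prd L)).
  exact (comm_pb L je cUU (inhabits p) (or_comV R) (pbi Tb)).
- intros P' X g cX W t t' w e.
  destruct (gpd_times L P' G) as [GP HGP].
  destruct cX as [q].
  assert (e1 : ps ∘ (d ∘ t) = ps ∘ (d ∘ t')).
  { rewrite !(comp_assoc ps), <- dbE, <- !comp_assoc. now rewrite e. }
  assert (e2 : ps ∘ (c ∘ t) = ps ∘ (c ∘ t')).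
  { rewrite !(comp_assoc ps), <- cbE, <- !comp_assoc. now rewrite e. }
  destruct (SIG W _ _ (eq_sym e1)) as [al [a1 [a2 a3]]].
  destruct (SIG W _ _ e2) as [be [b1 [b2 b3]]].
  assert (E' := KEY W _ _ _ _ al be a1 a2 a3 b1 b2 b3 t t' eq_refl eq_refl eq_refl eq_refl e).
  assert (mult : forall x y : W ~> T, c ∘ x = d ∘ y -> g ∘ ⟪mul G x y, w⟫ =
    mal q (g ∘ ⟪x, w⟫) (g ∘ ⟪s ∘ (c ∘ x), w⟫) (g ∘ ⟪y, w⟫)).
  { intros x y exy.
    assert (h := mal_functor L je q GP g (x := ⟪x, w⟫) (y := ⟪y, w⟫)).
    rewrite HGP, !pc, <- !comp_assoc, !pl, !pr in h. apply h. now rewrite exy. }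
  assert (units : forall x x' : W ~> U, ps ∘ x = ps ∘ x' -> g ∘ ⟪s ∘ x, w⟫ = g ∘ ⟪s ∘ x', w⟫).
  { intros x x' h. assert (Q := SU P' X (g ∘ ⟪s ∘ prl (prd L U P'), prr (prd L U P')⟫) (inhabits q) W x x' w h).
    rewrite <- !comp_assoc, !pc, <- !comp_assoc, !pl, !pr in Q. exact Q. }
  assert (small : forall x : W ~> T, tau ∘ x = O W -> g ∘ ⟪x, w⟫ = g ∘ ⟪s ∘ (d ∘ x), w⟫).
  { intros x hx. pose (Q := prd L U P').
    pose (sQ := ⟪s ∘ prl (prd L U P'), prr (prd L U P')⟫).
    destruct (mal_gpd L je q (g ∘ sQ)) as [GM _].
    assert (pb : is_pullback d (prl (prd L U P')) (prl (prd L T P'))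
      ⟪d ∘ prl (prd L T P'), prr (prd L T P')⟫).
    { apply mk_pb.
      - now rewrite pl.
      - intros Z a b h. exists ⟪a, prr _ ∘ b⟫. split; [apply pl |].
        rewrite pc, <- comp_assoc, pl, pr, h. apply pair_eta.
      - intros Z a b h1 h2. apply prod_eq; [exact h1 |].
        rewrite !pc in h2. apply (pair_inj h2). }
    assert (Z := UP (prd L U P') (prd L T P') (prd L (prd L U P') X) (prl _) (prl _) _ GM _ _ pb sQ
      ⟪⟪d ∘ prl (prd L T P'), prr (prd L T P')⟫, g⟫).
    lapply Z; clear Z; [intros Z | unfold sQ; apply pl].
    lapply Z; clear Z; [intros Z |].
    2:{ unfold sQ. rewrite pc, <- comp_assoc, pl, pr, (ca1 (gds G)). apply pair_id. }
    lapply Z; clear Z; [intros Z | apply pl].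
    lapply Z; clear Z; [intros Z |].
    2:{ rewrite pc. f_equal. unfold sQ. rewrite pc, <- comp_assoc, pl, pr, (ca1 (gds G)). apply pair_id. }
    specialize (Z W ⟪x, w⟫ ⟪s ∘ (d ∘ x), w⟫).
    rewrite !pc, <- !comp_assoc, !pl, !pr, (ds G) in Z. specialize (Z eq_refl).
    rewrite hx, tsE in Z. specialize (Z eq_refl).
    apply (pair_inj Z). }
  rewrite E'.
  assert (c1 : c ∘ al = d ∘ t) by exact a2.
  assert (c2 : c ∘ mul G al t = d ∘ be) by (rewrite cm; auto).
  rewrite (mult _ _ c2), (mult _ _ c1), (cm _ _ _ c1), a2.
  rewrite (small _ a3), (small _ b3), a1, b1.
  now rewrite mal_xyy, (units _ _ (eq_sym e1)), mal_xxy.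
- split; [exact dbE |]. split; [exact cbE |]. split; [exact PULL |]. split; [exact UNI |].
  intros W x x' y y' e1 e2.
  destruct (SIG W x' x (eq_sym e1)) as [al [a1 [a2 a3]]].
  destruct (SIG W y y' e2) as [be [b1 [b2 b3]]].
  exists al, be. repeat split; auto. intros t t' h1 h2 h3 h4 h5.
  exact (KEY W x x' y y' al be a1 a2 a3 b1 b2 b3 t t' h1 h2 h3 h4 h5).
Qed.
End Groupoid.
End Refl.

(** * Parallel cells *)

Section Glob.
Variable C : Category.

Fixpoint omor (n : nat) : forall (X Y : nGrd C n), (X ~> Y) -> (obj0 X ~> obj0 Y) :=
  match n return forall (X Y : nGrd C n), (X ~> Y) -> (obj0 X ~> obj0 Y) with
  | O => fun X Y F => fmap cells F
  | S m => fun X Y F => @omor m (under X) (under Y) (umor F)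
  end.

Lemma gf0_comp (B : Category) (F : CatOver B) (b b' b'' : Total F)
  (x : FOb (GrdOver F) b) (x' : FOb (GrdOver F) b') (x'' : FOb (GrdOver F) b'')
  (G : FHom x' x'') (H : FHom x x') :
  gf0 (@fcomp _ (GrdOver F) _ _ _ x x' x'' G H) = @comp (Total F) _ _ _ (gf0 G) (gf0 H).
Proof. reflexivity. Qed.

Lemma umor_comp n (X Y Z : nGrd C (S n)) (G : Y ~> Z) (F : X ~> Y) :
  umor (G ∘ F) = umor G ∘ umor F.
Proof.
exact (@gf0_comp _ (st_over (stage C n)) (projT1 X) (projT1 Y) (projT1 Z)
  (projT2 X) (projT2 Y) (projT2 Z) G F).
Qed.

Lemma bd_nat n (X Y : nGrd C n) (F : X ~> Y) :
  bd Y ∘ fmap cells F = omor F ∘ bd X.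
Proof.
induction n as [| n IH].
- exact (eq_trans (comp_idl _) (eq_sym (comp_idr _))).
- rewrite !bd_S.
  refine (eq_trans (eq_sym (comp_assoc _ _ _)) _).
  refine (eq_trans (f_equal (fun h => bd (under Y) ∘ h) (dom_nat F)) _).
  refine (eq_trans (comp_assoc _ _ _) _).
  refine (eq_trans (f_equal (fun h => h ∘ dom X) (IH _ _ (umor F))) _).
  exact (eq_sym (comp_assoc _ _ _)).
Qed.

Lemma bc_nat n (X Y : nGrd C n) (F : X ~> Y) :
  bc Y ∘ fmap cells F = omor F ∘ bc X.
Proof.
induction n as [| n IH].
- exact (eq_trans (comp_idl _) (eq_sym (comp_idr _))).
- rewrite !bc_S.
  refine (eq_trans (eq_sym (comp_assoc _ _ _)) _).
  refine (eq_trans (f_equal (fun h => bc (under Y) ∘ h) (cod_nat F)) _).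
  refine (eq_trans (comp_assoc _ _ _) _).
  refine (eq_trans (f_equal (fun h => h ∘ cod X) (IH _ _ (umor F))) _).
  exact (eq_sym (comp_assoc _ _ _)).
Qed.

Lemma bs_nat n (X Y : nGrd C n) (F : X ~> Y) :
  fmap cells F ∘ bs X = bs Y ∘ omor F.
Proof.
induction n as [| n IH].
- exact (eq_trans (comp_idr _) (eq_sym (comp_idl _))).
- rewrite !bs_S.
  refine (eq_trans (comp_assoc _ _ _) _).
  refine (eq_trans (f_equal (fun h => h ∘ bs (under X)) (idc_nat F)) _).
  refine (eq_trans (eq_sym (comp_assoc _ _ _)) _).
  refine (eq_trans (f_equal (fun h => idc Y ∘ h) (IH _ _ (umor F))) _).
  exact (comp_assoc _ _ _).
Qed.

Lemma par_refl n (X : nGrd C n) T (u : T ~> cells X) : par u u.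
Proof. destruct n; [exact I | split; reflexivity]. Qed.

Definition IsPar (n : nat) (X : nGrd C n) (P : C) (p0 p1 : P ~> cells X) : Prop :=
  par p0 p1 /\
  (forall T (u v : T ~> cells X), par u v -> exists w : T ~> P, p0 ∘ w = u /\ p1 ∘ w = v) /\
  (forall T (w w' : T ~> P), p0 ∘ w = p0 ∘ w' -> p1 ∘ w = p1 ∘ w' -> w = w').

Section Lex.
Variable L : Lex C.

Lemma ispar_exists n (X : nGrd C n) :
  exists (P : C) (p0 p1 : P ~> cells X), IsPar p0 p1.
Proof.
destruct n as [| n].
- pose (P := prd L (cells X) (cells X)). exists P, (prl P), (prr P).
  split; [exact I |]. split.
  + intros T u v _. exists (pr_pair P u v). split; [apply prl_pair | apply prr_pair].
  + intros T w w'. apply prod_eq.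
- pose (D := prd L (cells (under X)) (cells (under X))).
  pose (P := lx_pb L (pr_pair D (dom X) (cod X)) (pr_pair D (dom X) (cod X))).
  assert (H : forall T (u v : T ~> cells X),
    pr_pair D (dom X) (cod X) ∘ u = pr_pair D (dom X) (cod X) ∘ v <-> par u v).
  { intros T u v. rewrite !pr_pair_comp. split.
    - intros e. split.
      + apply (f_equal (fun h => prl D ∘ h)) in e. now rewrite !prl_pair in e.
      + apply (f_equal (fun h => prr D ∘ h)) in e. now rewrite !prr_pair in e.
    - intros [-> ->]. reflexivity. }
  exists P, (pp0 P), (pp1 P). split; [apply H, (pb_sq (pbi P)) |]. split.
  + intros T u v h. apply (pb_ex (pbi P)). now apply H.
  + intros T w w'. apply (pb_uniq (pbi P)).
Qed.

Lemma isparallel_ispar n (X : nGrd C n) (P : C) (p0 p1 : P ~> cells X) :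
  IsParallel p0 p1 <-> IsPar p0 p1.
Proof.
revert X P p0 p1. induction n as [| n IH]; intros X P p0 p1.
- split.
  + intros [h]. split; [exact I |]. split.
    * intros T u v _. exists (pair h u v). split; [apply pair_l | apply pair_r].
    * apply (pair_uniq h).
  + intros [_ [h1 h2]]. constructor.
    unshelve refine {| pair := fun T a b => proj1_sig
      (constructive_indefinite_description _ (h1 T a b I)) |};
      intros; try (destruct constructive_indefinite_description; simpl; tauto).
    now apply h2.
- split.
  + intros [Q [q0 [q1 [c [hq [e0 [e1 [pb]]]]]]]].
    apply IH in hq. destruct hq as [a1 [a2 a3]].
    assert (sq := pb_sq pb). split; [| split].
    * split; rewrite <- ?e0, <- ?e1, <- !comp_assoc; now rewrite sq.
    * intros T u v [h1 h2]. apply (pb_ex pb).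
      apply a3; rewrite !comp_assoc, ?e0, ?e1; assumption.
    * apply (pb_uniq pb).
  + intros [a1 [a2 a3]].
    destruct (ispar_exists (under X)) as [Q [q0 [q1 hq]]].
    destruct (proj1 (proj2 hq) _ _ _ (par_dc X)) as [c [c0 c1]].
    exists Q, q0, q1, c. split; [now apply IH |]. split; [exact c0 |]. split; [exact c1 |].
    constructor. apply mk_pb; [| | exact a3].
    * destruct a1 as [h1 h2]. apply (proj2 (proj2 hq)); rewrite !comp_assoc, ?c0, ?c1; assumption.
    * intros T u v e. apply a2. split; rewrite <- ?c0, <- ?c1, <- !comp_assoc; now rewrite e.
Qed.

Section JE.
Variable je : JE C.

(** Boundaries and inverses of cells are compatible with composition along the
    objects for free, since every map of reflexive graphs is a functor. *)
Lemma dom_functor n (X : nGrd C (S (S n))) (G : Gpd (bd X) (bc X) (bs X))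
  (H : Gpd (bd (under X)) (bc (under X)) (bs (under X))) T (x y : T ~> cells X) :
  bc X ∘ x = bd X ∘ y ->
  dom X ∘ mul G x y = mul H (dom X ∘ x) (dom X ∘ y) /\
  cod X ∘ mul G x y = mul H (cod X ∘ x) (cod X ∘ y).
Proof.
destruct (par_b (par_dc X)) as [e1 e2].
intros e. split; apply (functor_mul L je G H (k := id _)); auto;
  rewrite ?bd_S, ?bc_S, ?bs_S, ?comp_idl, ?comp_idr; auto.
- exact (ca1 (dom_idc X) _).
- exact (ca1 (cod_idc X) _).
Qed.

Lemma dom_inv n (X : nGrd C (S (S n))) (G : Gpd (bd X) (bc X) (bs X))
  (H : Gpd (bd (under X)) (bc (under X)) (bs (under X))) :
  dom X ∘ inv G = inv H ∘ dom X /\ cod X ∘ inv G = inv H ∘ cod X.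
Proof.
destruct (par_b (par_dc X)) as [e1 e2].
split; apply (functor_inv L je G H (k := id _)); auto;
  rewrite ?bd_S, ?bc_S, ?bs_S, ?comp_idl, ?comp_idr; auto.
- exact (ca1 (dom_idc X) _).
- exact (ca1 (cod_idc X) _).
Qed.

Lemma par_mul n (X : nGrd C (S n)) (G : Gpd (bd X) (bc X) (bs X))
  T (x y x' y' : T ~> cells X) : bc X ∘ x = bd X ∘ y ->
  par x x' -> par y y' -> par (mul G x y) (mul G x' y').
Proof.
intros e px py.
assert (e' : bc X ∘ x' = bd X ∘ y').
{ destruct (par_b px), (par_b py). congruence. }
destruct n as [| n].
- destruct px as [a1 a2], py as [b1 b2].
  assert (D : dom X = bd X) by (rewrite bd_S; symmetry; apply comp_idl).
  assert (K : cod X = bc X) by (rewrite bc_S; symmetry; apply comp_idl).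
  split.
  + rewrite D. refine (eq_trans (d_mul L je G e) (eq_trans _ (eq_sym (d_mul L je G e')))).
    rewrite <- D. exact a1.
  + rewrite K. refine (eq_trans (c_mul L je G e) (eq_trans _ (eq_sym (c_mul L je G e')))).
    rewrite <- K. exact b2.
- destruct (extr (under X)) as [H].
  destruct (dom_functor G H e) as [h1 h2]. destruct (dom_functor G H e') as [h1' h2'].
  destruct px as [a1 a2], py as [b1 b2].
  split.
  + rewrite h1, h1'. now rewrite a1, b1.
  + rewrite h2, h2'. now rewrite a2, b2.
Qed.

Lemma par_inv n (X : nGrd C (S n)) (G : Gpd (bd X) (bc X) (bs X))
  T (x x' : T ~> cells X) : par x x' -> par (inv G ∘ x) (inv G ∘ x').
Proof.
intros px. destruct (par_b px) as [p1 p2].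
destruct n as [| n].
- assert (D : dom X = bd X) by (rewrite bd_S; symmetry; apply comp_idl).
  assert (K : cod X = bc X) by (rewrite bc_S; symmetry; apply comp_idl).
  split; [rewrite D | rewrite K].
  + exact (eq_trans (di G x) (eq_trans p2 (eq_sym (di G x')))).
  + exact (eq_trans (ci G x) (eq_trans p1 (eq_sym (ci G x')))).
- destruct (extr (under X)) as [H]. destruct (dom_inv G H) as [h1 h2].
  destruct px as [a1 a2].
  split; [rewrite !(comp_assoc (dom X)), h1 | rewrite !(comp_assoc (cod X)), h2];
    rewrite <- !comp_assoc; congruence.
Qed.

Lemma par_gpd n (X : nGrd C (S n)) (G : Gpd (bd X) (bc X) (bs X)) (P : C)
  (p0 p1 : P ~> cells X) : IsPar p0 p1 ->
  exists (s : obj0 X ~> P) (GP : Gpd (bd X ∘ p0) (bc X ∘ p0) s),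
    p0 ∘ s = bs X /\ p1 ∘ s = bs X /\
    forall T (x y : T ~> P), bc X ∘ (p0 ∘ x) = bd X ∘ (p0 ∘ y) ->
     p0 ∘ mul GP x y = mul G (p0 ∘ x) (p0 ∘ y) /\
     p1 ∘ mul GP x y = mul G (p1 ∘ x) (p1 ∘ y).
Proof.
intros [pp [ex un]].
assert (ppE : forall T (x : T ~> P), par (p0 ∘ x) (p1 ∘ x)) by (intros; now apply par_comp).
destruct (ex _ _ _ (par_refl (bs X))) as [s [s0 s1]].
pose (KP := lx_pb L (bc X ∘ p0) (bd X ∘ p0)).
assert (sK := pb_sq (pbi KP)). rewrite <- !comp_assoc in sK.
assert (sK1 : bc X ∘ (p1 ∘ pp0 KP) = bd X ∘ (p1 ∘ pp1 KP)).
{ destruct (par_b (ppE _ (pp0 KP))), (par_b (ppE _ (pp1 KP))). congruence. }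
destruct (ex _ _ _ (par_mul G sK (ppE _ (pp0 KP)) (ppE _ (pp1 KP)))) as [m [m0 m1]].
destruct (ex _ _ _ (par_inv G pp)) as [i [i0 i1]].
assert (M0 : forall T (w : T ~> KP), p0 ∘ (m ∘ w) = mul G (p0 ∘ (pp0 KP ∘ w)) (p0 ∘ (pp1 KP ∘ w))).
{ intros. rewrite (ca m0), mul_nat by exact sK. now ra. }
assert (M1 : forall T (w : T ~> KP), p1 ∘ (m ∘ w) = mul G (p1 ∘ (pp0 KP ∘ w)) (p1 ∘ (pp1 KP ∘ w))).
{ intros. rewrite (ca m1), mul_nat by exact sK1. now ra. }
assert (B : forall T (x : T ~> P), bd X ∘ (p0 ∘ x) = bd X ∘ (p1 ∘ x) /\
   bc X ∘ (p0 ∘ x) = bc X ∘ (p1 ∘ x)) by (intros; apply par_b, ppE).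
edestruct (gpd_of_map (s := s) (pbi KP) (m := m) (i := i)) as [GP HGP].
- rewrite <- comp_assoc, s0. apply (gds G).
- rewrite <- comp_assoc, s0. apply (gcs G).
- now rewrite <- comp_assoc, i0, (ca (gdi G)).
- now rewrite <- comp_assoc, i0, (ca (gci G)).
- intros T w h. apply un; [rewrite M0 | rewrite M1]; rewrite h.
  + rewrite (ca s0), <- comp_assoc. apply mul1l.
  + rewrite (ca s1), <- comp_assoc, (proj1 (B _ _)). apply mul1l.
- intros T w h. apply un; [rewrite M0 | rewrite M1]; rewrite h.
  + rewrite (ca s0), <- comp_assoc. apply mul1r.
  + rewrite (ca s1), <- comp_assoc, (proj2 (B _ _)). apply mul1r.
- intros T w h. apply un; [rewrite M0 | rewrite M1]; rewrite h.
  + rewrite (ca s0), (ca i0), <- !comp_assoc. apply mulV.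
  + rewrite (ca s1), (ca i1), <- !comp_assoc, (proj1 (B _ _)). apply mulV.
- intros T w h. apply un; [rewrite M0 | rewrite M1]; rewrite h.
  + rewrite (ca s0), (ca i0), <- !comp_assoc. apply mulVl.
  + rewrite (ca s1), (ca i1), <- !comp_assoc, (proj2 (B _ _)). apply mulVl.
- exists s, GP. split; [exact s0 |]. split; [exact s1 |].
  intros T x y e.
  destruct (pb_ex (pbi KP) (a := x) (b := y)) as [w [<- <-]]; [now rewrite <- !comp_assoc |].
  rewrite HGP. auto.
Qed.

(** Pairs of parallel cells form a groupoid on which [nu] is almost a functor
    ([mal_functor]); composition with cells is composition with equal pairs, where
    [nu] vanishes. For the direction of an n-groupoid this says that differences
    of parallel cells are invariant under composition. *)
Lemma whisker n (X : nGrd C (S n)) (G : Gpd (bd X) (bc X) (bs X)) (P A : C)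
  (p0 p1 : P ~> cells X) (nu : P ~> A) (z : lx_one L ~> A) :
  IsPar p0 p1 -> Commutative A ->
  (forall T (w : T ~> P), p0 ∘ w = p1 ∘ w -> nu ∘ w = z ∘ bng L T) ->
  forall T (a b : T ~> cells X) (w w' : T ~> P),
    bc X ∘ a = bd X ∘ (p0 ∘ w) -> bc X ∘ (p0 ∘ w) = bd X ∘ b ->
    p0 ∘ w' = mul G (mul G a (p0 ∘ w)) b -> p1 ∘ w' = mul G (mul G a (p1 ∘ w)) b ->
    nu ∘ w' = nu ∘ w.
Proof.
intros hP [p] hz T a b w w' e1 e2 h0 h1.
destruct (par_gpd G hP) as [s [GP [s0 [s1 HG]]]].
destruct hP as [pp [ex un]].
destruct (ex _ _ _ (par_refl a)) as [aa [a0 a1]].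
destruct (ex _ _ _ (par_refl b)) as [bb [b0 b1]].
assert (f1 : bc X ∘ (p0 ∘ aa) = bd X ∘ (p0 ∘ w)) by now rewrite a0.
destruct (HG _ _ _ f1) as [H0 H1].
assert (f2 : bc X ∘ (p0 ∘ mul GP aa w) = bd X ∘ (p0 ∘ bb)).
{ rewrite H0, (c_mul L je G), b0; auto. }
destruct (HG _ _ _ f2) as [K0 K1].
assert (w' = mul GP (mul GP aa w) bb) as ->.
{ apply un.
  - now rewrite K0, H0, a0, b0, h0.
  - now rewrite K1, H1, a1, b1, h1. }
assert (g1 : bc X ∘ p0 ∘ aa = bd X ∘ p0 ∘ w) by now rewrite <- !comp_assoc.
assert (g2 : bc X ∘ p0 ∘ mul GP aa w = bd X ∘ p0 ∘ bb) by now rewrite <- !comp_assoc.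
rewrite (mal_functor L je p GP nu g2), (mal_functor L je p GP nu g1).
rewrite (hz _ aa) by congruence. rewrite (hz _ bb) by congruence.
rewrite (hz _ (s ∘ (bc X ∘ p0 ∘ aa))) by (rewrite (ca s0), (ca s1); reflexivity).
rewrite (hz _ (s ∘ (bc X ∘ p0 ∘ mul GP aa w))) by (rewrite (ca s0), (ca s1); reflexivity).
now rewrite mal_xxy, mal_xyy.
Qed.

(** The composite is x - s (d y) + y. This makes higher groupoids in commutative
    objects mere reflexive globular objects. *)
Lemma comm_gpd (Z X : C) (d c : Z ~> X) (s : X ~> Z) : Commutative Z -> Commutative X ->
  d ∘ s = id X -> c ∘ s = id X -> inhabited (Gpd d c s).
Proof.
intros [p] [q] ds0 cs0.
pose (iv := mal p (s ∘ d) (id Z) (s ∘ c)).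
assert (ivE : forall T (x : T ~> Z), iv ∘ x = mal p (s ∘ (d ∘ x)) x (s ∘ (c ∘ x))).
{ intros. unfold iv. rewrite mal_nat, comp_idl. now ra. }
assert (diE : d ∘ iv = c).
{ unfold iv. rewrite (mal_map L je p q), (ca1 ds0), (ca1 ds0), comp_idr. apply mal_xxy. }
assert (ciE : c ∘ iv = d).
{ unfold iv. rewrite (mal_map L je p q), (ca1 cs0), (ca1 cs0), comp_idr. apply mal_xyy. }
constructor.
unshelve refine {| mul := fun T x y => mal p x (s ∘ (d ∘ y)) y; inv := iv |}; auto; cbv beta.
- intros. rewrite mal_nat. now ra.
- intros. apply mal_xxy.
- intros. rewrite (ca1 ds0). apply mal_xyy.
- intros. rewrite (ca diE), ivE, (mal_comm L je p (s ∘ (d ∘ x))), <- (mal_assoc L je).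
  now rewrite mal_xyy, mal_xxy.
- intros. rewrite ivE, (mal_comm L je p (s ∘ (d ∘ x))), (mal_assoc L je).
  now rewrite mal_xxy, mal_xyy.
Qed.
End JE.
End Lex.
End Glob.

(** * Asphericity and directions *)

Section Asph.
Variables (C : Category) (R : RegCtx C) (je : JE C).
Notation L := (rx_lex R).

Lemma par_epi n (X : nGrd C n) T S (u v : T ~> cells X) (k : S ~> T) :
  RegEpi k -> par (u ∘ k) (v ∘ k) -> par u v.
Proof.
intros hk. destruct n; [easy |]. intros [e1 e2].
split; apply (regepi_epi hk); now rewrite <- !comp_assoc.
Qed.

Lemma gsupp (X : C) : GlobalSupport X <-> RegEpi (bng L X).
Proof.
split.
- intros [T [t [[hT] ht]]].
  replace (bng L X) with (bng L T ∘ t) by apply one_eq.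
  apply regepi_iso_l; [exact ht |]. exists (bang hT (lx_one L)). split.
  + apply (bang_uniq hT).
  + apply one_eq.
- intros h. exists (lx_one L), (bng L X). split; [constructor; apply lx_term | exact h].
Qed.

(** Asphericity without reference to the objects of parallel cells: these depend
    on the category, whereas the local form can be transported. *)
Fixpoint AsphLocal (n : nat) : nGrd C n -> Prop :=
  match n return nGrd C n -> Prop with
  | O => fun X => RegEpi (bng L (cells X))
  | S m => fun X => @AsphLocal m (under X) /\
     forall T (u v : T ~> cells (under X)), par u v ->
       exists T' (k : T' ~> T) (w : T' ~> cells X),
         RegEpi k /\ dom X ∘ w = u ∘ k /\ cod X ∘ w = v ∘ k
  end.

Lemma asphl_core n (X : nGrd C (S n)) (Q : C) (q0 q1 : Q ~> cells (under X)) (c : cells X ~> Q) :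
  IsPar q0 q1 -> q0 ∘ c = dom X -> q1 ∘ c = cod X ->
  (RegEpi c <-> forall T (u v : T ~> cells (under X)), par u v ->
       exists T' (k : T' ~> T) (w : T' ~> cells X),
         RegEpi k /\ dom X ∘ w = u ∘ k /\ cod X ∘ w = v ∘ k).
Proof.
intros [pq [ex un]] c0 c1. split.
- intros rc T u v h. destruct (ex _ _ _ h) as [t [<- <-]].
  destruct (cover R t rc) as [T' [k [w [rk e]]]].
  exists T', k, w. split; [exact rk |].
  split; [rewrite <- c0 | rewrite <- c1]; now rewrite <- !comp_assoc, e.
- intros H. destruct (H _ _ _ pq) as [T' [k [w [rk [e0 e1]]]]].
  apply (regepi_local R (c := k) (a := w) rk).
  apply un; [rewrite <- e0, <- c0 | rewrite <- e1, <- c1]; apply comp_assoc.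
Qed.

Lemma aspherical_asphl n (X : nGrd C n) : Aspherical X <-> AsphLocal X.
Proof.
induction n as [| n IH]; [apply gsupp |].
split.
- intros [a [Q [c [[q0 [q1 [hq [c0 c1]]]] rc]]]]. split; [now apply IH |].
  apply (isparallel_ispar L) in hq. exact (proj1 (asphl_core hq c0 c1) rc).
- intros [a H]. split; [now apply IH |].
  destruct (ispar_exists L (under X)) as [Q [q0 [q1 hq]]].
  destruct (proj1 (proj2 hq) _ _ _ (par_dc X)) as [c [c0 c1]].
  exists Q, c. split.
  + exists q0, q1. split; [now apply (isparallel_ispar L) |]. auto.
  + exact (proj2 (asphl_core hq c0 c1) H).
Qed.

Lemma asphl_conn n (X : nGrd C (S n)) : AsphLocal X -> forall T (a b : T ~> obj0 X),
  exists T' (k : T' ~> T) (t : T' ~> cells X), RegEpi k /\ bd X ∘ t = a ∘ k /\ bc X ∘ t = b ∘ k.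
Proof.
induction n as [| n IH]; intros [hX H] T a b.
- destruct (H T a b I) as [T' [k [t [rk [e0 e1]]]]]. exists T', k, t. split; [exact rk |].
  split; [refine (eq_trans _ e0) | refine (eq_trans _ e1)].
  + exact (f_equal (fun h => h ∘ t) (comp_idl (dom X))).
  + exact (f_equal (fun h => h ∘ t) (comp_idl (cod X))).
- destruct (IH (under X) hX T a b) as [T' [k [t [rk [e0 e1]]]]].
  exists T', k, (idc X ∘ t). split; [exact rk |].
  rewrite bd_S, bc_S, <- !comp_assoc, (ca1 (dom_idc X)), (ca1 (cod_idc X)). auto.
Qed.

Lemma asphl_gs0 n (X : nGrd C n) : AsphLocal X -> RegEpi (bng L (obj0 X)).
Proof. induction n as [| n IH]; [easy |]. intros [h _]. exact (IH _ h). Qed.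

Lemma asphl_gs n (X : nGrd C n) : AsphLocal X -> RegEpi (bng L (cells X)).
Proof.
destruct n as [| n]; [easy |]. induction n as [| n IH].
- intros [h _]. apply (regepi_right R (f := idc X)).
  replace (bng L (cells X) ∘ idc X) with (bng L (cells (under X))) by apply one_eq. exact h.
- intros [h _]. apply (regepi_right R (f := idc X)).
  replace (bng L (cells X) ∘ idc X) with (bng L (cells (under X))) by apply one_eq. exact (IH _ h).
Qed.

Section Dir.
Variable A : AbGroup C.
Notation O T := (zero A ∘ to_one A T).

Lemma zeroE T S (u : S ~> T) : O T ∘ u = O S.
Proof. rewrite <- comp_assoc. f_equal. apply (bang_uniq (ab_one_term (ab_str A))). Qed.

Lemma plus_nat T S (a b : T ~> A) (u : S ~> T) : plus a b ∘ u = plus (a ∘ u) (b ∘ u).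
Proof. unfold plus, ab_plus. now rewrite <- comp_assoc, pr_pair_comp. Qed.

(** The direction of an n-groupoid as a relation: [N u v a] is to be read as
    v - u = a. A relation, unlike the map [a_nu], needs no chosen object of
    parallel cells and can be pulled back and pushed forward cell by cell. *)
Record Dir n (X : nGrd C n) := {
  N : forall T, (T ~> cells X) -> (T ~> cells X) -> (T ~> A) -> Prop;
  N_nat : forall T u v a S (w : S ~> T), N u v a -> N (u ∘ w) (v ∘ w) (a ∘ w);
  N_par : forall T (u v : T ~> cells X) a, N u v a -> par u v;
  N_ex : forall T (u v : T ~> cells X), par u v -> exists a, N u v a;
  N_fun : forall T (u v : T ~> cells X) a a', N u v a -> N u v a' -> a = a';
  N_refl : forall T (u : T ~> cells X), N u u (O T);
  N_inj : forall T (u v v' : T ~> cells X) a, N u v a -> N u v' a -> v = v';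
  N_inj' : forall T (u u' v : T ~> cells X) a, N u v a -> N u' v a -> u = u';
  N_lift : forall T (u : T ~> cells X) a, exists v, N u v a;
  N_lift' : forall T (v : T ~> cells X) a, exists u, N u v a
}.
Arguments N {n X} d {T} u v a.

Definition sub_of (n : nat) (X : AsphGrd A n) T (u v : T ~> cells (a_grd X)) (a : T ~> A) :=
  exists w, a_p0 X ∘ w = u /\ a_p1 X ∘ w = v /\ a_nu X ∘ w = a.

Lemma iso_lift (X P : C) (p : P ~> X) (nu : P ~> A) :
  (exists W : Product X A, IsIso (pr_pair W p nu)) <->
  (forall T (u : T ~> X) (a : T ~> A), exists w, p ∘ w = u /\ nu ∘ w = a) /\
  (forall T (w w' : T ~> P), p ∘ w = p ∘ w' -> nu ∘ w = nu ∘ w' -> w = w').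
Proof.
split.
- intros [W [g [h1 h2]]]. split.
  + intros T u a. exists (g ∘ pr_pair W u a).
    assert (E := ca1 h2 (pr_pair W u a)). rewrite pr_pair_comp in E. split.
    * apply (f_equal (fun h => prl W ∘ h)) in E. now rewrite !prl_pair in E.
    * apply (f_equal (fun h => prr W ∘ h)) in E. now rewrite !prr_pair in E.
  + intros T w w' e1 e2. rewrite <- (ca1 h1 w), <- (ca1 h1 w'), !pr_pair_comp. congruence.
- intros [ex un]. pose (W := prd L X A). exists W.
  destruct (ex W (prl W) (prr W)) as [g [g1 g2]]. exists g. split.
  + apply un.
    * rewrite (ca g1), prl_pair, comp_idr. reflexivity.
    * rewrite (ca g2), prr_pair, comp_idr. reflexivity.
  + rewrite pr_pair_comp, g1, g2. rewrite <- (comp_idr (prl W)), <- (comp_idr (prr W)).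
    apply pair_eta.
Qed.

Lemma dir_asph n (X : AsphGrd A n) :
  exists D : Dir (a_grd X), forall T u v a, N D (T := T) u v a <-> sub_of u v a.
Proof.
destruct (proj1 (isparallel_ispar L (a_p0 X) (a_p1 X)) (a_par_is X)) as [pp [ex un]].
destruct (proj1 (iso_lift _ _) (a_nu0 X)) as [l0 u0].
destruct (proj1 (iso_lift _ _) (a_nu1 X)) as [l1 u1].
destruct (a_push X) as [s [s0 [s1 [po]]]]. assert (sq := pb_sq po). simpl in sq.
unshelve eexists {| N := @sub_of n X |}; [.. | reflexivity].
- intros T u v a S w [t [<- [<- <-]]]. exists (t ∘ w). now rewrite !comp_assoc.
- intros T u v a [t [<- [<- <-]]]. now apply par_comp.
- intros T u v h. destruct (ex _ _ _ h) as [w [e0 e1]]. exists (a_nu X ∘ w). now exists w.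
- intros T u v a a' [t [e0 [e1 <-]]] [t' [e0' [e1' <-]]]. f_equal. apply un; congruence.
- intros T u. exists (s ∘ u). rewrite (ca s0), (ca s1), (ca sq), comp_idl, zeroE. auto.
- intros T u v v' a [t [e0 [<- e2]]] [t' [e0' [<- e2']]]. f_equal. apply u0; congruence.
- intros T u v v' a [t [<- [e1 e2]]] [t' [<- [e1' e2']]]. f_equal. apply u1; congruence.
- intros T u a. destruct (l0 T u a) as [w [e0 e1]]. exists (a_p1 X ∘ w), w. auto.
- intros T u a. destruct (l1 T u a) as [w [e0 e1]]. exists (a_p0 X ∘ w), w. auto.
Qed.

Lemma dir_local n (X : nGrd C n) (D : Dir X) T (u v : T ~> cells X) a S (k : S ~> T) :
  RegEpi k -> N D (u ∘ k) (v ∘ k) (a ∘ k) -> N D u v a.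
Proof.
intros rk h. destruct (N_ex D (u := u) (v := v)) as [b hb].
- exact (par_epi rk (N_par h)).
- replace a with b; [exact hb |]. apply (regepi_epi rk).
  exact (N_fun (N_nat k hb) h).
Qed.

(** Aspherical n-groupoids with direction, in local form; [to_ag] and [of_ag]
    translate to and from [AsphGrd]. *)
Record AG n := { ag_X : nGrd C n; ag_as : AsphLocal ag_X; ag_D : Dir ag_X }.

Record DirRep n (X : AG n) := {
  dr_P : C;
  dr_p0 : dr_P ~> cells (ag_X X);
  dr_p1 : dr_P ~> cells (ag_X X);
  dr_par : IsParallel dr_p0 dr_p1;
  dr_nu : dr_P ~> A;
  dr_epi : RegEpi dr_nu;
  dr_nu0 : exists W : Product (cells (ag_X X)) A, IsIso (pr_pair W dr_p0 dr_nu);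
  dr_nu1 : exists W : Product (cells (ag_X X)) A, IsIso (pr_pair W dr_p1 dr_nu);
  dr_push : exists s : cells (ag_X X) ~> dr_P, dr_p0 ∘ s = id _ /\ dr_p1 ∘ s = id _ /\
      IsPushout s (to_one A (cells (ag_X X))) dr_nu (zero A);
  dr_N : forall T u v a, N (ag_D X) (T := T) u v a <->
    exists w, dr_p0 ∘ w = u /\ dr_p1 ∘ w = v /\ dr_nu ∘ w = a
}.

(** The pushout condition is the only one with content. A map [g] on parallel
    pairs which is constant on equal pairs depends on the difference only: by
    [JE] on pairs (x, y) and a difference a, it suffices to know this for x = y and
    for a = 0. *)
Lemma asph_dir n (X : AG n) : inhabited (DirRep X).
Proof.
destruct X as [X as_ D]. simpl.
destruct (ispar_exists L X) as [P [p0 [p1 hP]]].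
destruct hP as [pp [ex un]].
destruct (N_ex D pp) as [nu hnu].
assert (NE : forall T u v a, N D (T := T) u v a <-> exists w, p0 ∘ w = u /\ p1 ∘ w = v /\ nu ∘ w = a).
{ intros T u v a. split.
  - intros h. destruct (ex _ _ _ (N_par h)) as [w [<- <-]]. exists w. repeat split.
    exact (N_fun (N_nat w hnu) h).
  - intros [w [<- [<- <-]]]. apply N_nat, hnu. }
assert (V0 : (forall T (u : T ~> cells X) (a : T ~> A), exists w, p0 ∘ w = u /\ nu ∘ w = a) /\
  (forall T (w w' : T ~> P), p0 ∘ w = p0 ∘ w' -> nu ∘ w = nu ∘ w' -> w = w')).
{ split.
  - intros T u a. destruct (N_lift D u a) as [v h]. apply NE in h. destruct h as [w [e0 [e1 e2]]].
    now exists w.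
  - intros T w w' e0 e1. apply un; [exact e0 |].
    apply (N_inj (d := D) (u := p0 ∘ w) (a := nu ∘ w)); apply NE; [now exists w | now exists w']. }
assert (V1 : (forall T (u : T ~> cells X) (a : T ~> A), exists w, p1 ∘ w = u /\ nu ∘ w = a) /\
  (forall T (w w' : T ~> P), p1 ∘ w = p1 ∘ w' -> nu ∘ w = nu ∘ w' -> w = w')).
{ split.
  - intros T u a. destruct (N_lift' D u a) as [v h]. apply NE in h. destruct h as [w [e0 [e1 e2]]].
    now exists w.
  - intros T w w' e0 e1. apply un; [| exact e0].
    apply (N_inj' (d := D) (v := p1 ∘ w) (a := nu ∘ w)); apply NE; [now exists w | now exists w']. }
assert (gs := asphl_gs as_).
assert (cov : forall T, exists T' (k : T' ~> T) (x : T' ~> cells X), RegEpi k).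
{ intros T. destruct (cover R (bng L T) gs) as [T' [k [x [rk _]]]]. now exists T', k, x. }
constructor.
unshelve refine {| dr_p0 := p0 : P ~> cells (ag_X {| ag_X := X; ag_as := as_; ag_D := D |});
  dr_p1 := p1; dr_nu := nu; dr_N := NE |};
  [now apply (isparallel_ispar L) | | now apply iso_lift | now apply iso_lift |].
- destruct (cov A) as [T [k [x rk]]]. destruct (proj1 V0 T x k) as [w [_ e]].
  exact (regepi_local R rk e).
- destruct (proj1 (NE _ _ _ _) (N_refl D (id (cells X)))) as [s [s0 [s1 s2]]].
  exists s. split; [exact s0 |]. split; [exact s1 |]. constructor.
  assert (KEY : forall T (g : P ~> T) (z : one A ~> T), g ∘ s = z ∘ to_one A (cells X) ->
    exists g' : A ~> T, g' ∘ nu = g /\ g' ∘ zero A = z).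
  { intros T g z e.
    destruct (proj1 V0 (prd L (cells X) A) (prl _) (prr _)) as [i [i0 i1]].
    assert (iE : forall S (x : S ~> cells X), i ∘ pr_pair _ x (O S) = s ∘ x).
    { intros S x. apply (proj2 V0).
      - rewrite (ca i0), prl_pair, (ca s0), comp_idl. reflexivity.
      - rewrite (ca i1), prr_pair, (ca s2), zeroE. reflexivity. }
    assert (J : forall S (x y : S ~> cells X) (a : S ~> A),
       g ∘ (i ∘ pr_pair _ x a) = g ∘ (i ∘ pr_pair _ y a)).
    { intros S x y a.
      pose (XX := prd L (cells X) (cells X)).
      assert (K := @je_fun C L je XX (prd L (cells X) A) (cells X) T (prl XX) (prl (prd L (cells X) A))
        (pr_pair XX (id _) (id _)) (pr_pair _ (id _) (O _))
        (fun S u v => g ∘ (i ∘ pr_pair (prd L (cells X) A) (prr XX ∘ u) (prr _ ∘ v)))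
        (fun S u v => g ∘ (i ∘ pr_pair (prd L (cells X) A) (prl XX ∘ u) (prr _ ∘ v)))).
      lapply K; clear K; [intros K | apply prl_pair].
      lapply K; clear K; [intros K | apply prl_pair].
      lapply K; clear K; [intros K | intros; now rewrite <- !comp_assoc, pr_pair_comp, <- !comp_assoc].
      lapply K; clear K; [intros K | intros; now rewrite <- !comp_assoc, pr_pair_comp, <- !comp_assoc].
      lapply K; clear K; [intros K |].
      2:{ rewrite !(comp_assoc (prr _)), prr_pair, zeroE, !iE, !(ca e), <- !comp_assoc.
          f_equal. apply (bang_uniq (ab_one_term (ab_str A))). }
      lapply K; clear K; [intros K |].
      2:{ now rewrite !comp_assoc, prl_pair, prr_pair. }
      specialize (K S (pr_pair XX y x) (pr_pair _ y a)).
      rewrite !prl_pair, !prr_pair in K. apply K. reflexivity. }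
    assert (iN : forall S (w : S ~> P), i ∘ pr_pair _ (p0 ∘ w) (nu ∘ w) = w).
    { intros S w. apply (proj2 V0).
      - now rewrite (ca i0), prl_pair.
      - now rewrite (ca i1), prr_pair. }
    assert (rnu : RegEpi nu).
    { destruct (cov A) as [T1 [k [x rk]]]. destruct (proj1 V0 T1 x k) as [w [_ e1]].
      exact (regepi_local R rk e1). }
    destruct (regepi_desc (g := g) rnu) as [g' hg].
    { intros S w w' e1. rewrite <- (iN S w), <- (iN S w'), e1. apply J. }
    exists g'. split; [exact hg |].
    (* the map to the terminal object is an epimorphism by global support *)
    assert (r1 : RegEpi (to_one A (cells X))).
    { replace (to_one A (cells X)) with (bang (ab_one_term (ab_str A)) (lx_one L) ∘ bng L (cells X))
        by apply (bang_uniq (ab_one_term (ab_str A))).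
      apply regepi_iso_l; [exact gs |].
      exists (bng L _). split; [apply one_eq | apply (bang_uniq (ab_one_term (ab_str A)))]. }
    apply (regepi_epi r1). rewrite <- e, <- hg, <- !comp_assoc. f_equal.
    rewrite s2. reflexivity. }
  apply (@mk_pb (op C)).
  + exact s2.
  + intros T g z e. destruct (KEY T g z e) as [g' [h1 h2]]. now exists g'.
  + intros T u v e _. simpl in e.
    destruct (cov A) as [T1 [k [x rk]]]. destruct (proj1 V0 T1 x k) as [w [_ e1]].
    exact (regepi_epi (regepi_local R rk e1) e).
Qed.

Definition of_ag n (X : AG n) : AsphGrd A n :=
  let d := choice_of (asph_dir X) in
  Build_AsphGrd (proj2 (aspherical_asphl (ag_X X)) (ag_as X))
    (dr_par d) (dr_epi d) (dr_nu0 d) (dr_nu1 d) (dr_push d).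

Definition to_ag n (X : AsphGrd A n) : AG n :=
  {| ag_X := a_grd X; ag_as := proj1 (aspherical_asphl (a_grd X)) (a_asph X);
     ag_D := proj1_sig (constructive_indefinite_description _ (dir_asph X)) |}.

Lemma to_agE n (X : AsphGrd A n) T u v a : N (ag_D (to_ag X)) (T := T) u v a <-> sub_of u v a.
Proof.
unfold to_ag. simpl. destruct constructive_indefinite_description as [D h]. exact (h T u v a).
Qed.

Lemma of_agE n (X : AG n) T (u v : T ~> cells (ag_X X)) a :
  N (ag_D (to_ag (of_ag X))) (T := T) u v a <-> N (ag_D X) u v a.
Proof.
rewrite (to_agE (X := of_ag X) u v a). unfold sub_of, of_ag. simpl.
symmetry. apply (dr_N (choice_of (asph_dir X))).
Qed.

Definition agmor n (X Z : AG n) : Prop :=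
  exists F : ag_X X ~> ag_X Z, forall T (u v : T ~> cells (ag_X X)) a,
    N (ag_D X) u v a -> N (ag_D Z) (fmap cells F ∘ u) (fmap cells F ∘ v) a.

Definition agsum n (X X' Z : AG n) : Prop :=
  exists (Q : Product (ag_X X) (ag_X X')) (F : prod_ob Q ~> ag_X Z),
    forall T (u v : T ~> cells (prod_ob Q)) a a', par u v ->
    N (ag_D X) (fmap cells (prl Q) ∘ u) (fmap cells (prl Q) ∘ v) a ->
    N (ag_D X') (fmap cells (prr Q) ∘ u) (fmap cells (prr Q) ∘ v) a' ->
    N (ag_D Z) (fmap cells F ∘ u) (fmap cells F ∘ v) (plus a a').

Lemma asph_mor_ag n (X Z : AsphGrd A n) : asph_mor X Z <-> agmor (to_ag X) (to_ag Z).
Proof.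
split.
- intros [F [f [[f0 f1] fn]]]. exists F. intros T u v a h.
  apply to_agE in h. destruct h as [w [<- [<- <-]]].
  apply (to_agE (X := Z)). exists (f ∘ w).
  split; [| split].
  + exact (eq_trans (comp_assoc _ _ _) (eq_trans (f_equal (fun h => h ∘ w) f0) (eq_sym (comp_assoc _ _ _)))).
  + exact (eq_trans (comp_assoc _ _ _) (eq_trans (f_equal (fun h => h ∘ w) f1) (eq_sym (comp_assoc _ _ _)))).
  + exact (ca fn w).
- intros [F H]. exists F.
  assert (h : sub_of (X := X) (a_p0 X) (a_p1 X) (a_nu X)).
  { exists (id _). now rewrite !comp_idr. }
  apply to_agE in h. apply H, to_agE in h. destruct h as [f [f0 [f1 fn]]].
  exists f. split; [now split | exact fn].
Qed.

Lemma asph_sum_ag n (X X' Z : AsphGrd A n) :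
  asph_sum X X' Z <-> agsum (to_ag X) (to_ag X') (to_ag Z).
Proof.
split.
- intros [Q [F [P [p0 [p1 [f [g [g' [hP [[f0 f1] [[g0 g1] [[h0 h1] fn]]]]]]]]]]]].
  exists Q, F. intros T u v a a' pp n1 n2.
  apply (isparallel_ispar L) in hP. destruct hP as [pP [ex un]].
  destruct (ex _ _ _ pp) as [w [<- <-]].
  assert (m1 : sub_of (X := X) (fmap cells (prl Q) ∘ (p0 ∘ w)) (fmap cells (prl Q) ∘ (p1 ∘ w)) (a_nu X ∘ (g ∘ w))).
  { exists (g ∘ w). now rewrite (ca g0), (ca g1), <- !comp_assoc. }
  assert (m2 : sub_of (X := X') (fmap cells (prr Q) ∘ (p0 ∘ w)) (fmap cells (prr Q) ∘ (p1 ∘ w)) (a_nu X' ∘ (g' ∘ w))).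
  { exists (g' ∘ w). now rewrite (ca h0), (ca h1), <- !comp_assoc. }
  apply to_agE in m1, m2.
  rewrite (N_fun n1 m1), (N_fun n2 m2). apply (to_agE (X := Z)).
  exists (f ∘ w). split; [| split].
  + exact (eq_trans (comp_assoc _ _ _) (eq_trans (f_equal (fun h => h ∘ w) f0) (eq_sym (comp_assoc _ _ _)))).
  + exact (eq_trans (comp_assoc _ _ _) (eq_trans (f_equal (fun h => h ∘ w) f1) (eq_sym (comp_assoc _ _ _)))).
  + now rewrite (ca fn), plus_nat, <- !comp_assoc.
- intros [Q [F H]]. exists Q, F.
  destruct (ispar_exists L (prod_ob Q)) as [P [p0 [p1 hP]]].
  assert (pp := proj1 hP).
  destruct (N_ex (ag_D (to_ag X)) (par_mor (prl Q) pp)) as [a na].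
  destruct (N_ex (ag_D (to_ag X')) (par_mor (prr Q) pp)) as [a' na'].
  assert (nb := H _ _ _ _ _ pp na na').
  apply to_agE in na, na', nb.
  destruct na as [g [g0 [g1 gn]]], na' as [g' [h0 [h1 hn]]], nb as [f [f0 [f1 fn]]].
  exists P, p0, p1, f, g, g'. split; [now apply (isparallel_ispar L) |].
  split; [now split |]. split; [now split |]. split; [now split |].
  rewrite gn, hn. exact fn.
Qed.
End Dir.
End Asph.

(** * Towers of functors *)

Section Towers.
Variables (C : Category) (L : Lex C) (je : JE C).

(** Restrictions and products of groupoids at once: arrows of [Z] are pairs of
    arrows of the two groupoids lying over the same pair of objects of [U]. *)
Lemma gpd_joint (Z U Z1 U1 Z2 U2 : C) (d c : Z ~> U) (s : U ~> Z)
  (d1 c1 : Z1 ~> U1) (s1 : U1 ~> Z1) (G1 : Gpd d1 c1 s1)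
  (d2 c2 : Z2 ~> U2) (s2 : U2 ~> Z2) (G2 : Gpd d2 c2 s2)
  (g1 : Z ~> Z1) (k1 : U ~> U1) (g2 : Z ~> Z2) (k2 : U ~> U2) :
  d1 ∘ g1 = k1 ∘ d -> c1 ∘ g1 = k1 ∘ c -> d2 ∘ g2 = k2 ∘ d -> c2 ∘ g2 = k2 ∘ c ->
  (forall T (x1 : T ~> Z1) (x2 : T ~> Z2) (a b : T ~> U),
     d1 ∘ x1 = k1 ∘ a -> c1 ∘ x1 = k1 ∘ b -> d2 ∘ x2 = k2 ∘ a -> c2 ∘ x2 = k2 ∘ b ->
     exists z, g1 ∘ z = x1 /\ g2 ∘ z = x2 /\ d ∘ z = a /\ c ∘ z = b) ->
  (forall T (z z' : T ~> Z), g1 ∘ z = g1 ∘ z' -> g2 ∘ z = g2 ∘ z' ->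
     d ∘ z = d ∘ z' -> c ∘ z = c ∘ z' -> z = z') ->
  d ∘ s = id U -> c ∘ s = id U -> g1 ∘ s = s1 ∘ k1 -> g2 ∘ s = s2 ∘ k2 ->
  inhabited (Gpd d c s).
Proof.
intros hd1 hc1 hd2 hc2 ex un ds0 cs0 hs1 hs2.
pose (P := lx_pb L c d).
assert (sq := pb_sq (pbi P)).
assert (e1 : c1 ∘ (g1 ∘ pp0 P) = d1 ∘ (g1 ∘ pp1 P)).
{ rewrite (ca hc1), (ca hd1), <- !comp_assoc. now rewrite sq. }
assert (e2 : c2 ∘ (g2 ∘ pp0 P) = d2 ∘ (g2 ∘ pp1 P)).
{ rewrite (ca hc2), (ca hd2), <- !comp_assoc. now rewrite sq. }
destruct (ex _ (mul G1 (g1 ∘ pp0 P) (g1 ∘ pp1 P)) (mul G2 (g2 ∘ pp0 P) (g2 ∘ pp1 P))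
  (d ∘ pp0 P) (c ∘ pp1 P)) as [m [m1 [m2 [md mc]]]].
{ now rewrite (d_mul L je G1 e1), (ca hd1), <- comp_assoc. }
{ now rewrite (c_mul L je G1 e1), (ca hc1), <- comp_assoc. }
{ now rewrite (d_mul L je G2 e2), (ca hd2), <- comp_assoc. }
{ now rewrite (c_mul L je G2 e2), (ca hc2), <- comp_assoc. }
destruct (ex _ (inv G1 ∘ g1) (inv G2 ∘ g2) c d) as [i [i1 [i2 [id_ ic]]]].
{ now rewrite (ca (gdi G1)). }
{ now rewrite (ca (gci G1)). }
{ now rewrite (ca (gdi G2)). }
{ now rewrite (ca (gci G2)). }
assert (M1 : forall T (w : T ~> P), g1 ∘ (m ∘ w) = mul G1 (g1 ∘ (pp0 P ∘ w)) (g1 ∘ (pp1 P ∘ w))).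
{ intros. rewrite (ca m1), mul_nat by exact e1. now ra. }
assert (M2 : forall T (w : T ~> P), g2 ∘ (m ∘ w) = mul G2 (g2 ∘ (pp0 P ∘ w)) (g2 ∘ (pp1 P ∘ w))).
{ intros. rewrite (ca m2), mul_nat by exact e2. now ra. }
assert (MD : forall T (w : T ~> P), d ∘ (m ∘ w) = d ∘ (pp0 P ∘ w)).
{ intros. rewrite (ca md). now ra. }
assert (MC : forall T (w : T ~> P), c ∘ (m ∘ w) = c ∘ (pp1 P ∘ w)).
{ intros. rewrite (ca mc). now ra. }
edestruct (gpd_of_map (s := s) (pbi P) (m := m) (i := i) ds0 cs0 id_ ic) as [G _];
  [.. | now constructor]; intros T w h; apply un; rewrite ?M1, ?M2, ?MD, ?MC, ?h.
- rewrite (ca hs1), <- comp_assoc, (comp_assoc k1), <- hd1, <- comp_assoc. apply mul1l.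
- rewrite (ca hs2), <- comp_assoc, (comp_assoc k2), <- hd2, <- comp_assoc. apply mul1l.
- now rewrite (ca1 ds0).
- reflexivity.
- rewrite (ca hs1), <- comp_assoc, (comp_assoc k1), <- hc1, <- comp_assoc. apply mul1r.
- rewrite (ca hs2), <- comp_assoc, (comp_assoc k2), <- hc2, <- comp_assoc. apply mul1r.
- reflexivity.
- now rewrite (ca1 cs0).
- rewrite (ca i1), (ca hs1), <- !comp_assoc, (comp_assoc k1), <- hd1, <- comp_assoc. apply mulV.
- rewrite (ca i2), (ca hs2), <- !comp_assoc, (comp_assoc k2), <- hd2, <- comp_assoc. apply mulV.
- now rewrite (ca1 ds0).
- now rewrite (ca ic), (ca1 cs0).
- rewrite (ca i1), (ca hs1), <- !comp_assoc, (comp_assoc k1), <- hc1, <- comp_assoc. apply mulVl.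
- rewrite (ca i2), (ca hs2), <- !comp_assoc, (comp_assoc k2), <- hc2, <- comp_assoc. apply mulVl.
- now rewrite (ca id_), (ca1 ds0).
- now rewrite (ca1 cs0).
Qed.

Lemma gpd_one : Gpd (id (lx_one L)) (id (lx_one L)) (id (lx_one L)).
Proof.
refine {| mul := fun T x y => x; inv := id _ |}; intros; try apply one_eq; reflexivity.
Qed.

(** The 0-source of the codomain and the 0-target of the domain of an
    (n+1)-cell from [a] to [b]. In dimension one ([n = 0]) the codomain is the
    object [b] and the domain is the object [a]; in higher dimensions both
    are again cells from [a] to [b]. *)
Definition stgt (n : nat) T (X : C) (a b : T ~> X) := match n with O => b | _ => a end.
Definition ttgt (n : nat) T (X : C) (a b : T ~> X) := match n with O => a | _ => b end.

Lemma stgt_map n T (X Y : C) (f : X ~> Y) (a b : T ~> X) :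
  f ∘ stgt n a b = stgt n (f ∘ a) (f ∘ b).
Proof. now destruct n. Qed.
Lemma ttgt_map n T (X Y : C) (f : X ~> Y) (a b : T ~> X) :
  f ∘ ttgt n a b = ttgt n (f ∘ a) (f ∘ b).
Proof. now destruct n. Qed.

Lemma bd_dom n (X : nGrd C (S n)) T (z : T ~> cells X) : bd (under X) ∘ (dom X ∘ z) = bd X ∘ z.
Proof. exact (comp_assoc _ _ _). Qed.
Lemma bc_cod n (X : nGrd C (S n)) T (z : T ~> cells X) : bc (under X) ∘ (cod X ∘ z) = bc X ∘ z.
Proof. exact (comp_assoc _ _ _). Qed.
Lemma bc_dom n (X : nGrd C (S n)) T (z : T ~> cells X) :
  bc (under X) ∘ (dom X ∘ z) = ttgt n (bd X ∘ z) (bc X ∘ z).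
Proof.
destruct n as [| n]; [exact (comp_assoc _ _ _) |].
refine (eq_trans _ (bc_cod z)). exact (proj2 (par_b (par_comp z (par_dc X)))).
Qed.
Lemma bd_cod n (X : nGrd C (S n)) T (z : T ~> cells X) :
  bd (under X) ∘ (cod X ∘ z) = stgt n (bd X ∘ z) (bc X ∘ z).
Proof.
destruct n as [| n]; [exact (comp_assoc _ _ _) |].
refine (eq_trans _ (bd_dom z)). exact (eq_sym (proj1 (par_b (par_comp z (par_dc X))))).
Qed.

Lemma bd_dom1 n (X : nGrd C (S n)) : bd (under X) ∘ dom X = bd X.
Proof. reflexivity. Qed.
Lemma bc_cod1 n (X : nGrd C (S n)) : bc (under X) ∘ cod X = bc X.
Proof. reflexivity. Qed.
Lemma bc_dom1 n (X : nGrd C (S n)) : bc (under X) ∘ dom X = ttgt n (bd X) (bc X).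
Proof. rewrite <- (comp_idr (dom X)), bc_dom, !comp_idr. reflexivity. Qed.
Lemma bd_cod1 n (X : nGrd C (S n)) : bd (under X) ∘ cod X = stgt n (bd X) (bc X).
Proof. rewrite <- (comp_idr (cod X)), bd_cod, !comp_idr. reflexivity. Qed.

Lemma bd_idc n (X : nGrd C (S n)) T (z : T ~> cells (under X)) :
  bd X ∘ (idc X ∘ z) = bd (under X) ∘ z.
Proof. rewrite bd_S, <- comp_assoc, (ca1 (dom_idc X)). reflexivity. Qed.
Lemma bc_idc n (X : nGrd C (S n)) T (z : T ~> cells (under X)) :
  bc X ∘ (idc X ∘ z) = bc (under X) ∘ z.
Proof. rewrite bc_S, <- comp_assoc, (ca1 (cod_idc X)). reflexivity. Qed.

Lemma bdE n (X Y : nGrd C n) (F : X ~> Y) T (x : T ~> cells X) :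
  bd Y ∘ (fmap cells F ∘ x) = omor F ∘ (bd X ∘ x).
Proof. now rewrite (ca (bd_nat F)), comp_assoc. Qed.
Lemma bcE n (X Y : nGrd C n) (F : X ~> Y) T (x : T ~> cells X) :
  bc Y ∘ (fmap cells F ∘ x) = omor F ∘ (bc X ∘ x).
Proof. now rewrite (ca (bc_nat F)), comp_assoc. Qed.
Lemma domE n (X Y : nGrd C (S n)) (F : X ~> Y) T (x : T ~> cells X) :
  dom Y ∘ (fmap cells F ∘ x) = fmap cells (umor F) ∘ (dom X ∘ x).
Proof. now rewrite (ca (dom_nat F)), comp_assoc. Qed.
Lemma codE n (X Y : nGrd C (S n)) (F : X ~> Y) T (x : T ~> cells X) :
  cod Y ∘ (fmap cells F ∘ x) = fmap cells (umor F) ∘ (cod X ∘ x).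
Proof. now rewrite (ca (cod_nat F)), comp_assoc. Qed.

Lemma bd_bs n (X : nGrd C n) : bd X ∘ bs X = id _.
Proof.
induction n as [| n IH]; [exact (comp_idl _) |].
rewrite bs_S, bd_idc. apply IH.
Qed.
Lemma bc_bs n (X : nGrd C n) : bc X ∘ bs X = id _.
Proof.
induction n as [| n IH]; [exact (comp_idl _) |].
rewrite bs_S, bc_idc. apply IH.
Qed.

(** Fully faithful functors in every positive dimension: the cells of [X] between
    two objects are those of [Y] between their images. *)
Fixpoint Cart (n : nat) : forall (X Y : nGrd C n), (X ~> Y) -> Prop :=
  match n return forall (X Y : nGrd C n), (X ~> Y) -> Prop with
  | O => fun _ _ _ => True
  | S m => fun X Y F => @Cart m (under X) (under Y) (umor F) /\
     (forall T (a b : T ~> obj0 X) (y : T ~> cells Y),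
       bd Y ∘ y = omor F ∘ a -> bc Y ∘ y = omor F ∘ b ->
       exists x, bd X ∘ x = a /\ bc X ∘ x = b /\ fmap cells F ∘ x = y) /\
     (forall T (x x' : T ~> cells X), fmap cells F ∘ x = fmap cells F ∘ x' ->
       bd X ∘ x = bd X ∘ x' -> bc X ∘ x = bc X ∘ x' -> x = x')
  end.

Lemma cart_uni n (X Y : nGrd C n) (F : X ~> Y) : Cart F ->
  forall T (x x' : T ~> cells X), fmap cells F ∘ x = fmap cells F ∘ x' ->
       bd X ∘ x = bd X ∘ x' -> bc X ∘ x = bc X ∘ x' -> x = x'.
Proof.
destruct n as [| n]; [| intros [_ [_ h]]; exact h].
intros _ T x x' _ e _. exact (eq_trans (eq_sym (comp_idl x)) (eq_trans e (comp_idl x'))).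
Qed.

Lemma cart_ex n (X Y : nGrd C n) (F : X ~> Y) : Cart F ->
  forall T (a b : T ~> obj0 X) (y : T ~> cells Y),
    bd Y ∘ y = omor F ∘ a -> bc Y ∘ y = omor F ∘ b -> (n = 0 -> a = b) ->
    exists x, bd X ∘ x = a /\ bc X ∘ x = b /\ fmap cells F ∘ x = y.
Proof.
destruct n as [| n]; [| intros [_ [h _]]; intros; now apply h].
intros _ T a b y e _ eq. rewrite <- (eq eq_refl). exists a.
split; [exact (comp_idl a) |]. split; [exact (comp_idl a) |].
exact (eq_trans (eq_sym e) (comp_idl y)).
Qed.

Lemma cart_lift n (W X V : nGrd C n) (phi : W ~> X) (psi : V ~> X) (h : obj0 V ~> obj0 W) :
  Cart phi -> omor phi ∘ h = omor psi ->
  exists th : V ~> W, phi ∘ th = psi /\ omor th = h.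
Proof.
induction n as [| n IH]; intros cp e.
- exists h. split; [exact e | reflexivity].
- destruct cp as [cp [ex un]].
  destruct (IH (under W) (under X) (under V) (umor phi) (umor psi) h cp e) as [th [t1 t2]].
  destruct (ex _ (h ∘ bd V) (h ∘ bc V) (fmap cells psi)) as [u [u0 [u1 u2]]].
  { rewrite bd_nat, comp_assoc. exact (f_equal (fun k => k ∘ bd V) (eq_sym e)). }
  { rewrite bc_nat, comp_assoc. exact (f_equal (fun k => k ∘ bc V) (eq_sym e)). }
  assert (T1 : forall T (x : T ~> cells (under V)), fmap cells (umor phi) ∘ (fmap cells th ∘ x) =
     fmap cells (umor psi) ∘ x).
  { intros. now rewrite comp_assoc, <- fmap_comp, t1. }
  destruct (nGrd_mor L je (X := V) (Y := W) (F := th) (u := u)) as [Th [h1 h2]].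
  + apply (cart_uni cp).
    * rewrite T1, <- (dom_nat psi), <- u2, domE. reflexivity.
    * rewrite bdE, t2, bd_dom, bd_dom1. exact u0.
    * rewrite bcE, t2, bc_dom, bc_dom1, ttgt_map, u0, u1. reflexivity.
  + apply (cart_uni cp).
    * rewrite T1, <- (cod_nat psi), <- u2, codE. reflexivity.
    * rewrite bdE, t2, bd_cod, bd_cod1, stgt_map, u0, u1. reflexivity.
    * rewrite bcE, t2, bc_cod, bc_cod1. exact u1.
  + apply un.
    * rewrite (ca u2), (idc_nat psi), (comp_assoc _ (idc W)), (idc_nat phi), <- comp_assoc.
      f_equal. rewrite <- (comp_idr (fmap cells th)), T1. now rewrite comp_idr.
    * rewrite (ca u0), <- comp_assoc. rewrite <- (comp_idr (idc V)), !bd_idc.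
      rewrite <- (comp_idr (fmap cells th)), bdE, t2. reflexivity.
    * rewrite (ca u1), <- comp_assoc. rewrite <- (comp_idr (idc V)), !bc_idc.
      rewrite <- (comp_idr (fmap cells th)), bcE, t2. reflexivity.
  + exists Th. split.
    * apply nGrd_ext; [rewrite umor_comp, h1; exact t1 |].
      rewrite fmap_comp, h2. exact u2.
    * change (omor (umor Th) = h). now rewrite h1.
Qed.

(** The property [Pr] for the map of cells of every dimension. *)
Fixpoint Levelwise (Pr : forall A B : C, (A ~> B) -> Prop) (n : nat) :
    forall (X Y : nGrd C n), (X ~> Y) -> Prop :=
  match n return forall (X Y : nGrd C n), (X ~> Y) -> Prop with
  | O => fun X Y F => Pr _ _ (fmap cells F)
  | S m => fun X Y F => @Levelwise Pr m (under X) (under Y) (umor F) /\ Pr _ _ (fmap cells F)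
  end.

Fixpoint CommLevels (n : nat) : nGrd C n -> Prop :=
  match n return nGrd C n -> Prop with
  | O => fun X => Commutative (cells X)
  | S m => fun X => @CommLevels m (under X) /\ Commutative (cells X)
  end.

Lemma lp_top Pr n (X Y : nGrd C n) (F : X ~> Y) : Levelwise Pr F -> Pr _ _ (fmap cells F).
Proof. destruct n; [easy | now intros [_ h]]. Qed.
Lemma lp_obj Pr n (X Y : nGrd C n) (F : X ~> Y) : Levelwise Pr F -> Pr _ _ (omor F).
Proof. induction n as [| n IH]; [easy |]. intros [h _]. exact (IH _ _ _ h). Qed.
Lemma lp_imp (P Q : forall A B : C, (A ~> B) -> Prop) n (X Y : nGrd C n) (F : X ~> Y) :
  (forall A B f, P A B f -> Q A B f) -> Levelwise P F -> Levelwise Q F.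
Proof. intros h. induction n as [| n IH]; [apply h |]. intros [h1 h2]. split; auto. Qed.
Lemma comml_top n (X : nGrd C n) : CommLevels X -> Commutative (cells X).
Proof. destruct n; [easy | now intros [_ h]]. Qed.
Lemma comml_obj n (X : nGrd C n) : CommLevels X -> Commutative (obj0 X).
Proof. induction n as [| n IH]; [easy |]. intros [h _]. exact (IH _ h). Qed.

Definition CommQuotient (A B : C) (q : A ~> B) : Prop :=
  RegEpi q /\ forall X (g : A ~> X), Commutative X -> exists g', g' ∘ q = g.

Lemma fact n (V Q Y : nGrd C n) (pi : V ~> Q) (psi : V ~> Y) :
  Levelwise CommQuotient pi -> CommLevels Y -> exists chi : Q ~> Y, chi ∘ pi = psi.
Proof.
induction n as [| n IH]; [intros [_ h] cY; exact (h _ psi cY) |].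
intros [h1 [rp h2]] [c1 c2].
destruct (IH _ _ _ (umor pi) (umor psi) h1 c1) as [chi hc].
destruct (h2 _ (fmap cells psi) c2) as [u hu].
assert (HC : forall T (x : T ~> cells (under V)),
  fmap cells chi ∘ (fmap cells (umor pi) ∘ x) = fmap cells (umor psi) ∘ x).
{ intros. now rewrite comp_assoc, <- fmap_comp, hc. }
destruct (nGrd_mor L je (X := Q) (Y := Y) (F := chi) (u := u)) as [Ch [k1 k2]].
- apply (regepi_epi rp). rewrite <- !comp_assoc, hu, (dom_nat pi), HC. apply dom_nat.
- apply (regepi_epi rp). rewrite <- !comp_assoc, hu, (cod_nat pi), HC. apply cod_nat.
- apply (regepi_epi (proj1 (lp_top h1))).
  rewrite <- !comp_assoc, <- (idc_nat pi), (ca hu).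
  rewrite (idc_nat psi). f_equal. rewrite <- (comp_idr (fmap cells (umor psi))), <- HC. now rewrite comp_idr.
- exists Ch. apply nGrd_ext; [rewrite umor_comp, k1; exact hc |].
  rewrite fmap_comp, k2. exact hu.
Qed.

(** Cells which are iterated identities of 1-cells; unlike other cells they can be
    composed with cells of every dimension along the objects, coherently. *)
Fixpoint IteratedId (m : nat) : forall (Z : nGrd C (S m)) T, (T ~> cells Z) -> Prop :=
  match m return forall (Z : nGrd C (S m)) T, (T ~> cells Z) -> Prop with
  | O => fun _ _ _ => True
  | S k => fun Z T H => exists H', @IteratedId k (under Z) T H' /\ H = idc Z ∘ H'
  end.

Lemma mul_idc n (X : nGrd C (S (S n))) (G : Gpd (bd X) (bc X) (bs X))
  (H : Gpd (bd (under X)) (bc (under X)) (bs (under X))) T (x y : T ~> cells (under X)) :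
  bc (under X) ∘ x = bd (under X) ∘ y ->
  idc X ∘ mul H x y = mul G (idc X ∘ x) (idc X ∘ y).
Proof.
apply (functor_mul L je H G (h := idc X) (k := id _)).
- rewrite comp_idl, <- (comp_idr (idc X)), bd_idc. apply comp_idr.
- rewrite comp_idl, <- (comp_idr (idc X)), bc_idc. apply comp_idr.
- rewrite comp_idr. reflexivity.
Qed.
Lemma inv_idc n (X : nGrd C (S (S n))) (G : Gpd (bd X) (bc X) (bs X))
  (H : Gpd (bd (under X)) (bc (under X)) (bs (under X))) :
  idc X ∘ inv H = inv G ∘ idc X.
Proof.
apply (functor_inv L je H G (h := idc X) (k := id _)).
- rewrite comp_idl, <- (comp_idr (idc X)), bd_idc. apply comp_idr.
- rewrite comp_idl, <- (comp_idr (idc X)), bc_idc. apply comp_idr.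
- rewrite comp_idr. reflexivity.
Qed.

(** A functor may be conjugated by 1-cells issuing from its values on objects,
    which moves those values to the targets of the 1-cells: x is sent to
    H(source)^-1 psi(x) H(target). Up to this, functors between connected
    n-groupoids can be prescribed on objects. *)
Lemma twist m (W Z : nGrd C (S m)) (psi : W ~> Z) (H : obj0 W ~> cells Z) :
  IteratedId H -> bd Z ∘ H = omor psi ->
  exists (G : Gpd (bd Z) (bc Z) (bs Z)) (chi : W ~> Z), omor chi = bc Z ∘ H /\
    fmap cells chi = mul G (mul G (inv G ∘ (H ∘ bd W)) (fmap cells psi)) (H ∘ bc W).
Proof.
induction m as [| m IH]; intros hH e.
- destruct (extr Z) as [G].
  assert (e1 : bc Z ∘ (inv G ∘ (H ∘ bd W)) = bd Z ∘ fmap cells psi).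
  { rewrite (ci G), comp_assoc, e. symmetry. apply bd_nat. }
  assert (e2 : bc Z ∘ mul G (inv G ∘ (H ∘ bd W)) (fmap cells psi) = bd Z ∘ (H ∘ bc W)).
  { rewrite (c_mul L je G e1), bc_nat, (comp_assoc (bd Z)). now rewrite e. }
  set (u := mul G (mul G (inv G ∘ (H ∘ bd W)) (fmap cells psi)) (H ∘ bc W)) in *.
  destruct (nGrd_mor L je (X := W) (Y := Z) (F := bc Z ∘ H) (u := u)) as [chi [h1 h2]].
  + refine (eq_trans (f_equal (fun k => k ∘ u) (eq_sym (comp_idl (dom Z)))) _).
    refine (eq_trans (d_mul L je G e2) (eq_trans (d_mul L je G e1) _)).
    refine (eq_trans (di G _) _). rewrite comp_assoc.
    exact (f_equal (fun k => bc Z ∘ H ∘ k) (comp_idl (dom W))).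
  + refine (eq_trans (f_equal (fun k => k ∘ u) (eq_sym (comp_idl (cod Z)))) _).
    refine (eq_trans (c_mul L je G e2) _). rewrite comp_assoc.
    exact (f_equal (fun k => bc Z ∘ H ∘ k) (comp_idl (cod W))).
  + assert (B : idc W = bs W) by (symmetry; exact (comp_idr (idc W))).
    assert (B' : idc Z = bs Z) by (symmetry; exact (comp_idr (idc Z))).
    rewrite B, B'. unfold u. rewrite mul_nat, mul_nat by auto.
    rewrite <- !comp_assoc.
    refine (eq_trans (f_equal (fun k => mul G (mul G (inv G ∘ (H ∘ k)) _) _) (bd_bs W)) _).
    refine (eq_trans (f_equal (fun k => mul G _ (H ∘ k)) (bc_bs W)) _).
    refine (eq_trans (f_equal (fun k => mul G (mul G _ k) _) (bs_nat psi)) _).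
    refine (eq_trans (f_equal (fun k => mul G (mul G _ (bs Z ∘ k)) _) (eq_sym e)) _).
    refine (eq_trans (f_equal (fun k => mul G (mul G (inv G ∘ k) _) _) (comp_idr H)) _).
    refine (eq_trans (f_equal (fun k => mul G _ k) (comp_idr H)) _).
    refine (eq_trans (f_equal (fun k => mul G (mul G _ (bs Z ∘ k)) _) (eq_sym (ci G H))) _).
    refine (eq_trans (f_equal (fun k => mul G k _) (mul1r G _)) _).
    exact (mulVl G H).
  + exists G, chi. split; [| exact h2]. change (omor (umor chi) = bc Z ∘ H). rewrite h1. reflexivity.
- destruct hH as [H' [hH' ->]]. change (obj0 (under W) ~> cells (under Z)) in H'.
  rewrite bd_idc in e.
  destruct (IH (under W) (under Z) (umor psi) H' hH' e) as [G' [chi' [o' c']]].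
  destruct (extr Z) as [G].
  set (H := idc Z ∘ H').
  assert (eH : bd Z ∘ H = omor psi) by (unfold H; rewrite bd_idc; exact e).
  assert (e1 : bc Z ∘ (inv G ∘ (H ∘ bd W)) = bd Z ∘ fmap cells psi).
  { rewrite (ci G), comp_assoc, eH. exact (eq_sym (bd_nat psi)). }
  assert (e2 : bc Z ∘ mul G (inv G ∘ (H ∘ bd W)) (fmap cells psi) = bd Z ∘ (H ∘ bc W)).
  { rewrite (c_mul L je G e1), (bc_nat psi), (comp_assoc (bd Z)), eH. reflexivity. }
  change (bd (under Z) ∘ H' = omor (umor psi)) in e.
  assert (e1' : bc (under Z) ∘ (inv G' ∘ (H' ∘ bd (under W))) = bd (under Z) ∘ fmap cells (umor psi)).
  { rewrite (ci G'), comp_assoc, e. exact (eq_sym (bd_nat (umor psi))). }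
  assert (e2' : bc (under Z) ∘ mul G' (inv G' ∘ (H' ∘ bd (under W))) (fmap cells (umor psi)) = bd (under Z) ∘ (H' ∘ bc (under W))).
  { rewrite (c_mul L je G' e1'), (bc_nat (umor psi)), (comp_assoc (bd (under Z))), e. reflexivity. }
  set (u := mul G (mul G (inv G ∘ (H ∘ bd W)) (fmap cells psi)) (H ∘ bc W)) in *.
  assert (dH : dom Z ∘ H = H') by apply (ca1 (dom_idc Z)).
  assert (cH : cod Z ∘ H = H') by apply (ca1 (cod_idc Z)).
  destruct (dom_inv L je G G') as [i0 i1].
  destruct (par_b (par_dc W)) as [w0 w1].
  destruct (nGrd_mor L je (X := W) (Y := Z) (F := chi') (u := u)) as [chi [h1 h2]].
  + unfold u. rewrite (proj1 (dom_functor L je G G' e2)), (proj1 (dom_functor L je G G' e1)).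
    rewrite c', !mul_nat, (ca i0), <- !comp_assoc, !(ca dH), (dom_nat psi), w1 by auto.
    reflexivity.
  + unfold u. rewrite (proj2 (dom_functor L je G G' e2)), (proj2 (dom_functor L je G G' e1)).
    rewrite c', !mul_nat, (ca i1), <- !comp_assoc, !(ca cH), (cod_nat psi), <- w0 by auto.
    reflexivity.
  + rewrite c', (mul_idc G G' e2'), (mul_idc G G' e1').
    rewrite (ca (inv_idc G G')). unfold u. rewrite !mul_nat by auto.
    unfold H. rewrite <- (idc_nat psi), <- !comp_assoc.
    assert (k0 : bd W ∘ idc W = bd (under W)).
    { rewrite <- (comp_idr (idc W)), bd_idc. apply comp_idr. }
    assert (k1 : bc W ∘ idc W = bc (under W)).
    { rewrite <- (comp_idr (idc W)), bc_idc. apply comp_idr. }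
    exact (f_equal2 (fun a b => mul G (mul G (inv G ∘ (idc Z ∘ (H' ∘ a)))
      (fmap cells psi ∘ idc W)) (idc Z ∘ (H' ∘ b))) k0 k1).
  + exists G, chi. split; [| exact h2]. change (omor (umor chi) = bc Z ∘ H). rewrite h1, o'.
    unfold H. now rewrite bc_idc.
Qed.

Lemma ttgt_b n (X : nGrd C n) T (x : T ~> cells X) : ttgt n (bd X ∘ x) (bc X ∘ x) = bc X ∘ x.
Proof. now destruct n. Qed.
Lemma stgt_b n (X : nGrd C n) T (x : T ~> cells X) : stgt n (bd X ∘ x) (bc X ∘ x) = bd X ∘ x.
Proof. now destruct n. Qed.
Lemma ttgt_comp n T S (X : C) (a b : T ~> X) (u : S ~> T) : ttgt n a b ∘ u = ttgt n (a ∘ u) (b ∘ u).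
Proof. now destruct n. Qed.
Lemma stgt_comp n T S (X : C) (a b : T ~> X) (u : S ~> T) : stgt n a b ∘ u = stgt n (a ∘ u) (b ∘ u).
Proof. now destruct n. Qed.

Lemma cart_par n (W X : nGrd C n) (phi : W ~> X) : Cart phi ->
  forall T (u v : T ~> cells W), bd W ∘ u = bd W ∘ v -> bc W ∘ u = bc W ∘ v ->
  par (fmap cells phi ∘ u) (fmap cells phi ∘ v) -> par u v.
Proof.
destruct n as [| n]; [intros; exact I |].
intros [cp _] T u v e0 e1 [h0 h1]. rewrite !domE in h0. rewrite !codE in h1.
split; apply (cart_uni cp); auto.
- now rewrite !bd_dom.
- now rewrite !bc_dom, e0, e1.
- now rewrite !bd_cod, e0, e1.
- now rewrite !bc_cod.
Qed.

(** The (m+1)-cells of the restriction are triples (x, a, b) with x an (m+1)-cell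
    from f a to f b. *)
Lemma restrict n (X : nGrd C n) (U : C) (f : U ~> obj0 X) :
  exists (W : nGrd C n) (phi : W ~> X) (j : obj0 W ~> U),
    IsIso j /\ f ∘ j = omor phi /\ Cart phi.
Proof.
induction n as [| m IH].
- exists (existT _ tt U : nGrd C 0), f, (id U). split; [| split; [exact (comp_idr f) | exact I]].
  exists (id U). split; apply comp_idl.
- destruct (IH (under X) f) as [W [phi [j [ij [ej cp]]]]].
  pose (WW := prd L (obj0 W) (obj0 W)). pose (B := prd L (obj0 X) (obj0 X)).
  pose (Z := lx_pb L (pr_pair B (bd X) (bc X))
    (pr_pair B (omor phi ∘ prl WW) (omor phi ∘ prr WW))).
  pose (x := pp0 Z). pose (a := prl WW ∘ pp1 Z). pose (b := prr WW ∘ pp1 Z).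
  assert (sq := pb_sq (pbi Z)). rewrite !pr_pair_comp in sq.
  assert (xa : bd X ∘ x = omor phi ∘ a).
  { apply (f_equal (fun h => prl B ∘ h)) in sq. rewrite !prl_pair in sq.
    unfold a. now rewrite comp_assoc. }
  assert (xb : bc X ∘ x = omor phi ∘ b).
  { apply (f_equal (fun h => prr B ∘ h)) in sq. rewrite !prr_pair in sq.
    unfold b. now rewrite comp_assoc. }
  assert (univ : forall T (x' : T ~> cells X) (a' b' : T ~> obj0 W),
    bd X ∘ x' = omor phi ∘ a' -> bc X ∘ x' = omor phi ∘ b' ->
    exists z : T ~> Z, x ∘ z = x' /\ a ∘ z = a' /\ b ∘ z = b').
  { intros T x' a' b' ea eb.
    destruct (pb_ex (pbi Z) (a := x') (b := pr_pair WW a' b')) as [z [z0 z1]].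
    { rewrite !pr_pair_comp, <- !comp_assoc, prl_pair, prr_pair. congruence. }
    exists z. split; [exact z0 |]. unfold a, b. rewrite <- !comp_assoc, z1.
    rewrite prl_pair, prr_pair. auto. }
  assert (uniq : forall T (z z' : T ~> Z), x ∘ z = x ∘ z' -> a ∘ z = a ∘ z' -> b ∘ z = b ∘ z' -> z = z').
  { intros T z z' e0 e1 e2. unfold a in e1. unfold b in e2. rewrite <- !comp_assoc in e1, e2.
    apply (pb_uniq (pbi Z)); [exact e0 |]. now apply prod_eq. }
  clearbody x a b.
  destruct (cart_ex cp (a := a) (b := ttgt m a b) (y := dom X ∘ x)) as [d [d0 [d1 d2]]].
  { rewrite bd_dom. exact xa. }
  { rewrite bc_dom, ttgt_map. exact (f_equal2 (fun h k => ttgt m h k) xa xb). }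
  { now intros ->. }
  destruct (cart_ex cp (a := stgt m a b) (b := b) (y := cod X ∘ x)) as [c [c0 [c1 c2]]].
  { rewrite bd_cod, stgt_map. exact (f_equal2 (fun h k => stgt m h k) xa xb). }
  { rewrite bc_cod. exact xb. }
  { now intros ->. }
  destruct (univ _ (idc X ∘ fmap cells phi) (bd W) (bc W)) as [s [s0 [s1 s2]]].
  { rewrite bd_idc. exact (bd_nat phi). }
  { rewrite bc_idc. exact (bc_nat phi). }
  assert (ds0 : d ∘ s = id _).
  { apply (cart_uni cp); rewrite comp_idr, comp_assoc.
    - rewrite d2, <- comp_assoc, s0. apply (ca1 (dom_idc X)).
    - now rewrite d0.
    - rewrite d1, ttgt_comp, s1, s2. rewrite <- (comp_idr (bd W)), <- (comp_idr (bc W)).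
      apply ttgt_b. }
  assert (cs0 : c ∘ s = id _).
  { apply (cart_uni cp); rewrite comp_idr, comp_assoc.
    - rewrite c2, <- comp_assoc, s0. apply (ca1 (cod_idc X)).
    - rewrite c0, stgt_comp, s1, s2. rewrite <- (comp_idr (bd W)), <- (comp_idr (bc W)).
      apply stgt_b.
    - now rewrite c1. }
  assert (pp : par d c).
  { destruct m as [| m]; [exact I |]. apply (cart_par cp).
    - now rewrite d0, c0.
    - now rewrite d1, c1.
    - rewrite d2, c2. apply par_comp, par_dc. }
  assert (GG : inhabited (Gpd (bd W ∘ d) (bc W ∘ c) (s ∘ bs W))).
  { destruct (extr X) as [GX].
    apply (gpd_joint GX gpd_one (g1 := x) (k1 := omor phi) (g2 := bng L _) (k2 := bng L _));
      try (intros; apply one_eq).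
    - now rewrite d0.
    - now rewrite c1.
    - intros T x1 x2 a' b' h1 h2 _ _. destruct (univ T x1 a' b' h1 h2) as [z [z0 [z1 z2]]].
      exists z. rewrite d0, c1. repeat split; auto. apply one_eq.
    - intros T z z' h1 _. rewrite d0, c1. now apply uniq.
    - rewrite <- comp_assoc, (ca1 ds0). apply bd_bs.
    - rewrite <- comp_assoc, (ca1 cs0). apply bc_bs.
    - rewrite (ca s0), <- comp_assoc, (bs_nat phi), bs_S, comp_assoc. reflexivity. }
  destruct (nGrd_build L je {| rd := d; rc := c; rs := s; rds := ds0; rcs := cs0;
    rpar := pp; rgp := GG |}) as [W1 [i [[i' [i1 i2]] [hd [hc hs]]]]]. simpl in hd, hc, hs.
  set (V := tot (n := S m) W1 : nGrd C (S m)) in *.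
  destruct (nGrd_mor L je (X := V) (Y := X) (F := phi) (u := x ∘ i)) as [Phi [p1 p2]].
  { rewrite comp_assoc, <- d2, <- comp_assoc. f_equal. exact hd. }
  { rewrite comp_assoc, <- c2, <- comp_assoc. f_equal. exact hc. }
  { exact (eq_trans (eq_sym (comp_assoc _ _ _)) (eq_trans (f_equal (fun k => x ∘ k) hs) s0)). }
  assert (BD : forall T (w : T ~> cells V), bd V ∘ w = a ∘ (i ∘ w)).
  { intros T w. rewrite <- bd_dom, <- d0, <- hd, <- !comp_assoc. reflexivity. }
  assert (BC : forall T (w : T ~> cells V), bc V ∘ w = b ∘ (i ∘ w)).
  { intros T w. rewrite <- bc_cod, <- c1, <- hc, <- !comp_assoc. reflexivity. }
  exists V, Phi, j. split; [exact ij |].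
  split; [change (f ∘ j = omor (umor Phi)); now rewrite p1 |].
  split; [now rewrite p1 |].
  assert (OP : omor (umor Phi) = omor phi) by now rewrite p1.
  split.
  + intros T a' b' y h0 h1.
    destruct (univ T y a' b') as [z [z0 [z1 z2]]].
    { rewrite h0. exact (f_equal (fun k => k ∘ a') OP). }
    { rewrite h1. exact (f_equal (fun k => k ∘ b') OP). }
    exists (i' ∘ z). rewrite BD, BC, p2, <- comp_assoc, (ca1 i2). auto.
  + intros T w w'. rewrite p2, !BD, !BC, <- !comp_assoc. intros h0 h1 h2.
    rewrite <- (ca1 i1 w), <- (ca1 i1 w'). f_equal. now apply uniq.
Qed.

Definition IsPr (A B P : C) (p : P ~> A) (q : P ~> B) : Prop :=
  (forall T (a : T ~> A) (b : T ~> B), exists w, p ∘ w = a /\ q ∘ w = b) /\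
  (forall T (w w' : T ~> P), p ∘ w = p ∘ w' -> q ∘ w = q ∘ w' -> w = w').

Fixpoint LProd (n : nat) : forall (V X Y : nGrd C n), (V ~> X) -> (V ~> Y) -> Prop :=
  match n return forall (V X Y : nGrd C n), (V ~> X) -> (V ~> Y) -> Prop with
  | O => fun V X Y p q => IsPr (fmap cells p) (fmap cells q)
  | S m => fun V X Y p q =>
      @LProd m (under V) (under X) (under Y) (umor p) (umor q) /\
      IsPr (fmap cells p) (fmap cells q)
  end.

Lemma lprod_top n (V X Y : nGrd C n) (p : V ~> X) (q : V ~> Y) : LProd p q ->
  IsPr (fmap cells p) (fmap cells q).
Proof. destruct n; [easy | now intros [_ h]]. Qed.
Lemma lprod_obj n (V X Y : nGrd C n) (p : V ~> X) (q : V ~> Y) : LProd p q ->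
  IsPr (omor p) (omor q).
Proof. induction n as [| n IH]; [easy |]. intros [h _]. exact (IH _ _ _ _ _ h). Qed.

Lemma lprod_exists n (X Y : nGrd C n) :
  exists (V : nGrd C n) (p : V ~> X) (q : V ~> Y), LProd p q.
Proof.
induction n as [| m IH].
- pose (P := prd L (cells X) (cells Y)).
  exists (existT _ tt (prod_ob P) : nGrd C 0), (prl P), (prr P). split.
  + intros T a b. exists (pr_pair P a b). split; [apply prl_pair | apply prr_pair].
  + intros T w w'. apply prod_eq.
- destruct (IH (under X) (under Y)) as [V [p [q hV]]].
  pose (Z := prd L (cells X) (cells Y)).
  destruct (lprod_top hV) as [ex un].
  destruct (ex _ (dom X ∘ prl Z) (dom Y ∘ prr Z)) as [d [d0 d1]].
  destruct (ex _ (cod X ∘ prl Z) (cod Y ∘ prr Z)) as [c [c0 c1]].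
  pose (s := pr_pair Z (idc X ∘ fmap cells p) (idc Y ∘ fmap cells q)).
  assert (ds0 : d ∘ s = id _).
  { apply un; rewrite comp_idr, comp_assoc, ?d0, ?d1, <- comp_assoc; unfold s;
      rewrite ?prl_pair, ?prr_pair; apply (ca1 (dom_idc _)). }
  assert (cs0 : c ∘ s = id _).
  { apply un; rewrite comp_idr, comp_assoc, ?c0, ?c1, <- comp_assoc; unfold s;
      rewrite ?prl_pair, ?prr_pair; apply (ca1 (cod_idc _)). }
  assert (pp : par d c).
  { destruct m as [| m]; [exact I |]. destruct hV as [hV _].
    destruct (lprod_top hV) as [_ un'].
    destruct (par_comp (prl Z) (par_dc X)) as [x0 x1].
    destruct (par_comp (prr Z) (par_dc Y)) as [y0 y1].
    split; apply un'.
    - rewrite <- !domE, d0, c0. exact x0.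
    - rewrite <- !domE, d1, c1. exact y0.
    - rewrite <- !codE, d0, c0. exact x1.
    - rewrite <- !codE, d1, c1. exact y1. }
  destruct (lprod_obj hV) as [ex0 un0].
  assert (BD : omor p ∘ (bd V ∘ d) = bd X ∘ prl Z /\ omor q ∘ (bd V ∘ d) = bd Y ∘ prr Z).
  { rewrite <- !bdE, d0, d1, !bd_dom. auto. }
  assert (BC : omor p ∘ (bc V ∘ c) = bc X ∘ prl Z /\ omor q ∘ (bc V ∘ c) = bc Y ∘ prr Z).
  { rewrite <- !bcE, c0, c1, !bc_cod. auto. }
  destruct BD as [bd0 bd1], BC as [bc0 bc1].
  assert (GG : inhabited (Gpd (bd V ∘ d) (bc V ∘ c) (s ∘ bs V))).
  { destruct (extr X) as [GX], (extr Y) as [GY].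
    apply (gpd_joint GX GY (g1 := prl Z) (k1 := omor p) (g2 := prr Z) (k2 := omor q)); auto.
    - intros T x1 x2 a b h1 h2 h3 h4. exists (pr_pair Z x1 x2).
      split; [apply prl_pair |]. split; [apply prr_pair |].
      split; apply un0; rewrite comp_assoc, ?bd0, ?bd1, ?bc0, ?bc1, <- comp_assoc,
        ?prl_pair, ?prr_pair; assumption.
    - intros T z z' h1 h2 _ _. now apply prod_eq.
    - rewrite <- comp_assoc, (ca1 ds0). apply bd_bs.
    - rewrite <- comp_assoc, (ca1 cs0). apply bc_bs.
    - unfold s. rewrite (comp_assoc (prl Z)), prl_pair, <- comp_assoc, (bs_nat p), bs_S, comp_assoc. reflexivity.
    - unfold s. rewrite (comp_assoc (prr Z)), prr_pair, <- comp_assoc, (bs_nat q), bs_S, comp_assoc. reflexivity. }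
  destruct (nGrd_build L je {| rd := d; rc := c; rs := s; rds := ds0; rcs := cs0;
    rpar := pp; rgp := GG |}) as [W1 [i [[i' [i1 i2]] [hd [hc hs]]]]]. simpl in hd, hc, hs.
  set (W := tot (n := S m) W1 : nGrd C (S m)) in *.
  destruct (nGrd_mor L je (X := W) (Y := X) (F := p) (u := prl Z ∘ i)) as [P1 [p1 p2]].
  { rewrite comp_assoc, <- d0, <- comp_assoc. f_equal. exact hd. }
  { rewrite comp_assoc, <- c0, <- comp_assoc. f_equal. exact hc. }
  { exact (eq_trans (eq_sym (comp_assoc _ _ _)) (eq_trans (f_equal (fun k => prl Z ∘ k) hs) (prl_pair _ _ _))). }
  destruct (nGrd_mor L je (X := W) (Y := Y) (F := q) (u := prr Z ∘ i)) as [P2 [q1 q2]].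
  { rewrite comp_assoc, <- d1, <- comp_assoc. f_equal. exact hd. }
  { rewrite comp_assoc, <- c1, <- comp_assoc. f_equal. exact hc. }
  { exact (eq_trans (eq_sym (comp_assoc _ _ _)) (eq_trans (f_equal (fun k => prr Z ∘ k) hs) (prr_pair _ _ _))). }
  exists W, P1, P2. split; [rewrite p1, q1; exact hV |].
  rewrite p2, q2. split.
  + intros T a b. exists (i' ∘ pr_pair Z a b).
    rewrite <- !comp_assoc, !(ca1 i2). split; [apply prl_pair | apply prr_pair].
  + intros T w w'. rewrite <- !comp_assoc. intros h0 h1.
    rewrite <- (ca1 i1 w), <- (ca1 i1 w'). f_equal. now apply prod_eq.
Qed.

Lemma lprod_ex n (V X Y T : nGrd C n) (p : V ~> X) (q : V ~> Y) (f : T ~> X) (g : T ~> Y) :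
  LProd p q -> exists h : T ~> V, p ∘ h = f /\ q ∘ h = g.
Proof.
induction n as [| n IH]; [intros [ex _]; exact (ex (cells T) f g) |].
intros [hl [ex un]].
destruct (IH _ _ _ _ _ _ (umor f) (umor g) hl) as [h [h0 h1]].
destruct (ex _ (fmap cells f) (fmap cells g)) as [u [u0 u1]].
destruct (lprod_top hl) as [_ un'].
assert (K0 : forall S (x : S ~> cells (under T)),
  fmap cells (umor p) ∘ (fmap cells h ∘ x) = fmap cells (umor f) ∘ x).
{ intros. now rewrite comp_assoc, <- fmap_comp, h0. }
assert (K1 : forall S (x : S ~> cells (under T)),
  fmap cells (umor q) ∘ (fmap cells h ∘ x) = fmap cells (umor g) ∘ x).
{ intros. now rewrite comp_assoc, <- fmap_comp, h1. }
destruct (nGrd_mor L je (X := T) (Y := V) (F := h) (u := u)) as [H [e1 e2]].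
- apply un'; rewrite ?K0, ?K1, <- domE, ?u0, ?u1; apply dom_nat.
- apply un'; rewrite ?K0, ?K1, <- codE, ?u0, ?u1; apply cod_nat.
- apply un.
  + rewrite (ca u0), (idc_nat f), (ca (idc_nat p)), <- comp_assoc. f_equal.
    rewrite <- (comp_idr (fmap cells h)), K0. now rewrite comp_idr.
  + rewrite (ca u1), (idc_nat g), (ca (idc_nat q)), <- comp_assoc. f_equal.
    rewrite <- (comp_idr (fmap cells h)), K1. now rewrite comp_idr.
- exists H. split; apply nGrd_ext; rewrite ?umor_comp, ?fmap_comp, ?e1, ?e2; assumption.
Qed.

Lemma lprod_uni n (V X Y T : nGrd C n) (p : V ~> X) (q : V ~> Y) (h k : T ~> V) :
  LProd p q -> p ∘ h = p ∘ k -> q ∘ h = q ∘ k -> h = k.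
Proof.
induction n as [| n IH]; [intros [_ un]; exact (un (cells T) h k) |].
intros [hl [ex un]] e0 e1. apply nGrd_ext.
- apply (IH _ _ _ _ _ _ _ _ hl); rewrite <- !umor_comp; congruence.
- apply un; rewrite <- !fmap_comp; congruence.
Qed.

Lemma lprod_product n (V X Y : nGrd C n) (p : V ~> X) (q : V ~> Y) :
  LProd p q -> inhabited (is_product p q).
Proof.
intros hl. constructor.
unshelve refine {| pair := fun T f g => proj1_sig
  (constructive_indefinite_description _ (lprod_ex (T := T) f g hl)) |};
  try (intros; destruct constructive_indefinite_description; simpl; tauto).
intros T u v. now apply (lprod_uni hl).
Qed.
End Towers.

(** * Transport of asphericity and direction *)

Section Conn.
Variables (T : Type) (mor : T -> T -> Prop).
Lemma conn_trans x y z : Connected mor x y -> Connected mor y z -> Connected mor x z.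
Proof.
intros q1 q2. induction q1 as [| a b' b q q1 IH | a b' b q q1 IH]; [exact q2 | |].
- exact (conn_mor q (IH q2)).
- exact (conn_rom q (IH q2)).
Qed.
Lemma conn_sym x y : Connected mor x y -> Connected mor y x.
Proof.
intros q1. induction q1 as [a | a b' b q q1 IH | a b' b q q1 IH]; [apply conn_refl | |];
  apply (conn_trans IH).
- apply (conn_rom q), conn_refl.
- apply (conn_mor q), conn_refl.
Qed.
Lemma conn_one x y : mor x y -> Connected mor x y.
Proof. intros h. apply (conn_mor h), conn_refl. Qed.
End Conn.

Section Transport.
Variables (C : Category) (R : RegCtx C) (je : JE C) (A : AbGroup C).
Notation L := (rx_lex R).
Notation Oz T := (zero A ∘ to_one A T).

(** Differences of parallel cells are invariant under composition along the
    objects, by [whisker]. *)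
Lemma N_whisk n (X : nGrd C (S n)) (D : Dir A X) (G : Gpd (bd X) (bc X) (bs X))
  T (al be u v : T ~> cells X) a : N D u v a -> bc X ∘ al = bd X ∘ u -> bc X ∘ u = bd X ∘ be ->
  N D (mul G (mul G al u) be) (mul G (mul G al v) be) a.
Proof.
intros h e1 e2.
destruct (ispar_exists L X) as [P [p0 [p1 hP]]].
assert (hP' := hP). destruct hP' as [pp [ex un]].
destruct (N_ex D pp) as [nu hnu].
assert (puv := N_par h). destruct (par_b puv) as [b0 b1].
destruct (ex _ _ _ puv) as [w [w0 w1]].
assert (pal : par al al) by apply par_refl. assert (pbe : par be be) by apply par_refl.
assert (e3 : bc X ∘ mul G al u = bd X ∘ be) by (rewrite (c_mul L je G e1); exact e2).
assert (pq := par_mul L je G e3 (par_mul L je G e1 pal puv) pbe).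
destruct (ex _ _ _ pq) as [w' [w0' w1']].
assert (hA : Commutative (ab_ob A)).
{ apply commutative_ab with (1 := fun X Y => inhabits (prd L X Y)). exact (ab_str A). }
assert (K := @whisker C L je n X G P A p0 p1 nu (Oz (lx_one L)) hP hA).
lapply K; clear K; [intros K |].
2:{ intros S x e. rewrite zeroE. apply (N_fun (N_nat x hnu)). rewrite e. apply N_refl. }
specialize (K T al be w w').
rewrite w0, w1 in K. specialize (K e1 e2 w0' w1').
assert (h1 := N_nat w' hnu). rewrite w0', w1', K in h1.
assert (h2 := N_nat w hnu). rewrite w0, w1 in h2.
now rewrite (N_fun h h2).
Qed.

Section Pull.
Lemma pull_asph n (W X : nGrd C n) (phi : W ~> X) : Cart phi -> AsphLocal R X ->
  RegEpi (bng L (obj0 W)) -> AsphLocal R W.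
Proof.
induction n as [| n IH]; [intros _ _ h; exact h |].
intros [cp [ex un]] [aX H] g. split; [exact (IH _ _ _ cp aX g) |].
intros T u v p.
destruct (H T _ _ (par_mor (umor phi) p)) as [T' [k [w [rk [w0 w1]]]]].
assert (B : bc (under W) ∘ u = ttgt n (bd (under W) ∘ u) (bc (under W) ∘ v) /\
  bd (under W) ∘ v = stgt n (bd (under W) ∘ u) (bc (under W) ∘ v)).
{ destruct n as [| n]; [split; reflexivity |].
  destruct (par_b p) as [h0 h1]. split; [exact h1 | exact (eq_sym h0)]. }
destruct B as [B0 B1].
destruct (ex T' (bd (under W) ∘ u ∘ k) (bc (under W) ∘ v ∘ k) w) as [w' [h0 [h1 h2]]].
{ rewrite <- bd_dom, w0, <- comp_assoc, bdE, <- comp_assoc. reflexivity. }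
{ rewrite <- bc_cod, w1, <- comp_assoc, bcE, <- comp_assoc. reflexivity. }
exists T', k, w'. split; [exact rk |]. split; apply (cart_uni cp).
- rewrite <- domE, h2, w0. symmetry. apply comp_assoc.
- rewrite bd_dom. rewrite comp_assoc. exact h0.
- rewrite bc_dom, (comp_assoc (bc (under W))), B0, ttgt_comp.
  exact (f_equal2 (fun a b => ttgt n a b) h0 h1).
- rewrite <- codE, h2, w1. symmetry. apply comp_assoc.
- rewrite bd_cod, (comp_assoc (bd (under W))), B1, stgt_comp.
  exact (f_equal2 (fun a b => stgt n a b) h0 h1).
- rewrite bc_cod. rewrite comp_assoc. exact h1.
Qed.

Lemma pull_dir n (W X : nGrd C (S n)) (phi : W ~> X) (D : Dir A X) : Cart phi ->
  exists D' : Dir A W, forall T (u v : T ~> cells W) a,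
    N D' u v a <-> par u v /\ N D (fmap cells phi ∘ u) (fmap cells phi ∘ v) a.
Proof.
intros cp.
unshelve eexists {| N := fun T u v a =>
  par u v /\ N D (fmap cells phi ∘ u) (fmap cells phi ∘ v) a |}; [.. | reflexivity]; cbv beta.
- intros T u v a S w [h1 h2]. split; [now apply par_comp |].
  rewrite !comp_assoc. now apply N_nat.
- now intros T u v a [h _].
- intros T u v h. destruct (N_ex D (par_mor phi h)) as [a ha]. now exists a.
- intros T u v a a' [_ h] [_ h']. exact (N_fun h h').
- intros T u. split; [apply par_refl | apply N_refl].
- intros T u v v' a [p h] [p' h']. destruct (par_b p), (par_b p').
  apply (cart_uni cp); try congruence. exact (N_inj h h').
- intros T u v v' a [p h] [p' h']. destruct (par_b p), (par_b p').
  apply (cart_uni cp); try congruence. exact (N_inj' h h').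
- intros T u a. destruct (N_lift D (fmap cells phi ∘ u) a) as [y h].
  destruct (par_b (N_par h)) as [b0 b1].
  destruct (cart_ex cp (a := bd W ∘ u) (b := bc W ∘ u) (y := y)) as [v [v0 [v1 v2]]].
  { now rewrite <- b0, bdE. } { now rewrite <- b1, bcE. } { easy. }
  exists v. split; [| now rewrite v2].
  apply (cart_par cp); auto. rewrite v2. exact (N_par h).
- intros T u a. destruct (N_lift' D (fmap cells phi ∘ u) a) as [y h].
  destruct (par_b (N_par h)) as [b0 b1].
  destruct (cart_ex cp (a := bd W ∘ u) (b := bc W ∘ u) (y := y)) as [v [v0 [v1 v2]]].
  { now rewrite b0, bdE. } { now rewrite b1, bcE. } { easy. }
  exists v. split; [| now rewrite v2].
  apply (cart_par cp); auto. rewrite v2. exact (N_par h).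
Qed.
End Pull.

Section Push.
Definition RE (X Y : C) (f : X ~> Y) := RegEpi f.

Lemma lift2 (W X : C) (q : W ~> X) T (a b : T ~> X) : RegEpi q ->
  exists T' (k : T' ~> T) a' b', RegEpi k /\ q ∘ a' = a ∘ k /\ q ∘ b' = b ∘ k.
Proof.
intros rq.
destruct (cover R a rq) as [T1 [k1 [a1 [r1 h1]]]].
destruct (cover R (b ∘ k1) rq) as [T2 [k2 [b2 [r2 h2]]]].
exists T2, (k1 ∘ k2), (a1 ∘ k2), b2. split; [now apply (regepi_comp R) |].
rewrite (comp_assoc q), h1, h2, <- !comp_assoc. auto.
Qed.

Lemma push_par n (W X : nGrd C n) (rho : W ~> X) : Cart rho -> Levelwise RE rho ->
  forall T (u v : T ~> cells X), par u v -> exists T' (k : T' ~> T) u' v',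
    RegEpi k /\ par u' v' /\ fmap cells rho ∘ u' = u ∘ k /\ fmap cells rho ∘ v' = v ∘ k.
Proof.
intros cp hr T u v p.
destruct n as [| n].
- destruct (lift2 u v (lp_top hr)) as [T' [k [u' [v' [rk [h0 h1]]]]]].
  exists T', k, u', v'. auto.
- destruct (par_b p) as [b0 b1].
  destruct (lift2 (bd X ∘ u) (bc X ∘ u) (lp_obj hr)) as [T' [k [a [b [rk [h0 h1]]]]]].
  destruct (cart_ex cp (a := a) (b := b) (y := u ∘ k)) as [u' [u0 [u1 u2]]];
    [now rewrite h0, comp_assoc | now rewrite h1, comp_assoc | easy |].
  destruct (cart_ex cp (a := a) (b := b) (y := v ∘ k)) as [v' [v0 [v1 v2]]];
    [now rewrite h0, b0, comp_assoc | now rewrite h1, b1, comp_assoc | easy |].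
  exists T', k, u', v'. split; [exact rk |]. split; [| auto].
  apply (cart_par cp); [congruence | congruence |]. rewrite u2, v2. now apply par_comp.
Qed.

Lemma push_asph n (W X : nGrd C n) (rho : W ~> X) : Cart rho -> Levelwise RE rho ->
  AsphLocal R W -> AsphLocal R X.
Proof.
induction n as [| n IH].
- intros _ hr h. apply (regepi_right R (f := fmap cells rho)).
  replace (bng L (cells X) ∘ fmap cells rho) with (bng L (cells W)) by apply one_eq. exact h.
- intros [cp _] [hr _] [aW H]. split; [exact (IH _ _ _ cp hr aW) |].
  intros T u v p.
  destruct (push_par cp hr p) as [T1 [k1 [u' [v' [r1 [p' [h0 h1]]]]]]].
  destruct (H T1 u' v' p') as [T2 [k2 [w [r2 [e0 e1]]]]].
  exists T2, (k1 ∘ k2), (fmap cells rho ∘ w). split; [now apply (regepi_comp R) |].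
  rewrite domE, codE, e0, e1, !comp_assoc, h0, h1. auto.
Qed.

(** The condition under which a direction descends along a quotient: a cell is
    moved to any other cell with the same image by composing with cells that
    depend on the objects concerned only, hence serve for a whole parallel pair.
*)
Definition KernelByComposition n : forall (W X : nGrd C n), (W ~> X) -> Prop :=
  match n return forall (W X : nGrd C n), (W ~> X) -> Prop with
  | O => fun _ _ _ => True
  | S m => fun W X rho => exists G : Gpd (bd W) (bc W) (bs W),
     forall T (a a' b b' : T ~> obj0 W), omor rho ∘ a = omor rho ∘ a' ->
       omor rho ∘ b = omor rho ∘ b' ->
     exists al be, bd W ∘ al = a' /\ bc W ∘ al = a /\ bd W ∘ be = b /\ bc W ∘ be = b' /\
     forall t t' : T ~> cells W, bd W ∘ t = a -> bc W ∘ t = b -> bd W ∘ t' = a' ->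
       bc W ∘ t' = b' -> fmap cells rho ∘ t = fmap cells rho ∘ t' ->
       t' = mul G (mul G al t) be
  end.

(** Parallel cells below lift locally to parallel cells above; the difference does
    not depend on the lifting, since any two liftings of a pair are related by one
    composition as in [KernelByComposition], under which differences are invariant. *)
Lemma push_dir n (W X : nGrd C (S n)) (rho : W ~> X) (D : Dir A W) :
  Cart rho -> Levelwise RE rho -> KernelByComposition rho ->
  exists D' : Dir A X, forall T (u v : T ~> cells W) a, N D u v a ->
    N D' (fmap cells rho ∘ u) (fmap cells rho ∘ v) a.
Proof.
intros cp hr [G hK].
set (f := fmap cells rho).
assert (rf : RegEpi f) by exact (lp_top hr).
assert (CL : forall T (u1 v1 u2 v2 : T ~> cells W) a, f ∘ u1 = f ∘ u2 -> f ∘ v1 = f ∘ v2 ->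
  N D u1 v1 a -> par u2 v2 -> N D u2 v2 a).
{ intros T u1 v1 u2 v2 a e1 e2 h p2. assert (p1 := N_par h).
  destruct (par_b p1) as [b0 b1], (par_b p2) as [b2 b3].
  destruct (hK T (bd W ∘ u1) (bd W ∘ u2) (bc W ∘ u1) (bc W ∘ u2)) as
    [al [be [a0 [a1 [a2 [a3 H]]]]]].
  { rewrite <- !bdE. fold f. now rewrite e1. }
  { rewrite <- !bcE. fold f. now rewrite e1. }
  rewrite (H u1 u2), (H v1 v2) by (first [exact e1 | exact e2 | congruence]).
  apply N_whisk; congruence. }
assert (LF : forall T (u1 : T ~> cells W) (v : T ~> cells X), par (f ∘ u1) v ->
  exists v1, par u1 v1 /\ f ∘ v1 = v).
{ intros T u1 v p. destruct (par_b p) as [b0 b1].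
  destruct (cart_ex cp (a := bd W ∘ u1) (b := bc W ∘ u1) (y := v)) as [v1 [v0 [v1' v2]]].
  { rewrite <- bdE. symmetry. exact b0. } { rewrite <- bcE. symmetry. exact b1. } { easy. }
  exists v1. split; [| exact v2]. apply (cart_par cp); auto. fold f. unfold f. now rewrite v2. }
assert (SY : forall n (Y : nGrd C n) T (u v : T ~> cells Y), par u v -> par v u).
{ intros [|k] Y T u v; [easy |]. intros [h0 h1]. split; symmetry; assumption. }
pose (NN := fun T (u v : T ~> cells X) (a : T ~> A) =>
  exists T' (k : T' ~> T) u' v', RegEpi k /\ f ∘ u' = u ∘ k /\ f ∘ v' = v ∘ k /\
    N D u' v' (a ∘ k)).
assert (JO : forall (T T1 T2 : C) (k1 : T1 ~> T) (k2 : T2 ~> T), RegEpi k1 -> RegEpi k2 ->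
  exists T3 (c1 : T3 ~> T1) (c2 : T3 ~> T2), k1 ∘ c1 = k2 ∘ c2 /\ RegEpi (k1 ∘ c1)).
{ intros T T1 T2 k1 k2 r1 r2. destruct (cover R k1 r2) as [T3 [c1 [c2 [rc e]]]].
  exists T3, c1, c2. split; [congruence |]. now apply (regepi_comp R). }
assert (INJ : forall T (u v v' : T ~> cells X) a, NN T u v a -> NN T u v' a -> v = v').
{ intros T u v v' a [T1 [k1 [u1 [v1 [r1 [e1 [f1 h1]]]]]]] [T2 [k2 [u2 [v2 [r2 [e2 [f2 h2]]]]]]].
  destruct (JO _ _ _ k1 k2 r1 r2) as [T3 [c1 [c2 [ec rc]]]].
  apply (regepi_epi rc).
  assert (p2 := N_par h2).
  destruct (LF _ (u1 ∘ c1) (v' ∘ k1 ∘ c1)) as [v3 [p3 f3]].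
  { rewrite (comp_assoc f), e1, <- !comp_assoc, ec, !comp_assoc, <- e2, <- f2, <- !comp_assoc.
    apply (par_mor rho), par_comp, p2. }
  assert (h3 : N D (u1 ∘ c1) v3 (a ∘ k2 ∘ c2)).
  { apply (CL _ (u2 ∘ c2) (v2 ∘ c2)); [| | now apply N_nat | exact p3].
    - rewrite !comp_assoc, e1, e2, <- !comp_assoc. now rewrite ec.
    - rewrite !comp_assoc, f2, f3, <- !comp_assoc. now rewrite ec. }
  assert (h4 := N_nat c1 h1). rewrite <- comp_assoc, ec, comp_assoc in h4.
  assert (E := N_inj h3 h4).
  rewrite (comp_assoc v' k1), <- f3, E, (comp_assoc f), f1. apply comp_assoc. }
assert (INJ' : forall T (u u' v : T ~> cells X) a, NN T u v a -> NN T u' v a -> u = u').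
{ intros T v v' u a [T1 [k1 [v1 [u1 [r1 [f1 [e1 h1]]]]]]] [T2 [k2 [v2 [u2 [r2 [f2 [e2 h2]]]]]]].
  destruct (JO _ _ _ k1 k2 r1 r2) as [T3 [c1 [c2 [ec rc]]]].
  apply (regepi_epi rc).
  assert (p2 := SY _ _ _ _ _ (N_par h2)).
  destruct (LF _ (u1 ∘ c1) (v' ∘ k1 ∘ c1)) as [v3 [p3 f3]].
  { rewrite (comp_assoc f), e1, <- !comp_assoc, ec, !comp_assoc, <- e2, <- f2, <- !comp_assoc.
    apply (par_mor rho), par_comp, p2. }
  assert (h3 : N D v3 (u1 ∘ c1) (a ∘ k2 ∘ c2)).
  { apply (CL _ (v2 ∘ c2) (u2 ∘ c2)); [| | now apply N_nat | exact (SY _ _ _ _ _ p3)].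
    - rewrite !comp_assoc, f2, f3, <- !comp_assoc. now rewrite ec.
    - rewrite !comp_assoc, e1, e2, <- !comp_assoc. now rewrite ec. }
  assert (h4 := N_nat c1 h1). rewrite <- comp_assoc, ec, comp_assoc in h4.
  assert (E := N_inj' h3 h4).
  rewrite (comp_assoc v' k1), <- f3, E, (comp_assoc f), f1. apply comp_assoc. }
assert (DN : forall T (u v : T ~> cells W) a, N D u v a -> NN T (f ∘ u) (f ∘ v) a).
{ intros T u v a h. exists T, (id T), u, v. rewrite !comp_idr. split; [| auto].
  apply iso_regepi. exists (id T). split; apply comp_idl. }
unshelve eexists {| N := NN; N_inj := INJ; N_inj' := INJ' |}; [.. | exact DN].
- intros T u v a S w [T' [k [u' [v' [rk [e0 [e1 h]]]]]]].
  destruct (cover R w rk) as [S' [c [x [rc e]]]].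
  exists S', c, (u' ∘ x), (v' ∘ x). split; [exact rc |].
  rewrite !(comp_assoc f), e0, e1, <- !comp_assoc, <- e. split; [auto |]. split; [auto |].
  rewrite (comp_assoc a). now apply N_nat.
- intros T u v a [T' [k [u' [v' [rk [e0 [e1 h]]]]]]].
  apply (par_epi rk). rewrite <- e0, <- e1. apply (par_mor rho), (N_par h).
- intros T u v p. destruct (push_par cp hr p) as [T' [k [u' [v' [rk [p' [e0 e1]]]]]]].
  destruct (N_ex D p') as [a0 h0].
  destruct (regepi_desc (g := a0) rk) as [a ha].
  { intros S x y e. apply (N_fun (N_nat x h0)).
    apply (CL _ (u' ∘ y) (v' ∘ y)); [| | | now apply par_comp].
    - rewrite !comp_assoc. unfold f. rewrite e0, <- !comp_assoc. now rewrite e.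
    - rewrite !comp_assoc. unfold f. rewrite e1, <- !comp_assoc. now rewrite e.
    - now apply N_nat. }
  exists a, T', k, u', v'. rewrite ha. auto.
- intros T u v a a' [T1 [k1 [u1 [v1 [r1 [e1 [f1 h1]]]]]]] [T2 [k2 [u2 [v2 [r2 [e2 [f2 h2]]]]]]].
  destruct (JO _ _ _ k1 k2 r1 r2) as [T3 [c1 [c2 [ec rc]]]].
  apply (regepi_epi rc).
  assert (h3 : N D (u1 ∘ c1) (v1 ∘ c1) (a' ∘ k2 ∘ c2)).
  { apply (CL _ (u2 ∘ c2) (v2 ∘ c2)).
    - rewrite !comp_assoc, e1, e2, <- !comp_assoc. now rewrite ec.
    - rewrite !comp_assoc, f1, f2, <- !comp_assoc. now rewrite ec.
    - now apply N_nat.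
    - apply par_comp, (N_par h1). }
  assert (E := N_fun (N_nat c1 h1) h3). rewrite <- !comp_assoc in E. now rewrite E, ec.
- intros T u. destruct (cover R u rf) as [T' [k [u' [rk e]]]].
  exists T', k, u', u'. rewrite zeroE. repeat split; auto. apply N_refl.
- intros T u a. destruct (cover R u rf) as [T' [k [u' [rk e]]]].
  destruct (N_lift D u' (a ∘ k)) as [v' h].
  destruct (regepi_desc (g := f ∘ v') rk) as [v hv].
  { intros S x y exy. apply (INJ _ (f ∘ (u' ∘ x)) _ _ (a ∘ k ∘ x)).
    - rewrite <- comp_assoc. now apply DN, N_nat.
    - rewrite (comp_assoc f), e, <- !comp_assoc, exy, !comp_assoc, <- e, <- !comp_assoc.
      apply DN. rewrite (comp_assoc a). now apply N_nat. }
  exists v, T', k, u', v'. auto.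
- intros T u a. destruct (cover R u rf) as [T' [k [u' [rk e]]]].
  destruct (N_lift' D u' (a ∘ k)) as [v' h].
  destruct (regepi_desc (g := f ∘ v') rk) as [v hv].
  { intros S x y exy. apply (INJ' _ _ _ (f ∘ (u' ∘ x)) (a ∘ k ∘ x)).
    - rewrite <- comp_assoc. now apply DN, N_nat.
    - rewrite (comp_assoc f), e, <- !comp_assoc, exy, !comp_assoc, <- e, <- !comp_assoc.
      apply DN. rewrite (comp_assoc a). now apply N_nat. }
  exists v, T', k, v', u'. auto.
Qed.

Lemma agmor_refl n (X : AG R A n) : agmor X X.
Proof. exists (id _). intros T u v a h. now rewrite fmap_id, !comp_idl. Qed.

Definition presN n (X Y : AG R A n) (F : ag_X X ~> ag_X Y) : Prop :=
  forall T (u v : T ~> cells (ag_X X)) a,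
    N (ag_D X) u v a -> N (ag_D Y) (fmap cells F ∘ u) (fmap cells F ∘ v) a.

Lemma presN_comp n (X Y Z : AG R A n) (F : ag_X X ~> ag_X Y) (G : ag_X Y ~> ag_X Z) :
  presN F -> presN G -> presN (X := X) (Y := Z) (G ∘ F).
Proof.
intros hF hG T u v a h. rewrite fmap_comp, <- !comp_assoc. now apply hG, hF.
Qed.

Lemma presN_lift n (W X : AG R A n) (rho : ag_X W ~> ag_X X) :
  Cart rho -> Levelwise RE rho -> presN rho ->
  forall T (u v : T ~> cells (ag_X X)) a, N (ag_D X) u v a ->
  exists T' (k : T' ~> T) u' v', RegEpi k /\ fmap cells rho ∘ u' = u ∘ k /\
    fmap cells rho ∘ v' = v ∘ k /\ N (ag_D W) u' v' (a ∘ k).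
Proof.
intros cp hr hN T u v a h.
destruct (push_par cp hr (N_par h)) as [T' [k [u' [v' [rk [p' [e0 e1]]]]]]].
exists T', k, u', v'. split; [exact rk |]. split; [exact e0 |]. split; [exact e1 |].
destruct (N_ex (ag_D W) p') as [a' h'].
assert (h1 := hN _ _ _ _ h'). rewrite e0, e1 in h1.
now rewrite (N_fun (N_nat k h) h1).
Qed.

Lemma presN_epi n (W X Y : AG R A n) (rho : ag_X W ~> ag_X X) (psi : ag_X W ~> ag_X Y)
  (ka : ag_X X ~> ag_X Y) : Cart rho -> Levelwise RE rho -> presN rho -> presN psi ->
  ka ∘ rho = psi -> presN ka.
Proof.
intros cp hr hN hP e T u v a h.
destruct (presN_lift cp hr hN h) as [T' [k [u' [v' [rk [e0 [e1 h']]]]]]].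
apply (dir_local rk). assert (h1 := hP _ _ _ _ h').
rewrite <- e, fmap_comp, <- !comp_assoc in h1. rewrite e0, e1 in h1. now rewrite <- !comp_assoc.
Qed.
End Push.
End Transport.

(** * Reflecting aspherical groupoids *)

Section Reflection.
Variables (E : Category) (K : Ctx E).
Notation Rg := (cx_reg K).
Notation L := (rx_lex (cx_reg K)).
Notation je := (je_ctx K).
Notation "⟪ a , b ⟫" := (pr_pair (prd L _ _) a b).
Notation pl := (pl K).
Notation pr := (pr K).
Notation pc := (pc K).
Variables (I : E) (iI : is_initial I).

Lemma iniE (X : E) (f g : I ~> X) : f = g.
Proof. exact (@bang_uniq _ _ iI X f g). Qed.

Definition SR (A B : E) (q : A ~> B) : Prop := SRefl K q.

Lemma srefl_iso (A B B' : E) (q : A ~> B) (i : B ~> B') : SRefl K q -> IsIso i -> SRefl K (i ∘ q).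
Proof.
intros [rq [cB H]] [j [ji ij]]. split; [| split].
- apply regepi_iso_l; [exact rq | now exists j].
- apply (comm_quot Rg je (q := i)); [| exact cB]. apply iso_regepi. now exists j.
- intros P' X g cX W u v w e. apply (H P' X g cX W u v w).
  rewrite <- (ca1 ji (q ∘ u)), <- (ca1 ji (q ∘ v)). now rewrite !(comp_assoc i), e.
Qed.

Lemma sr_rf (A B : E) (q : A ~> B) : SR q -> CommQuotient q.
Proof. intros h. split; [apply h |]. intros X g cX. exact (srefl_fac g h cX). Qed.

Lemma sr_re (A B : E) (q : A ~> B) : SR q -> RE q.
Proof. intros h. apply h. Qed.

(** The levels of [W] are groupoids over the objects, so [grefl_exists] reflects
    each of them; the quotients form an n-groupoid because reflexive globular
    objects in commutative objects always do ([comm_gpd]). *)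
Lemma lref n (W : nGrd E n) (R : ORefl K (obj0 W)) (om : I ~> obj0 W) :
  RegEpi (bng L (obj0 W)) ->
  match n with O => True | S _ => RegEpi ⟪bd W, bc W⟫ /\
    exists r : prd L (obj0 W) I ~> cells W, bd W ∘ r = om ∘ prr _ /\ bc W ∘ r = prl _ end ->
  exists (x : nGrd E n) (rho : W ~> x) (ka : obj0 x ~> or_U R), IsIso ka /\
    ka ∘ omor rho = or_ps R /\ Levelwise SR rho /\ CommLevels x /\ Cart rho /\ KernelByComposition rho.
Proof.
intros gU. induction n as [| m IH]; intros hyp.
- exists (existT _ tt (or_U R) : nGrd E 0), (or_ps R), (id _).
  split; [exists (id _); split; apply comp_idl |].
  split; [exact (comp_idl _) |].
  split; [exact (or_refl R) |]. split; [exact (proj1 (proj2 (or_refl R))) |].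
  split; exact Logic.I.
- destruct hyp as [gT [r [r0 r1]]]. destruct (extr W) as [G].
  destruct (grefl_exists iI R G gU gT r0 r1) as
    [Tb [pt [db [cb [spt [dbE [cbE [PULL [UNI KE]]]]]]]]].
  destruct (IH (under W) R om gU) as [x [rho [ka [[kb [kb0 kb1]] [kaE [lp [cm [cart _]]]]]]]].
  { destruct m as [| k]; [exact Logic.I |]. destruct (par_b (par_dc W)) as [b0 b1].
    assert (BC : bc (under W) ∘ dom W = bc W) by (rewrite b1; reflexivity). split.
    - apply (regepi_right Rg (f := dom W)). rewrite pc.
      refine (eq_ind _ (fun h => RegEpi ⟪bd W, h⟫) gT _ (eq_sym BC)).
    - exists (dom W ∘ r). split; [exact (eq_trans (comp_assoc _ _ _) r0) |].
      refine (eq_trans (comp_assoc _ _ _) _).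
      exact (eq_trans (f_equal (fun h => h ∘ r) BC) r1). }
  destruct (lp_top lp) as [rr [cx _]].
  set (ps := or_ps R) in *.
  assert (rpt : RegEpi pt) by apply spt. assert (cT : Commutative Tb) by apply spt.
  destruct (srefl_fac (fmap cells rho ∘ dom W) spt cx) as [d d0].
  destruct (srefl_fac (fmap cells rho ∘ cod W) spt cx) as [c c0].
  destruct (srefl_fac (pt ∘ idc W) (lp_top lp) cT) as [s s0].
  assert (ds0 : d ∘ s = id _).
  { apply (regepi_epi rr). rewrite <- comp_assoc, s0, (ca d0), <- comp_assoc, (dom_idc W).
    now rewrite comp_idl, comp_idr. }
  assert (cs0 : c ∘ s = id _).
  { apply (regepi_epi rr). rewrite <- comp_assoc, s0, (ca c0), <- comp_assoc, (cod_idc W).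
    now rewrite comp_idl, comp_idr. }
  assert (pp : par d c).
  { apply (par_epi rpt). rewrite d0, c0. apply (par_mor rho), par_dc. }
  assert (BD : ka ∘ (bd x ∘ d) = db).
  { apply (regepi_epi rpt). refine (eq_trans _ (eq_sym dbE)). rewrite <- !comp_assoc, d0, bdE, (ca kaE). reflexivity. }
  assert (BC : ka ∘ (bc x ∘ c) = cb).
  { apply (regepi_epi rpt). refine (eq_trans _ (eq_sym cbE)). rewrite <- !comp_assoc, c0, bcE, (ca kaE). reflexivity. }
  assert (GG : inhabited (Gpd (bd x ∘ d) (bc x ∘ c) (s ∘ bs x))).
  { apply (comm_gpd L je cT (comml_obj cm)).
    - rewrite <- comp_assoc, (ca1 ds0). apply bd_bs.
    - rewrite <- comp_assoc, (ca1 cs0). apply bc_bs. }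
  destruct (nGrd_build L je {| rd := d; rc := c; rs := s; rds := ds0; rcs := cs0;
    rpar := pp; rgp := GG |}) as [V1 [i [[i' [i1 i2]] [hd [hc hs]]]]]. simpl in hd, hc, hs.
  set (V := tot (n := S m) V1 : nGrd E (S m)) in *.
  destruct (nGrd_mor L je (X := W) (Y := V) (F := rho) (u := i' ∘ pt)) as [Rho [p1 p2]].
  { refine (eq_trans (f_equal (fun h => h ∘ (i' ∘ pt)) (eq_sym hd)) _).
    rewrite <- comp_assoc, (ca1 i2). exact d0. }
  { refine (eq_trans (f_equal (fun h => h ∘ (i' ∘ pt)) (eq_sym hc)) _).
    rewrite <- comp_assoc, (ca1 i2). exact c0. }
  { refine (eq_trans (eq_sym (comp_assoc _ _ _)) (eq_trans (f_equal (fun h => i' ∘ h) (eq_sym s0)) _)).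
    refine (eq_trans (comp_assoc _ _ _) (f_equal (fun h => h ∘ fmap cells rho) _)).
    rewrite <- hs. exact (ca1 i1 (idc V)). }
  assert (ij : IsIso i') by (exists i; auto).
  assert (BV : forall T (y : T ~> cells V), ka ∘ (bd V ∘ y) = db ∘ (i ∘ y)).
  { intros. rewrite <- BD, <- !comp_assoc, (comp_assoc d i). refine (f_equal (fun h => ka ∘ h) _).
    refine (eq_trans (eq_sym (bd_dom y)) _). refine (f_equal (fun h => bd x ∘ (h ∘ y)) (eq_sym hd)). }
  assert (CV : forall T (y : T ~> cells V), ka ∘ (bc V ∘ y) = cb ∘ (i ∘ y)).
  { intros. rewrite <- BC, <- !comp_assoc, (comp_assoc c i). refine (f_equal (fun h => ka ∘ h) _).
    refine (eq_trans (eq_sym (bc_cod y)) _). refine (f_equal (fun h => bc x ∘ (h ∘ y)) (eq_sym hc)). }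
  assert (OR : ka ∘ omor (umor Rho) = ps) by (rewrite p1; exact kaE).
  assert (KI : forall T (z z' : T ~> obj0 x), ka ∘ z = ka ∘ z' -> z = z').
  { intros T z z' e. rewrite <- (ca1 kb0 z), <- (ca1 kb0 z'). now rewrite e. }
  assert (RI : forall T (z z' : T ~> cells W), fmap cells Rho ∘ z = fmap cells Rho ∘ z' -> pt ∘ z = pt ∘ z').
  { intros T z z' e. rewrite p2, <- !comp_assoc in e.
    rewrite <- (ca1 i2 (pt ∘ z)), <- (ca1 i2 (pt ∘ z')). now rewrite e. }
  exists V, Rho, ka. split; [now exists kb |].
  split; [exact OR |].
  split; [split; [now rewrite p1 |] |].
  { rewrite p2. now apply srefl_iso. }
  split; [split; [exact cm | exact (proj1 (proj2 (srefl_iso spt ij)))] |].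
  split; [split; [now rewrite p1 | split] |].
  + intros T a b y e0 e1.
    destruct (PULL T a b (i ∘ y)) as [t [t0 [t1 t2]]].
    { rewrite <- BV, e0. exact (ca OR a). }
    { rewrite <- CV, e1. exact (ca OR b). }
    exists t. split; [exact t0 |]. split; [exact t1 |].
    rewrite p2, <- comp_assoc, t2. apply (ca1 i1).
  + intros T t t' e e0 e1. exact (UNI T t t' e0 e1 (RI _ _ _ e)).
  + exists G. intros T a a' b b' e0 e1.
    destruct (KE T a a' b b') as [al [be [h0 [h1 [h2 [h3 h4]]]]]].
    { fold ps. rewrite <- OR, <- !comp_assoc. f_equal. exact e0. }
    { fold ps. rewrite <- OR, <- !comp_assoc. f_equal. exact e1. }
    exists al, be. repeat split; auto.
Qed.

Section Coh.
Variable A : AbGroup E.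

Lemma res_ag n (Z : AG Rg A (S n)) (U : E) (f : U ~> obj0 (ag_X Z)) : RegEpi (bng L U) ->
  exists (W : AG Rg A (S n)) (phi : ag_X W ~> ag_X Z) (j : obj0 (ag_X W) ~> U),
    IsIso j /\ f ∘ j = omor phi /\ Cart phi /\ presN phi /\
    (forall T (u v : T ~> cells (ag_X W)) a, par u v ->
       N (ag_D Z) (fmap cells phi ∘ u) (fmap cells phi ∘ v) a -> N (ag_D W) u v a).
Proof.
intros gU. destruct (restrict L je f) as [W [phi [j [ij [e cp]]]]].
assert (aW : AsphLocal Rg W).
{ apply (pull_asph cp (ag_as Z)). destruct ij as [j' [j1 j2]].
  apply (regepi_right Rg (f := j')).
  replace (bng L (obj0 W) ∘ j') with (bng L U) by apply one_eq. exact gU. }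
destruct (pull_dir (ag_D Z) cp) as [D hD].
exists {| ag_X := W; ag_as := aW; ag_D := D |}, phi, j.
split; [exact ij |]. split; [exact e |]. split; [exact cp |]. split.
- intros T u v a h. now apply hD in h.
- intros T u v a p h. now apply hD.
Qed.

Lemma ref_ag n (W : AG Rg A (S n)) (om : I ~> obj0 (ag_X W))
  (r : prd L (obj0 (ag_X W)) I ~> cells (ag_X W)) :
  bd (ag_X W) ∘ r = om ∘ prr _ -> bc (ag_X W) ∘ r = prl _ ->
  exists (x : AG Rg A (S n)) (rho : ag_X W ~> ag_X x),
    Levelwise SR rho /\ CommLevels (ag_X x) /\ Cart rho /\ presN rho.
Proof.
intros r0 r1.
assert (gU := asphl_gs0 (ag_as W)).
destruct (orefl_exists gU) as [R].
destruct (@lref (S n) (ag_X W) R om gU) as [x [rho [ka [_ [_ [lp [cm [cp ker]]]]]]]].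
{ split; [| now exists r].
  pose (UU := prd L (obj0 (ag_X W)) (obj0 (ag_X W))).
  destruct (asphl_conn (ag_as W) (prl UU) (prr UU)) as [T [k [t [rk [e0 e1]]]]].
  apply (regepi_local Rg (c := k) (a := t) rk).
  rewrite pc, e0, e1. apply pair_eta. }
assert (lre := lp_imp sr_re lp).
assert (ax := push_asph cp lre (ag_as W)).
destruct (push_dir Rg je (ag_D W) cp lre ker) as [D hD].
exists {| ag_X := x; ag_as := ax; ag_D := D |}, rho. auto.
Qed.

Variables (F : E) (gF : RegEpi (bng L F)) (pF : Projective F) (pFI : Projective (prd L F I)).

Lemma proj_split (T T' : E) (k : T' ~> T) : Projective T -> RegEpi k -> exists s, k ∘ s = id T.
Proof. intros hp hk. exact (hp _ _ k (id T) hk). Qed.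

(** Local connectedness is global over a projective. *)
Lemma conn_id n (Z : nGrd E (S n)) T (a b : T ~> obj0 Z) : AsphLocal Rg Z -> Projective T ->
  exists H : T ~> cells Z, IteratedId H /\ bd Z ∘ H = a /\ bc Z ∘ H = b.
Proof.
intros aZ hT. induction n as [| n IH].
- destruct (asphl_conn aZ a b) as [T' [k [t [rk [e0 e1]]]]].
  destruct (proj_split hT rk) as [s hs]. exists (t ∘ s). split; [exact Logic.I |].
  rewrite !comp_assoc, e0, e1, <- !comp_assoc, hs, !comp_idr. auto.
- destruct aZ as [aZ _]. destruct (IH (under Z) a b aZ) as [H [h0 [h1 h2]]].
  exists (idc Z ∘ H). split; [now exists H |].
  rewrite bd_idc, bc_idc. auto.
Qed.

Lemma idl_comp n (Z : nGrd E (S n)) T S (H : T ~> cells Z) (u : S ~> T) : IteratedId H -> IteratedId (H ∘ u).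
Proof.
induction n as [| n IH]; [easy |]. intros [H' [h ->]].
exists (H' ∘ u). split; [now apply IH | symmetry; apply comp_assoc].
Qed.

(** An aspherical groupoid is connected by restriction and reflection to one with
    commutative levels: first replace the objects by the projective F, then
    reflect. The intermediate groupoid has the arrows from the base point I
    required by [grefl_exists] because F x I is projective. *)
Definition ReflectedRestriction n (X x : AG Rg A (S n)) : Prop :=
  exists (W : AG Rg A (S n)) (j : obj0 (ag_X W) ~> F) (phi : ag_X W ~> ag_X X)
    (rho : ag_X W ~> ag_X x),
    IsIso j /\ Cart phi /\ presN phi /\ Levelwise SR rho /\ Cart rho /\ presN rho /\ CommLevels (ag_X x).

Lemma res_r n (W : AG Rg A (S n)) (j : obj0 (ag_X W) ~> F) (om : I ~> obj0 (ag_X W)) : IsIso j ->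
  exists r : prd L (obj0 (ag_X W)) I ~> cells (ag_X W),
    bd (ag_X W) ∘ r = om ∘ prr _ /\ bc (ag_X W) ∘ r = prl _.
Proof.
intros [j' [j1 j2]].
destruct (asphl_conn (ag_as W) (om ∘ prr (prd L F I)) (j' ∘ prl (prd L F I)))
  as [T [k [t [rk [e0 e1]]]]].
destruct (proj_split pFI rk) as [s hs].
exists (t ∘ s ∘ ⟪j ∘ prl _, prr _⟫).
rewrite !comp_assoc, e0, e1, <- !(comp_assoc _ k s), hs, !comp_idr, <- !comp_assoc.
rewrite pl, pr. split; [reflexivity | apply (ca1 j1)].
Qed.

Lemma rx_exists n (X : AG Rg A (S n)) : exists x, ReflectedRestriction X x.
Proof.
destruct (pF (bng L F) (asphl_gs0 (ag_as X))) as [f _].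
destruct (res_ag (Z := X) f gF) as [W [phi [j [ij [ej [cp [hp _]]]]]]].
pose (om := @bang _ _ iI (obj0 (ag_X W)) : I ~> obj0 (ag_X W)).
destruct (res_r om ij) as [r [r0 r1]].
destruct (ref_ag r0 r1) as [x [rho [lp [cm [cr hr]]]]].
exists x, W, j, phi, rho. exact (conj ij (conj cp (conj hp (conj lp (conj cr (conj hr cm)))))) .
Qed.

(** The construction of [ReflectedRestriction] involves the choice of a map from F to the objects,
    but two choices are joined by 1-cells, F being projective, and conjugation by
    these ([twist]) does not alter differences. *)
Lemma rx_mor n (X Z x z : AG Rg A (S n)) : ReflectedRestriction X x -> ReflectedRestriction Z z -> agmor X Z -> agmor x z.
Proof.
intros [W1 [j1 [phi1 [rho1 [i1 [c1 [n1 [l1 [k1 [m1 cm1]]]]]]]]]]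
  [W2 [j2 [phi2 [rho2 [i2 [c2 [n2 [l2 [k2 [m2 cm2]]]]]]]]]] [F0 hF0].
pose (psi := F0 ∘ phi1 : ag_X W1 ~> ag_X Z).
assert (npsi : presN (X := W1) (Y := Z) psi) by (apply (presN_comp (Y := X)); assumption).
destruct i1 as [j1' [e1 e1']], i2 as [j2' [e2 e2']].
destruct (conn_id (Z := ag_X Z) (omor psi ∘ j1') (omor phi2 ∘ j2') (ag_as Z) pF) as [H0 [hI [hb hc]]].
pose (H := H0 ∘ j1).
destruct (twist L je (W := ag_X W1) (Z := ag_X Z) (psi := psi) (H := H)) as [G [chi [o1 ch]]].
{ now apply idl_comp. }
{ unfold H. rewrite comp_assoc, hb, <- comp_assoc, e1. apply comp_idr. }
assert (oH : bc (ag_X Z) ∘ H = omor phi2 ∘ (j2' ∘ j1)).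
{ unfold H. rewrite comp_assoc, hc, <- comp_assoc. reflexivity. }
destruct (cart_lift L je (phi := phi2) (psi := chi) (h := j2' ∘ j1) c2) as [th [t1 _]];
  [congruence |].
assert (nth' : presN (X := W1) (Y := W2) th).
{ intros T u v a h.
  destruct (N_ex (ag_D W2) (par_mor th (N_par h))) as [a2 h2].
  assert (h3 := n2 _ _ _ _ h2). rewrite !comp_assoc, <- fmap_comp, t1, ch in h3.
  assert (h4 := npsi _ _ _ _ h).
  assert (b := par_b (N_par h)). destruct b as [b0 b1].
  assert (pb : bd (ag_X Z) ∘ H = omor psi).
  { unfold H. rewrite comp_assoc, hb, <- comp_assoc, e1. apply comp_idr. }
  assert (g1 : bc (ag_X Z) ∘ (inv G ∘ (H ∘ bd (ag_X W1))) = bd (ag_X Z) ∘ fmap cells psi).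
  { rewrite (ci G), comp_assoc, pb. symmetry. apply bd_nat. }
  assert (g2 : bc (ag_X Z) ∘ mul G (inv G ∘ (H ∘ bd (ag_X W1))) (fmap cells psi) = bd (ag_X Z) ∘ (H ∘ bc (ag_X W1))).
  { rewrite (c_mul L je G g1), bc_nat, (comp_assoc (bd (ag_X Z))). now rewrite pb. }
  rewrite !mul_nat in h3 by auto. rewrite <- !comp_assoc in h3. rewrite <- b0, <- b1 in h3.
  assert (h5 := N_whisk Rg je G (al := inv G ∘ (H ∘ (bd (ag_X W1) ∘ u))) (be := H ∘ (bc (ag_X W1) ∘ u)) h4).
  lapply h5; clear h5; [intros h5 | rewrite (ci G), (ca pb), bdE; reflexivity].
  lapply h5; clear h5; [intros h5 | rewrite (ca pb), bcE; reflexivity].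
  now rewrite (N_fun h5 h3). }
destruct (fact L je (pi := rho1) (rho2 ∘ th) (lp_imp sr_rf l1) cm2) as [ka hka].
exists ka. exact (presN_epi (W := W1) (X := x) (Y := z) (psi := rho2 ∘ th) k1 (lp_imp sr_re l1) m1
  (presN_comp (X := W1) (Y := W2) (Z := z) nth' m2) hka).
Qed.

Lemma rx_comm n (X x : AG Rg A (S n)) : ReflectedRestriction X x -> CommLevels (ag_X X) -> agmor x X.
Proof.
intros [W1 [j1 [phi1 [rho1 [i1 [c1 [n1 [l1 [k1 [m1 cm1]]]]]]]]]] cX.
destruct (fact L je (pi := rho1) phi1 (lp_imp sr_rf l1) cX) as [ka hka].
exists ka. exact (presN_epi (W := W1) (X := x) (Y := X) k1 (lp_imp sr_re l1) m1 n1 hka).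
Qed.

Lemma rx_conn n (X x : AG Rg A (S n)) : ReflectedRestriction X x -> Connected (@agmor _ Rg A (S n)) X x.
Proof.
intros [W1 [j1 [phi1 [rho1 [i1 [c1 [n1 [l1 [k1 [m1 cm1]]]]]]]]]].
apply (conn_rom (y := W1)); [now exists phi1 |].
apply (conn_mor (y := x)); [now exists rho1 | apply conn_refl].
Qed.

Lemma rx_comml n (X x : AG Rg A (S n)) : ReflectedRestriction X x -> CommLevels (ag_X x).
Proof. intros [W1 [j1 [phi1 [rho1 h]]]]. apply h. Qed.

Definition agmorC n (X Y : AG Rg A n) : Prop :=
  CommLevels (ag_X X) /\ CommLevels (ag_X Y) /\ agmor X Y.

(** The construction is applied to every object of a connecting zigzag, and by
    [rx_comm] the ends of the new zigzag are joined to those of the old one. *)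
Lemma conn_comm n (X Y : AG Rg A (S n)) : Connected (@agmor _ Rg A (S n)) X Y ->
  CommLevels (ag_X X) -> CommLevels (ag_X Y) -> Connected (@agmorC (S n)) X Y.
Proof.
intros h cX cY.
assert (H : forall x y, ReflectedRestriction X x -> ReflectedRestriction Y y -> Connected (@agmorC (S n)) x y).
{ clear cX cY. induction h as [X | X Y Z m h IH | X Y Z m h IH]; intros x y hx hy.
  - apply (conn_mor (y := y)); [| apply conn_refl].
    split; [exact (rx_comml hx) | split; [exact (rx_comml hy) |]].
    exact (rx_mor hx hy (agmor_refl X)).
  - destruct (rx_exists Y) as [w hw]. apply (conn_mor (y := w)); [| now apply IH].
    split; [exact (rx_comml hx) | split; [exact (rx_comml hw) |]].
    exact (rx_mor hx hw m).
  - destruct (rx_exists Y) as [w hw]. apply (conn_rom (y := w)); [| now apply IH].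
    split; [exact (rx_comml hw) | split; [exact (rx_comml hx) |]].
    exact (rx_mor hw hx m). }
destruct (rx_exists X) as [x hx], (rx_exists Y) as [y hy].
apply (conn_rom (y := x)).
- split; [exact (rx_comml hx) | split; [exact cX | exact (rx_comm hx cX)]].
- apply (conn_trans (y := y)); [now apply H |].
  apply (conn_mor (y := Y)); [| apply conn_refl].
  split; [exact (rx_comml hy) | split; [exact cY | exact (rx_comm hy cY)]].
Qed.

Lemma lprod_par n (V X Y : nGrd E (S n)) (p : V ~> X) (q : V ~> Y) T (u v : T ~> cells V) :
  LProd p q -> par (fmap cells p ∘ u) (fmap cells p ∘ v) ->
  par (fmap cells q ∘ u) (fmap cells q ∘ v) -> par u v.
Proof.
intros [hl _] [a0 a1] [b0 b1]. rewrite !domE in a0, b0. rewrite !codE in a1, b1.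
destruct (lprod_top hl) as [_ un]. split; now apply un.
Qed.

(** The two arguments are reflected one after the other, each time with the other
    one as parameter. *)
Lemma srefl_prod (A1 A2 P B1 B2 Q : E) (p : P ~> A1) (q : P ~> A2) (p' : Q ~> B1) (q' : Q ~> B2)
  (r1 : A1 ~> B1) (r2 : A2 ~> B2) (pi : P ~> Q) : IsPr p q -> IsPr p' q' ->
  p' ∘ pi = r1 ∘ p -> q' ∘ pi = r2 ∘ q -> SRefl K r1 -> SRefl K r2 -> CommQuotient pi.
Proof.
intros [ex un] [ex' un'] h1 h2 [g1 [_ s1]] [g2 [_ s2]].
assert (rp : RegEpi pi).
{ destruct (cover Rg p' g1) as [T1 [k1 [a1 [q1 e1]]]].
  destruct (cover Rg (q' ∘ k1) g2) as [T2 [k2 [a2 [q2 e2]]]].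
  destruct (ex T2 (a1 ∘ k2) a2) as [w [w1 w2]].
  apply (regepi_local Rg (c := k1 ∘ k2) (a := w)); [now apply (regepi_comp Rg) |].
  apply un'.
  - rewrite (ca h1), <- comp_assoc, w1, (comp_assoc r1), e1. now ra.
  - rewrite (ca h2), <- comp_assoc, w2, e2. now ra. }
split; [exact rp |]. intros X g cX. apply (regepi_desc rp).
intros T u v e.
assert (e1 : r1 ∘ (p ∘ u) = r1 ∘ (p ∘ v)) by (rewrite !(comp_assoc r1), <- h1, <- !comp_assoc; now rewrite e).
assert (e2 : r2 ∘ (q ∘ u) = r2 ∘ (q ∘ v)) by (rewrite !(comp_assoc r2), <- h2, <- !comp_assoc; now rewrite e).
destruct (ex _ (prl (prd L A1 A2)) (prr (prd L A1 A2))) as [i [i1 i2]].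
destruct (ex _ (prr (prd L A2 A1)) (prl (prd L A2 A1))) as [i' [i1' i2']].
assert (D1 := s1 A2 X (g ∘ i) cX T (p ∘ u) (p ∘ v) (q ∘ u) e1).
assert (D2 := s2 A1 X (g ∘ i') cX T (q ∘ u) (q ∘ v) (p ∘ v) e2).
rewrite <- !comp_assoc in D1, D2.
replace (i ∘ ⟪p ∘ u, q ∘ u⟫) with u in D1 by (symmetry; apply un; rewrite ?(ca i1), ?(ca i2); rewrite ?pl, ?pr; reflexivity).
replace (i' ∘ ⟪q ∘ v, p ∘ v⟫) with v in D2 by (symmetry; apply un; rewrite ?(ca i1'), ?(ca i2'); rewrite ?pl, ?pr; reflexivity).
rewrite D1, <- D2. f_equal. apply un.
- rewrite (ca i1), (ca i1'). now rewrite pl, pr.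
- rewrite (ca i2), (ca i2'). now rewrite pl, pr.
Qed.

Lemma lprod_rf n (V X Y V' X' Y' : nGrd E n) (p : V ~> X) (q : V ~> Y) (p' : V' ~> X') (q' : V' ~> Y')
  (r1 : X ~> X') (r2 : Y ~> Y') (pi : V ~> V') : LProd p q -> LProd p' q' ->
  p' ∘ pi = r1 ∘ p -> q' ∘ pi = r2 ∘ q -> Levelwise SR r1 -> Levelwise SR r2 -> Levelwise (@CommQuotient E) pi.
Proof.
induction n as [| n IH].
- intros h h' e1 e2 s1 s2. exact (srefl_prod h h' e1 e2 s1 s2).
- intros [h t] [h' t'] e1 e2 [l1 s1] [l2 s2]. split.
  + apply (IH _ _ _ _ _ _ (umor p) (umor q) (umor p') (umor q') (umor r1) (umor r2)); auto.
    * rewrite <- !umor_comp. now rewrite e1.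
    * rewrite <- !umor_comp. now rewrite e2.
  + apply (srefl_prod t t' (r1 := fmap cells r1) (r2 := fmap cells r2)); auto.
    * rewrite <- !fmap_comp. now rewrite e1.
    * rewrite <- !fmap_comp. now rewrite e2.
Qed.

(** For a morphism X x Y -> Z adding directions, X and Y are restricted along F and
    Z along F x F. The restriction of Z can be reflected as well: the arrows from a
    base point to all objects that this requires are the images of pairs of such
    arrows in the restrictions of X and Y. Stability of the reflections under
    products then lets the morphism descend. *)
Lemma sum_comm n (X Y Z : AG Rg A (S n)) : agsum X Y Z ->
  exists x y z, CommLevels (ag_X x) /\ CommLevels (ag_X y) /\ CommLevels (ag_X z) /\
    Connected (@agmor _ Rg A (S n)) X x /\ Connected (@agmor _ Rg A (S n)) Y y /\
    Connected (@agmor _ Rg A (S n)) Z z /\ agsum x y z.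
Proof.
intros [Q [F0 hF]].
destruct (rx_exists X) as [x hx], (rx_exists Y) as [y hy]. exists x, y.
assert (Cx := rx_conn hx). assert (Cy := rx_conn hy).
destruct hx as [W1 [j1 [phi1 [rho1 [i1 [c1 [n1 [l1 [k1 [m1 cm1]]]]]]]]]].
destruct hy as [W2 [j2 [phi2 [rho2 [i2 [c2 [n2 [l2 [k2 [m2 cm2]]]]]]]]]].
destruct (lprod_exists L je (ag_X W1) (ag_X W2)) as [V [p [q hV]]].
pose (e := pr_pair Q (phi1 ∘ p) (phi2 ∘ q) : V ~> prod_ob Q).
assert (e1 : prl Q ∘ e = phi1 ∘ p) by apply prl_pair.
assert (e2 : prr Q ∘ e = phi2 ∘ q) by apply prr_pair.
destruct (lprod_obj hV) as [exO unO].
assert (gV : RegEpi (bng L (obj0 V))).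
{ destruct (cover Rg (id (lx_one L)) (asphl_gs0 (ag_as W1))) as [T1 [b1 [a1 [q1 _]]]].
  destruct (cover Rg b1 (asphl_gs0 (ag_as W2))) as [T2 [b2 [a2 [q2 _]]]].
  destruct (exO T2 (a1 ∘ b2) a2) as [w _].
  apply (regepi_local Rg (c := b1 ∘ b2) (a := w)); [now apply (regepi_comp Rg) | apply one_eq]. }
destruct (res_ag (Z := Z) (omor (F0 ∘ e)) gV) as [W3 [phi3 [j3 [[j3' [a3 b3]] [ej3 [c3 [n3 n3']]]]]]].
destruct (cart_lift L je (phi := phi3) (psi := F0 ∘ e) (h := j3') c3) as [xi [x1 x2]].
{ rewrite <- ej3, <- comp_assoc, b3. apply comp_idr. }
pose (o1 := @bang _ _ iI (obj0 (ag_X W1)) : I ~> obj0 (ag_X W1)).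
pose (o2 := @bang _ _ iI (obj0 (ag_X W2)) : I ~> obj0 (ag_X W2)).
pose (o3 := @bang _ _ iI (obj0 (ag_X W3)) : I ~> obj0 (ag_X W3)).
pose (oV := @bang _ _ iI (obj0 V) : I ~> obj0 V).
destruct (res_r o1 i1) as [r1 [d1 f1]]. destruct (res_r o2 i2) as [r2 [d2 f2]].
pose (P3 := prd L (obj0 (ag_X W3)) I).
destruct (proj1 (lprod_top hV) P3 (r1 ∘ ⟪omor p ∘ j3 ∘ prl P3, prr P3⟫)
  (r2 ∘ ⟪omor q ∘ j3 ∘ prl P3, prr P3⟫)) as [v [v1 v2]].
destruct (@ref_ag n W3 o3 (fmap cells xi ∘ v)) as [z [rho3 [l3 [cm3 [k3 m3]]]]].
{ rewrite bdE, x2. replace (bd V ∘ v) with (oV ∘ prr P3).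
  - rewrite comp_assoc. f_equal. apply iniE.
  - apply unO; rewrite <- bdE, ?v1, ?v2, (comp_assoc (bd _)), ?d1, ?d2, (comp_assoc _ oV), <- (comp_assoc _ (prr _));
      rewrite pr; f_equal; apply iniE. }
{ rewrite bcE, x2. replace (bc V ∘ v) with (j3 ∘ prl P3).
  - apply (ca1 a3).
  - apply unO; rewrite <- bcE, ?v1, ?v2, (comp_assoc (bc _)), ?f1, ?f2; rewrite pl; apply comp_assoc. }
exists z. split; [exact cm1 |]. split; [exact cm2 |]. split; [exact cm3 |].
split; [exact Cx |]. split; [exact Cy |]. split.
{ apply (conn_rom (y := W3)); [now exists phi3 |].
  apply (conn_mor (y := z)); [now exists rho3 | apply conn_refl]. }
destruct (lprod_exists L je (ag_X x) (ag_X y)) as [V' [p' [q' hV']]].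
destruct (lprod_product L je hV') as [isp].
destruct (lprod_ex L je (rho1 ∘ p) (rho2 ∘ q) hV') as [pi [pi1 pi2]].
assert (lpi := lprod_rf hV hV' pi1 pi2 l1 l2).
destruct (fact L je (pi := pi) (rho3 ∘ xi) lpi cm3) as [ka hka].
exists {| prod_ob := V'; prl := p'; prr := q'; prod_is := isp |}, ka.
intros T u w a a' pp h1 h2. change (T ~> cells V') in u, w.
change (N (ag_D x) (fmap cells p' ∘ u) (fmap cells p' ∘ w) a) in h1.
change (N (ag_D y) (fmap cells q' ∘ u) (fmap cells q' ∘ w) a') in h2.
change (N (ag_D z) (fmap cells ka ∘ u) (fmap cells ka ∘ w) (plus a a')).
destruct (presN_lift k1 (lp_imp sr_re l1) m1 h1) as [T1 [t1 [u1 [w1 [g1 [ga1 [gb1 h1']]]]]]].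
assert (h2' := N_nat t1 h2).
destruct (presN_lift k2 (lp_imp sr_re l2) m2 h2') as [T2 [t2 [u2 [w2 [g2 [ga2 [gb2 h2'']]]]]]].
destruct (proj1 (lprod_top hV) T2 (u1 ∘ t2) u2) as [u' [su1 su2]].
destruct (proj1 (lprod_top hV) T2 (w1 ∘ t2) w2) as [w' [sw1 sw2]].
apply (dir_local (k := t1 ∘ t2)); [now apply (regepi_comp Rg) |].
assert (h3 := N_nat t2 h1'). rewrite <- su1, <- sw1 in h3. rewrite <- su2, <- sw2 in h2''.
assert (puw : par u' w') by exact (lprod_par hV (N_par h3) (N_par h2'')).
assert (hF' := hF T2 (fmap cells e ∘ u') (fmap cells e ∘ w') (a ∘ t1 ∘ t2) (a' ∘ t1 ∘ t2) (par_mor e puw)).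
rewrite !comp_assoc, <- !fmap_comp, e1, e2, !fmap_comp, <- !(comp_assoc _ _ u'), <- !(comp_assoc _ _ w') in hF'.
specialize (hF' (n1 _ _ _ _ h3) (n2 _ _ _ _ h2'')).
assert (h4 : N (ag_D W3) (fmap cells xi ∘ u') (fmap cells xi ∘ w') (plus (a ∘ t1 ∘ t2) (a' ∘ t1 ∘ t2))).
{ apply n3'; [now apply par_mor |].
  rewrite !comp_assoc, <- !fmap_comp, x1, !fmap_comp, <- !comp_assoc. rewrite <- !comp_assoc in hF'. exact hF'. }
apply m3 in h4.
assert (EU : fmap cells pi ∘ u' = u ∘ (t1 ∘ t2) /\ fmap cells pi ∘ w' = w ∘ (t1 ∘ t2)).
{ split; apply (proj2 (lprod_top hV')).
  - rewrite comp_assoc, <- fmap_comp, pi1, fmap_comp, <- comp_assoc, su1, (comp_assoc _ u1), ga1. now ra.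
  - rewrite comp_assoc, <- fmap_comp, pi2, fmap_comp, <- comp_assoc, su2, ga2. now ra.
  - rewrite comp_assoc, <- fmap_comp, pi1, fmap_comp, <- comp_assoc, sw1, (comp_assoc _ w1), gb1. now ra.
  - rewrite comp_assoc, <- fmap_comp, pi2, fmap_comp, <- comp_assoc, sw2, gb2. now ra. }
destruct EU as [EU EW].
rewrite !comp_assoc, <- !fmap_comp, <- hka, !fmap_comp, <- !(comp_assoc _ _ u'), <- !(comp_assoc _ _ w'), EU, EW in h4.
rewrite plus_nat, !comp_assoc. rewrite !comp_assoc in h4. exact h4.
Qed.
End Coh.
End Reflection.

(** * The category of commutative objects *)

Section InM.
Variables (E : Category) (R : RegCtx E) (je : JE E).
Notation L := (rx_lex R).
Notation ME := (M E).
Notation inE X := (proj1_sig (X : ME)).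

Ltac me := cbn [M FullSub Hom comp id] in *.

Definition mk_ME (X : E) (h : Commutative X) : ME := exist _ X h.

Lemma hasprod : HasProducts E.
Proof. intros X Y. constructor. apply (prd L). Qed.

Lemma comm_prd (A B : E) (P : Product A B) : Commutative A -> Commutative B -> Commutative P.
Proof. apply commutative_prod, hasprod. Qed.

Lemma comm_iso (X Y : E) (i : X ~> Y) : IsIso i -> Commutative X -> Commutative Y.
Proof. intros hi. apply (comm_quot R je (q := i)). now apply iso_regepi. Qed.

Definition oneM : ME := mk_ME (commutative_terminal hasprod (lx_term L)).

Definition termM : is_terminal oneM :=
  @Build_is_terminal ME oneM (fun X => bng L (inE X))
    (fun X f g => one_eq (L := L) (f : inE X ~> lx_one L) g).

Definition pbM (A B Z : ME) (f : A ~> Z) (g : B ~> Z) : @Pbk ME A B Z f g.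
Proof.
pose (P := lx_pb L (f : inE A ~> inE Z) (g : inE B ~> inE Z)).
pose (PM := mk_ME (comm_pb L je (proj2_sig A) (proj2_sig B) (proj2_sig Z) (pbi P))).
refine (@Build_Pbk ME A B Z f g PM (pp0 P) (pp1 P) _).
apply (@mk_pb ME).
- exact (pb_sq (pbi P)).
- intros T a b e. exact (pb_ex (pbi P) (T := inE T) (a := a) (b := b) e).
- intros T u v. exact (@pb_uniq _ _ _ _ _ _ _ _ _ (pbi P) (inE T) u v).
Defined.

Definition lexM : Lex ME := @Build_Lex ME oneM termM pbM.

(** Finite limits, regular epimorphisms and isomorphisms of M(E) are those of E,
    since commutative objects are closed under finite limits and quotients. *)
Lemma m_pb (A B Z P : ME) (f : A ~> Z) (g : B ~> Z) (p : P ~> A) (q : P ~> B) :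
  is_pullback f g p q ->
  inhabited (@is_pullback E (inE A) (inE B) (inE Z) (inE P) f g p q).
Proof.
intros pb.
pose (P' := lx_pb L (f : inE A ~> inE Z) (g : inE B ~> inE Z)).
pose (PM := mk_ME (comm_pb L je (proj2_sig A) (proj2_sig B) (proj2_sig Z) (pbi P'))).
destruct (@pb_ex ME _ _ _ _ _ _ _ _ pb PM (pp0 P') (pp1 P') (pb_sq (pbi P'))) as [i [i0 i1]].
destruct (pb_ex (pbi P') (a := (p : inE P ~> inE A)) (b := (q : inE P ~> inE B)) (pb_sq pb)) as [j [j0 j1]].
assert (ij : @comp ME P PM P i j = id P).
{ apply (pb_uniq pb).
  - rewrite comp_assoc. rewrite i0, comp_idr. exact j0.
  - rewrite comp_assoc. rewrite i1, comp_idr. exact j1. }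
me. constructor. apply mk_pb.
- exact (pb_sq pb).
- intros T a b e. destruct (pb_ex (pbi P') e) as [w [w0 w1]]. exists (@comp E _ _ _ i w).
  split; [rewrite (ca i0) | rewrite (ca i1)]; assumption.
- intros T u v e0 e1. rewrite <- (ca1 ij u), <- (ca1 ij v). f_equal.
  apply (pb_uniq (pbi P')); [rewrite !(ca j0) | rewrite !(ca j1)]; assumption.
Qed.

Lemma m_prod (A B P : ME) (p : P ~> A) (q : P ~> B) :
  is_product p q -> inhabited (@is_product E (inE A) (inE B) (inE P) p q).
Proof.
intros pd.
pose (P' := prd L (inE A) (inE B)).
pose (PM := mk_ME (comm_prd P' (proj2_sig A) (proj2_sig B))).
pose (i := @pair ME _ _ _ _ _ pd PM (prl P') (prr P')).
assert (i0 : @comp E _ _ _ p i = prl P') by exact (@pair_l ME _ _ _ _ _ pd PM (prl P') (prr P')).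
assert (i1 : @comp E _ _ _ q i = prr P') by exact (@pair_r ME _ _ _ _ _ pd PM (prl P') (prr P')).
pose (j := pr_pair P' (p : inE P ~> inE A) (q : inE P ~> inE B)).
assert (ij : @comp E _ _ _ i j = id (inE P)).
{ apply (pair_uniq pd (T := P) (u := @comp ME P PM P i j) (v := id P)); me.
  - rewrite (ca i0), comp_idr. apply prl_pair.
  - rewrite (ca i1), comp_idr. apply prr_pair. }
constructor.
refine (@Build_is_product E _ _ _ p q (fun T a b => @comp E _ _ _ i (pr_pair P' a b)) _ _ _).
- intros. rewrite (ca i0). apply prl_pair.
- intros. rewrite (ca i1). apply prr_pair.
- intros T u v e0 e1.
  assert (ju : j ∘ u = j ∘ v) by (unfold j; apply prod_eq; rewrite !comp_assoc, ?prl_pair, ?prr_pair; assumption).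
  exact (eq_trans (eq_sym (ca1 ij u)) (eq_trans (f_equal (fun h => @comp E _ _ _ i h) ju) (ca1 ij v))).
Qed.

Lemma jeM : JE ME.
Proof.
intros A B Z P f g p q pb s t h1 h2 ja jb h3 h4 h5 h6 W u v e0 e1.
destruct (m_pb pb) as [pbE].
exact (je pbE h1 h2 h3 h4 h5 h6 e0 e1).
Qed.

(** The image in E of a map between commutative objects is commutative, as a
    quotient of its domain. *)
Lemma regepi_M (X Y : ME) (f : X ~> Y) : RegEpi f <-> @RegEpi E (inE X) (inE Y) f.
Proof.
assert (EM : forall (X Y : ME) (f : X ~> Y), @RegEpi E (inE X) (inE Y) f -> RegEpi f).
{ clear X Y f. intros X Y f hf.
  pose (K := lx_pb lexM f f). exists (pbo K), (pp0 K), (pp1 K). apply coeqP. split.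
  - exact (pb_sq (pbi K)).
  - intros T t e.
    destruct (m_pb (pbi K)) as [pbE].
    destruct (regepi_desc (C := E) (g := (t : inE X ~> inE T)) hf) as [u hu].
    { intros S a b eab. destruct (pb_ex pbE eab) as [w [w0 w1]]. me.
      rewrite <- w0, <- w1, !comp_assoc. f_equal. exact e. }
    exists u. split; [exact hu |].
    intros u' hu'. apply (regepi_epi hf). me. congruence. }
split; [| apply EM].
intros hf.
destruct (image R (f : inE X ~> inE Y)) as [I [q [m [rq [mm e]]]]].
pose (IM := mk_ME (comm_quot R je rq (proj2_sig X))).
destruct (regepi_strong (C := ME) (q := f) (m := (m : IM ~> Y)) (h := (q : X ~> IM)) hf)
  as [j [j1 j2]].
- intros T u v. apply (mm (inE T)).
- exact e.
- me. rewrite <- e. apply regepi_iso_l; [exact rq |]. exists j. split; assumption.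
Qed.

Definition regM : RegCtx ME.
Proof.
refine {| rx_lex := lexM |}.
- intros X Y K f p0 p1 [hk].
  destruct (m_pb hk) as [hE].
  destruct (rx_kp R (inhabits hE)) as [Q [q hq]].
  assert (rq : RegEpi q) by (exists (inE K), p0, p1; exact hq).
  pose (QM := mk_ME (comm_quot R je rq (proj2_sig X))).
  exists QM, q. apply coeqP in hq. apply coeqP. destruct hq as [h1 h2]. split; [exact h1 |].
  intros T t e. exact (h2 (inE T) t e).
- intros A B Z P f g p q [pb] hf.
  apply regepi_M. apply regepi_M in hf. destruct (m_pb pb) as [pbE].
  exact (rx_st R (inhabits pbE) hf).
Defined.

Lemma comm_in_M (X : ME) : @Commutative ME X.
Proof.
destruct X as [X [p]].
apply commutative_of_nat with (1 := fun A B => inhabits (prd lexM A B))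
  (f := fun T (x y z : inE T ~> X) => mal p x y z).
- intros T S x y z u. exact (mal_nat p (T := inE T) (S := inE S) x y z u).
- intros T x y. exact (mal_xyy p (T := inE T) x y).
- intros T x y. exact (mal_xxy p (T := inE T) x y).
Qed.

Lemma iso_M (X Y : ME) (f : X ~> Y) : IsIso f <-> @IsIso E (inE X) (inE Y) f.
Proof. split; intros [g h]; exists g; exact h. Qed.
End InM.

(** * Higher groupoids in the category of commutative objects *)

Section Compare.
Variables (E : Category) (R : RegCtx E) (je : JE E).
Notation L := (rx_lex R).
Notation ME := (M E).
Notation inE X := (proj1_sig (X : ME)).
Notation RM := (regM R je).
Notation LM := (lexM R je).
Notation jM := (jeM R je).
Notation "g ⋆ f" := (@comp E _ _ _ g f) (at level 40, left associativity).

(** Having isomorphic underlying globular objects is all that an n-groupoid in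
    M(E) and one in E can be asked to share without an equality of objects in
    dependent types; by [nGrd_mor] it suffices for functors to correspond. *)
Fixpoint LevelIso (n : nat) : forall (X : nGrd ME n) (Y : nGrd E n),
    (inE (cells X) ~> cells Y) -> Prop :=
  match n return forall (X : nGrd ME n) (Y : nGrd E n),
    (inE (cells X) ~> cells Y) -> Prop with
  | O => fun X Y i => IsIso i
  | S m => fun X Y i => IsIso i /\ exists i' : inE (cells (under X)) ~> cells (under Y),
      @LevelIso m (under X) (under Y) i' /\
      dom Y ⋆ i = i' ⋆ dom X /\ cod Y ⋆ i = i' ⋆ cod X /\ i ⋆ idc X = idc Y ⋆ i'
  end.
Arguments LevelIso {n} X Y i.

Lemma li_iso n (X : nGrd ME n) (Y : nGrd E n) i : LevelIso X Y i -> IsIso i.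
Proof. destruct n; [easy | now intros [h _]]. Qed.

Lemma li_comm n (X : nGrd ME n) (Y : nGrd E n) i : LevelIso X Y i -> CommLevels Y.
Proof.
induction n as [| n IH].
- intros h. exact (comm_iso R je h (proj2_sig (cells X))).
- intros [h [i' [h' _]]]. split; [exact (IH _ _ _ h') |].
  exact (comm_iso R je h (proj2_sig (cells X))).
Qed.

Lemma iso_mono (A B : E) (i : A ~> B) T (u v : T ~> A) : IsIso i -> i ∘ u = i ∘ v -> u = v.
Proof. intros [j [h _]] e. rewrite <- (ca1 h u), <- (ca1 h v). now rewrite e. Qed.

Lemma li_par n (X : nGrd ME n) (Y : nGrd E n) i : LevelIso X Y i ->
  forall (T : ME) (u v : T ~> cells X),
    par u v <-> @par E n Y (inE T) (i ⋆ u) (i ⋆ v).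
Proof.
destruct n as [| n]; [easy |].
intros [h [i' [h' [hd [hc hs]]]]] T u v.
assert (hi := li_iso h').
split; intros [a b]; split.
- rewrite !(ca hd), <- !comp_assoc. exact (f_equal (fun k => i' ⋆ k) a).
- rewrite !(ca hc), <- !comp_assoc. exact (f_equal (fun k => i' ⋆ k) b).
- rewrite !(ca hd), <- !comp_assoc in a. exact (iso_mono hi a).
- rewrite !(ca hc), <- !comp_assoc in b. exact (iso_mono hi b).
Qed.

(** Globular objects with commutative levels are higher groupoids in either
    category, by [comm_gpd], so each side determines the other. *)
Lemma li_E n (X : nGrd ME n) : exists (Y : nGrd E n) i, LevelIso X Y i.
Proof.
induction n as [| m IH].
- exists (existT _ tt (inE (cells X)) : nGrd E 0), (id _). exists (id _). split; apply comp_idl.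
- destruct (IH (under X)) as [Y [i' h']].
  assert (hi := li_iso h'). destruct hi as [j [j1 j2]].
  pose (d := i' ⋆ dom X). pose (c := i' ⋆ cod X). pose (s := @comp E _ _ (inE (cells X)) (idc X) j).
  assert (ds0 : d ∘ s = id _).
  { unfold d, s. rewrite <- comp_assoc, (comp_assoc (dom X : inE (cells X) ~> inE (cells (under X)))).
    refine (eq_trans (f_equal (fun k => i' ⋆ (k ⋆ j)) (dom_idc X)) _).
    refine (eq_trans (f_equal (fun k => i' ⋆ k) (comp_idl j)) j2). }
  assert (cs0 : c ∘ s = id _).
  { unfold c, s. rewrite <- comp_assoc, (comp_assoc (cod X : inE (cells X) ~> inE (cells (under X)))).
    refine (eq_trans (f_equal (fun k => i' ⋆ (k ⋆ j)) (cod_idc X)) _).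
    refine (eq_trans (f_equal (fun k => i' ⋆ k) (comp_idl j)) j2). }
  assert (pp : par d c) by exact (proj1 (li_par h' _ _) (par_dc X)).
  assert (GG : inhabited (Gpd (bd Y ∘ d) (bc Y ∘ c) (s ∘ bs Y))).
  { apply (comm_gpd L je).
    - exact (proj2_sig (cells X)).
    - exact (comml_obj (li_comm h')).
    - rewrite <- comp_assoc, (ca1 ds0). apply bd_bs.
    - rewrite <- comp_assoc, (ca1 cs0). apply bc_bs. }
  destruct (nGrd_build L je {| rd := d; rc := c; rs := s; rds := ds0; rcs := cs0;
    rpar := pp; rgp := GG |}) as [V1 [k [[k' [k1 k2]] [hd [hc hs]]]]]. simpl in hd, hc, hs.
  set (V := tot (n := S m) V1 : nGrd E (S m)) in *.
  exists V, k'. split; [exists k; auto |]. exists i'. split; [exact h' |].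
  split; [| split].
  + refine (eq_trans (f_equal (fun h => h ∘ k') (eq_sym hd)) _).
    exact (eq_trans (eq_sym (comp_assoc d k k')) (eq_trans (f_equal (fun h => d ∘ h) k2) (comp_idr d))).
  + refine (eq_trans (f_equal (fun h => h ∘ k') (eq_sym hc)) _).
    exact (eq_trans (eq_sym (comp_assoc c k k')) (eq_trans (f_equal (fun h => c ∘ h) k2) (comp_idr c))).
  + assert (Q : k' ∘ s = idc V) by (rewrite <- hs; exact (ca1 k1 (idc V))).
    rewrite <- Q. unfold s.
    refine (eq_sym (eq_trans (eq_sym (comp_assoc _ _ _)) (f_equal (fun h => k' ∘ h) _))).
    refine (eq_trans (eq_sym (comp_assoc _ _ _)) _).
    exact (eq_trans (f_equal (fun h => @comp E _ _ (inE (cells X)) (idc X) h) j1) (comp_idr (c := E) _)).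
Qed.

Lemma li_M n (Y : nGrd E n) : CommLevels Y -> exists (X : nGrd ME n) i, LevelIso X Y i.
Proof.
induction n as [| m IH].
- intros cY. exists (existT _ tt (mk_ME cY) : nGrd ME 0), (id _). exists (id _). split; apply comp_idl.
- intros [cu cY]. destruct (IH (under Y) cu) as [X [i' h']].
  assert (hi := li_iso h'). destruct hi as [j [j1 j2]].
  pose (Z := mk_ME cY).
  pose (d := (j ⋆ dom Y : inE Z ~> inE (cells X)) : @Hom ME Z (cells X)).
  pose (c := (j ⋆ cod Y : inE Z ~> inE (cells X)) : @Hom ME Z (cells X)).
  pose (s := (idc Y ⋆ i' : inE (cells X) ~> inE Z) : @Hom ME (cells X) Z).
  assert (ds0 : d ∘ s = id _).
  { change ((j ⋆ dom Y) ⋆ (idc Y ⋆ i') = id _).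
    now rewrite <- comp_assoc, (ca1 (dom_idc Y)). }
  assert (cs0 : c ∘ s = id _).
  { change ((j ⋆ cod Y) ⋆ (idc Y ⋆ i') = id _).
    now rewrite <- comp_assoc, (ca1 (cod_idc Y)). }
  assert (pp : par d c).
  { apply (li_par h'). change (@par E m (under Y) (cells Y) (i' ⋆ (j ⋆ dom Y)) (i' ⋆ (j ⋆ cod Y))).
    rewrite !(ca1 j2). apply par_dc. }
  assert (GG : inhabited (Gpd (bd X ∘ d) (bc X ∘ c) (s ∘ bs X))).
  { apply (comm_gpd LM jM).
    - apply (comm_in_M R je).
    - apply (comm_in_M R je).
    - rewrite <- comp_assoc, (ca1 ds0). apply bd_bs.
    - rewrite <- comp_assoc, (ca1 cs0). apply bc_bs. }
  destruct (nGrd_build LM jM {| rd := d; rc := c; rs := s; rds := ds0; rcs := cs0;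
    rpar := pp; rgp := GG |}) as [V1 [k [hk [hd [hc hs]]]]]. simpl in hd, hc, hs.
  set (V := tot (n := S m) V1 : nGrd ME (S m)) in *.
  exists V, k. split; [exact (proj1 (iso_M _) hk) |]. exists i'. split; [exact h' |].
  split; [| split].
  + refine (eq_trans _ (f_equal (fun h => i' ⋆ h) hd)).
    refine (eq_trans _ (eq_sym (comp_assoc (c := E) i' (j ⋆ dom Y) k))).
    exact (eq_sym (f_equal (fun h => h ⋆ k) (ca1 j2 (dom Y)))).
  + refine (eq_trans _ (f_equal (fun h => i' ⋆ h) hc)).
    refine (eq_trans _ (eq_sym (comp_assoc (c := E) i' (j ⋆ cod Y) k))).
    exact (eq_sym (f_equal (fun h => h ⋆ k) (ca1 j2 (cod Y)))).
  + exact hs.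
Qed.

Lemma li_mor n (X X2 : nGrd ME n) (Y Y2 : nGrd E n) i i2 (F : X ~> X2) :
  LevelIso X Y i -> LevelIso X2 Y2 i2 ->
  exists G : Y ~> Y2, fmap cells G ⋆ i = i2 ⋆ fmap cells F.
Proof.
induction n as [| m IH].
- intros [j [j1 j2]] _. exists (i2 ⋆ fmap cells F ⋆ j).
  refine (eq_trans (eq_sym (comp_assoc (c := E) (i2 ⋆ fmap cells F) j i)) _).
  rewrite j1. apply comp_idr.
- intros [[j [j1 j2]] [i' [h' [hd [hc hs]]]]] [_ [i2' [h2' [hd2 [hc2 hs2]]]]].
  destruct (IH _ _ _ _ _ _ (umor F) h' h2') as [G hG].
  assert (FD := dom_nat F). assert (FC := cod_nat F). assert (FS := idc_nat F).
  change (dom X2 ⋆ fmap cells F = fmap cells (umor F) ⋆ dom X) in FD.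
  change (cod X2 ⋆ fmap cells F = fmap cells (umor F) ⋆ cod X) in FC.
  change (fmap cells F ⋆ idc X = idc X2 ⋆ fmap cells (umor F)) in FS.
  destruct (li_iso h') as [j' [j1' j2']].
  destruct (nGrd_mor L je (X := Y) (Y := Y2) (F := G) (u := i2 ⋆ fmap cells F ⋆ j)) as [H [e1 e2]].
  + rewrite <- !comp_assoc, (ca hd2), <- comp_assoc, (ca FD), <- comp_assoc, (ca (eq_sym hG)).
    rewrite <- comp_assoc, (ca (eq_sym hd)), <- (comp_assoc (dom Y)), j2, comp_idr. reflexivity.
  + rewrite <- !comp_assoc, (ca hc2), <- comp_assoc, (ca FC), <- comp_assoc, (ca (eq_sym hG)).
    rewrite <- comp_assoc, (ca (eq_sym hc)), <- (comp_assoc (cod Y)), j2, comp_idr. reflexivity.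
  + assert (Q : j ⋆ idc Y = idc X ⋆ j').
    { rewrite <- (comp_idr (idc Y)), <- j2', (ca (eq_sym hs)), <- (comp_assoc i), (ca1 j1). reflexivity. }
    rewrite <- (comp_assoc _ j), Q, <- comp_assoc, (ca FS), <- comp_assoc, (ca hs2), <- comp_assoc, (ca (eq_sym hG)).
    rewrite <- comp_assoc, j2', comp_idr. reflexivity.
  + exists H. rewrite e2, <- comp_assoc, j1. apply comp_idr.
Qed.

Lemma li_mor' n (X X2 : nGrd ME n) (Y Y2 : nGrd E n) i i2 (G : Y ~> Y2) :
  LevelIso X Y i -> LevelIso X2 Y2 i2 ->
  exists F : X ~> X2, fmap cells G ⋆ i = i2 ⋆ fmap cells F.
Proof.
induction n as [| m IH].
- intros _ [j2 [h1 h2]]. exists (j2 ⋆ (fmap cells G ⋆ i)).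
  exact (eq_sym (ca1 h2 (fmap cells G ⋆ i))).
- intros [_ [i' [h' [hd [hc hs]]]]] [[j2 [h1 h2]] [i2' [h2' [hd2 [hc2 hs2]]]]].
  destruct (IH _ _ _ _ _ _ (umor G) h' h2') as [F hF].
  assert (hi2 := li_iso h2').
  set (u := j2 ⋆ (fmap cells G ⋆ i) : inE (cells X) ~> inE (cells X2)).
  assert (hu : i2 ⋆ u = fmap cells G ⋆ i) by apply (ca1 h2).
  assert (iA : IsIso i2) by (exists j2; auto).
  destruct (@nGrd_mor ME LM jM m X X2 F u) as [H [e1 e2]].
  + apply (iso_mono hi2). change (i2' ⋆ (dom X2 ⋆ u) = i2' ⋆ (fmap cells F ⋆ dom X)).
    rewrite (ca (eq_sym hd2)), <- comp_assoc, hu, (ca (dom_nat G)), <- comp_assoc, hd.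
    rewrite (ca hF), <- comp_assoc. reflexivity.
  + apply (iso_mono hi2). change (i2' ⋆ (cod X2 ⋆ u) = i2' ⋆ (fmap cells F ⋆ cod X)).
    rewrite (ca (eq_sym hc2)), <- comp_assoc, hu, (ca (cod_nat G)), <- comp_assoc, hc.
    rewrite (ca hF), <- comp_assoc. reflexivity.
  + apply (iso_mono iA). change (i2 ⋆ (u ⋆ idc X) = i2 ⋆ (idc X2 ⋆ fmap cells F)).
    rewrite (ca hu), <- comp_assoc, hs, (ca (idc_nat G)), <- comp_assoc, hF.
    rewrite (ca hs2), <- comp_assoc. reflexivity.
  + exists H. rewrite <- hu. exact (f_equal (fun k => i2 ⋆ k) (eq_sym e2)).
Qed.

Lemma ispar_comm n (Y : nGrd E n) (P : E) (p0 p1 : P ~> cells Y) : CommLevels Y -> IsPar p0 p1 ->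
  Commutative P.
Proof.
destruct n as [| n].
- intros c [_ [ex un]]. apply (comm_pb L je (f := bng L (cells Y)) (g := bng L (cells Y)) (p := p0) (q := p1)); auto.
  + apply commutative_terminal; [exact (hasprod R) | apply lx_term].
  + apply mk_pb; [apply one_eq | | exact un]. intros T a b _. now apply ex.
- intros [cu c] [[h0 h1] [ex un]].
  pose (D := prd L (cells (under Y)) (cells (under Y))).
  apply (comm_pb L je (f := pr_pair D (dom Y) (cod Y)) (g := pr_pair D (dom Y) (cod Y)) (p := p0) (q := p1)); auto.
  + apply (comm_prd R); apply comml_top, cu.
  + apply mk_pb; [| | exact un].
    * rewrite !pr_pair_comp. congruence.
    * intros T a b e. rewrite !pr_pair_comp in e. apply ex. split.
      -- apply (f_equal (fun h => prl D ∘ h)) in e. now rewrite !prl_pair in e.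
      -- apply (f_equal (fun h => prr D ∘ h)) in e. now rewrite !prr_pair in e.
Qed.

Lemma li_ispar n (X : nGrd ME n) (Y : nGrd E n) i (P : ME) (p0 p1 : P ~> cells X) :
  LevelIso X Y i -> IsPar p0 p1 -> @IsPar E n Y (inE P) (i ⋆ p0) (i ⋆ p1).
Proof.
intros h [pp [ex un]].
destruct (ispar_exists L Y) as [Q [q0 [q1 hQ]]].
assert (cQ := ispar_comm (li_comm h) hQ).
destruct hQ as [pq [exq unq]].
pose (QM := mk_ME cQ).
destruct (li_iso h) as [j [j1 j2]].
destruct (ex QM (j ⋆ q0) (j ⋆ q1)) as [a [a0 a1]].
{ apply (li_par h). change (par (i ⋆ (j ⋆ q0)) (i ⋆ (j ⋆ q1))). now rewrite !(ca1 j2). }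
assert (pp' := proj1 (li_par h _ _) pp).
destruct (exq _ _ _ pp') as [b [b0 b1]].
change (p0 ⋆ a = j ⋆ q0) in a0. change (p1 ⋆ a = j ⋆ q1) in a1.
assert (ab : @comp E _ _ _ a b = id (inE P)).
{ apply (un P (a ⋆ b) (id _)); [change (p0 ⋆ (a ⋆ b) = p0 ⋆ id _) | change (p1 ⋆ (a ⋆ b) = p1 ⋆ id _)].
  - rewrite (ca a0), <- comp_assoc, b0, (ca1 j1). now rewrite comp_idr.
  - rewrite (ca a1), <- comp_assoc, b1, (ca1 j1). now rewrite comp_idr. }
split; [exact pp' |]. split.
- intros T u v huv. destruct (exq _ _ _ huv) as [w [w0 w1]]. exists (a ⋆ w).
  rewrite <- !comp_assoc, (ca a0), (ca a1), <- !comp_assoc, !(ca1 j2). auto.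
- intros T w w' e0 e1.
  assert (Q' : b ⋆ w = b ⋆ w').
  { apply unq; rewrite ?(ca b0), ?(ca b1); assumption. }
  exact (eq_trans (eq_sym (ca1 ab w)) (eq_trans (f_equal (fun h => a ⋆ h) Q') (ca1 ab w'))).
Qed.

Lemma li_asph n (X : nGrd ME n) (Y : nGrd E n) i : LevelIso X Y i ->
  (AsphLocal RM X <-> AsphLocal R Y).
Proof.
induction n as [| n IH].
- intros [j [j1 j2]].
  assert (K : AsphLocal RM X <-> RegEpi (bng L (inE (cells X)))) by exact (regepi_M R je (bng LM (cells X))).
  rewrite K. change (RegEpi (bng L (inE (cells X))) <-> RegEpi (bng L (cells Y))). split; intros h.
  + apply (regepi_right R (f := i)).
    replace (bng L (cells Y) ∘ i) with (bng L (inE (cells X))) by apply one_eq. exact h.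
  + apply (regepi_right R (f := j)).
    replace (bng L (inE (cells X)) ∘ j) with (bng L (cells Y)) by apply one_eq. exact h.
- intros [[j [j1 j2]] [i' [h' [hd [hc hs]]]]].
  specialize (IH _ _ _ h').
  destruct (ispar_exists LM (under X)) as [Q [q0 [q1 hQ]]].
  destruct (proj1 (proj2 hQ) _ _ _ (par_dc X)) as [c [c0 c1]].
  assert (hQ' := li_ispar h' hQ).
  assert (A1 := asphl_core RM hQ c0 c1).
  assert (A2 := asphl_core R (X := Y) (c := c ⋆ j) hQ').
  change (q0 ⋆ c = dom X) in c0. change (q1 ⋆ c = cod X) in c1.
  lapply A2; clear A2; [intros A2 |].
  2:{ rewrite <- comp_assoc, (ca c0), (ca (eq_sym hd)), <- comp_assoc, j2. apply comp_idr. }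
  lapply A2; clear A2; [intros A2 |].
  2:{ rewrite <- comp_assoc, (ca c1), (ca (eq_sym hc)), <- comp_assoc, j2. apply comp_idr. }
  assert (K : RegEpi c <-> RegEpi (c ⋆ j)).
  { rewrite (regepi_M R je c). split; intros h.
    - apply (regepi_right R (f := i)). rewrite <- comp_assoc, j1. now rewrite comp_idr.
    - exact (regepi_right R h). }
  simpl AsphLocal. rewrite <- A1, <- A2, K, IH. reflexivity.
Qed.
End Compare.
Arguments LevelIso {E n} X Y i.

(** * Directions in the two categories *)

Section Compare.
Variables (E : Category) (R : RegCtx E) (je : JE E) (hp : HasProducts E) (A : AbGroup E).
Notation L := (rx_lex R).
Notation ME := (M E).
Notation inE X := (proj1_sig (X : ME)).
Notation RM := (regM R je).
Notation LM := (lexM R je).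
Notation jM := (jeM R je).
Notation AM := (in_M hp A).
Notation "g ⋆ f" := (@comp E _ _ _ g f) (at level 40, left associativity).

Definition SameCells n (X : AG RM AM n) (Y : AG R A n) : Prop :=
  exists i, LevelIso (ag_X X) (ag_X Y) i /\
  forall (T : ME) (u v : T ~> cells (ag_X X)) (a : T ~> AM),
    N (ag_D X) u v a <-> @N E A n (ag_X Y) (ag_D Y) (inE T) (i ⋆ u) (i ⋆ v) a.

Lemma rp_comm n (X : AG RM AM n) (Y : AG R A n) : SameCells X Y -> CommLevels (ag_X Y).
Proof. intros [i [h _]]. exact (li_comm R je h). Qed.

Lemma rp_M n (Y : AG R A n) : CommLevels (ag_X Y) -> exists X : AG RM AM n, SameCells X Y.
Proof.
intros cY. destruct (li_M R je cY) as [X [i h]].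
assert (aX := proj2 (li_asph R je h) (ag_as Y)).
destruct (li_iso h) as [j [j1 j2]].
assert (I1 : forall T (u v : T ~> inE (cells X)), i ⋆ u = i ⋆ v -> u = v).
{ intros T u v. apply (iso_mono (li_iso h)). }
assert (D : exists D : Dir AM X, forall (T : ME) (u v : T ~> cells X) (a : T ~> AM),
  N D u v a <-> @N E A n (ag_X Y) (ag_D Y) (inE T) (i ⋆ u) (i ⋆ v) a).
{ unshelve eexists (@Build_Dir ME AM n X (fun T u v a =>
    @N E A n (ag_X Y) (ag_D Y) (inE T) (i ⋆ u) (i ⋆ v) a) _ _ _ _ _ _ _ _ _);
    [.. | reflexivity]; cbv beta.
  - intros T u v a S w hN.
    change (@N E A n (ag_X Y) (ag_D Y) (inE S) (i ⋆ (u ⋆ w)) (i ⋆ (v ⋆ w)) (a ⋆ w)).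
    rewrite !comp_assoc. exact (@N_nat E A n _ (ag_D Y) (inE T) _ _ a (inE S) w hN).
  - intros T u v a hN. apply (li_par h). exact (N_par hN).
  - intros T u v p. apply (li_par h) in p. exact (N_ex (ag_D Y) p).
  - intros T u v a a'. exact (@N_fun _ _ _ _ (ag_D Y) (inE T) _ _ a a').
  - intros T u. exact (N_refl (ag_D Y) (i ⋆ u)).
  - intros T u v v' a h1 h2. apply I1. exact (N_inj h1 h2).
  - intros T u v v' a h1 h2. apply I1. exact (N_inj' h1 h2).
  - intros T u a. destruct (N_lift (ag_D Y) (i ⋆ u) (a : inE T ~> A)) as [v hv].
    exists (j ⋆ v). now rewrite (ca1 j2).
  - intros T u a. destruct (N_lift' (ag_D Y) (i ⋆ u) (a : inE T ~> A)) as [v hv].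
    exists (j ⋆ v). now rewrite (ca1 j2). }
destruct D as [D hD].
exists {| ag_X := X; ag_as := aX; ag_D := D |}, i. split; [exact h | exact hD].
Qed.

(** A direction in M(E) is tested by generalised elements with commutative domain
    only. It extends to E because the object of parallel cells is itself
    commutative: the difference of the universal parallel pair determines all
    others. *)
Lemma rp_E n (X : AG RM AM n) : exists Y : AG R A n, SameCells X Y.
Proof.
destruct X as [X aX D].
destruct (li_E R je X) as [Y [i h]].
assert (aY := proj1 (li_asph R je h) aX).
destruct (li_iso h) as [j [j1 j2]].
destruct (ispar_exists LM X) as [P [p0 [p1 hP]]].
assert (hP' := li_ispar R je h hP). destruct hP' as [pq [exq unq]].
destruct hP as [pp [ex un]].
destruct (N_ex D pp) as [nu hnu].
destruct (ex _ _ _ (par_refl (id (cells X)))) as [s [s0 s1]].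
assert (s2 : nu ∘ s = zero AM ∘ to_one AM (cells X)).
{ apply (N_fun (N_nat s hnu)). rewrite s0, s1. apply N_refl. }
change (p0 ⋆ s = id (inE (cells X))) in s0. change (p1 ⋆ s = id (inE (cells X))) in s1.
change (nu ⋆ s = zero A ⋆ to_one A (inE (cells X))) in s2.
pose (W := prd L (inE (cells X)) A).
pose (WM := mk_ME (comm_prd R W (proj2_sig (cells X)) (commutative_ab hp (ab_str A)))).
assert (LF : exists q : prod_ob W ~> inE P, p0 ⋆ q = prl W /\ nu ⋆ q = prr W).
{ destruct (@N_lift _ _ _ _ D WM (prl W) (prr W)) as [v hv].
  destruct (ex _ _ _ (N_par hv)) as [q [q0 q1]].
  exists q. split; [exact q0 |].
  assert (hq := N_nat q hnu). rewrite q0, q1 in hq. exact (N_fun hq hv). }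
assert (LF' : exists q : prod_ob W ~> inE P, p1 ⋆ q = prl W /\ nu ⋆ q = prr W).
{ destruct (@N_lift' _ _ _ _ D WM (prl W) (prr W)) as [v hv].
  destruct (ex _ _ _ (N_par hv)) as [q [q0 q1]].
  exists q. split; [exact q1 |].
  assert (hq := N_nat q hnu). rewrite q0, q1 in hq. exact (N_fun hq hv). }
destruct LF as [q [q0 q1]], LF' as [q' [q0' q1']].
assert (Q : q ⋆ pr_pair W p0 nu = id (inE P)).
{ assert (e1 : p0 ⋆ (q ⋆ pr_pair W p0 nu) = p0) by (rewrite (ca q0); apply prl_pair).
  assert (e2 : nu ⋆ (q ⋆ pr_pair W p0 nu) = nu) by (rewrite (ca q1); apply prr_pair).
  pose (z := (q ⋆ pr_pair W p0 nu : inE P ~> inE P) : @Hom ME P P).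
  assert (hz := N_nat z hnu).
  apply (un P z (id P)); [exact (eq_trans e1 (eq_sym (comp_idr (c := E) _))) |].
  refine (eq_trans _ (eq_sym (comp_idr (c := E) _))).
  refine (N_inj (d := D) (u := p0) (a := nu) _ hnu).
  exact (eq_ind _ (fun k => N D (T := P) k (p1 ∘ z) nu)
    (eq_ind _ (fun k => N D (T := P) (p0 ∘ z) (p1 ∘ z) k) hz _ e2) _ e1). }
assert (Q' : q' ⋆ pr_pair W p1 nu = id (inE P)).
{ assert (e1 : p1 ⋆ (q' ⋆ pr_pair W p1 nu) = p1) by (rewrite (ca q0'); apply prl_pair).
  assert (e2 : nu ⋆ (q' ⋆ pr_pair W p1 nu) = nu) by (rewrite (ca q1'); apply prr_pair).
  pose (z := (q' ⋆ pr_pair W p1 nu : inE P ~> inE P) : @Hom ME P P).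
  assert (hz := N_nat z hnu).
  apply (un P z (id P)); [| exact (eq_trans e1 (eq_sym (comp_idr (c := E) _)))].
  refine (eq_trans _ (eq_sym (comp_idr (c := E) _))).
  refine (N_inj' (d := D) (v := p1) (a := nu) _ hnu).
  exact (eq_ind _ (fun k => N D (T := P) (p0 ∘ z) k nu)
    (eq_ind _ (fun k => N D (T := P) (p0 ∘ z) (p1 ∘ z) k) hz _ e2) _ e1). }
assert (I1 : forall T (u v : T ~> inE (cells X)), i ⋆ u = i ⋆ v -> u = v).
{ intros T u v. apply (iso_mono (li_iso h)). }
pose (NN := fun T (u v : T ~> cells Y) (a : T ~> A) =>
  exists w : T ~> inE P, i ⋆ p0 ⋆ w = u /\ i ⋆ p1 ⋆ w = v /\ nu ⋆ w = a).
assert (D' : exists D' : Dir A Y, forall T u v a, N D' u v a <-> NN T u v a).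
{ unshelve eexists (@Build_Dir E A n Y NN _ _ _ _ _ _ _ _ _); [.. | reflexivity].
  - intros T u v a S w [t [<- [<- <-]]]. exists (t ⋆ w). now rewrite !comp_assoc.
  - intros T u v a [t [<- [<- <-]]]. now apply par_comp.
  - intros T u v p. destruct (exq _ _ _ p) as [w [w0 w1]]. exists (nu ⋆ w), w. auto.
  - intros T u v a a' [w [w0 [w1 w2]]] [w' [w0' [w1' w2']]].
    rewrite <- w2, <- w2'. f_equal. apply unq; congruence.
  - intros T u. exists (s ⋆ (j ⋆ u)).
    rewrite <- !(comp_assoc i), (ca s0), (ca s1), !comp_idl, (ca1 j2). split; [auto |]. split; [auto |].
    exact (eq_trans (ca s2 (j ⋆ u)) (zeroE A _)).
  - intros T u v v' a [w [w0 [w1 w2]]] [w' [w0' [w1' w2']]].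
    assert (e : pr_pair W p0 nu ⋆ w = pr_pair W p0 nu ⋆ w').
    { apply prod_eq; rewrite !comp_assoc, ?prl_pair, ?prr_pair; [apply I1; rewrite !comp_assoc; exact (eq_trans w0 (eq_sym w0')) | exact (eq_trans w2 (eq_sym w2'))]. }
    rewrite <- w1, <- w1'. f_equal. exact (eq_trans (eq_sym (ca1 Q w)) (eq_trans (f_equal (fun k => q ⋆ k) e) (ca1 Q w'))).
  - intros T u v v' a [w [w0 [w1 w2]]] [w' [w0' [w1' w2']]].
    assert (e : pr_pair W p1 nu ⋆ w = pr_pair W p1 nu ⋆ w').
    { apply prod_eq; rewrite !comp_assoc, ?prl_pair, ?prr_pair; [apply I1; rewrite !comp_assoc; exact (eq_trans w1 (eq_sym w1')) | exact (eq_trans w2 (eq_sym w2'))]. }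
    rewrite <- w0, <- w0'. f_equal. exact (eq_trans (eq_sym (ca1 Q' w)) (eq_trans (f_equal (fun k => q' ⋆ k) e) (ca1 Q' w'))).
  - intros T u a. exists (i ⋆ p1 ⋆ (q ⋆ pr_pair W (j ⋆ u) a)), (q ⋆ pr_pair W (j ⋆ u) a).
    rewrite <- (comp_assoc i p0), (ca q0), (ca q1), prl_pair, prr_pair, (ca1 j2). auto.
  - intros T u a. exists (i ⋆ p0 ⋆ (q' ⋆ pr_pair W (j ⋆ u) a)), (q' ⋆ pr_pair W (j ⋆ u) a).
    rewrite <- (comp_assoc i p1), (ca q0'), (ca q1'), prl_pair, prr_pair, (ca1 j2). auto. }
destruct D' as [D' hD'].
exists {| ag_X := Y; ag_as := aY; ag_D := D' |}, i. split; [exact h |].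
intros T u v a. rewrite (hD' (inE T) (i ⋆ u) (i ⋆ v) a). simpl. split.
- intros hN. destruct (ex _ _ _ (N_par hN)) as [w [w0 w1]].
  assert (hw := N_nat w hnu). rewrite w0, w1 in hw.
  exists w. rewrite <- !comp_assoc. split; [exact (f_equal (fun k => i ⋆ k) w0) |].
  split; [exact (f_equal (fun k => i ⋆ k) w1) |]. exact (N_fun hw hN).
- intros [w [w0 [w1 w2]]]. rewrite <- comp_assoc in w0, w1. apply I1 in w0, w1.
  assert (hw := N_nat (w : T ~> P) hnu).
  exact (eq_ind _ (fun k => N D (T := T) k v a) (eq_ind _ (fun k => N D (T := T) (p0 ∘ w) k a)
    (eq_ind _ (fun k => N D (T := T) (p0 ∘ w) (p1 ∘ w) k) hw _ w2) _ w1) _ w0).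
Qed.

(** Again it suffices to look at the universal parallel pair, whose domain is
    commutative. *)
Lemma rp_mor n (X X2 : AG RM AM n) (Y Y2 : AG R A n) : SameCells X Y -> SameCells X2 Y2 ->
  (agmor X X2 <-> agmor Y Y2).
Proof.
intros r1 [i2 [h2 N2]]. assert (cY := rp_comm r1). destruct r1 as [i [h N1]].
destruct (li_iso h) as [j [j1 j2]].
split.
- intros [F hF]. destruct (li_mor R je F h h2) as [G hG]. exists G.
  destruct (ispar_exists L (ag_X Y)) as [P [p0 [p1 hP]]].
  assert (cP := ispar_comm R je cY hP). destruct hP as [pp [ex un]].
  destruct (N_ex (ag_D Y) pp) as [nu hnu].
  assert (KEY : N (ag_D Y2) (fmap cells G ∘ p0) (fmap cells G ∘ p1) nu).
  { pose (PM := mk_ME cP).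
    assert (a1 : N (ag_D X) (T := PM) (j ⋆ p0) (j ⋆ p1) nu).
    { apply N1. now rewrite !(ca1 j2). }
    assert (a2 := proj1 (N2 _ _ _ _) (hF _ _ _ _ a1)).
    change (@N E A n (ag_X Y2) (ag_D Y2) P (i2 ⋆ (fmap cells F ⋆ (j ⋆ p0))) (i2 ⋆ (fmap cells F ⋆ (j ⋆ p1))) nu) in a2.
    rewrite !(ca (eq_sym hG)), <- !comp_assoc, !(ca1 j2) in a2. exact a2. }
  intros T u v a hN. destruct (ex _ _ _ (N_par hN)) as [w [<- <-]].
  rewrite <- (N_fun (N_nat w hnu) hN), !comp_assoc. now apply N_nat.
- intros [G hG]. destruct (li_mor' R je G h h2) as [F hF]. exists F.
  intros T u v a hN. apply N2.
  change (@N E A n (ag_X Y2) (ag_D Y2) (inE T) (i2 ⋆ (fmap cells F ⋆ u)) (i2 ⋆ (fmap cells F ⋆ v)) a).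
  rewrite !(ca (eq_sym hF)), <- !comp_assoc. apply hG. now apply N1.
Qed.

Lemma lprod_comm n (V X Y : nGrd E n) (p : V ~> X) (q : V ~> Y) : LProd p q ->
  CommLevels X -> CommLevels Y -> CommLevels V.
Proof.
assert (K : forall (P B D : E) (f : P ~> B) (g : P ~> D), IsPr f g -> Commutative B ->
  Commutative D -> Commutative P).
{ intros P B D f g [ex un] cB cD.
  apply (comm_pb L je (f := bng L B) (g := bng L D) (p := f) (q := g)); auto.
  - apply commutative_terminal; [exact hp | apply lx_term].
  - apply mk_pb; [apply one_eq | intros; apply ex | exact un]. }
induction n as [| n IH].
- exact (K _ _ _ _ _).
- intros [h1 h2] [c1 c2] [d1 d2]. split; [exact (IH _ _ _ _ _ h1 c1 d1) | exact (K _ _ _ _ _ h2 c2 d2)].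
Qed.

Lemma rp_sum n (X X2 X3 : AG RM AM n) (Y Y2 Y3 : AG R A n) : SameCells X Y -> SameCells X2 Y2 -> SameCells X3 Y3 ->
  (agsum X X2 X3 <-> agsum Y Y2 Y3).
Proof.
intros r1 r2 [i3 [h3 N3]]. assert (cY := rp_comm r1). assert (cY2 := rp_comm r2).
destruct r1 as [i [h N1]], r2 as [i2 [h2 N2]].
split.
- intros [Q [F hF]].
  destruct (lprod_exists L je (ag_X Y) (ag_X Y2)) as [V' [p' [q' hV']]].
  assert (cV := lprod_comm hV' cY cY2).
  destruct (lprod_product L je hV') as [isp].
  destruct (li_M R je cV) as [V [k hk]].
  destruct (li_mor' R je p' hk h) as [p ep], (li_mor' R je q' hk h2) as [q eq].
  pose (e := pr_pair Q p q : V ~> prod_ob Q).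
  assert (e1 : prl Q ∘ e = p) by apply prl_pair.
  assert (e2 : prr Q ∘ e = q) by apply prr_pair.
  destruct (li_mor R je (F ∘ e) hk h3) as [G hG].
  exists {| prod_ob := V'; prl := p'; prr := q'; prod_is := isp |}, G.
  destruct (ispar_exists L V') as [P [p0 [p1 hP]]].
  assert (cP := ispar_comm R je cV hP). destruct hP as [pp [ex un]].
  destruct (N_ex (ag_D Y) (par_mor p' pp)) as [nu hnu].
  destruct (N_ex (ag_D Y2) (par_mor q' pp)) as [mu hmu].
  destruct (li_iso hk) as [j [j1 j2]].
  assert (KEY : N (ag_D Y3) (fmap cells G ∘ p0) (fmap cells G ∘ p1) (plus nu mu)).
  { pose (PM := mk_ME cP).
    pose (u := (j ⋆ p0 : inE PM ~> inE (cells V)) : @Hom ME PM (cells V)).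
    pose (v := (j ⋆ p1 : inE PM ~> inE (cells V)) : @Hom ME PM (cells V)).
    assert (puv : par u v).
    { apply (li_par hk). change (par (k ⋆ (j ⋆ p0)) (k ⋆ (j ⋆ p1))). now rewrite !(ca1 j2). }
    assert (a1 : N (ag_D X) (T := PM) (fmap cells p ∘ u) (fmap cells p ∘ v) nu).
    { apply N1. change (@N E A n (ag_X Y) (ag_D Y) P (i ⋆ (fmap cells p ⋆ (j ⋆ p0))) (i ⋆ (fmap cells p ⋆ (j ⋆ p1))) nu).
      rewrite !(ca (eq_sym ep)), <- !comp_assoc, !(ca1 j2). exact hnu. }
    assert (a2 : N (ag_D X2) (T := PM) (fmap cells q ∘ u) (fmap cells q ∘ v) mu).
    { apply N2. change (@N E A n (ag_X Y2) (ag_D Y2) P (i2 ⋆ (fmap cells q ⋆ (j ⋆ p0))) (i2 ⋆ (fmap cells q ⋆ (j ⋆ p1))) mu).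
      rewrite !(ca (eq_sym eq)), <- !comp_assoc, !(ca1 j2). exact hmu. }
    assert (a3 := hF PM (fmap cells e ∘ u) (fmap cells e ∘ v) nu mu (par_mor e puv)).
    rewrite !(comp_assoc _ (fmap cells e)), <- !fmap_comp, e1, e2 in a3.
    specialize (a3 a1 a2). apply N3 in a3.
    change (@N E A n (ag_X Y3) (ag_D Y3) P (i3 ⋆ (fmap cells (F ∘ e) ⋆ (j ⋆ p0)))
      (i3 ⋆ (fmap cells (F ∘ e) ⋆ (j ⋆ p1))) (plus nu mu)) in a3.
    rewrite !(ca (eq_sym hG)), <- !comp_assoc, !(ca1 j2) in a3. exact a3. }
  intros T u v a a' puv h1 h1'. change (T ~> cells V') in u, v.
  change (N (ag_D Y) (fmap cells p' ∘ u) (fmap cells p' ∘ v) a) in h1.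
  change (N (ag_D Y2) (fmap cells q' ∘ u) (fmap cells q' ∘ v) a') in h1'.
  change (N (ag_D Y3) (fmap cells G ∘ u) (fmap cells G ∘ v) (plus a a')).
  destruct (ex _ _ _ puv) as [w [<- <-]].
  rewrite !(comp_assoc (fmap cells p')) in h1. rewrite !(comp_assoc (fmap cells q')) in h1'.
  rewrite <- (N_fun (N_nat w hnu) h1), <- (N_fun (N_nat w hmu) h1'), <- plus_nat, !comp_assoc.
  now apply N_nat.
- intros [Q [F hF]].
  destruct (lprod_exists LM jM (ag_X X) (ag_X X2)) as [V [p [q hV]]].
  destruct (lprod_product LM jM hV) as [isp].
  destruct (li_E R je V) as [V' [k hk]].
  destruct (li_mor R je p hk h) as [p' ep], (li_mor R je q hk h2) as [q' eq].
  pose (e := pr_pair Q p' q' : V' ~> prod_ob Q).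
  assert (e1 : prl Q ∘ e = p') by apply prl_pair.
  assert (e2 : prr Q ∘ e = q') by apply prr_pair.
  destruct (li_mor' R je (F ∘ e) hk h3) as [G hG].
  exists {| prod_ob := V; prl := p; prr := q; prod_is := isp |}, G.
  intros T u v a a' puv h1 h1'. change (T ~> cells V) in u, v.
  change (N (ag_D X) (fmap cells p ∘ u) (fmap cells p ∘ v) a) in h1.
  change (N (ag_D X2) (fmap cells q ∘ u) (fmap cells q ∘ v) a') in h1'.
  change (N (ag_D X3) (fmap cells G ∘ u) (fmap cells G ∘ v) (plus a a')).
  apply N3. apply N1 in h1. apply N2 in h1'.
  change (@N E A n (ag_X Y) (ag_D Y) (inE T) (i ⋆ (fmap cells p ⋆ u)) (i ⋆ (fmap cells p ⋆ v)) a) in h1.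
  change (@N E A n (ag_X Y2) (ag_D Y2) (inE T) (i2 ⋆ (fmap cells q ⋆ u)) (i2 ⋆ (fmap cells q ⋆ v)) a') in h1'.
  change (@N E A n (ag_X Y3) (ag_D Y3) (inE T) (i3 ⋆ (fmap cells G ⋆ u)) (i3 ⋆ (fmap cells G ⋆ v)) (@plus E A (inE T) a a')).
  rewrite !(ca (eq_sym ep)), <- e1, fmap_comp, <- !comp_assoc in h1.
  rewrite !(ca (eq_sym eq)), <- e2, fmap_comp, <- !comp_assoc in h1'.
  rewrite !(ca (eq_sym hG)), fmap_comp, <- !comp_assoc.
  apply hF; auto. apply (par_mor e). exact (proj1 (li_par hk _ _) puv).
Qed.
End Compare.

(** * Comparison in degrees two and higher *)

(** The correspondence need not reach every object of the second category, but
    only every component of it; likewise a sum of the second category has to be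
    realised in the first up to connectedness only. *)
Lemma comp_iso (T T' : Type) (mor : T -> T -> Prop) (sum : T -> T -> T -> Prop)
  (mor' : T' -> T' -> Prop) (sum' : T' -> T' -> T' -> Prop) (Rr : T -> T' -> Prop) :
  (forall x, exists y, Rr x y) ->
  (forall x x2 y y2, Rr x y -> Rr x2 y2 -> x = x2 \/ mor x x2 -> Connected mor' y y2) ->
  (forall y, exists x y0, Rr x y0 /\ Connected mor' y y0) ->
  (forall x x2 y y2, Rr x y -> Rr x2 y2 -> Connected mor' y y2 -> Connected mor x x2) ->
  (forall x y z a b c, sum x y z -> Rr x a -> Rr y b -> Rr z c -> sum' a b c) ->
  (forall a b c, sum' a b c -> exists x y z a0 b0 c0, Rr x a0 /\ Rr y b0 /\ Rr z c0 /\
    Connected mor' a a0 /\ Connected mor' b b0 /\ Connected mor' c c0 /\ sum x y z) ->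
  GroupIso (Components mor sum) (Components mor' sum').
Proof.
intros tot hm surj inj s1 s2.
assert (hm' : forall x x2, Connected mor x x2 -> forall y y2, Rr x y -> Rr x2 y2 -> Connected mor' y y2).
{ intros x x2 q. induction q as [a | a b c q q1 IH | a b c q q1 IH]; intros y y2 h h2.
  - apply (hm a a); auto.
  - destruct (tot b) as [w hw]. apply (conn_trans (y := w)); [apply (hm a b); auto | now apply IH].
  - destruct (tot b) as [w hw]. apply (conn_trans (y := w)); [| now apply IH].
    apply conn_sym, (hm b a); auto. }
assert (ext : forall S (P Q : S -> Prop), (forall s, P s <-> Q s) -> P = Q).
{ intros S P Q h. apply functional_extensionality. intros s. now apply propositional_extensionality. }
pose (F0 := fun (c : T -> Prop) (b : T') => exists x y, c x /\ Rr x y /\ Connected mor' y b).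
pose (G0 := fun (b : T' -> Prop) (x : T) => exists y, Rr x y /\ b y).
assert (FE : forall x0 y0, Rr x0 y0 -> F0 (Connected mor x0) = Connected mor' y0).
{ intros x0 y0 h0. apply ext. intros b. split.
  - intros [x [y [h1 [h2 h3]]]]. exact (conn_trans (hm' _ _ h1 _ _ h0 h2) h3).
  - intros h. exists x0, y0. split; [apply conn_refl | auto]. }
assert (GE : forall x0 y0, Rr x0 y0 -> G0 (Connected mor' y0) = Connected mor x0).
{ intros x0 y0 h0. apply ext. intros x. split.
  - intros [y [h1 h2]]. exact (inj _ _ _ _ h0 h1 h2).
  - intros h. destruct (tot x) as [y hy]. exists y. split; [exact hy |]. exact (hm' _ _ h _ _ h0 hy). }
assert (CE : forall y y0, Connected mor' y y0 -> Connected mor' y = Connected mor' y0).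
{ intros y y0 h. apply ext. intros b. split; intros h'.
  - exact (conn_trans (conn_sym h) h').
  - exact (conn_trans h h'). }
assert (FP : forall c : Components mor sum, exists y, F0 (proj1_sig c) = Connected mor' y).
{ intros [c [x ->]]. destruct (tot x) as [y hy]. exists y. now apply FE. }
assert (GP : forall c : Components mor' sum', exists x, G0 (proj1_sig c) = Connected mor x).
{ intros [c [y ->]]. destruct (surj y) as [x [y0 [h1 h2]]]. exists x.
  simpl. rewrite (CE _ _ h2). now apply GE. }
pose (f := fun c : Components mor sum => exist _ (F0 (proj1_sig c)) (FP c) : Components mor' sum').
pose (g := fun c : Components mor' sum' => exist _ (G0 (proj1_sig c)) (GP c) : Components mor sum).
exists f, g. split; [| split].
- intros [c [x ->]]. apply sig_ext. simpl. destruct (tot x) as [y hy].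
  rewrite (FE _ _ hy). now apply GE.
- intros [c [y ->]]. apply sig_ext. simpl. destruct (surj y) as [x [y0 [h1 h2]]].
  rewrite (CE _ _ h2), (GE _ _ h1). now apply FE.
- intros a b c. split.
  + intros [x [y [z [ha [hb [hc hs]]]]]].
    destruct (tot x) as [x' hx], (tot y) as [y' hy], (tot z) as [z' hz].
    exists x', y', z'. simpl. split; [exists x, x' | split; [exists y, y' | split; [exists z, z' |]]].
    * split; [exact ha | split; [exact hx | apply conn_refl]].
    * split; [exact hb | split; [exact hy | apply conn_refl]].
    * split; [exact hc | split; [exact hz | apply conn_refl]].
    * exact (s1 _ _ _ _ _ _ hs hx hy hz).
  + intros [x' [y' [z' [ha [hb [hc hs]]]]]].
    destruct (s2 _ _ _ hs) as [x [y [z [a0 [b0 [c0 [hx [hy [hz [ka [kb [kc hs']]]]]]]]]]]].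
    assert (Q : forall (d : Components mor sum) w' w0 w, proj1_sig (f d) w' -> Connected mor' w' w0 ->
      Rr w w0 -> proj1_sig d w).
    { intros [d [d0 ->]] w' w0 w [u [v [h1 [h2 h3]]]] h4 h5. simpl in *.
      apply (conn_trans h1). exact (inj _ _ _ _ h2 h5 (conn_trans h3 h4)). }
    exists x, y, z. split; [exact (Q _ _ _ _ ha ka hx) |].
    split; [exact (Q _ _ _ _ hb kb hy) |]. split; [exact (Q _ _ _ _ hc kc hz) | exact hs'].
Qed.

Section Higher.
Variables (E : Category) (K : Ctx E) (hp : HasProducts E) (A : AbGroup E).
Notation R := (cx_reg K).
Notation L := (rx_lex (cx_reg K)).
Notation je := (je_ctx K).
Notation ME := (M E).
Notation inE X := (proj1_sig (X : ME)).
Notation RM := (regM R je).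
Notation jM := (jeM R je).
Notation AM := (in_M hp A).
Notation "g ⋆ f" := (@comp E _ _ _ g f) (at level 40, left associativity).

Section Any.
Variables (C : Category) (Rc : RegCtx C) (jc : JE C) (B : AbGroup C) (n : nat).
Notation toA := (to_ag Rc).
Notation ofA := (of_ag jc).

Lemma agmor_comp (X Y Z : AG Rc B n) : agmor X Y -> agmor Y Z -> agmor X Z.
Proof. intros [F hF] [G hG]. exists (G ∘ F). exact (presN_comp (X := X) (Y := Y) (Z := Z) hF hG). Qed.

Lemma of_to (X : AG Rc B n) : agmor (toA (ofA X)) X /\ agmor X (toA (ofA X)).
Proof.
split; exists (id (ag_X X)); intros T u v a h; rewrite fmap_id, !comp_idl; now apply (of_agE jc).
Qed.

Lemma conn_ag (x y : AG Rc B n) : Connected (@agmor _ Rc B n) x y ->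
  forall X Y : AsphGrd B n, agmor (toA X) x /\ agmor x (toA X) -> agmor (toA Y) y /\ agmor y (toA Y) ->
  Connected (@asph_mor _ B n) X Y.
Proof.
intros q. induction q as [a | a b c q q1 IH | a b c q q1 IH]; intros X Y [x1 x2] [y1 y2].
- apply conn_one, (asph_mor_ag Rc). exact (agmor_comp x1 y2).
- destruct (of_to b) as [b1 b2]. apply (conn_trans (y := ofA b)); [| now apply IH].
  apply conn_one, (asph_mor_ag Rc). exact (agmor_comp x1 (agmor_comp q b2)).
- destruct (of_to b) as [b1 b2]. apply (conn_trans (y := ofA b)); [| now apply IH].
  apply conn_sym, conn_one, (asph_mor_ag Rc). exact (agmor_comp b1 (agmor_comp q x2)).
Qed.

Lemma conn_to (X Y : AsphGrd B n) : Connected (@asph_mor _ B n) X Y ->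
  Connected (@agmor _ Rc B n) (toA X) (toA Y).
Proof.
intros q. induction q as [a | a b c q q1 IH | a b c q q1 IH]; [apply conn_refl | |].
- exact (conn_mor (proj1 (asph_mor_ag Rc _ _) q) IH).
- exact (conn_rom (proj1 (asph_mor_ag Rc _ _) q) IH).
Qed.
End Any.

Lemma rp_of n (X : AG RM AM n) (Y : AG R A n) : SameCells X Y -> SameCells (to_ag RM (of_ag jM X)) Y.
Proof.
intros [i [h H]]. exists i. split; [exact h |]. intros T u v a.
rewrite <- (H T u v a). apply (of_agE jM).
Qed.

Lemma rp_of' n (X : AG RM AM n) (Y : AG R A n) : SameCells X Y -> SameCells X (to_ag R (of_ag je Y)).
Proof.
intros [i [h H]]. exists i. split; [exact h |]. intros T u v a.
rewrite (H T u v a). symmetry. apply (of_agE je).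
Qed.

Variables (I F : E) (iI : is_initial I) (gF : RegEpi (bng L F)) (pF : Projective F)
  (pFI : Projective (prd L F I)).

(** Aspherical groupoids of M(E) correspond to those of E with commutative levels.
    Surjectivity on components is [rx_conn], injectivity [conn_comm], and the
    Baer sum is handled by [sum_comm]. *)
Theorem hsucc_iso n : GroupIso (Hsucc AM (S n)) (Hsucc A (S n)).
Proof.
apply comp_iso with (Rr := fun X Y => SameCells (to_ag RM X) (to_ag R Y)).
- intros X. destruct (rp_E (to_ag RM X)) as [Y hY]. exists (of_ag je Y). now apply rp_of'.
- intros X X2 Y Y2 h h2 hm. apply conn_one, (asph_mor_ag R), (rp_mor h h2).
  destruct hm as [-> | hm]; [apply agmor_refl | now apply (asph_mor_ag RM)].
- intros Y. destruct (rx_exists iI gF pF pFI (to_ag R Y)) as [x hx].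
  assert (cx := rx_comml hx). destruct (rp_M je hp cx) as [X hX].
  exists (of_ag jM X), (of_ag je x). split; [apply rp_of, rp_of', hX |].
  apply (conn_ag je (rx_conn hx)).
  + split; apply agmor_refl.
  + apply of_to.
- intros X X2 Y Y2 h h2 q. apply (conn_to R) in q.
  apply (conn_comm iI gF pF pFI) in q; [| exact (rp_comm h) | exact (rp_comm h2)].
  revert X X2 h h2.
  induction q as [a | a b c q q1 IH | a b c q q1 IH]; intros X X2 h h2.
  + apply conn_one, (asph_mor_ag RM), (rp_mor h h2), agmor_refl.
  + destruct q as [_ [cb q]]. destruct (rp_M je hp cb) as [Z hZ].
    apply (conn_trans (y := of_ag jM Z)); [| apply IH; [now apply rp_of | exact h2]].
    apply conn_one, (asph_mor_ag RM), (rp_mor h (rp_of hZ)), q.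
  + destruct q as [cb [_ q]]. destruct (rp_M je hp cb) as [Z hZ].
    apply (conn_trans (y := of_ag jM Z)); [| apply IH; [now apply rp_of | exact h2]].
    apply conn_sym, conn_one, (asph_mor_ag RM), (rp_mor (rp_of hZ) h), q.
- intros x y z a b c hs h1 h2 h3. apply (asph_sum_ag R), (rp_sum h1 h2 h3). now apply (asph_sum_ag RM).
- intros a b c hs. apply (asph_sum_ag R) in hs.
  destruct (sum_comm iI gF pF pFI hs) as [x [y [z [cx [cy [cz [qx [qy [qz hs']]]]]]]]].
  destruct (rp_M je hp cx) as [X hX], (rp_M je hp cy) as [Y hY], (rp_M je hp cz) as [Z hZ].
  exists (of_ag jM X), (of_ag jM Y), (of_ag jM Z), (of_ag je x), (of_ag je y), (of_ag je z).
  split; [apply rp_of, rp_of', hX |]. split; [apply rp_of, rp_of', hY |].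
  split; [apply rp_of, rp_of', hZ |].
  split; [apply (conn_ag je qx); [split; apply agmor_refl | apply of_to] |].
  split; [apply (conn_ag je qy); [split; apply agmor_refl | apply of_to] |].
  split; [apply (conn_ag je qz); [split; apply agmor_refl | apply of_to] |].
  apply (asph_sum_ag RM). apply (rp_sum (rp_of hX) (rp_of hY) (rp_of hZ)). exact hs'.
Qed.
End Higher.

(** * Comparison in degree one *)

Arguments t_diff {E A} t {T} x y.

Section Torsors.
Variables (E : Category) (R : RegCtx E) (je : JE E) (hp : HasProducts E) (A : AbGroup E).
Hypothesis coeq : forall (X Y : E) (a b : X ~> Y),
  exists (Q : E) (q : Y ~> Q), IsCoequalizer a b q.
Notation L := (rx_lex R).
Notation ME := (M E).
Notation inE X := (proj1_sig (X : ME)).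
Notation RM := (regM R je).
Notation AM := (in_M hp A).
Notation "g ⋆ f" := (@comp E _ _ _ g f) (at level 40, left associativity).

Lemma t_diff_nat (C : Category) (B : AbGroup C) (t : Torsor B) T S (x y : T ~> t_ob t) (u : S ~> T) :
  t_diff t x y ∘ u = t_diff t (x ∘ u) (y ∘ u).
Proof. unfold t_diff. now rewrite <- comp_assoc, pr_pair_comp. Qed.

Lemma t_diff_at (C : Category) (B : AbGroup C) (t : Torsor B) T S (x y : T ~> t_ob t) (u : S ~> T)
  (x' y' : S ~> t_ob t) : x ∘ u = x' -> y ∘ u = y' -> t_diff t x y ∘ u = t_diff t x' y'.
Proof. intros <- <-. apply t_diff_nat. Qed.

Definition prodM (X Y : ME) (P : Product (inE X) (inE Y)) : @Product ME X Y :=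
  let PM := mk_ME (commutative_prod hp P (proj2_sig X) (proj2_sig Y)) in
  @Build_Product ME X Y PM (prl P) (prr P)
    (@Build_is_product ME X Y PM (prl P) (prr P)
      (fun T => @pair _ _ _ _ _ _ (prod_is P) (inE T))
      (fun T => @pair_l _ _ _ _ _ _ (prod_is P) (inE T))
      (fun T => @pair_r _ _ _ _ _ _ (prod_is P) (inE T))
      (fun T => @pair_uniq _ _ _ _ _ _ (prod_is P) (inE T))).

Definition malM (X : ME) (p : MalcevOp (inE X)) : @MalcevOp ME X :=
  let Q := prodM (X := X) (Y := X) (mal_sq p) in
  @Build_MalcevOp ME X Q (prodM (X := Q) (Y := X) (mal_cube p)) (mal_op p)
    (fun T => @mal_xyy _ _ p (inE T)) (fun T => @mal_xxy _ _ p (inE T)).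

Definition SameTorsor (X : Torsor AM) (Y : Torsor A) : Prop :=
  exists i : inE (t_ob X) ~> t_ob Y, IsIso i /\
  forall (T : ME) (x y : T ~> t_ob X), t_diff X x y = t_diff Y (i ⋆ x) (i ⋆ y).

Lemma rt_M (Y : Torsor A) : exists X, SameTorsor X Y.
Proof.
pose (O := mk_ME (inhabits (t_mal Y)) : ME).
assert (gs : @GlobalSupport ME O).
{ apply (gsupp RM), (regepi_M R je). apply (gsupp R). exact (t_supp Y). }
assert (qu : IsCoequalizer (chasles_l (malM (X := O) (t_mal Y))) (chasles_r (malM (X := O) (t_mal Y)))
  (t_dir Y : mal_sq (malM (X := O) (t_mal Y)) ~> AM)).
{ assert (h := t_quot Y). apply coeqP in h. apply coeqP. destruct h as [h1 h2].
  split; [exact h1 |]. intros T t e. exact (h2 (inE T) t e). }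
exists (@Build_Torsor ME AM O (malM (X := O) (t_mal Y)) gs (t_dir Y) qu
  (fun T x y z => @t_add _ _ Y (inE T) x y z)), (id (t_ob Y)).
split; [exists (id _); split; apply comp_idl |].
intros T x y. change (@Hom E (inE T) (t_ob Y)) in x, y.
change (t_diff Y x y = t_diff Y (id (t_ob Y) ⋆ x) (id (t_ob Y) ⋆ y)). now rewrite !comp_idl.
Qed.

Definition prodE (X Y : ME) (P : @Product ME X Y) : Product (inE X) (inE Y) :=
  @Build_Product E (inE X) (inE Y) (inE (prod_ob P)) (prl P) (prr P)
    (choice_of (m_prod R (prod_is P))).

Lemma prodE_pair (X Y : ME) (P : @Product ME X Y) (T : ME) (a : T ~> X) (b : T ~> Y) :
  pr_pair (prodE P) (T := inE T) a b = pr_pair P a b.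
Proof.
apply prod_eq; rewrite ?prl_pair, ?prr_pair; symmetry;
  [exact (prl_pair P a b) | exact (prr_pair P a b)].
Qed.

(** Torsors are the same in both categories, as their objects are commutative.
    Only the quotient property of the direction must be extended from M(E) to E:
    the coequalizer of the two legs in E is a quotient of a commutative object,
    hence lies in M(E). *)
Lemma rt_E (X : Torsor AM) : exists Y, SameTorsor X Y.
Proof.
pose (p := t_mal X). pose (O := inE (t_ob X)).
pose (S := prodE (mal_sq p)). pose (Cu := prodE (mal_cube p)).
pose (o := mal_op p : prod_ob Cu ~> O).
pose (c2 := prod_ob (mal_sq p)).
pose (s1 := prl S : inE c2 ~> O). pose (s2 := prr S : inE c2 ~> O).
assert (PC : forall a b c : inE c2 ~> O,
  o ⋆ pr_pair Cu (pr_pair S a b) c = @mal ME _ p c2 a b c).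
{ intros a b c. refine (f_equal (fun k => o ⋆ k) _).
  exact (eq_trans (f_equal (fun k => pr_pair Cu k c) (prodE_pair (mal_sq p) (T := c2) a b))
    (prodE_pair (mal_cube p) (T := c2) (@pr_pair ME _ _ (mal_sq p) c2 a b) c)). }
assert (PN : forall T (a b c : inE c2 ~> O) (w : T ~> inE c2),
  o ⋆ pr_pair Cu (pr_pair S a b) c ⋆ w = o ⋆ pr_pair Cu (pr_pair S (a ⋆ w) (b ⋆ w)) (c ⋆ w)).
{ intros T a b c w. refine (eq_trans (eq_sym (comp_assoc _ _ _)) (f_equal (fun k => o ⋆ k) _)).
  exact (eq_trans (pr_pair_comp Cu _ _ w) (f_equal (fun k => pr_pair Cu k (c ⋆ w)) (pr_pair_comp S a b w))). }
assert (w1 : forall T (x y : T ~> O), s1 ⋆ pr_pair S x y = x) by (intros; apply (prl_pair S)).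
assert (w2 : forall T (x y : T ~> O), s2 ⋆ pr_pair S x y = y) by (intros; apply (prr_pair S)).
assert (o1 : forall T (x y : T ~> O), o ⋆ pr_pair Cu (pr_pair S x y) y = x).
{ intros T x y.
  assert (h : o ⋆ pr_pair Cu (pr_pair S s1 s2) s2 = s1) by exact (eq_trans (PC s1 s2 s2) (@mal_xyy ME _ p c2 s1 s2)).
  assert (h' := f_equal (fun k => k ⋆ pr_pair S x y) h). cbv beta in h'.
  rewrite PN, w1, w2 in h'. exact (eq_trans h' (w1 _ x y)). }
assert (o2 : forall T (x y : T ~> O), o ⋆ pr_pair Cu (pr_pair S x x) y = y).
{ intros T x y.
  assert (h : o ⋆ pr_pair Cu (pr_pair S s1 s1) s2 = s2) by exact (eq_trans (PC s1 s1 s2) (@mal_xxy ME _ p c2 s1 s2)).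
  assert (h' := f_equal (fun k => k ⋆ pr_pair S x y) h). cbv beta in h'.
  rewrite PN, w1, w2 in h'. exact (eq_trans h' (w2 _ x y)). }
pose (pE := {| mal_sq := S; mal_cube := Cu; mal_op := o; mal_xyy := o1; mal_xxy := o2 |} : MalcevOp O).
assert (gs : GlobalSupport O).
{ apply (gsupp R). assert (h := t_supp X). apply (gsupp RM) in h. exact (proj1 (regepi_M R je _) h). }
assert (cr : chasles_r pE = chasles_r p).
{ unfold chasles_r. refine (eq_trans _ (prodE_pair (mal_sq p) _ _)). f_equal.
  unfold mal. simpl mal_op. refine (f_equal (fun k => o ⋆ k) _).
  refine (eq_trans _ (prodE_pair (mal_cube p) _ _)). f_equal.
  exact (prodE_pair (mal_sq p) _ _). }
assert (dE : forall (T : ME) (x y : T ~> t_ob X), t_diff X x y = t_dir X ⋆ pr_pair S (T := inE T) x y).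
{ intros T x y. unfold t_diff. exact (f_equal (fun k => t_dir X ⋆ k) (eq_sym (prodE_pair (mal_sq p) x y))). }
assert (qu : IsCoequalizer (chasles_l pE) (chasles_r pE) (t_dir X : mal_sq pE ~> A)).
{ rewrite cr. assert (h := t_quot X). apply coeqP in h. apply coeqP. destruct h as [h1 h2].
  split; [exact h1 |].
  intros T t et.
  destruct (coeq (chasles_l pE) (chasles_r pE)) as [Q [q hq]].
  assert (rq : RegEpi q) by (exists (prod_ob Cu), (chasles_l pE), (chasles_r pE); exact hq).
  pose (QM := mk_ME (comm_quot R je rq (proj2_sig (prod_ob (mal_sq p))))).
  apply coeqP in hq. destruct hq as [hq1 hq2]. rewrite cr in hq1, hq2.
  destruct (hq2 T t et) as [u [hu _]].
  destruct (h2 QM q hq1) as [v [hv _]].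
  change (v ⋆ t_dir X = q) in hv.
  exists (u ⋆ v). split; [exact (eq_trans (eq_sym (comp_assoc u v _)) (eq_trans (f_equal (fun k => u ⋆ k) hv) hu)) |].
  intros w hw.
  (* regular epimorphisms of M(E) are epimorphisms in E *)
  assert (rd : @RegEpi E (inE (prod_ob (mal_sq p))) (ab_ob A) (t_dir X)).
  { apply (regepi_M R je (X := prod_ob (mal_sq p)) (Y := ab_ob AM)). eexists _, _, _. exact (t_quot X). }
  apply (regepi_epi rd). refine (eq_trans _ (eq_sym hw)).
  exact (eq_trans (eq_sym (comp_assoc u v _)) (eq_trans (f_equal (fun k => u ⋆ k) hv) hu)). }
assert (add : forall T (x y z : T ~> O), plus (t_dir X ⋆ pr_pair S x y) (t_dir X ⋆ pr_pair S y z) =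
  t_dir X ⋆ pr_pair S x z).
{ intros T x y z.
  pose (c := prod_ob (mal_cube p)).
  pose (x0 := @comp ME c _ _ s1 (prl (mal_cube p))). pose (y0 := @comp ME c _ _ s2 (prl (mal_cube p))).
  pose (z0 := prr (mal_cube p)).
  assert (h := @t_add _ _ X c x0 y0 z0).
  change (@plus E A (inE c) (t_diff X x0 y0) (t_diff X y0 z0) = t_diff X x0 z0) in h.
  rewrite !dE in h.
  pose (w := pr_pair Cu (pr_pair S x y) z).
  assert (x1 : x0 ⋆ w = x).
  { refine (eq_trans (eq_sym (comp_assoc (c := E) _ _ _)) _).
    refine (eq_trans (f_equal (fun k => s1 ⋆ k) (prl_pair Cu (pr_pair S x y) z)) _). exact (prl_pair S x y). }
  assert (y1 : y0 ⋆ w = y).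
  { refine (eq_trans (eq_sym (comp_assoc (c := E) _ _ _)) _).
    refine (eq_trans (f_equal (fun k => s2 ⋆ k) (prl_pair Cu (pr_pair S x y) z)) _). exact (prr_pair S x y). }
  assert (z1 : z0 ⋆ w = z) by exact (prr_pair Cu (pr_pair S x y) z).
  assert (h' := f_equal (fun k => k ⋆ w) h). cbv beta in h'.
  assert (DW : forall (a b : inE c ~> O) (a' b' : T ~> O), a ⋆ w = a' -> b ⋆ w = b' ->
    t_dir X ⋆ pr_pair S a b ⋆ w = t_dir X ⋆ pr_pair S a' b').
  { intros a b a' b' <- <-.
    exact (eq_trans (eq_sym (comp_assoc _ _ _)) (f_equal (fun k => t_dir X ⋆ k) (pr_pair_comp S a b w))). }
  refine (eq_trans (eq_sym _) (eq_trans h' (DW x0 z0 x z x1 z1))).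
  refine (eq_trans (plus_nat _ _ w) _).
  exact (f_equal2 (fun a b => @plus E A T a b) (DW x0 y0 x y x1 y1) (DW y0 z0 y z y1 z1)). }
exists (@Build_Torsor E A O pE gs (t_dir X) qu add), (id O).
split; [exists (id _); split; apply comp_idl |].
intros T x y. rewrite dE. change (@Hom E (inE T) O) in x, y.
change (t_dir X ⋆ pr_pair S x y = t_dir X ⋆ pr_pair S (id O ⋆ x) (id O ⋆ y)). now rewrite !comp_idl.
Qed.

Lemma comm_sq (Y : Torsor A) : Commutative (mal_sq (t_mal Y)).
Proof. apply (commutative_prod hp); exact (inhabits (t_mal Y)). Qed.

Lemma rt_mor X X2 Y Y2 : SameTorsor X Y -> SameTorsor X2 Y2 -> (torsor_mor X X2 <-> torsor_mor Y Y2).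
Proof.
intros [i [[j [j1 j2]] H1]] [i2 [[k [k1 k2]] H2]]. split.
- intros [f hf]. exists (i2 ⋆ f ⋆ j).
  pose (S := mal_sq (t_mal Y)). pose (SM := mk_ME (comm_sq Y)).
  assert (h := hf SM (j ⋆ prl S) (j ⋆ prr S)).
  change (t_diff (E := ME) (A := AM) X2 (T := SM) (f ⋆ (j ⋆ prl S)) (f ⋆ (j ⋆ prr S)) = t_diff (E := ME) (A := AM) X (T := SM) (j ⋆ prl S) (j ⋆ prr S)) in h.
  rewrite H1, H2 in h. rewrite !(ca1 j2) in h.
  intros T x y. pose (w := pr_pair S x y).
  assert (W : forall (O : E) (g : t_ob Y ~> O), g ⋆ prl S ⋆ w = g ⋆ x /\ g ⋆ prr S ⋆ w = g ⋆ y).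
  { intros O g. unfold w. now rewrite <- !comp_assoc, prl_pair, prr_pair. }
  refine (eq_trans (eq_sym (t_diff_at _ _)) (eq_trans (f_equal (fun k => k ⋆ w) h) (t_diff_at _ _))).
  + rewrite !comp_assoc. apply W.
  + rewrite !comp_assoc. apply W.
  + apply prl_pair.
  + apply prr_pair.
- intros [f hf]. exists (k ⋆ (f ⋆ i)). intros T x y.
  rewrite H1, H2. rewrite <- hf.
  change (t_diff Y2 (i2 ⋆ (k ⋆ (f ⋆ i) ⋆ x)) (i2 ⋆ (k ⋆ (f ⋆ i) ⋆ y)) = t_diff Y2 (f ⋆ (i ⋆ x)) (f ⋆ (i ⋆ y))).
  rewrite <- !comp_assoc, !(ca1 k2). reflexivity.
Qed.

Lemma rt_sum X X2 X3 Y Y2 Y3 : SameTorsor X Y -> SameTorsor X2 Y2 -> SameTorsor X3 Y3 ->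
  (torsor_sum X X2 X3 <-> torsor_sum Y Y2 Y3).
Proof.
intros [i [[j [j1 j2]] H1]] [i2 [[k [k1 k2]] H2]] [i3 [[l [l1 l2]] H3]]. split.
- intros [Q [f hf]].
  pose (P := prd L (t_ob Y) (t_ob Y2)). pose (Q' := prodE Q).
  pose (e := pr_pair Q' (j ⋆ prl P) (k ⋆ prr P)).
  exists P, (i3 ⋆ f ⋆ e).
  assert (cP : Commutative P).
  { apply (commutative_prod hp); constructor; apply t_mal. }
  pose (PP := prd L P P).
  pose (PM := mk_ME (commutative_prod hp PP cP cP)).
  pose (u := (e ⋆ prl PP : prod_ob PP ~> inE (prod_ob Q)) : @Hom ME PM (prod_ob Q)).
  pose (v := (e ⋆ prr PP : prod_ob PP ~> inE (prod_ob Q)) : @Hom ME PM (prod_ob Q)).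
  assert (h := hf PM u v).
  rewrite H1, H2, H3 in h.
  assert (eq1 : forall T (w : T ~> P), prl Q ⋆ (e ⋆ w) = j ⋆ (prl P ⋆ w)).
  { intros T w. rewrite comp_assoc. refine (eq_trans (f_equal (fun h => h ⋆ w) (prl_pair Q' _ _)) _).
    symmetry. apply comp_assoc. }
  assert (eq2 : forall T (w : T ~> P), prr Q ⋆ (e ⋆ w) = k ⋆ (prr P ⋆ w)).
  { intros T w. rewrite comp_assoc. refine (eq_trans (f_equal (fun h => h ⋆ w) (prr_pair Q' _ _)) _).
    symmetry. apply comp_assoc. }
  change (t_diff Y3 (i3 ⋆ (f ⋆ (e ⋆ prl PP))) (i3 ⋆ (f ⋆ (e ⋆ prr PP))) =
    @plus E A PP (t_diff Y (i ⋆ (prl Q ⋆ (e ⋆ prl PP))) (i ⋆ (prl Q ⋆ (e ⋆ prr PP))))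
      (t_diff Y2 (i2 ⋆ (prr Q ⋆ (e ⋆ prl PP))) (i2 ⋆ (prr Q ⋆ (e ⋆ prr PP))))) in h.
  rewrite !eq1, !eq2, !(ca1 j2), !(ca1 k2) in h.
  intros T x y. pose (w := pr_pair PP x y).
  assert (W : forall (O : E) (g : P ~> O), g ⋆ prl PP ⋆ w = g ⋆ x /\ g ⋆ prr PP ⋆ w = g ⋆ y).
  { intros O g. unfold w. now rewrite <- !comp_assoc, prl_pair, prr_pair. }
  refine (eq_trans (eq_sym (t_diff_at _ _)) (eq_trans (f_equal (fun k => k ⋆ w) h) _)).
  + rewrite !comp_assoc. apply W.
  + rewrite !comp_assoc. apply W.
  + refine (eq_trans (plus_nat _ _ w) _).
    refine (f_equal2 (fun a b => @plus E A T a b) (t_diff_at _ _) (t_diff_at _ _)); apply W.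
- intros [Q [f hf]].
  pose (P := prd L (inE (t_ob X)) (inE (t_ob X2))).
  pose (e := pr_pair Q (i ⋆ prl P) (i2 ⋆ prr P)).
  exists (prodM P), (l ⋆ (f ⋆ e)). intros T x y.
  rewrite H1, H2, H3.
  assert (eq1 : forall T (w : T ~> P), prl Q ⋆ (e ⋆ w) = i ⋆ (prl P ⋆ w)).
  { intros S w. rewrite comp_assoc. unfold e. rewrite prl_pair. symmetry. apply comp_assoc. }
  assert (eq2 : forall T (w : T ~> P), prr Q ⋆ (e ⋆ w) = i2 ⋆ (prr P ⋆ w)).
  { intros S w. rewrite comp_assoc. unfold e. rewrite prr_pair. symmetry. apply comp_assoc. }
  change (t_diff Y3 (i3 ⋆ (l ⋆ (f ⋆ e) ⋆ (x : inE T ~> prod_ob P))) (i3 ⋆ (l ⋆ (f ⋆ e) ⋆ (y : inE T ~> prod_ob P))) =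
    @plus E A (inE T) (t_diff Y (i ⋆ (prl P ⋆ (x : inE T ~> prod_ob P))) (i ⋆ (prl P ⋆ (y : inE T ~> prod_ob P))))
      (t_diff Y2 (i2 ⋆ (prr P ⋆ (x : inE T ~> prod_ob P))) (i2 ⋆ (prr P ⋆ (y : inE T ~> prod_ob P))))).
  rewrite <- !eq1, <- !eq2, <- !comp_assoc, !(ca1 l2). apply hf.
Qed.

Theorem h1_iso : GroupIso (H1 AM) (H1 A).
Proof.
apply comp_iso with (Rr := SameTorsor).
- apply rt_E.
- intros X X2 Y Y2 h h2 hm. apply conn_one, (rt_mor h h2).
  destruct hm as [-> | hm]; [| exact hm].
  exists (id _). intros T x y. now rewrite !comp_idl.
- intros Y. destruct (rt_M Y) as [X hX]. exists X, Y. split; [exact hX | apply conn_refl].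
- intros X X2 Y Y2 h h2 q. revert X X2 h h2.
  induction q as [a | a b c q q1 IH | a b c q q1 IH]; intros X X2 h h2.
  + apply conn_one, (rt_mor h h2). exists (id _). intros T x y. now rewrite !comp_idl.
  + destruct (rt_M b) as [Z hZ]. apply (conn_trans (y := Z)); [| now apply IH].
    apply conn_one, (rt_mor h hZ), q.
  + destruct (rt_M b) as [Z hZ]. apply (conn_trans (y := Z)); [| now apply IH].
    apply conn_sym, conn_one, (rt_mor hZ h), q.
- intros x y z a b c hs h1 h2 h3. exact (proj1 (rt_sum h1 h2 h3) hs).
- intros a b c hs.
  destruct (rt_M a) as [X hX], (rt_M b) as [Y hY], (rt_M c) as [Z hZ].
  exists X, Y, Z, a, b, c. repeat split; auto using conn_refl.
  exact (proj2 (rt_sum hX hY hZ) hs).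
Qed.
End Torsors.

(** * Slices *)

Section SliceCtx.
Variable D : Category.
Hypotheses (hPt : Pointed D) (hLim : FinitelyComplete D) (hColim : FinitelyCocomplete D)
  (hReg : EfficientlyRegular D) (hProto : Protomodular D) (hPeri : PeriAbelian D).
Variable Y : D.
Notation S := (Slice Y).
Notation "g ⋆ f" := (@comp D _ _ _ g f) (at level 40, left associativity).

Lemma pbk_ex (C : Category) (h : FinitelyComplete C) (A B Z : C) (f : A ~> Z) (g : B ~> Z) :
  inhabited (Pbk f g).
Proof.
destruct (pullback_exists h f g) as [P [p [q [e H]]]].
constructor. refine {| pbo := P; pp0 := p; pp1 := q |}. apply mk_pb; [exact e | |].
- intros T a b eab. destruct (H T a b eab) as [u [hu _]]. now exists u.
- intros T u v e0 e1. destruct (H T (p ∘ u) (q ∘ u)) as [w [_ hw]].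
  + now rewrite !comp_assoc, e.
  + transitivity w; [symmetry |]; apply hw; auto.
Qed.

Lemma lexD_ex : inhabited (Lex D).
Proof.
destruct hPt as [Z [[t] _]]. constructor.
exact {| lx_one := Z; lx_term := t; lx_pb := fun A B Z f g => choice_of (pbk_ex hLim f g) |}.
Qed.
Definition LD : Lex D := choice_of lexD_ex.

Lemma lexop_ex : inhabited (Lex (op D)).
Proof.
destruct hPt as [Z [_ [t]]]. constructor.
exact {| lx_one := Z : op D; lx_term := t;
  lx_pb := fun A B Z f g => choice_of (@pbk_ex (op D) hColim A B Z f g) |}.
Qed.

Definition RD : RegCtx D := {| rx_lex := LD; rx_kp := proj1 (proj2 (proj1 hReg));
  rx_st := proj2 (proj2 (proj1 hReg)) |}.

Definition jeD : JE D := je_proto LD hProto.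

Definition ob (X : D) (x : X ~> Y) : S := existT _ X x.
Definition hm (X Z : S) (f : projT1 X ~> projT1 Z) (e : projT2 Z ⋆ f = projT2 X) : X ~> Z := exist _ f e.
Notation un f := (proj1_sig f).

Lemma un_eq (X Z : S) (f g : X ~> Z) : un f = un g -> f = g.
Proof. apply sig_ext. Qed.
Lemma un_tri (X Z : S) (f : X ~> Z) : projT2 Z ⋆ un f = projT2 X.
Proof. exact (proj2_sig f). Qed.

Lemma un_triE (X Z : S) (f : X ~> Z) T (x : T ~> projT1 X) : projT2 X ⋆ x = projT2 Z ⋆ (un f ⋆ x).
Proof. now rewrite comp_assoc, un_tri. Qed.

Lemma sl_pb (A B Z P : S) (f : A ~> Z) (g : B ~> Z) (p : P ~> A) (q : P ~> B) :
  is_pullback f g p q -> is_pullback (un f) (un g) (un p) (un q).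
Proof.
intros pb. apply mk_pb.
- exact (f_equal (fun h => un h) (pb_sq pb)).
- intros T a b e.
  pose (TS := ob (projT2 A ⋆ a)).
  assert (eb : projT2 B ⋆ b = projT2 A ⋆ a).
  { rewrite (un_triE g b), (un_triE f a). now rewrite e. }
  pose (a' := @hm TS A a eq_refl). pose (b' := @hm TS B b eb).
  destruct (pb_ex pb (a := a') (b := b')) as [w [w0 w1]]; [now apply un_eq |].
  exists (un w). split; [exact (f_equal (fun h => un h) w0) | exact (f_equal (fun h => un h) w1)].
- intros T u v e0 e1.
  pose (TS := ob (projT2 P ⋆ u)).
  assert (ev : projT2 P ⋆ v = projT2 P ⋆ u).
  { rewrite (un_triE p v), (un_triE p u). now rewrite e0. }
  exact (f_equal (fun h => un h) (pb_uniq pb (u := @hm TS P u eq_refl) (v := @hm TS P v ev)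
    (un_eq (f := p ∘ @hm TS P u eq_refl) (g := p ∘ @hm TS P v ev) e0)
    (un_eq (f := q ∘ @hm TS P u eq_refl) (g := q ∘ @hm TS P v ev) e1))).
Qed.

Lemma sl_prod (A B P : S) (p : P ~> A) (q : P ~> B) : is_product p q ->
  is_pullback (projT2 A) (projT2 B) (un p) (un q).
Proof.
intros pd. apply mk_pb.
- now rewrite !un_tri.
- intros T a b e.
  pose (TS := ob (projT2 A ⋆ a)).
  pose (a' := @hm TS A a eq_refl). pose (b' := @hm TS B b (eq_sym e)).
  exists (un (pair pd a' b')). split.
  + exact (f_equal (fun h => un h) (pair_l pd a' b')).
  + exact (f_equal (fun h => un h) (pair_r pd a' b')).
- intros T u v e0 e1.
  pose (TS := ob (projT2 P ⋆ u)).
  assert (ev : projT2 P ⋆ v = projT2 P ⋆ u).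
  { rewrite (un_triE p v), (un_triE p u). now rewrite e0. }
  exact (f_equal (fun h => un h) (pair_uniq pd (u := @hm TS P u eq_refl) (v := @hm TS P v ev)
    (un_eq (f := p ∘ @hm TS P u eq_refl) (g := p ∘ @hm TS P v ev) e0)
    (un_eq (f := q ∘ @hm TS P u eq_refl) (g := q ∘ @hm TS P v ev) e1))).
Qed.

Definition oneS : S := ob (id Y).
Definition termS : is_terminal oneS.
Proof.
refine {| bang := fun X : S => @hm X oneS (projT2 X) (comp_idl _) |}.
intros X f g. apply un_eq. rewrite <- (comp_idl (un f)), <- (comp_idl (un g)).
exact (eq_trans (un_tri f) (eq_sym (un_tri g))).
Defined.

Definition pbS (A B Z : S) (f : A ~> Z) (g : B ~> Z) : Pbk f g.
Proof.
pose (P := lx_pb LD (un f) (un g)).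
assert (sq := pb_sq (pbi P)).
assert (ep : projT2 B ⋆ pp1 P = projT2 A ⋆ pp0 P).
{ rewrite (un_triE f (pp0 P)), (un_triE g (pp1 P)). now rewrite sq. }
pose (PS := ob (projT2 A ⋆ pp0 P)).
refine {| pbo := PS; pp0 := @hm PS A (pp0 P) eq_refl; pp1 := @hm PS B (pp1 P) ep |}.
apply mk_pb.
- apply un_eq. exact sq.
- intros T a b e.
  destruct (pb_ex (pbi P) (f_equal (fun h => un h) e)) as [w [w0 w1]].
  assert (ew : projT2 PS ⋆ w = projT2 T).
  { simpl. rewrite <- comp_assoc, w0. apply un_tri. }
  exists (@hm T PS w ew). split; now apply un_eq.
- intros T u v e0 e1. apply un_eq. apply (pb_uniq (pbi P)).
  + exact (f_equal (fun h => un h) e0).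
  + exact (f_equal (fun h => un h) e1).
Defined.

Definition LS : Lex S := {| lx_one := oneS; lx_term := termS; lx_pb := pbS |}.

Lemma coeq_S (X W Q : D) (a b : W ~> X) (q : X ~> Q) (x : X ~> Y) (u : Q ~> Y)
  (eu : u ∘ q = x) (eab : x ∘ b = x ∘ a) :
  IsCoequalizer a b q ->
  @IsCoequalizer S (ob (x ∘ a)) (ob x) (ob u)
    (@hm (ob (x ∘ a)) (ob x) a eq_refl) (@hm (ob (x ∘ a)) (ob x) b eab) (@hm (ob x) (ob u) q eu).
Proof.
intros h. assert (rq : RegEpi q) by (exists W, a, b; exact h).
apply coeqP in h. destruct h as [h1 h2]. apply coeqP. split; [apply un_eq; exact h1 |].
intros T t e. destruct (h2 _ (un t) (f_equal (fun h => un h) e)) as [v [hv uv]].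
assert (ev : projT2 T ⋆ v = u).
{ apply (regepi_epi rq). rewrite <- comp_assoc, hv, eu. apply (un_tri t). }
exists (@hm (ob u) T v ev). split; [apply un_eq; exact hv |].
intros v' hv'. apply un_eq. apply uv. exact (f_equal (fun h => un h) hv').
Qed.

Lemma regepi_S (X Z : S) (f : X ~> Z) : RegEpi f <-> RegEpi (un f).
Proof.
split.
- intros [W [a [b h]]]. apply coeqP in h. destruct h as [h1 h2].
  exists (projT1 W), (un a), (un b). apply coeqP. split; [exact (f_equal (fun h => un h) h1) |].
  intros T t e.
  (* maps to T correspond to maps to T x Y over Y *)
  pose (P := prd LD T Y). pose (TS := ob (prr P)).
  assert (et : projT2 TS ⋆ pr_pair P t (projT2 X) = projT2 X) by apply prr_pair.
  destruct (h2 TS (@hm X TS (pr_pair P t (projT2 X)) et)) as [v [hv uv]].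
  { apply un_eq. simpl. rewrite !pr_pair_comp, e. f_equal.
    exact (eq_trans (un_tri a) (eq_sym (un_tri b))). }
  exists (prl P ⋆ un v). split.
  + rewrite <- comp_assoc. apply (f_equal (fun h => prl P ⋆ un h)) in hv. simpl in hv.
    rewrite prl_pair in hv. exact hv.
  + intros v' hv'.
    assert (ev : projT2 TS ⋆ pr_pair P v' (projT2 Z) = projT2 Z) by apply prr_pair.
    rewrite (uv (@hm Z TS (pr_pair P v' (projT2 Z)) ev)); [apply prl_pair |].
    apply un_eq. simpl. rewrite pr_pair_comp, hv'. f_equal. apply un_tri.
- intros hf. pose (K := lx_pb LD (un f) (un f)). assert (sq := pb_sq (pbi K)).
  destruct X as [X x], Z as [Z z], f as [f ef]. simpl in *.
  assert (eab : x ∘ pp1 K = x ∘ pp0 K) by (rewrite <- ef, <- !comp_assoc; now rewrite sq).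
  exists (ob (x ∘ pp0 K)), (@hm (ob (x ∘ pp0 K)) (ob x) (pp0 K) eq_refl),
    (@hm (ob (x ∘ pp0 K)) (ob x) (pp1 K) eab).
  apply (coeq_S (u := z) ef eab). apply coeqP. split; [exact sq |].
  intros T t e. destruct (regepi_desc (g := t) hf) as [v hv].
  { intros W a b ew. destruct (pb_ex (pbi K) ew) as [w [<- <-]]. rewrite !comp_assoc. now rewrite e. }
  exists v. split; [exact hv |]. intros v' hv'. apply (regepi_epi hf). congruence.
Qed.

Definition RS : RegCtx S.
Proof.
refine {| rx_lex := LS |}.
- intros X Z K f p0 p1 [hk].
  destruct (rx_kp RD (inhabits (sl_pb hk))) as [Q [q hq]].
  assert (hq' := hq). apply coeqP in hq'. destruct hq' as [h1 h2].
  destruct (h2 Y (projT2 X)) as [u [hu _]]; [now rewrite !un_tri |].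
  destruct X as [X x], K as [K k]. simpl in *.
  destruct p0 as [p0 p0'], p1 as [p1 p1']. simpl in *. destruct p0'.
  exists (ob u), (@hm (ob x) (ob u) q hu).
  exact (coeq_S hu p1' hq).
- intros A B Z P f g p q [pb] hf. apply regepi_S. apply regepi_S in hf.
  exact (rx_st RD (inhabits (sl_pb pb)) hf).
Defined.

(** The kernel pair of the structural map X -> Y is the square of X in the slice,
    so efficient regularity speaks of the equivalence relations on X above Y. *)
Lemma eff_S (X T : S) (t0 t1 : T ~> X) : IsEquivRel t0 t1 ->
    (exists (W : S) (a b : prd LS X X ~> W),
       IsEqualizer (pr_pair (prd LS X X) t0 t1) a b) ->
    IsEffective t0 t1.
Proof.
intros [m1 [[r [r0 r1]] [[s [s0 s1]] tr]]] [W [a [b [ab uni]]]].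
pose (P := prd LS X X). pose (kp := sl_prod (prod_is P)).
set (j := un (pr_pair P t0 t1)).
assert (j0 : un (prl P) ⋆ j = un t0) by exact (f_equal (fun h => un h) (prl_pair P t0 t1)).
assert (j1 : un (prr P) ⋆ j = un t1) by exact (f_equal (fun h => un h) (prr_pair P t0 t1)).
assert (ER : IsEquivRel (un (prl P) ⋆ j) (un (prr P) ⋆ j)).
{ rewrite j0, j1. split; [| split; [| split]].
  - intros V u v e0 e1. pose (VS := ob (projT2 T ⋆ u)).
    assert (ev : projT2 T ⋆ v = projT2 T ⋆ u).
    { rewrite (un_triE t0 v), (un_triE t0 u). now rewrite e0. }
    exact (f_equal (fun h => un h) (m1 VS (@hm VS T u eq_refl) (@hm VS T v ev)
      (un_eq (f := t0 ∘ @hm VS T u eq_refl) (g := t0 ∘ @hm VS T v ev) e0)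
      (un_eq (f := t1 ∘ @hm VS T u eq_refl) (g := t1 ∘ @hm VS T v ev) e1))).
  - exists (un r). split; [exact (f_equal (fun h => un h) r0) | exact (f_equal (fun h => un h) r1)].
  - exists (un s). split; [exact (f_equal (fun h => un h) s0) | exact (f_equal (fun h => un h) s1)].
  - intros V u v e. pose (VS := ob (projT2 T ⋆ u)).
    assert (ev : projT2 T ⋆ v = projT2 T ⋆ u).
    { rewrite (un_triE t0 v), (un_triE t1 u). now rewrite e. }
    destruct (tr VS (@hm VS T u eq_refl) (@hm VS T v ev)) as [c [c0 c1]]; [now apply un_eq |].
    exists (un c). split; [exact (f_equal (fun h => un h) c0) | exact (f_equal (fun h => un h) c1)]. }
destruct (proj2 hReg (projT1 X) Y (projT1 (prod_ob P)) (projT1 T) (projT2 X) (un (prl P)) (un (prr P)) j (inhabits kp) ER)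
  as [Q [g [kg]]].
{ exists (projT1 W), (un a), (un b). split; [exact (f_equal (fun h => un h) ab) |].
  intros V t e. pose (VS := ob (projT2 (prod_ob P) ⋆ t)).
  destruct (uni VS (@hm VS (prod_ob P) t eq_refl)) as [u [hu uu]]; [now apply un_eq |].
  exists (un u). split; [exact (f_equal (fun h => un h) hu) |].
  intros u' hu'.
  assert (eu : projT2 T ⋆ u' = projT2 VS).
  { simpl. rewrite <- hu'. exact (un_triE (pr_pair P t0 t1) u'). }
  rewrite (uu (@hm VS T u' eu)); [reflexivity | now apply un_eq]. }
rewrite j0, j1 in kg.
pose (QY := prd LD Q Y). pose (QS := ob (prr QY)).
assert (eg : projT2 QS ⋆ pr_pair QY g (projT2 X) = projT2 X) by apply prr_pair.
exists QS, (@hm X QS (pr_pair QY g (projT2 X)) eg). constructor. apply mk_pb.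
- apply un_eq. simpl. rewrite !pr_pair_comp, (pb_sq kg). f_equal. exact (eq_trans (un_tri t0) (eq_sym (un_tri t1))).
- intros V u v e. apply (f_equal (fun h => prl QY ⋆ un h)) in e. simpl in e.
  rewrite !comp_assoc, prl_pair in e.
  destruct (pb_ex kg e) as [w [w0 w1]].
  assert (ew : projT2 T ⋆ w = projT2 V).
  { rewrite (un_triE t0 w), w0. apply un_tri. }
  exists (@hm V T w ew). split; now apply un_eq.
- intros V u v e0 e1. apply un_eq. apply (pb_uniq kg).
  + exact (f_equal (fun h => un h) e0).
  + exact (f_equal (fun h => un h) e1).
Qed.

Lemma coeq_ex_S (X Z : S) (a b : X ~> Z) : exists (Q : S) (q : Z ~> Q), IsCoequalizer a b q.
Proof.
destruct lexop_ex as [Lop].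
destruct (@equ_ex (op D) Lop (projT1 Z) (projT1 X) (un a) (un b)) as [Q [q [hq [hl hu]]]].
assert (hq' : IsCoequalizer (un a) (un b) (q : projT1 Z ~> Q)).
{ apply coeqP. split; [exact hq |]. intros T t e. destruct (hl T t e) as [v hv].
  exists v. split; [exact hv |]. intros v' hv'. apply hu. exact (eq_trans hv (eq_sym hv')). }
destruct (hl Y (projT2 Z)) as [u hu0]; [exact (eq_trans (un_tri a) (eq_sym (un_tri b))) |].
destruct Z as [Z z], X as [X x], a as [a ea], b as [b eb]. simpl in *. subst x.
exists (ob u), (@hm (ob z) (ob u) q hu0).
exact (coeq_S hu0 eb hq').
Qed.

Section Points.
Variable Q : S.
Definition dn (P : Pt Q) : Pt (projT1 Q) :=
  mkpt (Q := projT1 Q) (M := projT1 (pt_ob P)) (m := un (pt_map P)) (z := un (pt_sec P))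
    (f_equal (fun h => un h) (pt_split P)).
Definition dnh (P P' : Pt Q) (h : P ~> P') : dn P ~> dn P' :=
  exist _ (un (un h)) (conj (f_equal (fun h => un h) (proj1 (proj2_sig h)))
    (f_equal (fun h => un h) (proj2 (proj2_sig h)))).
Lemma dnh_eq (P P' : Pt Q) (h k : P ~> P') : dnh h = dnh k -> h = k.
Proof. intros e. apply sig_ext, un_eq. exact (f_equal (fun h => un h) e). Qed.
Lemma dnh_ex (P P' : Pt Q) (h : dn P ~> dn P') : exists k : P ~> P', dnh k = h.
Proof.
destruct h as [h [h1 h2]].
change (projT1 (pt_ob P) ~> projT1 (pt_ob P')) in h.
change (un (pt_map P') ⋆ h = un (pt_map P)) in h1. change (h ⋆ un (pt_sec P) = un (pt_sec P')) in h2.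
assert (e : projT2 (pt_ob P') ⋆ h = projT2 (pt_ob P)).
{ rewrite (un_triE (pt_map P') h), h1. apply (un_tri (pt_map P)). }
assert (K : pt_map P' ∘ @hm P P' h e = pt_map P /\ @hm P P' h e ∘ pt_sec P = pt_sec P').
{ split; apply un_eq; assumption. }
exists (exist _ (@hm P P' h e) K). now apply sig_ext.
Qed.
Lemma dnh_iso (P P' : Pt Q) (h : P ~> P') : IsIso (dnh h) <-> IsIso h.
Proof.
split; intros [g [g1 g2]].
- destruct (dnh_ex g) as [k <-]. exists k. split; apply dnh_eq; apply sig_ext.
  + exact (f_equal (fun h => un h) g1).
  + exact (f_equal (fun h => un h) g2).
- exists (dnh g). split; apply sig_ext.
  + exact (f_equal (fun h => un (un h)) g1).
  + exact (f_equal (fun h => un (un h)) g2).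
Qed.
Lemma dn_onto (B : Pt (projT1 Q)) : exists P : Pt Q, dn P = B.
Proof.
destruct B as [X m z mz].
assert (es : projT2 (ob (projT2 Q ⋆ m)) ⋆ z = projT2 Q).
{ simpl. rewrite <- comp_assoc, mz. apply comp_idr. }
assert (e : @hm (ob (projT2 Q ⋆ m)) Q m eq_refl ∘ @hm Q (ob (projT2 Q ⋆ m)) z es = id Q).
{ apply un_eq. exact mz. }
exists (mkpt e). unfold dn, mkpt. simpl. f_equal. apply proof_irrelevance.
Qed.
End Points.

Lemma base_S (Q Q' : S) (h : Q' ~> Q) (P : Pt Q) (P' : Pt Q') (u : pt_ob P' ~> pt_ob P) :
  IsBaseChange h u -> IsBaseChange (P := dn P) (P' := dn P') (un h) (un u).
Proof.
intros [[pb] e]. split; [exact (inhabits (sl_pb pb)) | exact (f_equal (fun h => un h) e)].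
Qed.

Lemma proto_S : Protomodular S.
Proof.
intros Q Q' h P P1 P' P1' u v k k' b1 b2 bm hk'.
apply dnh_iso. apply dnh_iso in hk'.
exact (hProto (base_S b1) (base_S b2) (k := dnh k) (k' := dnh k')
  (f_equal (fun h => un h) bm) hk').
Qed.

Definition jeS : JE S := je_proto LS proto_S.

(** Points over an object of the slice are points over its domain. Group
    structures agree because a group in points is a groupoid with equal source
    and target, and pullbacks in the slice are those of the base. *)
Lemma gpd_S (Q Z : S) (m : Z ~> Q) (z : Q ~> Z) :
  inhabited (Gpd m m z) <-> inhabited (Gpd (un m) (un m) (un z)).
Proof.
pose (P := lx_pb LS m m). assert (pb := sl_pb (pbi P)).
split; intros [G].
- pose (mu := mul G (pp0 P) (pp1 P)).
  assert (M : forall T (w : T ~> P), mu ∘ w = mul G (pp0 P ∘ w) (pp1 P ∘ w)).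
  { intros. apply mul_nat, (pb_sq (pbi P)). }
  edestruct (gpd_of_map (s := un z) pb (m := un mu) (i := un (inv G))) as [g _]; [.. | now constructor].
  + exact (f_equal (fun h => un h) (gds G)).
  + exact (f_equal (fun h => un h) (gds G)).
  + exact (f_equal (fun h => un h) (gdi G)).
  + exact (f_equal (fun h => un h) (gdi G)).
  + intros T w h. pose (TS := ob (projT2 (pbo P) ⋆ w)). pose (wS := @hm TS (pbo P) w eq_refl).
    assert (e : pp0 P ∘ wS = z ∘ (m ∘ (pp1 P ∘ wS))) by now apply un_eq.
    assert (R := M TS wS). rewrite e, mul1l in R. exact (f_equal (fun h => un h) R).
  + intros T w h. pose (TS := ob (projT2 (pbo P) ⋆ w)). pose (wS := @hm TS (pbo P) w eq_refl).
    assert (e : pp1 P ∘ wS = z ∘ (m ∘ (pp0 P ∘ wS))) by now apply un_eq.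
    assert (R := M TS wS). rewrite e, mul1r in R. exact (f_equal (fun h => un h) R).
  + intros T w h. pose (TS := ob (projT2 (pbo P) ⋆ w)). pose (wS := @hm TS (pbo P) w eq_refl).
    assert (e : pp1 P ∘ wS = inv G ∘ (pp0 P ∘ wS)) by now apply un_eq.
    assert (R := M TS wS). rewrite e, mulV in R. exact (f_equal (fun h => un h) R).
  + intros T w h. pose (TS := ob (projT2 (pbo P) ⋆ w)). pose (wS := @hm TS (pbo P) w eq_refl).
    assert (e : pp0 P ∘ wS = inv G ∘ (pp1 P ∘ wS)) by now apply un_eq.
    assert (R := M TS wS). rewrite e, mulVl in R. exact (f_equal (fun h => un h) R).
- pose (mu := mul G (un (pp0 P)) (un (pp1 P))).
  assert (em : un m ⋆ mu = un m ⋆ un (pp0 P)) by exact (d_mul LD jeD G (pb_sq pb)).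
  assert (eZ : projT2 Z ⋆ mu = projT2 (pbo P)).
  { rewrite (un_triE m mu), em, <- (un_triE m). apply (un_tri (pp0 P)). }
  assert (eI : projT2 Z ⋆ inv G = projT2 Z).
  { rewrite (un_triE m (inv G)), (gdi G). apply (un_tri m). }
  assert (M : forall T (w : T ~> projT1 (pbo P)), mu ⋆ w = mul G (un (pp0 P) ⋆ w) (un (pp1 P) ⋆ w)).
  { intros. apply mul_nat, (pb_sq pb). }
  edestruct (gpd_of_map (s := z) (pbi P) (m := @hm (pbo P) Z mu eZ) (i := @hm Z Z (inv G) eI)) as [g _];
    [.. | now constructor].
  + apply un_eq. exact (gds G).
  + apply un_eq. exact (gds G).
  + apply un_eq. exact (gdi G).
  + apply un_eq. exact (gdi G).
  + intros T w h. apply un_eq. apply (f_equal (fun h => un h)) in h.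
    change (un (pp0 P) ⋆ un w = un z ⋆ (un m ⋆ (un (pp1 P) ⋆ un w))) in h.
    change (mu ⋆ un w = un (pp1 P) ⋆ un w). rewrite M, h. apply mul1l.
  + intros T w h. apply un_eq. apply (f_equal (fun h => un h)) in h.
    change (un (pp1 P) ⋆ un w = un z ⋆ (un m ⋆ (un (pp0 P) ⋆ un w))) in h.
    change (mu ⋆ un w = un (pp0 P) ⋆ un w). rewrite M, h. apply mul1r.
  + intros T w h. apply un_eq. apply (f_equal (fun h => un h)) in h.
    change (un (pp1 P) ⋆ un w = inv G ⋆ (un (pp0 P) ⋆ un w)) in h.
    change (mu ⋆ un w = un z ⋆ (un m ⋆ (un (pp0 P) ⋆ un w))). rewrite M, h. apply mulV.
  + intros T w h. apply un_eq. apply (f_equal (fun h => un h)) in h.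
    change (un (pp0 P) ⋆ un w = inv G ⋆ (un (pp1 P) ⋆ un w)) in h.
    change (mu ⋆ un w = un z ⋆ (un m ⋆ (un (pp1 P) ⋆ un w))). rewrite M, h. apply mulVl.
Qed.

Lemma abelian_gpd (C : Category) (LC : Lex C) (jC : JE C) (Q : C) (P : Pt Q) :
  @IsAbelian (Pt Q) P <-> inhabited (Gpd (pt_map P) (pt_map P) (pt_sec P)).
Proof.
destruct P as [M m z mz]. split.
- exact (ab_gpd LC (mz := mz)).
- intros [G]. exact (gpd_ab LC jC mz G).
Qed.

Lemma abelian_S (Q : S) (P : Pt Q) : @IsAbelian (Pt Q) P <-> @IsAbelian (Pt (projT1 Q)) (dn P).
Proof.
rewrite (abelian_gpd LS jeS), (abelian_gpd LD jeD). apply gpd_S.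
Qed.

Lemma assoc_S (Q : S) (P A : Pt Q) (eta : P ~> A) :
  @IsAssociatedAbelian (Pt Q) P A eta -> @IsAssociatedAbelian (Pt (projT1 Q)) (dn P) (dn A) (dnh eta).
Proof.
intros [hA hU]. split; [now apply abelian_S |].
intros B hB g. destruct (dn_onto B) as [B' <-].
destruct (dnh_ex g) as [k <-].
destruct (hU B' (proj2 (abelian_S B') hB) k) as [k' [<- uk]].
exists (dnh k'). split; [now apply sig_ext |].
intros l hl. destruct (dnh_ex l) as [l' <-]. f_equal.
apply uk, dnh_eq. rewrite <- hl. now apply sig_ext.
Qed.

Lemma peri_S : PeriAbelian S.
Proof.
intros Q Q' h P A P' hA B u v eta heta eta' b1 b2 bm a1 a2.
destruct (hPeri (base_S b1) (base_S b2) (eta := dnh eta) (heta := dnh heta) (eta' := dnh eta')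
  (f_equal (fun h => un h) bm) (assoc_S a1) (assoc_S a2)) as [c [hc ic]].
destruct (dnh_ex c) as [k <-]. exists k. split.
- apply dnh_eq. rewrite <- hc. now apply sig_ext.
- now apply dnh_iso.
Qed.

Definition ctxS : Ctx S := {| cx_reg := RS; cx_eff := eff_S; cx_coeq := coeq_ex_S;
  cx_proto := proto_S; cx_peri := peri_S |}.

(** The initial object of the slice is Z -> Y, with Z the zero object. For the
    projective cover q : H -> Y the product of (H, q) with it is the kernel of q.
    This is where projective dimension one enters: both H and the kernel are
    projective. *)
Lemma proj_S (hY : ProjectiveDimension1 Y) : exists (I F : S), inhabited (is_initial I) /\
  RegEpi (bng LS F) /\ Projective F /\ Projective (prd LS F I : S).
Proof.
destruct hY as [K [H [k [q [[Z [o [w [[_ [iZ]] [pb]]]]] [rq [pH pK]]]]]]].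
pose (I := ob o). pose (F := ob q). exists I, F.
assert (lift : forall P : S, Projective (projT1 P) -> Projective P).
{ intros P hP X X' e g re. apply regepi_S in re. destruct (hP _ _ _ (un g) re) as [l hl].
  assert (el : projT2 X ⋆ l = projT2 P).
  { rewrite (un_triE e l), hl. apply un_tri. }
  exists (@hm P X l el). now apply un_eq. }
split; [| split; [| split]].
- constructor. unshelve refine (@Build_is_terminal (op S) I _ _).
  + intros X. exact (@hm I X (@bang (op D) Z iZ (projT1 X)) (@bang_uniq (op D) Z iZ Y _ _)).
  + intros X f g. apply un_eq. exact (@bang_uniq (op D) Z iZ (projT1 X) (un f) (un g)).
- apply regepi_S. exact rq.
- apply lift. exact pH.
- apply lift.
  assert (pb' := sl_prod (prod_is (prd LS F I))).
  destruct (pb_ex pb (pb_sq pb')) as [i [i0 i1]].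
  destruct (pb_ex pb' (pb_sq pb)) as [j [j0 j1]].
  assert (ji : j ⋆ i = id _).
  { apply (pb_uniq pb'); rewrite comp_assoc, comp_idr, ?j0, ?j1; assumption. }
  intros X X' e g re. destruct (pK _ _ _ (g ⋆ j) re) as [l hl].
  exists (l ⋆ i). rewrite comp_assoc, hl, <- comp_assoc, ji. apply comp_idr.
Qed.
End SliceCtx.

Theorem theorem4p2 (D : Category)
  (hPt : Pointed D)
  (hLim : FinitelyComplete D)
  (hColim : FinitelyCocomplete D)
  (hReg : EfficientlyRegular D)
  (hProto : Protomodular D)
  (hPeri : PeriAbelian D)
  (Y : D) (hY : ProjectiveDimension1 Y)
  (A : AbGroup (Slice Y)) (n : nat) :
  GroupIso (Cohomology (in_M (slice_products Y hLim) A) n) (Cohomology A n).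
Proof.
pose (K := ctxS hPt hLim hColim hReg hProto hPeri Y).
destruct n as [| [| n]].
- exists (fun x => x), (fun x => x). split; [reflexivity |]. split; [reflexivity |].
  intros a b c. reflexivity.
- exact (h1_iso (cx_reg K) (je_ctx K) (slice_products Y hLim) A (cx_coeq K)).
- destruct (proj_S hPt hLim hY) as [I [F [[iI] [gF [pF pFI]]]]].
  exact (hsucc_iso (K := K) (slice_products Y hLim) A iI gF pF pFI n).
Qed.
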